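(* Let $n\ge1$, $\alpha\in(0,n+2)$, $T>0$, and let $\Omega$ be a nonempty open subset of $\mathbb{R}^n$. Call $u$ an admissible solution if $u\ge0$, $u\in C^{2,1}(\mathbb{R}^n\times(0,T))\cap L^\lambda(\mathbb{R}^n\times(0,T))$, and $$0\le u_t-\Delta u\le \Big(\iint_{\mathbb{R}^n\times(0,T)}\Phi(x-y,t-s)^{\alpha/n}u(y,s)^\lambda\,dy\,ds\Big)\,u(x,t)^\sigma\quad\text{in }\Omega\times(0,T).$$ (i) If $0<\lambda<\frac{n+2-\alpha}{n}$ and $\sigma=g_\alpha(\lambda)$, then for every compact $K\subset\Omega$ and every admissible solution $u$, $\max_{x\in K}u(x,t)=O(t^{-n/2})$ as $t\to0^+$. (ii) If $\alpha\in(2,n+2)$, $\lambda>\frac{n+2}{\alpha-2}$ and $\sigma=g_\alpha(\lambda)$, then there is no continuous function $\varphi:(0,1)\to(0,\infty)$ such that for every compact $K\subset\Omega$ and every admissible solution $u$ one has $\max_{x\in K}u(x,t)=O(\varphi(t))$ as $t\to0^+$.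
   Context: $\Phi$ is the heat kernel: $\Phi(x,t)=(4\pi t)^{-n/2}e^{-|x|^2/(4t)}$ for $t>0$ and $\Phi(x,t)=0$ for $t\le0$. For $\alpha\in(0,n+2)$, $g_\alpha(\lambda)=\frac{n+2}{n}$ if $0<\lambda<\frac{n+2-\alpha}{n}$; $g_\alpha(\lambda)=\frac{2(n+2)-\alpha}{n}-\lambda$ if $\frac{n+2-\alpha}{n}\le\lambda<\frac{n+2}{n}$; $g_\alpha(\lambda)=\max\{0,1-\frac{\alpha-2}{n+2}\lambda\}$ if $\lambda\ge\frac{n+2}{n}$. *)

(* Defs.v *)
From HB Require Import structures.
From mathcomp Require Import all_boot all_order all_algebra.
From mathcomp Require Import all_classical all_reals all_analysis.
Set Implicit Arguments. Unset Strict Implicit. Unset Printing Implicit Defensive.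
Import Order.TTheory GRing.Theory Num.Theory.
Import numFieldNormedType.Exports.
Local Open Scope classical_set_scope.
Local Open Scope ring_scope.

Section defs.
Variable R : realType.

Definition sqnorm n (x : 'rV[R]_n) : R := \sum_(i < n) (x 0 i) ^+ 2.

Definition heat_kernel n (x : 'rV[R]_n) (t : R) : R :=
  if 0 < t then powR (4 * pi * t) (- (n%:R / 2)) * expR (- (sqnorm x / (4 * t)))
  else 0.

(* Lebesgue integral over R^n of a nonnegative extended-real function,
   written as the iterated (Tonelli) integral over the n coordinates,
   each with respect to the Lebesgue measure on R. *)
Fixpoint intRn (n : nat) : ('rV[R]_n -> \bar R) -> \bar R :=
  match n with
  | 0 => fun f => f 0
  | m.+1 => fun f => (\int[@lebesgue_measure R]_(a in setT)
              intRn (fun y : 'rV[R]_m => f (row_mx (\row_(_ < 1) a) y)))%E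
  end.

Definition itv0T (T : R) : set R := `]0, T[.

Definition int_spacetime n (T : R) (F : 'rV[R]_n -> R -> \bar R) : \bar R :=
  (\int[@lebesgue_measure R]_(s in itv0T T)
     intRn (fun y => F y s))%E.

Definition g_alpha n (alpha lambda : R) : R :=
  if lambda < (n%:R + 2 - alpha) / n%:R then (n%:R + 2) / n%:R
  else if lambda < (n%:R + 2) / n%:R then (2 * (n%:R + 2) - alpha) / n%:R - lambda
  else Num.max 0 (1 - (alpha - 2) / (n%:R + 2) * lambda).

Definition ex n (i : 'I_n) : 'rV[R]_n * R := (delta_mx 0 i, 0).
Definition et n : 'rV[R]_n * R := (0, 1).

Definition dx n (i : 'I_n) (u : 'rV[R]_n * R -> R) := 'D_(ex i) u.
Definition dt n (u : 'rV[R]_n * R -> R) := 'D_(@et n) u.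

Definition lap n (u : 'rV[R]_n * R -> R) (p : 'rV[R]_n * R) : R :=
  \sum_(i < n) dx i (dx i u) p.

Definition C21 n (D : set ('rV[R]_n * R)) (u : 'rV[R]_n * R -> R) : Prop :=
  forall p, D p ->
    [/\ {for p, continuous u},
        derivable u p (@et n),
        {for p, continuous (dt u)} &
        forall i : 'I_n,
          [/\ derivable u p (ex i),
              {for p, continuous (dx i u)} &
              forall j : 'I_n,
                derivable (dx i u) p (ex j) /\
                {for p, continuous (dx j (dx i u))}]].

Definition admissible n (alpha lambda sigma T : R) (Omega : set 'rV[R]_n)
    (u : 'rV[R]_n * R -> R) : Prop :=
  [/\ (forall x t, 0 < t < T -> 0 <= u (x, t)),
      C21 [set p | 0 < p.2 < T] u,
      (int_spacetime T (fun y s => (powR (u (y, s)) lambda)%:E) < +oo)%E &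
      forall x t, Omega x -> 0 < t < T ->
        0 <= dt u (x, t) - lap u (x, t) /\
        ((dt u (x, t) - lap u (x, t))%:E <=
          int_spacetime T (fun y s =>
            (powR (heat_kernel (x - y) (t - s)) (alpha / n%:R)
             * powR (u (y, s)) lambda)%:E)
          * (powR (u (x, t)) sigma)%:E)%E].

End defs.

(* Main.v *)
Require Import Defs.
From HB Require Import structures.
From mathcomp Require Import all_boot all_order all_algebra.
From mathcomp Require Import all_classical all_reals all_analysis.
From mathcomp Require Import measurable_realfun ring lra.
Set Implicit Arguments. Unset Strict Implicit. Unset Printing Implicit Defensive.
Import Order.TTheory GRing.Theory Num.Theory.
Import numFieldNormedType.Exports.
Local Open Scope classical_set_scope.
Local Open Scope ring_scope.

(** (i) Testing [u_t - Δu >= 0] against product cutoffs shows that [u (., t)] and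
the source [f := u_t - Δu] have locally bounded mass as [t -> 0]; testing against
truncated Gaussians gives a one-sided Duhamel inequality. Together they bound the
nonlocal factor locally: for [lambda < 1] by Young's inequality on time slices, for
[lambda >= 1] by Jensen's inequality in the Duhamel representation. Hence
[f <= N u^(1 + 2/n)] locally. This exponent is critical for the heat scaling, and at
a point that maximizes [d^n u], with [d] the parabolic distance to the boundary,
the smallness of the mass of [f] near [t = 0] contradicts the Duhamel inequality
unless [d^n u] is bounded.

(ii) Here [g_alpha lambda = 0], so [u] only has to satisfy [0 <= f <= N(u)]. Take [u]
to be a sum of bumps [theta^((n-kappa)/2) ramp((t-s)/theta) Gamma(x-x0, t-s+theta)]
with [theta = theta0 16^-m]. Each bump pays for the source of the next one through
[N], because [kappa (lambda - 1) > n + 4 - alpha], whereas [kappa lambda < n + 2]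
keeps [u] in [L^lambda]. Consecutive bumps focus at a time [t], where [u (x0, t)]
gets as large as desired after finitely many of them; then a new cascade is started
at an earlier time. *)

(** * Integrals over segments and boxes *)

Section segment_integral.
Context {R : realType}.
Local Notation mu := (@lebesgue_measure R).
Implicit Types (f g : R -> R) (a b c : R).

(** The nonlocal integral and the [L^lambda] norm are iterated Lebesgue integrals whose inner
    integrals come with no measurability statement. Almost everything is therefore done with
    continuous functions on segments and cubes, where Fubini, integration by parts and dependence on
    parameters are elementary; monotone convergence enters only to carry bounds over to
    [int_spacetime]. Two exponents govern the result. In (i) the kernel contributes
    [(t - s)^(-alpha/2)], and Gaussians raised to the power [lambda] contribute
    [|s - s'|^(-n (lambda - 1)/2)]; the product is integrable in time exactly when
    [lambda < (n + 2 - alpha)/n]. In (ii) the two conditions on [kappa] read [(n + 4 -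
    alpha)/(lambda - 1) < kappa < (n + 2)/lambda], an interval that is nonempty exactly when
    [lambda (alpha - 2) > n + 2]. Since [u] is not controlled at time 0, the estimates of (i) are
    made on [[t0, t1]] with [t0 > 0] and with constants that do not depend on [t0]. *)

Definition segint a b f : R := \int[mu]_(x in `[a, b]) f x.

Lemma segint_integrable a b f : continuous f ->
  mu.-integrable `[a, b] (EFin \o f).
Proof.
move=> cf; apply: continuous_compact_integrable; first exact: segment_compact.
exact: continuous_subspaceT.
Qed.

Lemma eq_segint a b f g : {in `[a, b], f =1 g} -> segint a b f = segint a b g.
Proof. by move=> fg; apply: eq_Rintegral => x /[!inE] xab; apply: fg. Qed.

Lemma segintD a b f g : continuous f -> continuous g ->
  segint a b (fun x => f x + g x) = segint a b f + segint a b g.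
Proof. by move=> cf cg; apply: RintegralD => //; exact: segint_integrable. Qed.

Lemma segintZ a b k f : continuous f ->
  segint a b (fun x => k * f x) = k * segint a b f.
Proof. by move=> cf; apply: RintegralZl => //; exact: segint_integrable. Qed.

Lemma segintB a b f g : continuous f -> continuous g ->
  segint a b (fun x => f x - g x) = segint a b f - segint a b g.
Proof. by move=> cf cg; apply: RintegralB => //; exact: segint_integrable. Qed.

Lemma le_segint a b f g : continuous f -> continuous g ->
  (forall x, a <= x <= b -> f x <= g x) -> segint a b f <= segint a b g.
Proof.
move=> cf cg fg; apply: le_Rintegral => //.
- exact: segint_integrable.
- exact: segint_integrable.
Qed.

Lemma segint_ge0 a b f : (forall x, a <= x <= b -> 0 <= f x) ->
  0 <= segint a b f.
Proof. by move=> f0; apply: Rintegral_ge0 => x /=; rewrite in_itv/=; exact: f0. Qed.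

Lemma segint_cst a b k : a <= b -> segint a b (fun=> k) = (b - a) * k.
Proof.
move=> ab; rewrite /segint Rintegral_cst//= lebesgue_measure_itv/= lte_fin.
by case: ltgtP ab => //= [_ _|-> _]; rewrite ?subrr ?mul0r ?mulr0 // mulrC.
Qed.

Lemma norm_segint a b f k : a <= b -> continuous f ->
  (forall x, a <= x <= b -> `|f x| <= k) -> `|segint a b f| <= (b - a) * k.
Proof.
move=> ab cf fk; rewrite -segint_cst//.
apply: (le_trans (le_normr_Rintegral _ _)) => //; first exact: segint_integrable.
apply: le_segint => // x; last exact: cvg_cst.
by apply: continuous_comp; [exact: cf|exact: norm_continuous].
Qed.

Lemma segintxx a f : segint a a f = 0.
Proof. by rewrite /segint set_itv1 Rintegral_set1. Qed.

Lemma segint_split a b c f : a <= b <= c -> continuous f ->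
  segint a c f = segint a b f + segint b c f.
Proof.
move=> /andP[ab bc] cf; rewrite /segint.
have := @Rintegral_itvB R f (BLeft a) (BRight c) b (segint_integrable a c cf).
rewrite !bnd_simp => /(_ ab bc).
rewrite Rintegral_itv_obnd_cbnd => [<-|]; first by rewrite addrC subrK.
apply: integrableS (segint_integrable b c cf) => //.
by apply: subset_itvr; rewrite bnd_simp.
Qed.

Lemma segint_FTC a b f F : a <= b ->
  (forall x, a <= x <= b -> {for x, continuous F}) ->
  (forall x, a < x < b -> is_derive x 1 F (f x)) ->
  continuous f -> segint a b f = F b - F a.
Proof.
rewrite le_eqVlt => /predU1P[<-|ab]; first by rewrite segintxx subrr.
move=> cF dF cf; rewrite /segint /Rintegral.
rewrite (@continuous_FTC2 _ f F a b) //.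
- exact: continuous_subspaceT.
- split.
  + move=> x /[!in_itv]/= xab; have /dF[] := xab; by [].
  + apply: cvg_at_right_filter; apply: cF; by rewrite lexx ltW.
  + apply: cvg_at_left_filter; apply: cF; by rewrite lexx ltW.
- move=> x /[!in_itv]/= xab; have h := dF _ xab.
  by rewrite derive1E; apply: derive_val.
Qed.

End segment_integral.

(** * Integrals depending on a parameter, and Fubini's theorem for continuous functions *)

Section param_integral.
Context {R : realType}.
Implicit Type P : topologicalType.

(** Compactness of the segment makes the neighbourhood of [p0] independent of [x] (tube lemma). This
    uniformity does the work of dominated convergence for parameter integrals. *)
Lemma near_segment_uniform P (G : P * R -> R) (a b : R) (p0 : P) (e : R) :
  continuous G -> 0 < e ->
  \forall p \near p0, forall x, a <= x <= b -> `|G (p0, x) - G (p, x)| < e.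
Proof.
move=> cG e0.
have /compact_near_coveringP K := @segment_compact R a b.
apply: (K _ (nbhs p0) (fun p x => `|G (p0, x) - G (p, x)| < e)) => x xab.
have e2 : 0 < e / 2 by rewrite divr_gt0.
have /cvgrPdist_lt/(_ _ e2)[[U V] [/= Up Vx] UV] := cG (p0, x).
exists (V, U) => //= -[y p] [/= Vy Up'].
have h1 := UV (p, y) (conj Up' Vy).
have h2 := UV (p0, y) (conj (nbhs_singleton Up) Vy).
rewrite (le_lt_trans (ler_distD (G (p0, x)) _ _))// distrC.
by rewrite [e]splitr ltrD.
Qed.

Lemma continuous_pairr (P Q S : topologicalType) (G : P * Q -> S) (p : P) :
  continuous G -> continuous (fun x => G (p, x)).
Proof.
move=> cG x; apply: (@continuous_comp _ _ _ (fun x => (p, x)) G); last exact: cG.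
by apply: cvg_pair; [exact: cvg_cst|exact: cvg_id].
Qed.

Lemma continuous_pairl (P Q S : topologicalType) (G : P * Q -> S) (q : Q) :
  continuous G -> continuous (fun x => G (x, q)).
Proof.
move=> cG x; apply: (@continuous_comp _ _ _ (fun x => (x, q)) G); last exact: cG.
by apply: cvg_pair; [exact: cvg_id|exact: cvg_cst].
Qed.

Lemma continuous_swap (P Q S : topologicalType) (G : P * Q -> S) :
  continuous G -> continuous (fun x => G (x.2, x.1)).
Proof.
move=> cG x.
apply: (@continuous_comp _ _ _ (fun x : Q * P => (x.2, x.1)) G); last exact: cG.
by apply: cvg_pair; [exact: cvg_snd|exact: cvg_fst].
Qed.

Lemma segint_continuous P (G : P * R -> R) (a b : R) : continuous G ->
  continuous (fun p => segint a b (fun x => G (p, x))).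
Proof.
move=> cG p0; have [ab|ba] := leP a b; last first.
  (* [segint] is not oriented: for [b < a] the domain is empty and the integral is 0. *)
  rewrite (_ : (fun _ => _) = fun=> 0); first exact: cvg_cst.
  by apply/funext => p; rewrite /segint set_itv_ge ?bnd_simp -?ltNge// Rintegral_set0.
apply/cvgrPdist_le => e e0.
have e1 : 0 < e / (b - a + 1) by rewrite divr_gt0// ltr_wpDl// subr_ge0.
near=> p.
rewrite -segintB; [|exact: continuous_pairr..].
apply: (@le_trans _ _ ((b - a) * (e / (b - a + 1)))).
  apply: norm_segint => //.
    move=> x; apply: (@cvgB _ R^o); exact: continuous_pairr.
  move=> x xab; apply: ltW; move: x xab; near: p.
  exact: near_segment_uniform.
rewrite mulrCA ger_pMr// ler_pdivrMr ?mul1r ?lerDl//.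
by rewrite ltr_wpDl// subr_ge0.
Unshelve. all: by end_near. Qed.

(** Let [B x] be the integral in the other order, with first variable up to [x]. Uniform continuity
    shows that its derivative is the inner integral [g], and the fundamental theorem of calculus
    concludes. *)
Lemma segint_Fubini (G : R * R -> R) (a b c d : R) : continuous G ->
  a <= b -> c <= d ->
  segint a b (fun x => segint c d (fun y => G (x, y))) =
  segint c d (fun y => segint a b (fun x => G (x, y))).
Proof.
move=> cG ab cd.
pose g x := segint c d (fun y => G (x, y)).
(* Starting to the left of [a] makes [B] differentiable from both sides at [a] itself. *)
pose a0 := a - 1.
pose B x := segint c d (fun y => segint a0 x (fun x => G (x, y))).
have cG' := continuous_swap cG.
have cg : continuous g by exact: segint_continuous.
have cI x1 x2 : continuous (fun y => segint x1 x2 (fun x => G (x, y))).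
  exact: (@segint_continuous _ (fun p => G (p.2, p.1)) x1 x2 cG').
have BE x1 x2 : a0 <= x1 <= x2 ->
    B x2 - B x1 = segint c d (fun y => segint x1 x2 (fun x => G (x, y))).
  move=> /andP[ax1 x12]; rewrite /B -segintB; [|exact: cI..].
  apply: eq_segint => y _; rewrite (segint_split (b := x1)) ?ax1//.
    by rewrite addrC addKr.
  exact: continuous_pairl.
(* Stated for ordered endpoints with [x0] on either side, because [segint] is not oriented; the left
   and right difference quotients both follow from it. *)
have Bapx x0 e : 0 < e -> \forall x \near x0, forall x1 x2,
    (x1 = x0 /\ x2 = x) \/ (x1 = x /\ x2 = x0) -> a0 <= x1 <= x2 ->
    `|B x2 - B x1 - (x2 - x1) * g x0| <= (x2 - x1) * ((d - c) * e).
  move=> e0; have := @near_segment_uniform _ G c d x0 e cG e0.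
  move=> /nbhs_ballP[r /= r0 H]; apply/nbhs_ballP; exists r => //= x xr x1 x2 hx.
  move=> /andP[ax1 x12].
  have H' z y : x1 <= z <= x2 -> c <= y <= d -> `|G (x0, y) - G (z, y)| < e.
    move=> zx ycd; apply: H => //; rewrite /ball/= in xr *.
    apply: le_lt_trans xr; move: zx => /andP[z1 z2]; rewrite ler_norml.
    have := ler_norm (x0 - x); have := ler_norm (x - x0); rewrite (distrC x x0).
    by case: hx z1 z2 => -[-> ->]; lra.
  rewrite BE ?ax1// -segintZ; last exact: continuous_pairr.
  rewrite -segintB; [|exact: cI|]; last first.
    by move=> y; apply: (@cvgM R); [exact: cvg_cst|exact: continuous_pairr].
  rewrite mulrCA; apply: norm_segint => //.
    move=> y; apply: (@cvgB _ R^o); first exact: cI.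
    by apply: (@cvgM R); [exact: cvg_cst|exact: continuous_pairr].
  move=> y ycd; rewrite -segint_cst// -segintB.
  - apply: norm_segint => //.
      by move=> z; apply: (@cvgB _ R^o); [exact: continuous_pairl|exact: cvg_cst].
    by move=> z zx; rewrite distrC ltW// H'.
  - exact: continuous_pairl.
  - by move=> ?; exact: cvg_cst.
have dB x0 : a0 < x0 -> is_derive x0 1 B (g x0).
  move=> ax0.
  suff H : h^-1 *: (B (h *: 1 + x0) - B x0) @[h --> 0^'] --> g x0.
    by apply: DeriveDef; [apply/cvg_ex; exists (g x0)|exact/cvg_lim].
  apply/cvgrPdist_le => e e0.
  have e1 : 0 < e / (d - c + 1) by rewrite divr_gt0// ltr_wpDl// subr_ge0.
  have e1e : (d - c) * (e / (d - c + 1)) <= e.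
    rewrite mulrCA ger_pMr// ler_pdivrMr ?mul1r ?lerDl//.
    by rewrite ltr_wpDl// subr_ge0.
  have /nbhs_ballP[r /= r0 Hr] := Bapx x0 _ e1.
  have ra : 0 < Num.min r (x0 - a0) by rewrite lt_min r0 subr_gt0.
  apply/nbhs_ballP; exists (Num.min r (x0 - a0)) => //= h.
  rewrite /ball/= sub0r normrN lt_min => /andP[hr hxa] h0.
  have hx : ball x0 r (h *: 1 + x0).
    by rewrite /ball/= opprD addrCA subrr addr0 normrN /= [h *: 1]mulr1.
  have Hr1 := Hr _ hx.
  rewrite {hx} [h *: 1]mulr1 in Hr1 *.
  rewrite -(@ler_pM2l _ `|h|) ?normr_gt0// -normrM mulrBr mulrA divff// mul1r.
  rewrite distrC; apply: le_trans (ler_wpM2l (normr_ge0 h) e1e).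
  case: (ltrgt0P h) h0 => // h0 _.
    have := Hr1 x0 (h + x0) (or_introl (conj erefl erefl)).
    by rewrite addrK (ltW ax0)/= lerDr (ltW h0) => /(_ isT).
  have := Hr1 (h + x0) x0 (or_intror (conj erefl erefl)).
  have -> : x0 - (h + x0) = - h by rewrite opprD addrCA subrr addr0.
  move=> H; rewrite -normrN.
  apply: le_trans (H _) => //.
    by rewrite mulNr opprK opprD opprB !opprK.
  rewrite gerDr (ltW h0) andbT; move: hxa; rewrite ltr0_norm//; lra.
have aa0 : a0 < a by rewrite /a0 ltrBlDr ltrDl.
have -> : segint a b (fun x => segint c d (fun y => G (x, y))) = B b - B a.
  apply: (@segint_FTC _ a b g B) => //.
  - move=> x0 /andP[ax0 _].
    have [dBx _] := dB _ (lt_le_trans aa0 ax0).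
    exact/differentiable_continuous/derivable1_diffP.
  - by move=> x /andP[ax _]; apply: dB; exact: lt_trans ax.
by rewrite BE// (ltW aa0).
Qed.

End param_integral.

Arguments segint_continuous {R P G} a b _.
Arguments continuous_pairl {P Q S G} q _.
Arguments continuous_pairr {P Q S G} p _.

Section continuity_combinators.
Implicit Types P Q S : topologicalType.

Lemma cont_comp P Q S (f : P -> Q) (g : Q -> S) :
  continuous f -> continuous g -> continuous (fun x => g (f x)).
Proof. by move=> cf cg x; apply: (@continuous_comp _ _ _ f g); [exact: cf|exact: cg]. Qed.

Lemma cont_pair P Q S (f : P -> Q) (g : P -> S) :
  continuous f -> continuous g -> continuous (fun x => (f x, g x)).
Proof. by move=> cf cg x; apply: cvg_pair; [exact: cf|exact: cg]. Qed.

Lemma cont_fst P Q S (f : P -> Q * S) : continuous f -> continuous (fun x => (f x).1).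
Proof. by move=> cf; apply: cont_comp cf _ => x; exact: cvg_fst. Qed.

Lemma cont_snd P Q S (f : P -> Q * S) : continuous f -> continuous (fun x => (f x).2).
Proof. by move=> cf; apply: cont_comp cf _ => x; exact: cvg_snd. Qed.

Lemma cont_id P : continuous (fun x : P => x).
Proof. by move=> x; exact: cvg_id. Qed.

Lemma cont_cst P Q (k : Q) : continuous (fun _ : P => k).
Proof. by move=> x; exact: cvg_cst. Qed.

End continuity_combinators.

Section row_cons.
Context {R : realType}.
Implicit Type P : topologicalType.

(** The row decomposition of [intRn], so that both iterated integrals unfold in the same way. *)
Definition vcons m (a : R) (y : 'rV[R]_m) : 'rV[R]_m.+1 :=
  row_mx (\row_(_ < 1) a) y.

Lemma vcons0 m a (y : 'rV[R]_m) : vcons a y 0 ord0 = a.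
Proof.
have -> : ord0 = lshift m (ord0 : 'I_1) by exact/val_inj.
by rewrite [LHS](row_mxEl (\row_(_ < 1) a) y 0 ord0) mxE.
Qed.

Lemma vconsS m a (y : 'rV[R]_m) i : vcons a y 0 (lift ord0 i) = y 0 i.
Proof.
have -> : lift ord0 i = rshift 1 i by exact/val_inj.
exact: (row_mxEr (\row_(_ < 1) a) y 0 i).
Qed.

Lemma continuous_rV P n (f : P -> 'rV[R]_n) :
  (forall i, continuous (fun p => f p 0 i)) -> continuous f.
Proof.
move=> cf p A [B MB BA].
apply: (@filterS _ (nbhs p) _ (fun p => forall i j, B i j (f p i j))).
  by move=> q Bq; apply: BA.
apply: filter_forall => i; apply: filter_forall => j.
have := cf j p; rewrite (ord1 i); apply; rewrite -(ord1 i); exact: MB.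
Qed.

Lemma continuous_coord n (i : 'I_n) : continuous (fun x : 'rV[R]_n => x 0 i).
Proof. exact: coord_continuous. Qed.

Lemma continuous_vcons P m (f : P -> R) (g : P -> 'rV[R]_m) :
  continuous f -> continuous g -> continuous (fun p => vcons (f p) (g p)).
Proof.
move=> cf cg; apply: continuous_rV => i; case: (unliftP ord0 i) => [j|] ->.
  under eq_fun do rewrite vconsS.
  by move=> p; apply: (@continuous_comp _ _ _ g (fun x => x 0 j));
    [exact: cg|exact: coord_continuous].
by under eq_fun do rewrite vcons0.
Qed.

End row_cons.

Ltac cont_proj := lazymatch goal with
  | |- continuous (fun x => x) => exact: cont_id
  | |- continuous (fun x => (@?f x, @?g x)) => refine (@cont_pair _ _ _ f g _ _); cont_proj
  | |- continuous (fun x => vcons (@?f x) (@?g x)) =>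
      refine (@continuous_vcons _ _ _ f g _ _); cont_proj
  | |- continuous (fun x => fst (@?f x)) => refine (@cont_fst _ _ _ f _); cont_proj
  | |- continuous (fun x => snd (@?f x)) => refine (@cont_snd _ _ _ f _); cont_proj
  | |- continuous (vcons ?k) => refine (@continuous_vcons _ _ _ (fun=> k) (fun x => x) _ _); cont_proj
  | |- continuous (@fst _ _) => refine (@cont_fst _ _ _ (fun x => x) (@cont_id _))
  | |- continuous (@snd _ _) => refine (@cont_snd _ _ _ (fun x => x) (@cont_id _))
  | |- continuous (fun _ => ?k) => exact: cont_cst
  end.

(** * Iterated integrals over cubes *)

Section box_integral.
Context {R : realType}.
Implicit Type P : topologicalType.

(** The centre is a sequence rather than a row, so that the recursive call merely shifts it; entries
    from index [n] on are ignored. *)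
Fixpoint boxint n (c : nat -> R) (L : R) : ('rV[R]_n -> R) -> R :=
  match n with
  | 0 => fun f => f 0
  | m.+1 => fun f => segint (c 0%N - L) (c 0%N + L)
      (fun a => boxint (fun i => c i.+1) L (fun y : 'rV[R]_m => f (vcons a y)))
  end.

Definition inbox n (c : nat -> R) (L : R) (x : 'rV[R]_n) :=
  forall i : 'I_n, `|x 0 i - c i| <= L.

Lemma inbox_vcons m c L a (y : 'rV[R]_m) :
  c 0%N - L <= a <= c 0%N + L -> inbox (fun i => c i.+1) L y ->
  inbox c L (vcons a y).
Proof.
move=> ha hy i; case: (unliftP ord0 i) => [j|] ->.
  by rewrite vconsS; exact: (hy j).
by rewrite vcons0 ler_distl.
Qed.

Lemma eq_boxint n c L (f g : 'rV[R]_n -> R) :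
  (forall x, inbox c L x -> f x = g x) -> boxint c L f = boxint c L g.
Proof.
elim: n c f g => [|n IH] c f g fg /=; first by apply: fg => -[].
apply: eq_segint => a /[!in_itv]/= ha; apply: IH => y hy.
by apply: fg; exact: inbox_vcons.
Qed.

Lemma boxint_continuous P n c L (F : P * 'rV[R]_n -> R) : continuous F ->
  continuous (fun p => boxint c L (fun x => F (p, x))).
Proof.
elim: n P c F => [|n IH] P c F cF /=; first exact: continuous_pairl.
pose G (q : P * R) := boxint (fun i => c i.+1) L (fun y => F (q.1, vcons q.2 y)).
have cG : continuous G.
  apply: (IH (P * R)%type _ (fun q => F (q.1.1, vcons q.1.2 q.2))).
  by apply: (cont_comp _ cF); cont_proj.
exact: (@segint_continuous R P G (c 0%N - L) (c 0%N + L) cG).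
Qed.

Lemma boxint_time_continuous n c L (F : 'rV[R]_n * R -> R) : continuous F ->
  continuous (fun s : R => boxint c L (fun x => F (x, s))).
Proof.
move=> cF; apply: (@boxint_continuous R n c L (fun q => F (q.2, q.1))).
by apply: (cont_comp _ cF); cont_proj.
Qed.

Lemma continuous_section m (f : 'rV[R]_m.+1 -> R) a : continuous f ->
  continuous (fun y => f (vcons a y)).
Proof.
by move=> cf; apply: (cont_comp _ cf); cont_proj.
Qed.

Lemma boxint_section_continuous m c L (f : 'rV[R]_m.+1 -> R) : continuous f ->
  continuous (fun a => boxint c L (fun y => f (vcons a y))).
Proof.
move=> cf; apply: (@boxint_continuous _ _ c L (fun q => f (vcons q.1 q.2))).
by apply: (cont_comp _ cf); cont_proj.
Qed.
Hint Resolve continuous_section boxint_section_continuous : core.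

Lemma continuousDR P (f g : P -> R) : continuous f -> continuous g ->
  continuous (fun x => f x + g x).
Proof. by move=> cf cg x; apply: (@cvgD _ R^o); [exact: cf|exact: cg]. Qed.

Lemma continuousBR P (f g : P -> R) : continuous f -> continuous g ->
  continuous (fun x => f x - g x).
Proof. by move=> cf cg x; apply: (@cvgB _ R^o); [exact: cf|exact: cg]. Qed.

Lemma continuousMR P (f g : P -> R) : continuous f -> continuous g ->
  continuous (fun x => f x * g x).
Proof. by move=> cf cg x; apply: (@cvgM R); [exact: cf|exact: cg]. Qed.

Lemma cont_bigprod P I (r : seq I) (Q : pred I) (f : I -> P -> R) :
  (forall i, continuous (f i)) -> continuous (fun x => \prod_(i <- r | Q i) f i x).
Proof.
move=> cf; elim: r => [|i r IH].
  by under eq_fun do rewrite big_nil; exact: cont_cst.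
under eq_fun do rewrite big_cons.
by case: (Q i) => //; exact: (continuousMR (cf i) IH).
Qed.

Lemma cont_bigsum P I (r : seq I) (Q : pred I) (f : I -> P -> R) :
  (forall i, continuous (f i)) -> continuous (fun x => \sum_(i <- r | Q i) f i x).
Proof.
move=> cf; elim: r => [|i r IH].
  by under eq_fun do rewrite big_nil; exact: cont_cst.
under eq_fun do rewrite big_cons.
by case: (Q i) => //; exact: (continuousDR (cf i) IH).
Qed.

Lemma boxintD n c L (f g : 'rV[R]_n -> R) : continuous f -> continuous g ->
  boxint c L (fun x => f x + g x) = boxint c L f + boxint c L g.
Proof.
elim: n c f g => [//|n IH] c f g cf cg /=.
rewrite -segintD; [|exact: boxint_section_continuous..].
by apply: eq_segint => a _; apply: IH; exact: continuous_section.
Qed.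

Lemma boxintZ n c L k (f : 'rV[R]_n -> R) : continuous f ->
  boxint c L (fun x => k * f x) = k * boxint c L f.
Proof.
elim: n c f => [//|n IH] c f cf /=.
rewrite -segintZ; last exact: boxint_section_continuous.
by apply: eq_segint => a _; apply: IH; exact: continuous_section.
Qed.

Lemma boxintB n c L (f g : 'rV[R]_n -> R) : continuous f -> continuous g ->
  boxint c L (fun x => f x - g x) = boxint c L f - boxint c L g.
Proof.
move=> cf cg; rewrite -[- boxint c L g]mulN1r -boxintZ// -boxintD//.
  by apply: eq_boxint => x _; rewrite mulN1r.
by apply: continuousMR => //; exact: cont_cst.
Qed.

Lemma le_boxint n c L (f g : 'rV[R]_n -> R) : continuous f -> continuous g ->
  (forall x, inbox c L x -> f x <= g x) -> boxint c L f <= boxint c L g.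
Proof.
elim: n c f g => [|n IH] c f g cf cg fg /=; first by apply: fg => -[].
apply: le_segint; do ?exact: boxint_section_continuous.
move=> a ha; apply: IH; do ?exact: continuous_section.
by move=> y hy; apply: fg; exact: inbox_vcons.
Qed.

Lemma boxint_cst n c L k : 0 <= L ->
  boxint c L (fun _ : 'rV[R]_n => k) = (2 * L) ^+ n * k.
Proof.
move=> L0; elim: n c => [|n IH] c /=; first by rewrite expr0 mul1r.
under eq_segint do rewrite IH.
rewrite segint_cst; last by lra.
by rewrite exprS mulrA; congr (_ * _ * _); lra.
Qed.

Lemma boxint_ge0 n c L (f : 'rV[R]_n -> R) :
  (forall x, inbox c L x -> 0 <= f x) -> 0 <= boxint c L f.
Proof.
elim: n c f => [|n IH] c f f0 /=; first by apply: f0 => -[].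
apply: segint_ge0 => a ha; apply: IH => y hy; apply: f0; exact: inbox_vcons.
Qed.

Lemma boxint0 n c L : boxint c L (fun _ : 'rV[R]_n => 0) = 0.
Proof.
rewrite -[RHS](mul0r (boxint c L (fun _ : 'rV[R]_n => 1))) -boxintZ; last exact: cont_cst.
by apply: eq_boxint => x _; rewrite mul0r.
Qed.

Lemma boxint_sum n c L m (f : 'I_m -> 'rV[R]_n -> R) :
  (forall i, continuous (f i)) ->
  boxint c L (fun x => \sum_i f i x) = \sum_i boxint c L (f i).
Proof.
elim: m f => [|m IH] f cf.
  under eq_boxint do rewrite big_ord0; rewrite big_ord0.
  exact: boxint0.
under eq_boxint do rewrite big_ord_recl; rewrite big_ord_recl boxintD//.
  by rewrite IH.
by apply: cont_bigsum.
Qed.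

Lemma boxint_segint_Fubini n c L (a b : R) (F : R * 'rV[R]_n -> R) :
  continuous F -> 0 <= L -> a <= b ->
  boxint c L (fun y => segint a b (fun s => F (s, y))) =
  segint a b (fun s => boxint c L (fun y => F (s, y))).
Proof.
move=> + L0 ab; elim: n c F => [//|n IH] c F cF /=.
have cV : continuous (fun q : (R * R) * 'rV[R]_n => F (q.1.1, vcons q.1.2 q.2)).
  by apply: (cont_comp _ cF); cont_proj.
rewrite (@segint_Fubini _ (fun q => boxint (fun i => c i.+1) L
   (fun y => F (q.1, vcons q.2 y)))) //; last by lra.
  apply: eq_segint => x _; apply: (IH _ (fun q => F (q.1, vcons x q.2))).
  by apply: (cont_comp _ cF); cont_proj.
exact: (@boxint_continuous _ _ _ _ _ cV).
Qed.

Lemma boxint_Fubini n m c L c' L' (F : 'rV[R]_n * 'rV[R]_m -> R) :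
  continuous F -> 0 <= L -> 0 <= L' ->
  boxint c L (fun x => boxint c' L' (fun y => F (x, y))) =
  boxint c' L' (fun y => boxint c L (fun x => F (x, y))).
Proof.
move=> + L0 L'0; elim: n c F => [//|n IH] c F cF /=.
under eq_segint => a _.
  rewrite (IH _ (fun q => F (vcons a q.1, q.2))); last first.
    by apply: (cont_comp _ cF); cont_proj.
  over.
rewrite -(@boxint_segint_Fubini _ _ _ _ _ (fun q => boxint (fun i => c i.+1) L
   (fun x => F (vcons q.1 x, q.2)))) //; last by lra.
apply: (@boxint_continuous _ _ _ _ (fun q : (R * 'rV[R]_m) * 'rV[R]_n =>
  F (vcons q.1.1 q.2, q.1.2))).
by apply: (cont_comp _ cF); cont_proj.
Qed.

Lemma boxint_prod n c L (h : nat -> R -> R) : (forall i, continuous (h i)) ->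
  boxint c L (fun x : 'rV[R]_n => \prod_(i < n) h i (x 0 i)) =
  \prod_(i < n) segint (c i - L) (c i + L) (h i).
Proof.
elim: n c h => [|n IH] c h ch /=; first by rewrite !big_ord0.
rewrite big_ord_recl -[RHS]mulrC -segintZ; last exact: ch.
apply: eq_segint => a _.
under eq_boxint do rewrite big_ord_recl vcons0.
rewrite boxintZ; last first.
  apply: cont_bigprod => i; apply: cont_comp (ch _).
  by under eq_fun do rewrite vconsS; exact: coord_continuous.
rewrite mulrC; congr (_ * _).
under eq_boxint do under eq_bigr do rewrite vconsS.
by rewrite (IH _ (fun i => h i.+1)).
Qed.

End box_integral.

Arguments boxint_time_continuous {R n} c L {F} _.
Arguments boxint_continuous {R P n} c L {F} _.
Arguments boxint_section_continuous {R m} c L {f} _.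

Section box_domains.
Context {R : realType}.

Lemma segint_sub (a b a' b' : R) (f : R -> R) : continuous f ->
  a' <= a -> a <= b -> b <= b' -> (forall x, a' <= x <= b' -> 0 <= f x) ->
  segint a b f <= segint a' b' f.
Proof.
move=> cf a'a ab bb' f0.
rewrite (@segint_split _ a' a b')//; last by rewrite a'a (le_trans ab).
rewrite (@segint_split _ a b b')//; last by rewrite ab.
rewrite addrCA lerDl addr_ge0//; apply: segint_ge0 => x /andP[h1 h2]; apply: f0;
  by apply/andP; split; lra.
Qed.

Lemma boxint_sub n (c c' : nat -> R) (L L' : R) (f : 'rV[R]_n -> R) :
  continuous f -> 0 <= L ->
  (forall i, (i < n)%N -> c' i - L' <= c i - L /\ c i + L <= c' i + L') ->
  (forall x, inbox c' L' x -> 0 <= f x) ->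
  boxint c L f <= boxint c' L' f.
Proof.
move=> + L0; elim: n c c' f => [//|n IH] c c' f cf cc' f0 /=.
have [h1 h2] := cc' 0%N isT.
apply: (@le_trans _ _ (segint (c 0%N - L) (c 0%N + L) (fun a =>
    boxint (fun i => c' i.+1) L' (fun y : 'rV_n => f (vcons a y))))).
  apply: le_segint; do ?exact: boxint_section_continuous.
  move=> a /andP[a1 a2]; apply: IH => //; first exact: continuous_section.
    by move=> i ni; apply: cc'.
  move=> y hy; apply: f0; apply: inbox_vcons => //; apply/andP; split; lra.
apply: segint_sub => //; first exact: boxint_section_continuous.
  by lra.
move=> a ha; apply: boxint_ge0 => y hy; apply: f0; exact: inbox_vcons.
Qed.

Lemma segint_supp (a b a' b' : R) (f : R -> R) : continuous f ->
  a' <= a -> a <= b -> b <= b' -> (forall x, (x < a) || (b < x) -> f x = 0) ->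
  segint a' b' f = segint a b f.
Proof.
move=> cf a'a ab bb' f0.
have z x y : x <= y -> (forall z, x < z < y -> f z = 0) -> segint x y f = 0.
  move=> xy h; apply: etrans (@segint_FTC _ x y f (fun=> 0) xy _ _ cf) _; last by rewrite subrr.
    by move=> ? _; exact: cvg_cst.
  by move=> z hz; rewrite h//; exact: is_derive_cst.
rewrite (@segint_split _ a' a b')//; last by rewrite a'a (le_trans ab).
rewrite (@segint_split _ a b b')//; last by rewrite ab.
rewrite (z a' a) ?(z b b') ?addr0 ?add0r// => x /andP[h1 h2]; apply: f0.
  by rewrite h1 orbT.
by rewrite h2.
Qed.

Lemma boxint_supp n (c : nat -> R) (L L' : R) (f : 'rV[R]_n -> R) :
  continuous f -> 0 <= L -> L <= L' ->
  (forall x, ~ inbox c L x -> f x = 0) ->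
  boxint c L' f = boxint c L f.
Proof.
move=> + L0 LL'; elim: n c f => [//|n IH] c f cf f0 /=.
rewrite (@segint_supp (c 0%N - L) (c 0%N + L)); [|exact: boxint_section_continuous|lra..|].
  apply: eq_segint => a ha; apply: IH; first exact: continuous_section.
  move=> y hy; apply: f0 => h; apply: hy => i.
  by have := h (lift ord0 i); rewrite vconsS.
move=> a ha; rewrite -[RHS](@boxint0 _ n (fun i => c i.+1) L').
apply: eq_boxint => y _; apply: f0 => h; have := h ord0; rewrite vcons0/= ler_distl.
by move: ha => /orP[]; lra.
Qed.

Lemma is_derive_path (V : normedModType R) (G : V -> R) (p v : V) (a d : R)
    (g : R -> V) : (forall h, g (h + a) = h *: v + p) ->
  is_derive p v G d -> is_derive a 1 (fun x => G (g x)) d.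
Proof.
move=> hg [dG dE].
have E : (fun h : R => h^-1 *: (((fun x => G (g x)) \o shift a) (h *: 1) - G (g a)))
       = (fun h => h^-1 *: ((G \o shift p) (h *: v) - G p)).
  apply/funext => h /=; rewrite [h *: 1]mulr1 hg.
  by rewrite -[in g a](add0r a) hg scale0r add0r.
by apply: DeriveDef; rewrite /derivable /derive E.
Qed.

(** The divergence theorem for a flux along one coordinate. When that coordinate is the outermost
    one, Fubini moves it inside; the fundamental theorem then leaves only values of [G] on two
    opposite faces, where it vanishes. *)
Lemma boxint_deriv_eq0 n (c : nat -> R) (L : R) (i : 'I_n) (G G' : 'rV[R]_n -> R) :
  0 <= L -> continuous G -> continuous G' ->
  (forall x, is_derive x (delta_mx 0 i) G (G' x)) ->
  (forall x : 'rV_n, x 0 i = c i - L \/ x 0 i = c i + L -> G x = 0) ->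
  boxint c L G' = 0.
Proof.
move=> L0; elim: n c i G G' => [|n IH] c i G G' cG cG' dG G0 /=; first by case: i {dG G0}.
case: (unliftP ord0 i) dG G0 => [j|] -> dG G0.
  rewrite (@eq_segint _ _ _ _ (fun=> 0)); first by rewrite segint_cst ?mulr0//; lra.
  move=> a _; apply: (IH _ j (fun y => G (vcons a y))).
  - exact: continuous_section.
  - exact: continuous_section.
  - move=> y; have := dG (vcons a y).
    set v := delta_mx _ _ => h.
    have E : (fun h : R => h^-1 *: (((fun y => G (vcons a y)) \o shift y) (h *: (delta_mx 0 j : 'rV_n)) - G (vcons a y)))
     = (fun h => h^-1 *: ((G \o shift (vcons a y)) (h *: v) - G (vcons a y))).
      apply/funext => k /=; congr (_ *: (G _ - _)); apply/rowP => l.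
      case: (unliftP ord0 l) => [l'|] ->.
        rewrite vconsS [RHS]mxE [LHS]mxE vconsS; congr (_ + _).
        by rewrite /v !mxE (inj_eq (@lift_inj _ ord0)).
      by rewrite vcons0 [RHS]mxE vcons0 /v !mxE /= mulr0 add0r.
    by case: h => h1 h2; apply: DeriveDef; rewrite /derivable /derive E.
  - by move=> x hx; apply: G0; rewrite vconsS.
rewrite -(@boxint_segint_Fubini _ _ _ _ _ _ (fun q => G' (vcons q.1 q.2)))//; [|by apply: (cont_comp _ cG'); cont_proj|lra].
rewrite -[RHS](@boxint0 _ n (fun i => c i.+1) L).
apply: eq_boxint => y _.
apply: etrans (@segint_FTC _ _ _ _ (fun a => G (vcons a y)) _ _ _ _) _.
- by lra.
- by move=> x _; apply: (cont_comp _ cG); cont_proj.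
- move=> x _; apply: (is_derive_path _ (dG (vcons x y))) => h.
  apply/rowP => l; case: (unliftP ord0 l) => [l'|] ->.
    by rewrite vconsS [RHS]mxE vconsS !mxE /= mulr0 add0r.
  by rewrite vcons0 [RHS]mxE vcons0 !mxE /= mulr1.
- by apply: (cont_comp _ cG'); cont_proj.
- by rewrite !G0 ?subrr// vcons0; [left|right].
Qed.

End box_domains.

(** * From integrals over cubes to the Lebesgue integrals of the statement *)

Section transfer.
Context {R : realType}.
Local Notation mu := (@lebesgue_measure R).

Lemma segments_eventually (a b : nat -> R) (x : R) :
  (forall k, a k <= x <= b k -> a k.+1 <= x <= b k.+1) ->
  (exists k, a k <= x <= b k) -> \forall k \near \oo, a k <= x <= b k.
Proof.
move=> ab1 [k0 k0x]; near=> k.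
have : (k0 <= k)%N by near: k; exact: nbhs_infty_ge.
elim: (k) => [|k' IH]; first by rewrite leqn0 => /eqP <-.
rewrite leq_eqVlt => /predU1P[<-//|]; rewrite ltnS => /IH; exact: ab1.
Unshelve. all: by end_near. Qed.

(** Monotone convergence in which the segments and the integrands grow together: the outer integrand
    of a box integral changes with the box. *)
Lemma segint_cvg_integral (D : set R) (a b : nat -> R) (h : nat -> R -> R)
    (g : R -> \bar R) : measurable D ->
  (forall k, continuous (h k)) ->
  (forall k, `[a k, b k] `<=` D) ->
  (forall k x, a k <= x <= b k -> a k.+1 <= x <= b k.+1) ->
  (forall x, D x -> exists k, a k <= x <= b k) ->
  (forall k x, a k <= x <= b k -> 0 <= h k x) ->
  (forall k x, a k <= x <= b k -> h k x <= h k.+1 x) ->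
  (forall x, D x -> (h k x)%:E @[k --> \oo] --> g x) ->
  (segint (a k) (b k) (h k))%:E @[k --> \oo] --> (\int[mu]_(x in D) g x)%E.
Proof.
move=> mD ch abD ab1 Dab h0 h1 hg.
pose f k : R -> \bar R := (EFin \o h k) \_ `[a k, b k].
have f0 k x : D x -> (0 <= f k x)%E.
  move=> _; rewrite /f patchE; case: ifPn => // /[!inE]/=.
  by rewrite in_itv/= => /h0; rewrite lee_fin.
have mf k : measurable_fun D (f k).
  apply: (measurable_funS measurableT) => //.
  apply/(measurable_restrictT _ _).1 => //.
  apply/measurable_EFinP; apply: measurable_funTS.
  exact: continuous_measurable_fun.
have f1 x : D x -> nondecreasing_seq (f ^~ x).
  move=> Dx; apply/nondecreasing_seqP => k; rewrite /f !patchE.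
  case: ifPn => [|_]; last by have := f0 k.+1 x Dx; rewrite /f patchE.
  rewrite inE/= in_itv/= => kx; have := ab1 k x kx => kx1.
  by rewrite mem_set/= ?in_itv//= lee_fin h1.
have fg x : D x -> limn (f ^~ x) = g x.
  move=> Dx; apply/cvg_lim => //; apply: cvg_trans (hg x Dx).
  apply: near_eq_cvg.
  have kx := segments_eventually (ab1 ^~ x) (Dab x Dx).
  near=> k; rewrite /f patchE mem_set//= in_itv/=.
  by near: k.
have -> : (\int[mu]_(x in D) g x = \int[mu]_(x in D) limn (f ^~ x))%E.
  by apply: eq_integral => x /[!inE] Dx; rewrite fg.
have := @cvg_monotone_convergence _ _ _ mu D mD f mf f0 f1.
apply: cvg_trans; apply: near_eq_cvg; near=> k.
rewrite /f -integral_mkcondr setIidr//.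
rewrite /segint /Rintegral fineK//.
apply: integrable_fin_num => //; exact: segint_integrable.
Unshelve. all: by end_near. Qed.

Lemma intRn_cvg n c (F : 'rV[R]_n -> R) : continuous F -> (forall x, 0 <= F x) ->
  (boxint c k%:R F)%:E @[k --> \oo] --> intRn (fun x => (F x)%:E).
Proof.
elim: n c F => [|n IH] c F cF F0 /=; first exact: cvg_cst.
apply: (@segint_cvg_integral setT (fun k => c 0%N - k%:R) (fun k => c 0%N + k%:R)
  (fun k a => boxint (fun i => c i.+1) k%:R (fun y => F (vcons a y)))) => //.
- by move=> k; exact: boxint_section_continuous.
- move=> k x; rewrite -natr1; lra.
- move=> x _; exists (Num.truncn `|x - c 0%N|).+1.
  by rewrite -ler_distl ltW// Num.Theory.truncnS_gt.
- by move=> k x _; exact: boxint_ge0.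
- move=> k x _; apply: boxint_sub => //; first exact: continuous_section.
  by move=> i _; rewrite -natr1; lra.
- move=> x _; apply: IH => //; exact: continuous_section.
Qed.

(** The projection onto [[a, b]]. Composing with it extends a function continuous on a time strip to
    a globally continuous one, without changing its integral over [[a, b]]; this is how functions
    singular at the ends of a time interval are fed to [segint]. *)
Definition clampr (a b s : R) := Num.max a (Num.min s b).

Lemma clampr_in a b s : a <= b -> a <= clampr a b s <= b.
Proof. by move=> ab; rewrite /clampr le_max lexx/= ge_max ab ge_min lexx orbT. Qed.

Lemma clampr_id a b s : a <= s <= b -> clampr a b s = s.
Proof. by case/andP => h1 h2; rewrite /clampr min_l// max_r. Qed.

Lemma continuous_clampr a b : continuous (clampr a b).
Proof.
move=> s; apply: (@continuous_max _ _ (fun=> a) (fun s => Num.min s b)).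
  exact: cvg_cst.
by apply: (@continuous_min _ _ id (fun=> b)); [exact: cvg_id|exact: cvg_cst].
Qed.

Lemma cont_clamp (V : topologicalType) (a b : R) (F : V * R -> R) : a <= b ->
  (forall p, a <= p.2 <= b -> {for p, continuous F}) ->
  continuous (fun p => F (p.1, clampr a b p.2)).
Proof.
move=> ab cF p.
have h : continuous (fun p : V * R => (p.1, clampr a b p.2)).
  apply: cont_pair; first by apply: cont_fst; exact: cont_id.
  by apply: (cont_comp _ (@continuous_clampr a b)); apply: cont_snd; exact: cont_id.
apply: (@continuous_comp _ _ _ (fun p : V * R => (p.1, clampr a b p.2)) F); first exact: h.
by apply: cF => /=; exact: clampr_in.
Qed.

Lemma cont_slice (V W : topologicalType) (F : V * W -> R) (s : W) :
  (forall y, {for (y, s), continuous F}) -> continuous (fun y => F (y, s)).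
Proof.
move=> cF y; apply: (@continuous_comp _ _ _ (fun y => (y, s)) F); last exact: cF.
exact: (@cont_pair _ _ _ id (fun=> s) (@cont_id _) (@cont_cst _ _ s) y).
Qed.

Variables (n : nat) (T t : R) (f : 'rV[R]_n * R -> R).
Hypotheses (t0 : 0 < t) (tT : t <= T) (f0 : forall p, 0 < p.2 < T -> 0 <= f p)
  (cf : forall p, 0 < p.2 < t -> {for p, continuous f})
  (ft : forall p, t <= p.2 < T -> f p = 0).

(** The offset ensures [lo k <= hi k] from [k = 0] on. *)
Let lo (k : nat) := t / k.+3%:R.
Let hi (k : nat) := t - t / k.+3%:R.

Let lo_gt0 k : 0 < lo k. Proof. by rewrite divr_gt0. Qed.
Let lo_hi k : lo k <= hi k.
Proof.
have k2 : k.+3%:R^-1 <= 2^-1 :> R by rewrite lef_pV2 ?posrE// ler_nat.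
rewrite /lo /hi; move: (k.+3%:R^-1) k2 => x x2.
by rewrite lerBrDr -mulrDr ger_pMr//; lra.
Qed.
Let hi_lt k : hi k < t. Proof. by rewrite /hi ltrBlDr ltrDl; exact: lo_gt0. Qed.
Let lo1 k : lo k.+1 <= lo k.
Proof. by rewrite /lo ler_pM2l// lef_pV2 ?posrE// ler_nat. Qed.

Let cc k : continuous (fun p : 'rV_n * R => f (p.1, clampr (lo k) (hi k) p.2)).
Proof.
apply: (cont_clamp (lo_hi k)) => p /andP[p1 p2]; apply: cf.
by rewrite (lt_le_trans _ p1)// (le_lt_trans p2).
Qed.

Let fc0 k y s : 0 <= f (y, clampr (lo k) (hi k) s).
Proof.
have /andP[h1 h2] := clampr_in s (lo_hi k); apply: f0 => /=.
by rewrite (lt_le_trans _ h1)// (le_lt_trans h2)// (lt_le_trans (hi_lt k)).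
Qed.

Let step k x : lo k <= x <= hi k -> lo k.+1 <= x <= hi k.+1.
Proof.
move=> /andP[h1 h2]; rewrite (le_trans (lo1 k))//= (le_trans h2)//.
by rewrite lerD2l lerN2; exact: lo1.
Qed.

Let ex_seg s : 0 < s < t -> exists k, lo k <= s <= hi k.
Proof.
move=> /andP[s0 st].
have m0 : 0 < Num.min s (t - s) by rewrite lt_min s0 subr_gt0.
  exists (Num.truncn (t / Num.min s (t - s))).
  set k := Num.truncn _.
  have : t / k.+3%:R <= Num.min s (t - s).
    rewrite ler_pdivrMr// mulrC -ler_pdivrMr// ltW//.
    by apply: lt_le_trans (truncnS_gt _) _; rewrite ler_nat ltnW// ltnW.
  by rewrite le_min => /andP[h1 h2]; rewrite /lo /hi h1/= lerBrDr -lerBrDl.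
Qed.

(** The integrand is continuous only before [t], where the kernel becomes singular, and vanishes
    from [t] on; hence the exhaustion of []0, t[] rather than []0, T[]. With [t = T] the same lemma
    serves for the [L^lambda] norm. *)
Lemma int_spacetime_cvg c :
  (segint (lo k) (hi k) (fun s => boxint c k%:R (fun y => f (y, clampr (lo k) (hi k) s))))%:E
    @[k --> \oo] --> int_spacetime T (fun y s => (f (y, s))%:E).
Proof.
have -> : int_spacetime T (fun y s => (f (y, s))%:E) =
    (\int[mu]_(s in itv0T t) intRn (fun y => (f (y, s))%:E))%E.
  rewrite /int_spacetime integral_mkcond [RHS]integral_mkcond.
  congr (integral _ _ _); apply/funext => s; rewrite /itv0T !patchE.
  rewrite !mem_setE !in_itv/=; case: (ltP 0 s) => //= s0.
  case: (ltP s t) => st; first by rewrite (lt_le_trans st tT).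
  case: ifP => // sT.
  rewrite (_ : (fun y => _) = fun _ : 'rV_n => 0%E); last first.
    by apply/funext => y; rewrite ft//= st sT.
  have := @intRn_cvg n (fun=> 0) (fun=> 0) (@cont_cst _ _ _) (fun=> lexx _).
  under eq_fun do rewrite boxint0.
  by move=> /cvg_lim <-//; rewrite lim_cst.
rewrite /itv0T; apply: (@segint_cvg_integral `]0, t[ lo hi
  (fun k s => boxint c k%:R (fun y => f (y, clampr (lo k) (hi k) s)))) => //.
- by move=> k; exact: (boxint_time_continuous _ _ (@cc k)).
- move=> k s /=; rewrite !in_itv/= => /andP[h1 h2].
  by rewrite (lt_le_trans _ h1)// (le_lt_trans h2).
- by move=> k s _; apply: boxint_ge0.
- move=> k s hs; rewrite (clampr_id (step hs)) -{2}(clampr_id hs).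
  apply: boxint_sub => //.
  + exact: (continuous_pairl _ (@cc k)).
  + by move=> i _; rewrite -natr1; lra.
- move=> s /=; rewrite in_itv/= => /andP[s0 st].
  have cfs : continuous (fun y => f (y, s)).
    by apply: cont_slice => y; apply: cf; rewrite /= s0.
  apply: cvg_trans (intRn_cvg c cfs _); last first.
    by move=> y; apply: f0; rewrite /= s0 (lt_le_trans st).
  apply: near_eq_cvg.
  have ks : \forall k \near \oo, lo k <= s <= hi k.
    apply: segments_eventually; last by apply: ex_seg; rewrite s0.
    by move=> k; exact: step.
  by near=> k; rewrite clampr_id//; near: k.
Unshelve. all: by end_near. Qed.

Lemma int_spacetime_le c (B : R) :
  (forall k s0 s1, 0 < s0 -> s0 <= s1 -> s1 < t ->
    segint s0 s1 (fun s => boxint c k%:R (fun y => f (y, clampr s0 s1 s))) <= B) ->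
  (int_spacetime T (fun y s => (f (y, s))%:E) <= B%:E)%E.
Proof.
move=> fB; have := @int_spacetime_cvg c => /cvg_lim <-//.
apply: lime_le; first by apply/cvg_ex; eexists; exact: int_spacetime_cvg.
by apply: nearW => k; rewrite lee_fin fB.
Qed.

Lemma int_spacetime_ge c (L s0 s1 : R) : 0 <= L -> 0 < s0 -> s0 <= s1 -> s1 < t ->
  ((segint s0 s1 (fun s => boxint c L (fun y => f (y, clampr s0 s1 s))))%:E <=
   int_spacetime T (fun y s => (f (y, s))%:E))%E.
Proof.
move=> L0 s00 s01 s1t; have := @int_spacetime_cvg c => /[dup] /cvg_lim <-// cv.
apply: lime_ge; first by apply/cvg_ex; eexists; exact: cv.
have fst s : 0 < s < t -> \forall k \near \oo, lo k <= s <= hi k.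
  move=> st; apply: segments_eventually; last exact: ex_seg.
  by move=> k; exact: step.
have s0t := fst s0; have s1t' := fst s1.
near=> k.
have /andP[k1 k2] : lo k <= s0 <= hi k by near: k; apply: s0t; rewrite s00 (le_lt_trans s01).
have /andP[k3 k4] : lo k <= s1 <= hi k by near: k; apply: s1t'; rewrite s1t (lt_le_trans s00).
have cs : continuous (fun p : 'rV_n * R => f (p.1, clampr s0 s1 p.2)).
  apply: (cont_clamp s01) => p /andP[p1 p2]; apply: cf.
  by rewrite (lt_le_trans _ p1)// (le_lt_trans p2).
have ck := @cc k.
rewrite lee_fin; apply: (@le_trans _ _ (segint s0 s1 (fun s =>
    boxint c k%:R (fun y => f (y, clampr (lo k) (hi k) s))))).
  apply: le_segint.
  - exact: (boxint_time_continuous _ _ cs).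
  - exact: (boxint_time_continuous _ _ ck).
  - move=> s /andP[h1 h2]; rewrite !clampr_id ?h1 ?h2// ?(le_trans k1) ?(le_trans h2)//.
    have E : clampr (lo k) (hi k) s = s by rewrite clampr_id// (le_trans k1)//= (le_trans h2).
    rewrite -E; apply: boxint_sub => //.
    + exact: (continuous_pairl _ ck).
    + move=> i _; have : L <= k%:R by near: k; exact: nbhs_infty_ger.
      lra.
apply: segint_sub => //; first exact: (boxint_time_continuous _ _ ck).
by move=> s _; exact: boxint_ge0.
Unshelve. all: by end_near. Qed.

End transfer.

(** * Local mass and Duhamel inequalities *)

Section product_derivative.
Context {R : realType}.

(** A directional derivative only sees the restriction to a line, so a function may be replaced by
    another one, possibly on another space, that agrees with it along that line. This reduces
    partial derivatives of products to one-dimensional ones. *)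
Lemma is_derive_growth (V W : normedModType R) (F : V -> R) (G : W -> R) p v q w d :
  (forall h : R, F (h *: v + p) = G (h *: w + q)) ->
  is_derive q w G d -> is_derive p v F d.
Proof.
move=> FG [dG dE].
have E : (fun h : R => h^-1 *: ((F \o shift p) (h *: v) - F p)) =
         (fun h : R => h^-1 *: ((G \o shift q) (h *: w) - G q)).
  apply/funext => h /=; rewrite FG.
  by have := FG 0; rewrite !scale0r !add0r => ->.
by apply: DeriveDef; rewrite /derivable /derive E.
Qed.

Lemma is_derive_bigprod n (f f' : 'I_n -> R -> R) (s : R) :
  (forall i, is_derive s 1 (f i) (f' i s)) ->
  is_derive s 1 (fun s => \prod_i f i s)
    (\sum_i f' i s * \prod_(j | j != i) f j s).
Proof.
elim: n f f' => [|n IH] f f' df.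
  rewrite big_ord0; rewrite (_ : (fun _ => _) = cst 1).
    exact: is_derive_cst.
  by apply/funext => x; rewrite big_ord0.
have -> : (fun s => \prod_i f i s) = (fun s => f ord0 s * \prod_i f (lift ord0 i) s).
  by apply/funext => x; rewrite big_ord_recl.
have IH' := IH (fun i => f (lift ord0 i)) (fun i => f' (lift ord0 i)) (fun i => df _).
have d0 := df ord0.
apply: is_derive_eq.
rewrite big_ord_recl [LHS]addrC; congr (_ + _).
  rewrite /GRing.scale/= mulrC; congr (_ * _).
  by rewrite [RHS]big_mkcond big_ord_recl/= mul1r.
rewrite /GRing.scale/= mulr_sumr; apply: eq_bigr => i _.
rewrite mulrCA; congr (_ * _).
rewrite [RHS]big_mkcond big_ord_recl/=; congr (_ * _).
by rewrite big_mkcond.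
Qed.

End product_derivative.

Section pointwise_continuity.
Context {R : realType}.

Lemma for_contM (V : topologicalType) (f g : V -> R) p : {for p, continuous f} ->
  {for p, continuous g} -> {for p, continuous (fun x => f x * g x)}.
Proof. by move=> cf cg; apply: (@cvgM R); [exact: cf|exact: cg]. Qed.

Lemma for_contD (V : topologicalType) (f g : V -> R) p : {for p, continuous f} ->
  {for p, continuous g} -> {for p, continuous (fun x => f x + g x)}.
Proof. by move=> cf cg; apply: (@cvgD _ R^o); [exact: cf|exact: cg]. Qed.

Lemma for_contB (V : topologicalType) (f g : V -> R) p : {for p, continuous f} ->
  {for p, continuous g} -> {for p, continuous (fun x => f x - g x)}.
Proof. by move=> cf cg; apply: (@cvgB _ R^o); [exact: cf|exact: cg]. Qed.

Lemma for_contS (V : topologicalType) J (r : seq J) (Q : pred J) (f : J -> V -> R) p :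
  (forall i, {for p, continuous (f i)}) ->
  {for p, continuous (fun x => \sum_(i <- r | Q i) f i x)}.
Proof.
move=> cf; elim: r => [|i r IH].
  rewrite (_ : (fun x => _) = fun=> 0); first exact: cvg_cst.
  by apply/funext => x; rewrite big_nil.
case Qi : (Q i); last first.
  rewrite (_ : (fun x => _) = fun x => \sum_(i <- r | Q i) f i x)//.
  by apply/funext => x; rewrite big_cons Qi.
rewrite (_ : (fun x => _) = fun x => f i x + \sum_(i <- r | Q i) f i x).
  exact: (for_contD (cf i) IH).
by apply/funext => x; rewrite big_cons Qi.
Qed.

Lemma for_contP (V : topologicalType) J (r : seq J) (Q : pred J) (f : J -> V -> R) p :
  (forall i, {for p, continuous (f i)}) ->
  {for p, continuous (fun x => \prod_(i <- r | Q i) f i x)}.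
Proof.
move=> cf; elim: r => [|i r IH].
  rewrite (_ : (fun x => _) = fun=> 1); first exact: cvg_cst.
  by apply/funext => x; rewrite big_nil.
case Qi : (Q i); last first.
  rewrite (_ : (fun x => _) = fun x => \prod_(i <- r | Q i) f i x)//.
  by apply/funext => x; rewrite big_cons Qi.
rewrite (_ : (fun x => _) = fun x => f i x * \prod_(i <- r | Q i) f i x).
  exact: (for_contM (cf i) IH).
by apply/funext => x; rewrite big_cons Qi.
Qed.

End pointwise_continuity.

(** * Green's identity for the heat operator, tested against products of one-dimensional
    functions *)

Section green.
Context {R : realType}.
Variables (n : nat) (T : R) (u : 'rV[R]_n * R -> R).
Hypothesis uC : C21 [set p | 0 < p.2 < T] u.

Variables (c : nat -> R) (L t0 t1 : R).
Hypotheses (L0 : 0 <= L) (t00 : 0 < t0) (t01 : t0 <= t1) (t1T : t1 < T).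

Variables om omt omz omzz : R * R -> R.
Let I s := t0 <= s <= t1.
Hypotheses (com : forall z s : R, I s -> {for (z, s), continuous om})
  (comt : forall z s : R, I s -> {for (z, s), continuous omt})
  (comz : forall z s : R, I s -> {for (z, s), continuous omz})
  (comzz : forall z s : R, I s -> {for (z, s), continuous omzz})
  (domt : forall z s : R, I s -> is_derive s 1 (fun s => om (z, s)) (omt (z, s)))
  (domz : forall z s : R, I s -> is_derive z 1 (fun z => om (z, s)) (omz (z, s)))
  (domzz : forall z s : R, I s -> is_derive z 1 (fun z => omz (z, s)) (omzz (z, s)))
  (om0 : forall z s : R, I s -> `|z| = L -> om (z, s) = 0 /\ omz (z, s) = 0).

(** A product of one factor per coordinate: each space derivative touches a single factor, so all
    that is asked of the test function is one-dimensional. *)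
Definition prodtest (p : 'rV[R]_n * R) := \prod_(i < n) om (p.1 0 i - c i, p.2).
Definition prodtest_but (i : 'I_n) (p : 'rV[R]_n * R) :=
  \prod_(j < n | j != i) om (p.1 0 j - c j, p.2).
Definition heat_source (p : 'rV[R]_n * R) := dt u p - lap u p.
(** With [w := prodtest] and [f := heat_source] this is [f w + u (w_t + Δw)], the adjoint heat
    operator being written out factor by factor. *)
Definition green_integrand (p : 'rV[R]_n * R) :=
  heat_source p * prodtest p + u p * \sum_(i < n) prodtest_but i p *
    (omt (p.1 0 i - c i, p.2) + omzz (p.1 0 i - c i, p.2)).

Let It s : I s -> 0 < s < T.
Proof. by move=> /andP[h1 h2]; rewrite (lt_le_trans t00 h1) (le_lt_trans h2 t1T). Qed.

Let ctest (h : R * R -> R) : (forall z s : R, I s -> {for (z, s), continuous h}) ->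
  forall (i : 'I_n) (p : 'rV[R]_n * R), I p.2 ->
    {for p, continuous (fun p : 'rV[R]_n * R => h (p.1 0 i - c i, p.2))}.
Proof.
move=> ch i p Ip.
apply: (@continuous_comp _ _ _ (fun p : 'rV[R]_n * R => (p.1 0 i - c i, p.2)) h).
  apply: (@cont_pair _ _ _ (fun p : 'rV[R]_n * R => p.1 0 i - c i) snd).
    apply: continuousBR; last exact: cont_cst.
    by apply: (cont_comp _ (@coord_continuous _ _ _ 0 i)); apply: cont_fst; exact: cont_id.
  by apply: cont_snd; exact: cont_id.
exact: ch.
Qed.

Lemma prodtest_continuous p : I p.2 -> {for p, continuous prodtest}.
Proof. by move=> Ip; apply: for_contP => i; exact: (ctest com). Qed.

Lemma prodtest_but_continuous i p : I p.2 -> {for p, continuous (prodtest_but i)}.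
Proof. by move=> Ip; apply: for_contP => j; exact: (ctest com). Qed.

Lemma heat_source_continuous p : 0 < p.2 < T -> {for p, continuous heat_source}.
Proof.
move=> Ip; have [_ _ h h'] := uC Ip; apply: for_contB => //.
by apply: for_contS => i; have [_ _ /(_ i)[]] := h' i.
Qed.

Lemma green_integrand_continuous p : I p.2 -> {for p, continuous green_integrand}.
Proof.
move=> Ip; have [cu _ _ _] := uC (It Ip); apply: for_contD.
  apply: for_contM; first exact: (heat_source_continuous (It Ip)).
  exact: prodtest_continuous.
apply: for_contM => //; apply: for_contS => i; apply: for_contM.
  exact: prodtest_but_continuous.
by apply: for_contD; [exact: (ctest comt)|exact: (ctest comzz)].
Qed.

(** The time derivative [E = u_t w + u w_t] of [u w] equals [green_integrand] minus the divergence
    of the flux [G i = u w_i - w u_i]. The flux vanishes on the faces of the cube because both [om]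
    and [omz] do, so its divergence integrates to zero. *)
Lemma green_identity :
  boxint c L (fun y => u (y, t1) * prodtest (y, t1)) -
  boxint c L (fun y => u (y, t0) * prodtest (y, t0)) =
  segint t0 t1 (fun s => boxint c L (fun y => green_integrand (y, clampr t0 t1 s))).
Proof.
pose prodt (p : 'rV[R]_n * R) := \sum_(i < n) omt (p.1 0 i - c i, p.2) * prodtest_but i p.
pose E (p : 'rV[R]_n * R) : R := dt u p * prodtest p + u p * prodt p.
have cprodt p : I p.2 -> {for p, continuous prodt}.
  move=> Ip; apply: for_contS => i; apply: for_contM; first exact: (ctest comt).
  exact: prodtest_but_continuous.
have cE p : I p.2 -> {for p, continuous E}.
  move=> Ip; have [cu _ cut _] := uC (It Ip).
  by apply: for_contD; apply: for_contM => //;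
    [exact: prodtest_continuous|exact: cprodt].
have cuw s : I s -> continuous (fun y => u (y, s) * prodtest (y, s)).
  move=> Is; apply: (@cont_slice _ _ _ (fun p => u p * prodtest p)) => y.
  by apply: for_contM; [have [] := uC (It (Is : I (y, s).2))|exact: prodtest_continuous].
have cEc : continuous (fun p : 'rV_n * R => E (p.1, clampr t0 t1 p.2)).
  exact: (cont_clamp t01 cE).
have It0 : I t0 by rewrite /I lexx.
have It1 : I t1 by rewrite /I lexx andbT.
rewrite -boxintB; [|exact: cuw..].
transitivity (boxint c L (fun y => segint t0 t1 (fun s => E (y, clampr t0 t1 s)))).
  apply: eq_boxint => y _.
  have du s : I s -> is_derive s 1 (fun s => u (y, s) * prodtest (y, s)) (E (y, s)).
    move=> Is.
    have d1 : is_derive s 1 (fun s => u (y, s)) (dt u (y, s)).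
      have [_ d _ _] := uC (It (Is : I (y, s).2)).
      apply: (@is_derive_path _ _ u (y, s) (@et R n)).
        by move=> h; rewrite /et; congr (_, _); rewrite /= ?scaler0 ?add0r// [h *: 1]mulr1.
      exact: derivableP.
    have d2 : is_derive s 1 (fun s => prodtest (y, s)) (prodt (y, s)).
      exact: (@is_derive_bigprod _ _ (fun i s => om (y 0 i - c i, s))
        (fun i s => omt (y 0 i - c i, s)) s (fun i => domt _ Is)).
    by apply: is_derive_eq; rewrite /GRing.scale/= addrC [X in X + _]mulrC.
  apply/esym; apply: (@segint_FTC _ t0 t1 _ (fun s => u (y, s) * prodtest (y, s))) => //.
  - move=> s Is; have [d _] := du s Is.
    exact/differentiable_continuous/derivable1_diffP.
  - move=> s /andP[/ltW h1 /ltW h2]; rewrite clampr_id ?h1//.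
    by apply: du; rewrite /I h1.
  - exact: (continuous_pairr y cEc).
rewrite (@boxint_segint_Fubini _ _ _ _ _ _ (fun q => E (q.2, clampr t0 t1 q.1)))//; last first.
  by apply: (cont_comp (f := fun q : R * 'rV_n => (q.2, q.1)) _ cEc); cont_proj.
apply: eq_segint => s /[!in_itv]/= Is; rewrite clampr_id//.
pose wi i (y : 'rV[R]_n) := omz (y 0 i - c i, s) * prodtest_but i (y, s).
pose wii i (y : 'rV[R]_n) := omzz (y 0 i - c i, s) * prodtest_but i (y, s).
pose G i (y : 'rV[R]_n) := u (y, s) * wi i y - prodtest (y, s) * dx i u (y, s).
pose G' i (y : 'rV[R]_n) := u (y, s) * wii i y - prodtest (y, s) * dx i (dx i u) (y, s).
have Iys (y : 'rV[R]_n) : I (y, s).2 by [].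
have cpb i : continuous (fun y => prodtest_but i (y, s)).
  by apply: cont_slice => y; exact: prodtest_but_continuous.
have cpt : continuous (fun y => prodtest (y, s)).
  by apply: cont_slice => y; exact: prodtest_continuous.
have cu : continuous (fun y => u (y, s)).
  by apply: cont_slice => y; have [] := uC (It (Iys y)).
have cui i : continuous (fun y => dx i u (y, s)).
  by apply: cont_slice => y; have [_ _ _ /(_ i)[]] := uC (It (Iys y)).
have cuii i : continuous (fun y => dx i (dx i u) (y, s)).
  by apply: cont_slice => y; have [_ _ _ /(_ i)[_ _ /(_ i)[]]] := uC (It (Iys y)).
have cG i : continuous (G i).
  apply: continuousBR; apply: continuousMR => //; apply: continuousMR => //.
  apply: (@cont_slice _ _ _ (fun p : 'rV[R]_n * R => omz (p.1 0 i - c i, p.2))) => y.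
  exact: (ctest comz).
have cG' i : continuous (G' i).
  apply: continuousBR; apply: continuousMR => //; apply: continuousMR => //.
  apply: (@cont_slice _ _ _ (fun p : 'rV[R]_n * R => omzz (p.1 0 i - c i, p.2))) => y.
  exact: (ctest comzz).
have prodtestE i y : prodtest (y, s) = om (y 0 i - c i, s) * prodtest_but i (y, s).
  by rewrite /prodtest (bigD1 i).
have -> : boxint c L (fun y => green_integrand (y, s)) =
    boxint c L (fun y => E (y, s) + \sum_i G' i y).
  apply: eq_boxint => y _; rewrite /green_integrand /E /heat_source /lap /prodt /G' /wii.
  rewrite sumrB -mulr_sumr -mulr_sumr /= mulrBl.
  set A := \sum_(i < n) _ * (_ + _).
  have -> : A = \sum_(i < n) omt (y 0 i - c i, s) * prodtest_but i (y, s) +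
     \sum_(i < n) omzz (y 0 i - c i, s) * prodtest_but i (y, s).
    by rewrite -big_split/=; apply: eq_bigr => i _; rewrite mulrC mulrDl.
  rewrite mulrDr; ring.
rewrite boxintD; [|by apply: (@cont_slice _ _ _ E) => y; exact: cE|exact: cont_bigsum].
rewrite boxint_sum// big1 ?addr0// => i _.
apply: (@boxint_deriv_eq0 _ _ _ _ i (G i)) => //.
  move=> y.
  have line (F : 'rV[R]_n * R -> R) d : is_derive (y, s) (ex R i) F d ->
      is_derive y (delta_mx 0 i : 'rV[R]_n) (fun y => F (y, s)) d.
    apply: is_derive_growth => h /=.
    by congr (F _); rewrite /ex; congr (_, _); rewrite /= scaler0 add0r.
  have d1 : is_derive y (delta_mx 0 i : 'rV[R]_n) (fun y => u (y, s)) (dx i u (y, s)).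
    by apply: line; have [_ _ _ /(_ i)[h _ _]] := uC (It (Iys y)); exact: derivableP.
  have d2 : is_derive y (delta_mx 0 i : 'rV[R]_n) (fun y => dx i u (y, s)) (dx i (dx i u) (y, s)).
    apply: line; have [_ _ _ /(_ i)[_ _ /(_ i)[h _]]] := uC (It (Iys y)).
    exact: derivableP.
  have coord (h h' : R * R -> R) : is_derive (y 0 i - c i) 1 (fun z => h (z, s)) (h' (y 0 i - c i, s)) ->
      is_derive y (delta_mx 0 i : 'rV[R]_n) (fun y => h (y 0 i - c i, s) * prodtest_but i (y, s))
       (h' (y 0 i - c i, s) * prodtest_but i (y, s)).
    move=> dh; pose g z := h (z, s) * prodtest_but i (y, s).
    apply: (@is_derive_growth _ _ _ _ g _ _ (y 0 i - c i) 1) => [k|].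
      rewrite /g; congr (h (_, _) * _).
        by rewrite !mxE !eqxx/= [k *: 1]mulr1 mulr1 addrA.
      rewrite /prodtest_but; apply: eq_bigr => j ji; congr (om (_ - _, _)).
      by rewrite !mxE eqxx/= (negbTE ji) mulr0 add0r.
    rewrite /g; apply: is_derive_eq.
    by rewrite /GRing.scale/= mulr0 add0r mulrC.
  have d3 := coord _ _ (domz (y 0 i - c i) Is).
  have d4 := coord _ _ (domzz (y 0 i - c i) Is).
  have d5 : is_derive y (delta_mx 0 i : 'rV[R]_n) (fun y => prodtest (y, s)) (wi i y).
    by under eq_fun do rewrite (prodtestE i).
  rewrite /G; apply: is_derive_eq; rewrite /G' /wi /wii /GRing.scale/=.
  by rewrite /wi; ring.
move=> y hy; have zL : `|y 0 i - c i| = L.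
  case: hy => ->; first by rewrite addrAC subrr sub0r normrN ger0_norm.
  by rewrite addrAC subrr add0r ger0_norm.
have [h1 h2] := om0 Is zL.
by rewrite /G /wi h2 (prodtestE i) h1 !mul0r mulr0 subrr.
Qed.

End green.

(** * Derivative rules and explicit cutoff functions *)

Section real_derivatives.
Context {R : realType}.
Implicit Types (f g : R -> R) (x a b : R).

Lemma is_der_eq f x a b : is_derive x 1 f a -> a = b -> is_derive x 1 f b.
Proof. by move=> h <-. Qed.

Lemma is_der_cst (k : R) x : is_derive x 1 (fun _ : R => k) 0.
Proof. exact: is_derive_cst. Qed.

Lemma is_der_id x : is_derive x 1 (fun x : R => x) 1.
Proof. exact: is_derive_id. Qed.

Lemma is_derD f g x a b : is_derive x 1 f a -> is_derive x 1 g b ->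
  is_derive x 1 (fun x => f x + g x) (a + b).
Proof. by move=> ? ?; exact: is_deriveD. Qed.

Lemma is_derB f g x a b : is_derive x 1 f a -> is_derive x 1 g b ->
  is_derive x 1 (fun x => f x - g x) (a - b).
Proof. by move=> ? ?; exact: is_deriveB. Qed.

Lemma is_derN f x a : is_derive x 1 f a -> is_derive x 1 (fun x => - f x) (- a).
Proof. by move=> ?; exact: is_deriveN. Qed.

Lemma is_derM f g x a b : is_derive x 1 f a -> is_derive x 1 g b ->
  is_derive x 1 (fun x => f x * g x) (a * g x + f x * b).
Proof.
move=> df dg; apply: (is_der_eq (is_deriveM df dg)).
by rewrite /GRing.scale/= addrC [g x * a]mulrC.
Qed.

Lemma is_der_comp f g x a b : is_derive (g x) 1 f a -> is_derive x 1 g b ->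
  is_derive x 1 (fun x => f (g x)) (a * b).
Proof. by move=> df dg; exact: is_derive1_comp. Qed.

Lemma is_der_exp f x a : is_derive x 1 f a ->
  is_derive x 1 (fun x => expR (f x)) (expR (f x) * a).
Proof. by move=> df; exact: (is_der_comp (is_derive_expR (f x)) df). Qed.

Lemma is_der_ln f x a : 0 < f x -> is_derive x 1 f a ->
  is_derive x 1 (fun x => ln (f x)) ((f x)^-1 * a).
Proof. by move=> f0 df; exact: (is_der_comp (is_derive1_ln f0) df). Qed.

Lemma is_der_inv f x a : f x != 0 -> is_derive x 1 f a ->
  is_derive x 1 (fun x => (f x)^-1) (- (f x) ^- 2 * a).
Proof.
move=> f0 df; have [d e] := df; apply: DeriveDef; first exact: derivableV.
by rewrite (deriveV f0 d) e.
Qed.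

Lemma is_der_sqr f x a : is_derive x 1 f a ->
  is_derive x 1 (fun x => f x ^+ 2) (2 * f x * a).
Proof.
move=> df; apply: (is_der_eq (is_derM df df)); ring.
Qed.

Definition posp (z : R) := Num.max 0 z.

Lemma posp_ge0 z : 0 <= posp z. Proof. by rewrite /posp le_max lexx. Qed.
Lemma posp_pos z : 0 <= z -> posp z = z. Proof. by move=> ?; rewrite /posp max_r. Qed.
Lemma posp_neg z : z <= 0 -> posp z = 0. Proof. by move=> ?; rewrite /posp max_l. Qed.
Lemma posp_mul z : z * posp z = posp z ^+ 2.
Proof.
have [z0|/ltW z0] := leP 0 z; first by rewrite posp_pos.
by rewrite posp_neg// mulr0 expr0n.
Qed.

Lemma is_der_posp2 x : is_derive x 1 (fun z => posp z ^+ 2) (2 * posp x).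
Proof.
suff H : h^-1 *: (posp (h *: 1 + x) ^+ 2 - posp x ^+ 2) @[h --> 0^'] --> 2 * posp x.
  by apply: DeriveDef; [apply/cvg_ex; exists (2 * posp x)|exact/cvg_lim].
apply/cvgrPdist_le => e e0.
apply/nbhs_ballP; exists e => //= h; rewrite /ball/= sub0r normrN => he h0.
rewrite [h *: 1]mulr1.
rewrite -(@ler_pM2l _ `|h|) ?normr_gt0// -normrM mulrBr /GRing.scale/= (mulrA h h^-1) divff// mul1r.
apply: (@le_trans _ _ (`|h| * `|h|)); last by rewrite ler_wpM2l// ltW.
rewrite -normrM ger0_norm; last by rewrite -expr2 sqr_ge0.
rewrite /posp; have [h1|h1] := ltP 0 x; have [h2|h2] := ltP 0 (h + x);
  rewrite ler_norml; apply/andP; split; nra.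
Qed.

(** The third power of the positive part is [C^2], which is the regularity that Green's identity
    asks of cutoffs; all of them are built from this one function. *)
Definition p3 (z : R) := posp z ^+ 3.

Lemma is_der_p3 x : is_derive x 1 p3 (3 * posp x ^+ 2).
Proof.
have -> : p3 = (fun z => z * posp z ^+ 2).
  by apply/funext => z; rewrite /p3 [in RHS]expr2 mulrA posp_mul -exprSr.
apply: (is_der_eq (is_derM (is_der_id x) (is_der_posp2 x))).
by rewrite mul1r mulrCA posp_mul; ring.
Qed.

Definition chi0 (z : R) := p3 (1 - z ^+ 2).
Definition chi0' (z : R) := - (6 * z) * posp (1 - z ^+ 2) ^+ 2.
Definition chi0'' (z : R) :=
  - 6 * posp (1 - z ^+ 2) ^+ 2 + 24 * z ^+ 2 * posp (1 - z ^+ 2).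

Lemma is_der_1Bsqr (x : R) : is_derive x 1 (fun z : R => 1 - z ^+ 2) (- (2 * x)).
Proof.
apply: (is_der_eq (is_derB (is_der_cst 1 x) (is_der_sqr (is_der_id x)))); ring.
Qed.

Lemma is_der_chi0 x : is_derive x 1 chi0 (chi0' x).
Proof.
apply: (is_der_eq (is_der_comp (is_der_p3 _) (is_der_1Bsqr x))).
by rewrite /chi0'; ring.
Qed.

Lemma is_der_chi0' x : is_derive x 1 chi0' (chi0'' x).
Proof.
apply: (is_der_eq (is_derM (is_derN (is_derM (is_der_cst 6 x) (is_der_id x)))
  (is_der_comp (is_der_posp2 _) (is_der_1Bsqr x)))).
by rewrite /chi0''; ring.
Qed.

Lemma chi0_ge0 z : 0 <= chi0 z.
Proof. by rewrite exprn_ge0// posp_ge0. Qed.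

(** With [q = 1 - z^2], the sum [chi0'' + 10 chi0] is [q] times a quadratic polynomial in [q]
    without real root. The bound holds up to the edge of the support, so an exponential factor in
    time can compensate the Laplacian of this cutoff. *)
Lemma chi0''_ge z : - (10 * chi0 z) <= chi0'' z.
Proof.
rewrite /chi0 /chi0'' /p3; have [h|/ltW h] := leP (1 - z ^+ 2) 0.
  by rewrite posp_neg// !expr0n/= !mulr0 addr0 oppr0.
rewrite posp_pos//; set q := 1 - z ^+ 2 in h *.
have -> : z ^+ 2 = 1 - q by rewrite /q; ring.
rewrite -subr_ge0.
have -> : -6 * q ^+ 2 + 24 * (1 - q) * q - - (10 * q ^+ 3) =
  q * (10 * (q - 3 / 2) ^+ 2 + 3 / 2) by field.
apply: mulr_ge0 => //; have := sqr_ge0 (q - 3 / 2); lra.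
Qed.

(** A cutoff with a plateau: it equals 1 where [chi0 z >= 1/8], that is for [z^2 <= 1/2], and 0 for
    [|z| >= 1]. *)
Definition chi1 (z : R) := 1 - p3 (1 - 8 * chi0 z).
Definition chi1' (z : R) := 24 * posp (1 - 8 * chi0 z) ^+ 2 * chi0' z.
Definition chi1'' (z : R) := 24 * posp (1 - 8 * chi0 z) ^+ 2 * chi0'' z
  - 24 * 16 * posp (1 - 8 * chi0 z) * chi0' z ^+ 2.

Lemma is_der_1B8chi0 (x : R) : is_derive x 1 (fun z => 1 - 8 * chi0 z) (- (8 * chi0' x)).
Proof.
apply: (is_der_eq (is_derB (is_der_cst 1 x) (is_derM (is_der_cst 8 x) (is_der_chi0 x)))).
ring.
Qed.

Lemma is_der_chi1 x : is_derive x 1 chi1 (chi1' x).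
Proof.
apply: (is_der_eq (is_derB (is_der_cst 1 x)
  (is_der_comp (is_der_p3 _) (is_der_1B8chi0 x)))).
by rewrite /chi1'; ring.
Qed.

Lemma is_der_chi1' x : is_derive x 1 chi1' (chi1'' x).
Proof.
apply: (is_der_eq (is_derM (is_derM (is_der_cst 24 x)
  (is_der_comp (is_der_posp2 _) (is_der_1B8chi0 x))) (is_der_chi0' x))).
by rewrite /chi1''; ring.
Qed.

Lemma posp_le1 z : z <= 1 -> posp z <= 1.
Proof. by move=> ?; rewrite /posp ge_max ler01. Qed.

Lemma chi1_ge0 z : 0 <= chi1 z.
Proof.
rewrite /chi1 subr_ge0 exprn_ile1 ?posp_ge0// posp_le1//.
by have := chi0_ge0 z; lra.
Qed.

Lemma chi1_le1 z : chi1 z <= 1.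
Proof. by rewrite /chi1 gerBl exprn_ge0// posp_ge0. Qed.

Lemma chi1_core z : z ^+ 2 <= 2^-1 -> [/\ chi1 z = 1, chi1' z = 0 & chi1'' z = 0].
Proof.
move=> h; have p0 : posp (1 - 8 * chi0 z) = 0.
  apply: posp_neg; rewrite /chi0 /p3 posp_pos; last by lra.
  have : (2^-1) ^+ 3 <= (1 - z ^+ 2) ^+ 3 by apply: lerXn2r; rewrite ?nnegrE; lra.
  lra.
by rewrite /chi1 /chi1' /chi1'' /p3 p0 !expr0n/= !(mulr0, mul0r, subr0).
Qed.

Lemma chi1_out z : 1 <= `|z| -> [/\ chi1 z = 0, chi1' z = 0 & chi1'' z = 0].
Proof.
move=> h; have p0 : posp (1 - z ^+ 2) = 0.
  by apply: posp_neg; rewrite subr_le0 -real_normK ?num_real// exprn_ege1.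
have c0 : chi0 z = 0 by rewrite /chi0 /p3 p0 expr0n.
have c1 : chi0' z = 0 by rewrite /chi0' p0 expr0n/= mulr0.
have c2 : chi0'' z = 0 by rewrite /chi0'' p0 expr0n/= !mulr0 addr0.
rewrite /chi1 /chi1' /chi1'' /p3 c0 c1 c2 mulr0 subr0 posp_pos// expr1n.
by rewrite expr0n/= !mulr0 !subrr.
Qed.

(** Read off the formulas for [chi1'] and [chi1''] from [|chi0'| <= 6] and [|chi0''| <= 30]; no
    attempt at sharpness. *)
Definition chi_bound : R := 24 * 30 + 24 * 16 * (6 * 6).

Lemma chi1_bounds z : `|chi1' z| <= chi_bound /\ `|chi1'' z| <= chi_bound.
Proof.
have [h|h] := leP 1 `|z|.
  by have [_ -> ->] := chi1_out h; rewrite normr0 /chi_bound; lra.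
have z2 : z ^+ 2 <= 1 by rewrite -real_normK ?num_real// exprn_ile1// ltW.
have zz : -1 <= z <= 1 by rewrite -ler_norml ltW.
rewrite /chi1' /chi1''.
have p1 := posp_ge0 (1 - 8 * chi0 z).
have p2 : posp (1 - 8 * chi0 z) <= 1 by apply: posp_le1; have := chi0_ge0 z; lra.
have q1 := posp_ge0 (1 - z ^+ 2).
have q2 : posp (1 - z ^+ 2) <= 1 by apply: posp_le1; have := sqr_ge0 z; lra.
rewrite /chi0' /chi0''.
move: (posp (1 - 8 * chi0 z)) p1 p2 (posp (1 - z ^+ 2)) q1 q2 => p p0 p1 q q0 q1.
have pp : 0 <= p ^+ 2 <= 1 by rewrite exprn_ge0//= exprn_ile1.
have qq : 0 <= q ^+ 2 <= 1 by rewrite exprn_ge0//= exprn_ile1.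
have bd (a b A B : R) : `|a| <= A -> `|b| <= B -> `|a * b| <= A * B.
  by move=> ha hb; rewrite normrM ler_pM.
have b1 : `|- (6 * z) * q ^+ 2| <= 6.
  rewrite -[leRHS]mulr1; apply: (bd); rewrite ler_norml; lra.
have b2 : `|- 6 * q ^+ 2 + 24 * z ^+ 2 * q| <= 30.
  have : `|24 * z ^+ 2 * q| <= (24 * 1) * 1.
    apply: (bd); last by rewrite ler_norml; lra.
    by apply: (bd); rewrite ler_norml; have := sqr_ge0 z; lra.
  by rewrite !ler_norml; lra.
have b3 : `|24 * p ^+ 2| <= 24 by rewrite ler_norml; lra.
have b4 : `|24 * 16 * p| <= 24 * 16 by rewrite ler_norml; lra.
split.
  apply: le_trans (bd _ _ _ _ b3 b1) _; rewrite /chi_bound; lra.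
apply: le_trans (ler_normB _ _) _; rewrite /chi_bound lerD//.
  exact: bd.
by rewrite expr2; apply: (bd _ _ _ _ b4); exact: bd.
Qed.

Lemma is_der_continuous f x a : is_derive x 1 f a -> {for x, continuous f}.
Proof. by move=> [d _]; exact/differentiable_continuous/derivable1_diffP. Qed.

Lemma continuous_posp : continuous posp.
Proof.
by move=> x; apply: (@continuous_max _ _ (fun=> 0) id); [exact: cvg_cst|exact: cvg_id].
Qed.

Lemma continuous_chi0 : continuous chi0.
Proof. by move=> x; exact: is_der_continuous (is_der_chi0 x). Qed.
Lemma continuous_chi0' : continuous chi0'.
Proof. by move=> x; exact: is_der_continuous (is_der_chi0' x). Qed.
Lemma continuous_chi1 : continuous chi1.
Proof. by move=> x; exact: is_der_continuous (is_der_chi1 x). Qed.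
Lemma continuous_chi1' : continuous chi1'.
Proof. by move=> x; exact: is_der_continuous (is_der_chi1' x). Qed.

Lemma continuousXR (P : topologicalType) (f : P -> R) k : continuous f ->
  continuous (fun y : P => f y ^+ k).
Proof.
move=> cf; elim: k => [|k IH].
  by under eq_fun do rewrite expr0; exact: cont_cst.
by under eq_fun do rewrite exprS; exact: continuousMR.
Qed.

Lemma continuous_chi0'' : continuous chi0''.
Proof.
have cq : continuous (fun z : R => posp (1 - z ^+ 2)).
  apply: (cont_comp _ continuous_posp); apply: continuousBR; first exact: cont_cst.
  by apply: continuousXR; exact: cont_id.
apply: continuousDR; first by apply: continuousMR; [exact: cont_cst|exact: continuousXR].
apply: continuousMR => //; apply: continuousMR; first exact: cont_cst.
by apply: continuousXR; exact: cont_id.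
Qed.

Lemma continuous_chi1'' : continuous chi1''.
Proof.
have cq : continuous (fun z : R => posp (1 - 8 * chi0 z)).
  apply: (cont_comp _ continuous_posp); apply: continuousBR; first exact: cont_cst.
  by apply: continuousMR; [exact: cont_cst|exact: continuous_chi0].
apply: continuousBR; apply: continuousMR.
- by apply: continuousMR; [exact: cont_cst|exact: continuousXR].
- exact: continuous_chi0''.
- by apply: continuousMR => //; exact: cont_cst.
- by apply: continuousXR; exact: continuous_chi0'.
Qed.

End real_derivatives.

Section gaussian.
Context {R : realType}.
Implicit Types z a s A r : R.

(** The one-dimensional heat kernel at time [a] without its factor [(4 pi)^(-1/2)], that is
    [a^(-1/2) exp (- z^2 / (4 a))]. Written as a single exponential, it is positive for every [a]
    and its derivatives come from the chain rule. *)
Definition gam z a := expR (- (ln a / 2) - z ^+ 2 / (4 * a)).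
Definition gamz z a := - (z / (2 * a)) * gam z a.
Definition gamzz z a := (z ^+ 2 / (4 * a ^+ 2) - (2 * a)^-1) * gam z a.

Lemma gam_gt0 z a : 0 < gam z a. Proof. exact: expR_gt0. Qed.
Lemma gam_ge0 z a : 0 <= gam z a. Proof. exact: expR_ge0. Qed.

Lemma gamE z a : 0 < a -> gam z a = (Num.sqrt a)^-1 * expR (- (z ^+ 2 / (4 * a))).
Proof.
move=> a0; rewrite /gam expRD; congr (_ * _).
rewrite expRN -powR12_sqrt ?ltW// /powR gt_eqF//.
by congr (expR _)^-1; rewrite mulrC.
Qed.

Lemma gam_le z a : 0 < a -> gam z a <= (Num.sqrt a)^-1.
Proof.
move=> a0; rewrite gamE// ger_pMr ?invr_gt0 ?sqrtr_gt0// expR_le1 oppr_le0.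
by rewrite divr_ge0 ?sqr_ge0// mulr_ge0// ltW.
Qed.

Lemma is_der_gam_z z a : 0 < a -> is_derive z 1 (fun z => gam z a) (gamz z a).
Proof.
move=> a0; apply: (is_der_eq (is_der_exp (is_derB (is_der_cst _ z)
  (is_derM (is_der_sqr (is_der_id z)) (is_der_cst _ z))))).
by rewrite /gamz /gam; field; rewrite gt_eqF.
Qed.

Lemma is_der_gamz_z z a : 0 < a -> is_derive z 1 (fun z => gamz z a) (gamzz z a).
Proof.
move=> a0; apply: (is_der_eq (is_derM (is_derN (is_derM (is_der_id z) (is_der_cst _ z)))
  (is_der_gam_z z a0))).
by rewrite /gamzz /gamz; field; rewrite gt_eqF.
Qed.

(** The derivative in [a] is the second derivative in [z]: this is the heat equation for [gam]. *)
Lemma is_der_gam_a z a : 0 < a -> is_derive a 1 (gam z) (gamzz z a).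
Proof.
move=> a0; apply: (is_der_eq (is_der_exp (is_derB
  (is_derN (is_derM (is_der_ln a0 (is_der_id a)) (is_der_cst _ a)))
  (is_derM (is_der_cst _ a) (is_der_inv _ (is_derM (is_der_cst 4 a) (is_der_id a))))))).
  by rewrite mulf_neq0// gt_eqF.
by rewrite /gamzz /gam; field; rewrite gt_eqF.
Qed.

Lemma is_der_gam_t z A s : s < A ->
  is_derive s 1 (fun s => gam z (A - s)) (- gamzz z (A - s)).
Proof.
move=> sA; apply: (is_der_eq (is_der_comp (is_der_gam_a z _)
  (is_derB (is_der_cst A s) (is_der_id s)))); first by rewrite subr_gt0.
by ring.
Qed.

Lemma for_cont_comp (V : topologicalType) (h : R -> R) (f : V -> R) p :
  {for p, continuous f} -> {for f p, continuous h} ->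
  {for p, continuous (fun x => h (f x))}.
Proof. by move=> cf ch; exact: (@continuous_comp _ _ _ f h). Qed.

Lemma for_contN (V : topologicalType) (f : V -> R) p :
  {for p, continuous f} -> {for p, continuous (fun x => - f x)}.
Proof. by move=> cf; apply: (@cvgN _ R^o); exact: cf. Qed.

Lemma for_cont_lag A (q : R * R) : {for q, continuous (fun q : R * R => A - q.2)}.
Proof.
by apply: continuousBR; [exact: cont_cst|apply: cont_snd; exact: cont_id].
Qed.

Lemma for_cont_fst (q : R * R) : {for q, continuous (fun q : R * R => q.1)}.
Proof. by apply: cont_fst; exact: cont_id. Qed.

Lemma for_cont_cst (V : topologicalType) (k : R) (q : V) :
  {for q, continuous (fun=> k)}.
Proof. exact: cvg_cst. Qed.

Lemma for_cont_gam A z s : s < A ->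
  {for (z, s), continuous (fun q : R * R => gam q.1 (A - q.2))}.
Proof.
move=> sA; have As : 0 < A - s by rewrite subr_gt0.
apply: (for_cont_comp (h := expR)); last exact: continuous_expR.
apply: for_contB.
  apply: for_contN.
  apply: for_contM; last exact: for_cont_cst.
  by apply: (for_cont_comp (h := @ln R) (f := fun q : R * R => A - q.2)); [exact: for_cont_lag|exact: continuous_ln].
apply: for_contM.
  apply: (continuousXR (f := fun q : R * R => q.1)); exact: for_cont_fst.
apply: (for_cont_comp (h := GRing.inv)).
  by apply: for_contM; [exact: for_cont_cst|exact: for_cont_lag].
by apply: inv_continuous; rewrite /= mulf_neq0// gt_eqF.
Qed.

Lemma for_cont_gamz A z s : s < A ->
  {for (z, s), continuous (fun q : R * R => gamz q.1 (A - q.2))}.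
Proof.
move=> sA; have As : 0 < A - s by rewrite subr_gt0.
apply: for_contM; last exact: for_cont_gam.
apply: for_contN.
apply: for_contM; first exact: for_cont_fst.
apply: (for_cont_comp (h := GRing.inv)).
  by apply: for_contM; [exact: for_cont_cst|exact: for_cont_lag].
by apply: inv_continuous; rewrite /= mulf_neq0// gt_eqF.
Qed.

Lemma for_cont_gamzz A z s : s < A ->
  {for (z, s), continuous (fun q : R * R => gamzz q.1 (A - q.2))}.
Proof.
move=> sA; have As : 0 < A - s by rewrite subr_gt0.
apply: for_contM; last exact: for_cont_gam.
apply: for_contB.
  apply: for_contM.
    apply: (continuousXR (f := fun q : R * R => q.1)); exact: for_cont_fst.
  apply: (for_cont_comp (h := GRing.inv)).
    apply: for_contM; first exact: for_cont_cst.
    by apply: (continuousXR (f := fun q : R * R => A - q.2)); exact: for_cont_lag.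
  by apply: inv_continuous; rewrite /= mulf_neq0// ?expf_neq0// gt_eqF.
apply: (for_cont_comp (h := GRing.inv)).
  by apply: for_contM; [exact: for_cont_cst|exact: for_cont_lag].
by apply: inv_continuous; rewrite /= mulf_neq0// gt_eqF.
Qed.

End gaussian.

Section centre.
Context {R : realType}.

(** Extends a row by 0 to the sequences that serve as centres of cubes. *)
Definition ctr n (x : 'rV[R]_n) (k : nat) : R :=
  if insub k is Some i then x 0 i else 0.

Lemma ctrE n (x : 'rV[R]_n) (i : 'I_n) : ctr x i = x 0 i.
Proof. by rewrite /ctr valK. Qed.

End centre.

(** * Local mass of [u] and of its source as the initial time tends to 0 *)

Section mass.
Context {R : realType}.
Variables (n : nat) (T : R) (u : 'rV[R]_n * R -> R).
Hypothesis uC : C21 [set p | 0 < p.2 < T] u.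
Hypothesis u0 : forall x t, 0 < t < T -> 0 <= u (x, t).
Variables (c : nat -> R) (r : R).
Hypotheses (r0 : 0 < r).
Hypothesis f0 : forall x t, inbox c r x -> 0 < t < T -> 0 <= heat_source u (x, t).

(** The rate that absorbs [chi0'' >= - 10 chi0] after scaling by [r]: every factor satisfies
    [omt + omzz >= 0], so the test function is a subsolution of the adjoint heat equation. *)
Let K := 10 / r ^+ 2.
Let om (q : R * R) := expR (K * q.2) * chi0 (q.1 / r).
Let omt (q : R * R) := K * om q.
Let omz (q : R * R) := expR (K * q.2) * (chi0' (q.1 / r) / r).
Let omzz (q : R * R) := expR (K * q.2) * (chi0'' (q.1 / r) / r ^+ 2).

Let is_der_scale (z : R) : is_derive z 1 (fun z => z / r) r^-1.
Proof.
apply: (is_der_eq (is_derM (is_der_id z) (is_der_cst _ z))).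
by rewrite mul1r mulr0 addr0.
Qed.

Let om_ge0 q : 0 <= om q.
Proof. by rewrite mulr_ge0// ?expR_ge0// chi0_ge0. Qed.

(** Since [w_t + Δw >= 0], the increase of the integral of [u w] over [[t0, t1]] is at least the
    integral of [f w], which is nonnegative. Both quantities are thus bounded by the integral at
    time [t1], whatever [t0]; on the half cube [w] is bounded below. *)
Lemma supertemp_mass t1 : 0 < t1 < T -> exists m, 0 <= m /\ forall t0, 0 < t0 -> t0 <= t1 ->
  boxint c (r / 2) (fun y => u (y, t0)) <= m /\
  segint t0 t1 (fun s => boxint c (r / 2) (fun y => heat_source u (y, clampr t0 t1 s))) <= m.
Proof.
move=> /andP[t10 t1T].
have r2 : r / 2 <= r by rewrite ler_pdivrMr// ler_pMr// ler1n.
have rr : 0 <= r / 2 by rewrite divr_ge0// ltW.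
pose w : 'rV[R]_n * R -> R := prodtest c om.
pose M := boxint c r (fun y => u (y, t1) * w (y, t1)).
have w0 p : 0 <= w p by apply: prodr_ge0 => i _; exact: om_ge0.
have M0 : 0 <= M.
  by apply: boxint_ge0 => y _; rewrite mulr_ge0// u0// t10.
(* The value of [chi0] at [1/2], a lower bound of each factor on the half cube. *)
pose k : R := (3 / 4) ^+ 3.
have k0 : 0 < k by rewrite exprn_gt0//; lra.
have wk p : 0 < p.2 -> inbox c (r / 2) p.1 -> k ^+ n <= w p.
  move=> s0 hp; rewrite /w /prodtest -[n in k ^+ n]card_ord -prodr_const.
  apply: ler_prod => i _; rewrite (ltW k0)/= /om -[k]mul1r ler_pM//.
    by rewrite ltW.
    by rewrite -expR0 ler_expR mulr_ge0 /K ?divr_ge0 ?sqr_ge0 ?(ltW s0).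
  have hz : ((p.1 0 i - c i) / r) ^+ 2 <= 4^-1.
    have -> : 4^-1 = 2^-1 ^+ 2 :> R by field.
    rewrite -real_normK ?num_real//; apply: lerXn2r; rewrite ?nnegrE ?normr_ge0 //.
    by rewrite normrM normfV (gtr0_norm r0) ler_pdivrMr// mulrC; exact: hp.
  have hq : 3 / 4 <= posp (1 - ((p.1 0 i - c i) / r) ^+ 2) by rewrite posp_pos; lra.
  by rewrite /chi0 /p3 /k /=; apply: lerXn2r; rewrite ?nnegrE ?posp_ge0 //; lra.
exists (M / k ^+ n); split; first by rewrite divr_ge0// exprn_ge0// ltW.
move=> t0 t00 t01.
have It s : t0 <= s <= t1 -> 0 < s < T.
  by move=> /andP[h1 h2]; rewrite (lt_le_trans t00)// (le_lt_trans h2).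
have cexp (q : R * R) : {for q, continuous (fun q : R * R => expR (K * q.2))}.
  apply: (for_cont_comp (h := expR)); last exact: continuous_expR.
  apply: for_contM; first exact: for_cont_cst.
  by apply: cont_snd; exact: cont_id.
have cchi (h : R -> R) (q : R * R) : continuous h ->
    {for q, continuous (fun q : R * R => h (q.1 / r))}.
  move=> ch; apply: (for_cont_comp (h := h)); last exact: ch.
  by apply: for_contM; [exact: for_cont_fst|exact: for_cont_cst].
have com z s : t0 <= s <= t1 -> {for (z, s), continuous om}.
  by move=> _; apply: for_contM; [exact: cexp|exact/cchi/continuous_chi0].
have G := @green_identity R n T u uC c r t0 t1 (ltW r0) t00 t01 t1T om omt omz omzz com.
have comt : forall z s : R, t0 <= s <= t1 -> {for (z, s), continuous omt}.
  by move=> z s Is; apply: for_contM; [exact: for_cont_cst|exact: com].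
move: (G comt) => {}G.
have : forall z s : R, t0 <= s <= t1 -> {for (z, s), continuous omz}.
  move=> z s _; apply: for_contM; first exact: cexp.
  by apply: for_contM; [exact/cchi/continuous_chi0'|exact: for_cont_cst].
move=> /G {}G.
have comzz : forall z s : R, t0 <= s <= t1 -> {for (z, s), continuous omzz}.
  move=> z s _; apply: for_contM; first exact: cexp.
  by apply: for_contM; [exact/cchi/continuous_chi0''|exact: for_cont_cst].
move: (G comzz) => {}G.
have d1 : forall z s : R, t0 <= s <= t1 ->
    is_derive s 1 (fun s => om (z, s)) (omt (z, s)).
  move=> z s _; rewrite /om /=; apply: (is_der_eq (is_derM (is_der_exp
    (is_derM (is_der_cst K s) (is_der_id s))) (is_der_cst (chi0 (z / r)) s))).
  by rewrite /omt /om /=; ring.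
have d2 : forall z s : R, t0 <= s <= t1 ->
    is_derive z 1 (fun z => om (z, s)) (omz (z, s)).
  move=> z s _; rewrite /om /=; apply: (is_der_eq (is_derM (is_der_cst (expR (K * s)) z)
    (is_der_comp (is_der_chi0 _) (is_der_scale z)))).
  by rewrite /omz mul0r add0r.
have d3 : forall z s : R, t0 <= s <= t1 ->
    is_derive z 1 (fun z => omz (z, s)) (omzz (z, s)).
  move=> z s _; rewrite /omz /=; apply: (is_der_eq (is_derM (is_der_cst (expR (K * s)) z)
    (is_derM (is_der_comp (is_der_chi0' _) (is_der_scale z)) (is_der_cst r^-1 z)))).
  by rewrite /omzz mul0r add0r mulr0 addr0 /= -mulrA expr2 invfM.
move: (G d1 d2 d3) => {}G.
have {}G : boxint c r (fun y => u (y, t1) * w (y, t1)) - boxint c r (fun y => u (y, t0) * w (y, t0)) =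
  segint t0 t1 (fun s => boxint c r (fun y => green_integrand u c om omt omzz (y, clampr t0 t1 s))).
  apply: G => z s _ zr.
  have p0 : posp (1 - (z / r) ^+ 2) = 0.
    apply: posp_neg; rewrite subr_le0 -real_normK ?num_real//.
    by rewrite normrM normfV (gtr0_norm r0) zr divff ?gt_eqF// expr1n.
  by rewrite /om /omz /chi0 /chi0' /p3 /= p0 !expr0n/= !(mulr0, mul0r).
have cw p : t0 <= p.2 <= t1 -> {for p, continuous w}.
  exact: (prodtest_continuous (om := om) com).
have chs p : 0 < p.2 < T -> {for p, continuous (heat_source u)}.
  exact: (heat_source_continuous uC).
have chsI p : t0 <= p.2 <= t1 -> {for p, continuous (heat_source u)}.
  by move=> /It; exact: chs.
have cgi p : t0 <= p.2 <= t1 -> {for p, continuous (green_integrand u c om omt omzz)}.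
  exact: (green_integrand_continuous uC t00 t1T com comt comzz).
have chsw p : t0 <= p.2 <= t1 -> {for p, continuous (fun p => heat_source u p * w p)}.
  by move=> h; apply: for_contM; [exact: (chs _ (It _ h))|exact: cw].
have cu p : 0 < p.2 < T -> {for p, continuous u} by move=> /uC[].
have ccl (h : 'rV[R]_n * R -> R) : (forall p, t0 <= p.2 <= t1 -> {for p, continuous h}) ->
    continuous (fun p : 'rV[R]_n * R => h (p.1, clampr t0 t1 p.2)).
  exact: cont_clamp.
have csl (h : 'rV[R]_n * R -> R) s : t0 <= s <= t1 ->
    (forall p, t0 <= p.2 <= t1 -> {for p, continuous h}) ->
    continuous (fun y : 'rV[R]_n => h (y, s)).
  by move=> Is ch; apply: cont_slice => y; exact: ch.
have t0t0 : t0 <= t0 <= t1 by rewrite lexx.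
have cu' p : t0 <= p.2 <= t1 -> {for p, continuous u} by move=> /It; exact: cu.
have cuw p : t0 <= p.2 <= t1 -> {for p, continuous (fun p => u p * w p)}.
  by move=> h; apply: for_contM; [exact: cu'|exact: cw].
have u0s y s : t0 <= s <= t1 -> 0 <= u (y, s) by move=> /It; exact: u0.
have gi_ge y s : t0 <= s <= t1 -> inbox c r y ->
    heat_source u (y, s) * w (y, s) <= green_integrand u c om omt omzz (y, s).
  move=> Is yr; rewrite /green_integrand lerDl mulr_ge0// ?u0s//.
  apply: sumr_ge0 => i _; apply: mulr_ge0.
    by apply: prodr_ge0 => j _; exact: om_ge0.
  rewrite /omt /omzz /om /K /=.
  set e := expR _; set z := (y 0 i - c i) / r.
  have -> : 10 / r ^+ 2 * (e * chi0 z) + e * (chi0'' z / r ^+ 2) =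
    (e / r ^+ 2) * (10 * chi0 z + chi0'' z) by ring.
  rewrite mulr_ge0//; first by rewrite divr_ge0 ?expR_ge0 ?sqr_ge0.
  by have := chi0''_ge z; lra.
have hw0 y s : t0 <= s <= t1 -> inbox c r y -> 0 <= heat_source u (y, s) * w (y, s).
  by move=> Is yr; rewrite mulr_ge0// f0// It.
have sub i : (i < n)%N -> c i - r <= c i - r / 2 /\ c i + r / 2 <= c i + r.
  by move=> _; rewrite lerD2l lerN2 lerD2l.
have S1 : segint t0 t1 (fun s => boxint c r (fun y =>
    heat_source u (y, clampr t0 t1 s) * w (y, clampr t0 t1 s))) <=
  M - boxint c r (fun y => u (y, t0) * w (y, t0)).
  rewrite G; apply: le_segint.
  - exact: (boxint_time_continuous c r (ccl _ chsw)).
  - exact: (boxint_time_continuous c r (ccl _ cgi)).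
  - move=> s Is; rewrite clampr_id//; apply: le_boxint.
    + exact: (csl _ _ Is chsw).
    + exact: (csl _ _ Is cgi).
    + by move=> y; exact: gi_ge.
have B0 : 0 <= boxint c r (fun y => u (y, t0) * w (y, t0)).
  by apply: boxint_ge0 => y _; rewrite mulr_ge0// u0s.
have S0 : 0 <= segint t0 t1 (fun s => boxint c r (fun y =>
    heat_source u (y, clampr t0 t1 s) * w (y, clampr t0 t1 s))).
  apply: segint_ge0 => s Is; apply: boxint_ge0 => y yr.
  by rewrite clampr_id//; exact: hw0.
have kn : 0 < k ^+ n by rewrite exprn_gt0.
split.
  rewrite ler_pdivlMr// mulrC -boxintZ; last exact: (csl _ _ t0t0 cu').
  apply: (@le_trans _ _ (boxint c r (fun y => u (y, t0) * w (y, t0)))); last by lra.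
  apply: (@le_trans _ _ (boxint c (r / 2) (fun y => u (y, t0) * w (y, t0)))); last first.
    apply: boxint_sub => //; first exact: (csl _ _ t0t0 cuw).
    by move=> y _; rewrite mulr_ge0// u0s.
  apply: le_boxint; last by move=> y yr; rewrite mulrC ler_wpM2l// ?u0s// wk.
    by apply: continuousMR; [exact: cont_cst|exact: (csl _ _ t0t0 cu')].
  exact: (csl _ _ t0t0 cuw).
rewrite ler_pdivlMr// mulrC -segintZ; last first.
  exact: (boxint_time_continuous c (r / 2) (ccl _ chsI)).
apply: (@le_trans _ _ (segint t0 t1 (fun s => boxint c r (fun y =>
    heat_source u (y, clampr t0 t1 s) * w (y, clampr t0 t1 s))))); last by lra.
apply: le_segint.
- apply: continuousMR; first exact: cont_cst.
  exact: (boxint_time_continuous c (r / 2) (ccl _ chsI)).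
- exact: (boxint_time_continuous c r (ccl _ chsw)).
move=> s Is; rewrite clampr_id//.
have chs' : continuous (fun y : 'rV[R]_n => heat_source u (y, s)).
  exact: (csl _ _ Is chsI).
rewrite -boxintZ//.
apply: (@le_trans _ _ (boxint c (r / 2) (fun y => heat_source u (y, s) * w (y, s)))); last first.
  apply: boxint_sub => //; first exact: (csl _ _ Is chsw).
  by move=> y; exact: hw0.
apply: le_boxint.
- by apply: continuousMR; [exact: cont_cst|].
- exact: (csl _ _ Is chsw).
- move=> y yr; rewrite mulrC ler_wpM2l//; last by apply: wk => //=; have /andP[] := It _ Is.
  by rewrite f0 ?It// => i; exact: le_trans (yr i) _.
Qed.

End mass.

(** * A one-sided Duhamel formula with a truncated Gaussian *)

Section duhamel.
Context {R : realType}.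

(** For [y > 1] and [v = y^2 / 8] it comes from [v^(n+2) <= (n+2)! exp v]; the summand 2 covers
    [y <= 1]. *)
Definition gauss_bound (n : nat) : R := 2 * 8 ^+ n.+2 * (n.+2)`!%:R + 2.

Lemma gauss_bound_gt0 n : 0 < gauss_bound n.
Proof. by rewrite ltr_wpDl// mulr_ge0// mulr_ge0// exprn_ge0. Qed.

Lemma poly_expR_bound n (y : R) : 0 <= y ->
  y ^+ n * (1 + y ^+ 2) * expR (- (y ^+ 2 / 8)) <= gauss_bound n.
Proof.
move=> y0; have b0 : 0 <= 2 * 8 ^+ n.+2 * (n.+2)`!%:R :> R.
  by rewrite mulr_ge0// mulr_ge0// exprn_ge0.
have y2 : 0 <= y ^+ 2 by exact: sqr_ge0.
have [y1|/ltW y1] := leP y 1.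
  rewrite /gauss_bound; apply: (@le_trans _ _ 2); last by rewrite lerDr.
  have -> : 2 = 1 * 2 * 1 :> R by rewrite mul1r mulr1.
  rewrite ler_pM// ?mulr_ge0 ?exprn_ge0 ?expR_ge0//.
  - by rewrite addr_ge0.
  - rewrite ler_pM// ?exprn_ge0 ?addr_ge0// ?exprn_ile1//.
    by rewrite -[leRHS]/(1 + 1) lerD2l exprn_ile1.
  - by rewrite expR_le1 oppr_le0 divr_ge0.
rewrite /gauss_bound; apply: (@le_trans _ _ (2 * 8 ^+ n.+2 * (n.+2)`!%:R)); last by rewrite lerDl.
rewrite expRN ler_pdivrMr ?expR_gt0//; set v := y ^+ 2 / 8.
have v0 : 0 <= v by rewrite divr_ge0.
have h := expR_ge1Dxn n.+1 v0.
have {}h : v ^+ n.+2 <= (n.+2)`!%:R * expR v.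
  rewrite mulrC -ler_pdivrMr ?ltr0n ?fact_gt0//.
  by apply: le_trans h; rewrite lerDr.
rewrite -[leRHS]mulrA; apply: (@le_trans _ _ (2 * 8 ^+ n.+2 * v ^+ n.+2)); last first.
  by rewrite ler_pM2l// mulr_gt0// exprn_gt0.
rewrite -[leRHS]mulrA -exprMn /v (_ : 8 * (y ^+ 2 / 8) = y ^+ 2); last by field.
apply: (@le_trans _ _ (2 * y ^+ n.+2)).
  have -> : y ^+ n.+2 = y ^+ n * y ^+ 2 by rewrite -exprD addn2.
  rewrite mulrCA ler_wpM2l ?exprn_ge0// mulr_natl mulr2n lerD2r.
  by rewrite exprn_ege1.
rewrite ler_pM2l//; apply: lerXn2r; rewrite ?nnegrE//.
by rewrite expr2 ler_peMr.
Qed.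

Definition duh_const (n : nat) : R := n%:R * (chi_bound * gauss_bound n).

(** The heat kernel at time [a] without its factor [(4 pi)^(-n/2)]. The product form is the one
    accepted by Green's identity. *)
Definition Gam n (x z : 'rV[R]_n) (a : R) := \prod_(i < n) gam (z 0 i - x 0 i) a.

Lemma Gam_ge0 n (x z : 'rV[R]_n) a : 0 <= Gam x z a.
Proof. by apply: prodr_ge0 => i _; exact: gam_ge0. Qed.

Lemma Gam_le n (x z : 'rV[R]_n) a : 0 < a -> Gam x z a <= (Num.sqrt a) ^- n.
Proof.
move=> a0; rewrite -exprVn -[n in leRHS]card_ord -prodr_const.
by apply: ler_prod => i _; rewrite gam_ge0 gam_le.
Qed.

Lemma for_cont_Gam n (x : 'rV[R]_n) A (p : 'rV[R]_n * R) : p.2 < A ->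
  {for p, continuous (fun p : 'rV[R]_n * R => Gam x p.1 (A - p.2))}.
Proof.
move=> pA; apply: for_contP => i.
apply: (@continuous_comp _ _ _ (fun p : 'rV[R]_n * R => (p.1 0 i - x 0 i, p.2))
  (fun q : R * R => gam q.1 (A - q.2))).
  apply: (@cont_pair _ _ _ (fun p : 'rV[R]_n * R => p.1 0 i - x 0 i) snd).
    apply: continuousBR; last exact: cont_cst.
    by apply: (cont_comp _ (@coord_continuous _ _ _ 0 i)); apply: cont_fst; exact: cont_id.
  by apply: cont_snd; exact: cont_id.
exact: for_cont_gam.
Qed.

Variables (n : nat) (T : R) (u : 'rV[R]_n * R -> R).
Hypothesis uC : C21 [set p | 0 < p.2 < T] u.
Hypothesis u0 : forall x t, 0 < t < T -> 0 <= u (x, t).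
Variables (x : 'rV[R]_n) (r t0 t d : R).
Hypotheses (r0 : 0 < r) (t00 : 0 < t0) (t0t : t0 <= t) (tT : t < T) (d0 : 0 < d).
Hypothesis f0 : forall z t, inbox (ctr x) r z -> 0 < t < T -> 0 <= heat_source u (z, t).

(** The Gaussian focuses at time [t + d], shortly after the observation time. At time [t] it is
    regular and bounded below on the cube of half-side [sqrt d] around [x], which replaces the
    passage to a Dirac mass. *)
Let A := t + d.
Let om (q : R * R) := chi1 (q.1 / r) * gam q.1 (A - q.2).
Let omt (q : R * R) := chi1 (q.1 / r) * - gamzz q.1 (A - q.2).
Let omz (q : R * R) := chi1' (q.1 / r) / r * gam q.1 (A - q.2) +
  chi1 (q.1 / r) * gamz q.1 (A - q.2).
Let omzz (q : R * R) := chi1'' (q.1 / r) / r ^+ 2 * gam q.1 (A - q.2) +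
  2 * (chi1' (q.1 / r) / r) * gamz q.1 (A - q.2) +
  chi1 (q.1 / r) * gamzz q.1 (A - q.2).
Let w : 'rV[R]_n * R -> R := prodtest (ctr x) om.

Let is_der_scale (z : R) : is_derive z 1 (fun z => z / r) r^-1.
Proof.
apply: (is_der_eq (is_derM (is_der_id z) (is_der_cst _ z))).
by rewrite mul1r mulr0 addr0.
Qed.

Let om_ge0 q : 0 <= om q. Proof. by rewrite mulr_ge0 ?chi1_ge0 ?gam_ge0. Qed.
Let om_le q : om q <= gam q.1 (A - q.2).
Proof. by rewrite ler_piMl ?gam_ge0 ?chi1_le1. Qed.

Let w_ge0 p : 0 <= w p. Proof. by apply: prodr_ge0 => i _; exact: om_ge0. Qed.
Let w_le p : w p <= Gam x p.1 (A - p.2).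
Proof.
apply: ler_prod => i _; rewrite om_ge0/=; apply: le_trans (om_le _) _.
by rewrite /= ctrE.
Qed.

Let IA s : s <= t -> 0 < A - s.
Proof. by move=> st; rewrite subr_gt0 /A (le_lt_trans st)// ltrDl. Qed.

(** The terms in [gamzz] cancel by the heat equation, and what remains carries a derivative of
    [chi1], hence lives where [z^2 > r^2 / 2]. There the Gaussian is at most
    [a^(-1/2) exp (- y^2 / 8)] with [y = r / sqrt a], and the exponential absorbs all powers of [y]:
    the bound is uniform in the age [a]. *)
Let err_bound p : p.2 <= t -> inbox (ctr x) r p.1 ->
  \sum_(i < n) prodtest_but (ctr x) om i p *
    (omt (p.1 0 i - ctr x i, p.2) + omzz (p.1 0 i - ctr x i, p.2)) <=
  duh_const n / r ^+ n.+2.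
Proof.
move=> pt pr; have a0 := IA pt; set a := A - p.2 in a0.
have sa : 0 < Num.sqrt a by rewrite sqrtr_gt0.
set y := r / Num.sqrt a.
have y0 : 0 <= y by rewrite divr_ge0// ltW.
have term (i : 'I_n) : prodtest_but (ctr x) om i p *
    (omt (p.1 0 i - ctr x i, p.2) + omzz (p.1 0 i - ctr x i, p.2)) <=
    chi_bound * gauss_bound n / r ^+ n.+2.
  set z := p.1 0 i - ctr x i; have zr : `|z| <= r := pr i.
  have -> : omt (z, p.2) + omzz (z, p.2) = (chi1'' (z / r) / r ^+ 2 +
     - (chi1' (z / r) / r * (z / a))) * gam z a.
    by rewrite /omt /omzz /gamz -/a /=; field; rewrite !gt_eqF.
  have B0 : 0 <= prodtest_but (ctr x) om i p.
    by apply: prodr_ge0 => j _; exact: om_ge0.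
  have cb0 : 0 <= chi_bound :> R by apply: le_trans (chi1_bounds 0).1; exact: normr_ge0.
  have [zc|zc] := leP ((z / r) ^+ 2) 2^-1.
    have [_ -> ->] := chi1_core zc; rewrite !mul0r oppr0 addr0 mul0r mulr0.
    by rewrite divr_ge0 ?exprn_ge0 ?(ltW r0)// mulr_ge0// ltW// gauss_bound_gt0.
  have g1 : gam z a <= (Num.sqrt a)^-1 * expR (- (y ^+ 2 / 8)).
    rewrite gamE// ler_pM2l ?invr_gt0// ler_expR lerN2.
    rewrite /y expr_div_n sqr_sqrtr ?(ltW a0)//.
    have : r ^+ 2 / 2 <= z ^+ 2.
      by move: zc; rewrite expr_div_n ltr_pdivlMr ?exprn_gt0// mulrC => /ltW.
    move=> h; have -> : r ^+ 2 / a / 8 = (r ^+ 2 / 2) / (4 * a) by field; rewrite gt_eqF.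
    by rewrite ler_pM2r// invr_gt0 mulr_gt0.
  have k1 : chi1'' (z / r) / r ^+ 2 - chi1' (z / r) / r * (z / a) <=
      chi_bound * (r ^- 2 + a^-1).
    apply: le_trans (ler_norm _) _; apply: le_trans (ler_normB _ _) _.
    rewrite mulrDr lerD//.
      rewrite normrM ler_pM// ?(chi1_bounds _).2//.
      by rewrite ger0_norm// invr_ge0 sqr_ge0.
    have -> : chi1' (z / r) / r * (z / a) = chi1' (z / r) * (z / r * a^-1) by ring.
    rewrite normrM ler_pM// ?(chi1_bounds _).1// normrM normfV (gtr0_norm a0).
    rewrite -[leRHS]mul1r ler_wpM2r ?invr_ge0 ?(ltW a0)//.
    by rewrite normrM normfV (gtr0_norm r0) ler_pdivrMr// mul1r.
  apply: (@le_trans _ _ (prodtest_but (ctr x) om i p *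
      (chi_bound * (r ^- 2 + a^-1) * ((Num.sqrt a)^-1 * expR (- (y ^+ 2 / 8)))))).
    rewrite ler_wpM2l//; apply: (@le_trans _ _ (chi_bound * (r ^- 2 + a^-1) * gam z a)).
      by rewrite ler_wpM2r ?gam_ge0.
    by rewrite ler_wpM2l// mulr_ge0// addr_ge0// invr_ge0 ?sqr_ge0// (ltW a0).
  have Bs : prodtest_but (ctr x) om i p * (Num.sqrt a)^-1 <= (Num.sqrt a) ^- n.
    rewrite -exprVn -[n in leRHS]card_ord -prodr_const (bigD1 i)//= mulrC.
    rewrite ler_pM2l ?invr_gt0//; apply: ler_prod => j _; rewrite om_ge0/=.
    by apply: le_trans (om_le _) _; rewrite /= gam_le.
  have E : chi_bound * gauss_bound n / r ^+ n.+2 =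
     (chi_bound * r ^- n.+2) * gauss_bound n by rewrite mulrAC.
  rewrite E.
  have -> : prodtest_but (ctr x) om i p *
      (chi_bound * (r ^- 2 + a^-1) * ((Num.sqrt a)^-1 * expR (- (y ^+ 2 / 8)))) =
    prodtest_but (ctr x) om i p * (Num.sqrt a)^-1 *
      (chi_bound * (r ^- 2 + a^-1) * expR (- (y ^+ 2 / 8))) by ring.
  apply: (@le_trans _ _ ((Num.sqrt a) ^- n *
      (chi_bound * (r ^- 2 + a^-1) * expR (- (y ^+ 2 / 8))))).
    rewrite ler_wpM2r// mulr_ge0 ?expR_ge0// mulr_ge0// addr_ge0// invr_ge0 ?sqr_ge0//.
    exact: ltW.
  have -> : (Num.sqrt a) ^- n * (chi_bound * (r ^- 2 + a^-1) * expR (- (y ^+ 2 / 8))) =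
     (chi_bound * r ^- n.+2) * (y ^+ n * (1 + y ^+ 2) * expR (- (y ^+ 2 / 8))).
    have -> : a^-1 = (Num.sqrt a) ^- 2 by rewrite sqr_sqrtr// (ltW a0).
    set e := expR _; clearbody e; rewrite /y !expr_div_n.
    have -> : r ^+ n.+2 = r ^+ n * r ^+ 2 by rewrite -exprD addn2.
    have rn0 : r ^+ n != 0 by rewrite expf_neq0// gt_eqF.
    have Sn0 : Num.sqrt a ^+ n != 0 by rewrite expf_neq0// gt_eqF.
    move: (r ^+ n) rn0 (Num.sqrt a ^+ n) Sn0 => X X0 Y Y0.
    by field; rewrite X0 Y0 !gt_eqF.
  rewrite ler_wpM2l ?poly_expR_bound//.
  by rewrite mulr_ge0// invr_ge0 exprn_ge0// ltW.
apply: le_trans (ler_sum _ (fun i _ => term i)) _.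
by rewrite sumr_const card_ord -[X in X <= _]mulr_natl mulrA.
Qed.

(** Green's identity on [[t0, t]]. At time [t] only the cube of half-side [sqrt d] is kept: its
    volume is [(2 sqrt d)^n], the Gaussian there is at least [d^(-n/2) exp (- n/4)], and [eta]
    bounds the drop of [u] below its value at [x]; the powers of [d] cancel. The last term is the
    cutoff error. *)
Lemma duhamel_ineq eta : Num.sqrt d <= r / 2 ->
  (forall z, inbox (ctr x) (Num.sqrt d) z -> u (x, t) - eta <= u (z, t)) ->
  (2 * expR (- 4^-1)) ^+ n * (u (x, t) - eta) <=
  boxint (ctr x) r (fun z => u (z, t0) * Gam x z (A - t0)) +
  segint t0 t (fun s => boxint (ctr x) r (fun z =>
    heat_source u (z, clampr t0 t s) * Gam x z (A - clampr t0 t s))) +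
  duh_const n / r ^+ n.+2 *
    segint t0 t (fun s => boxint (ctr x) r (fun z => u (z, clampr t0 t s))).
Proof.
move=> dr ueta.
have It s : t0 <= s <= t -> 0 < s < T.
  by move=> /andP[h1 h2]; rewrite (lt_le_trans t00)// (le_lt_trans h2).
have IsA s : t0 <= s <= t -> s < A by move=> /andP[_ h]; rewrite -subr_gt0 IA.
have cchi (h : R -> R) (q : R * R) : continuous h ->
    {for q, continuous (fun q : R * R => h (q.1 / r))}.
  move=> ch; apply: (for_cont_comp (h := h)); last exact: ch.
  by apply: for_contM; [exact: for_cont_fst|exact: for_cont_cst].
have cchir (h : R -> R) (k : R) (q : R * R) : continuous h ->
    {for q, continuous (fun q : R * R => h (q.1 / r) / k)}.
  by move=> ch; apply: for_contM; [exact: cchi|exact: for_cont_cst].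
have com z s : t0 <= s <= t -> {for (z, s), continuous om}.
  move=> Is; apply: for_contM; [exact/cchi/continuous_chi1|exact/for_cont_gam/IsA].
have comt z s : t0 <= s <= t -> {for (z, s), continuous omt}.
  move=> Is; apply: for_contM; first exact/cchi/continuous_chi1.
  by apply: for_contN; exact/for_cont_gamzz/IsA.
have comz z s : t0 <= s <= t -> {for (z, s), continuous omz}.
  move=> Is; apply: for_contD; apply: for_contM.
  - exact/cchir/continuous_chi1'.
  - exact/for_cont_gam/IsA.
  - exact/cchi/continuous_chi1.
  - exact/for_cont_gamz/IsA.
have comzz z s : t0 <= s <= t -> {for (z, s), continuous omzz}.
  move=> Is; apply: for_contD; first apply: for_contD; apply: for_contM.
  - exact/cchir/continuous_chi1''.
  - exact/for_cont_gam/IsA.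
  - by apply: for_contM; [exact: for_cont_cst|exact/cchir/continuous_chi1'].
  - exact/for_cont_gamz/IsA.
  - exact/cchi/continuous_chi1.
  - exact/for_cont_gamzz/IsA.
have d1 : forall z s : R, t0 <= s <= t ->
    is_derive s 1 (fun s => om (z, s)) (omt (z, s)).
  move=> z s Is; rewrite /om /=; apply: (is_der_eq (is_derM (is_der_cst (chi1 (z / r)) s)
    (is_der_gam_t z (IsA _ Is)))).
  by rewrite /omt /=; ring.
have d2 : forall z s : R, t0 <= s <= t ->
    is_derive z 1 (fun z => om (z, s)) (omz (z, s)).
  move=> z s Is; have /andP[_ st] := Is; rewrite /om /=.
  apply: (is_der_eq (is_derM (is_der_comp (is_der_chi1 _) (is_der_scale z))
    (is_der_gam_z z (IA st)))).
  by rewrite /omz /=.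
have d3 : forall z s : R, t0 <= s <= t ->
    is_derive z 1 (fun z => omz (z, s)) (omzz (z, s)).
  move=> z s Is; have /andP[_ st] := Is; rewrite /omz /=.
  apply: (is_der_eq (is_derD (is_derM (is_derM (is_der_comp (is_der_chi1' _) (is_der_scale z))
    (is_der_cst r^-1 z)) (is_der_gam_z z (IA st)))
    (is_derM (is_der_comp (is_der_chi1 _) (is_der_scale z)) (is_der_gamz_z z (IA st))))).
  by rewrite /omzz /=; field; rewrite gt_eqF.
have bd : forall z s : R, t0 <= s <= t -> `|z| = r -> om (z, s) = 0 /\ omz (z, s) = 0.
  move=> z s _ zr; have [c1 c2 _] : [/\ chi1 (z / r) = 0, chi1' (z / r) = 0 & chi1'' (z / r) = 0].
    by apply: chi1_out; rewrite normrM normfV (gtr0_norm r0) zr divff ?gt_eqF.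
  by rewrite /om /omz /= c1 c2 !mul0r addr0.
have G := @green_identity R n T u uC (ctr x) r t0 t (ltW r0) t00 t0t tT om omt omz omzz
  com comt comz comzz d1 d2 d3 bd.
rewrite -/w in G.
have cw p : t0 <= p.2 <= t -> {for p, continuous w}.
  exact: (prodtest_continuous (om := om) com).
have chs p : t0 <= p.2 <= t -> {for p, continuous (heat_source u)}.
  by move=> /It; exact: (heat_source_continuous uC).
have cgi p : t0 <= p.2 <= t ->
    {for p, continuous (green_integrand u (ctr x) om omt omzz)}.
  exact: (green_integrand_continuous uC t00 tT com comt comzz).
have cu p : t0 <= p.2 <= t -> {for p, continuous u} by move=> /It /uC[].
have cGm p : t0 <= p.2 <= t -> {for p, continuous (fun p : 'rV[R]_n * R => Gam x p.1 (A - p.2))}.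
  by move=> /IsA; exact: for_cont_Gam.
have chG p : t0 <= p.2 <= t -> {for p, continuous (fun p : 'rV[R]_n * R =>
    heat_source u p * Gam x p.1 (A - p.2))}.
  by move=> h; apply: for_contM; [exact: chs|exact: cGm].
have cuG p : t0 <= p.2 <= t -> {for p, continuous (fun p : 'rV[R]_n * R =>
    u p * Gam x p.1 (A - p.2))}.
  by move=> h; apply: for_contM; [exact: cu|exact: cGm].
have cuw p : t0 <= p.2 <= t -> {for p, continuous (fun p => u p * w p)}.
  by move=> h; apply: for_contM; [exact: cu|exact: cw].
have ccl (h : 'rV[R]_n * R -> R) : (forall p, t0 <= p.2 <= t -> {for p, continuous h}) ->
    continuous (fun p : 'rV[R]_n * R => h (p.1, clampr t0 t p.2)).
  exact: cont_clamp.
have csl (h : 'rV[R]_n * R -> R) s : t0 <= s <= t ->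
    (forall p, t0 <= p.2 <= t -> {for p, continuous h}) ->
    continuous (fun y : 'rV[R]_n => h (y, s)).
  by move=> Is ch; apply: cont_slice => y; exact: ch.
have It0 : t0 <= t0 <= t by rewrite lexx.
have Itt : t0 <= t <= t by rewrite lexx andbT.
have u0s y s : t0 <= s <= t -> 0 <= u (y, s) by move=> /It; exact: u0.
have sd : 0 < Num.sqrt d by rewrite sqrtr_gt0.
have r2r : r / 2 <= r by rewrite ler_pdivrMr// ler_pMr// ler1n.
have lower : (2 * expR (- 4^-1)) ^+ n * (u (x, t) - eta) <=
    boxint (ctr x) r (fun y => u (y, t) * w (y, t)).
  have [neg|/ltW pos] := leP (u (x, t) - eta) 0.
    apply: (@le_trans _ _ 0).
      by rewrite mulr_ge0_le0// exprn_ge0// mulr_ge0// expR_ge0.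
    by apply: boxint_ge0 => y _; rewrite mulr_ge0// u0s.
  apply: (@le_trans _ _ (boxint (ctr x) (Num.sqrt d) (fun y => u (y, t) * w (y, t)))); last first.
    apply: boxint_sub => //.
    - exact: (csl _ _ Itt cuw).
    - move=> i _; have := le_trans dr r2r => h.
      by rewrite lerD2l lerN2 lerD2l.
    - by move=> y _; rewrite mulr_ge0// u0s.
  have -> : (2 * expR (- 4^-1)) ^+ n * (u (x, t) - eta) =
    boxint (ctr x) (Num.sqrt d) (fun _ : 'rV[R]_n =>
      (u (x, t) - eta) * ((Num.sqrt d)^-1 * expR (- 4^-1)) ^+ n).
    rewrite boxint_cst ?(ltW sd)// [in RHS]mulrCA -exprMn [RHS]mulrC; congr (_ ^+ n * _).
    by rewrite mulrA -(mulrA 2) divff ?gt_eqF// mulr1.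
  apply: le_boxint; [exact: cont_cst|exact: (csl _ _ Itt cuw)|].
  move=> y yd; apply: ler_pM; [exact: pos| |exact: ueta|].
    by rewrite exprn_ge0// mulr_ge0 ?expR_ge0// invr_ge0 ltW.
  rewrite /w /prodtest -[n in _ ^+ n]card_ord -prodr_const; apply: ler_prod => i _.
  rewrite mulr_ge0 ?expR_ge0 ?invr_ge0 ?(ltW sd)//= /om /=.
  have AtE : A - t = d by rewrite /A addrC addKr.
  have zd : (y 0 i - ctr x i) ^+ 2 <= d.
    rewrite -[leRHS]sqr_sqrtr ?(ltW d0)// -real_normK ?num_real//.
    by apply: lerXn2r; rewrite ?nnegrE ?normr_ge0 ?(ltW sd)//; exact: yd.
  have dr2 : d <= r ^+ 2 / 4.
    have -> : r ^+ 2 / 4 = (r / 2) ^+ 2 by field.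
    by rewrite -[leLHS]sqr_sqrtr ?(ltW d0)//; apply: lerXn2r; rewrite ?nnegrE ?divr_ge0 ?(ltW r0) ?(ltW sd).
  have [-> _ _] : [/\ chi1 ((y 0 i - ctr x i) / r) = 1, chi1' ((y 0 i - ctr x i) / r) = 0 &
      chi1'' ((y 0 i - ctr x i) / r) = 0].
    apply: chi1_core; rewrite expr_div_n ler_pdivrMr ?exprn_gt0//.
    apply: le_trans zd (le_trans dr2 _); rewrite mulrC ler_wpM2r ?sqr_ge0//.
    by rewrite lef_pV2 ?posrE// ler_nat.
  rewrite mul1r AtE gamE// ler_pM2l ?invr_gt0// ler_expR lerN2.
  by rewrite ler_pdivrMr ?mulr_gt0// mulrA mulVf// mul1r.
apply: (le_trans lower).
rewrite -[leLHS](subrK (boxint (ctr x) r (fun y => u (y, t0) * w (y, t0)))) G addrC -addrA lerD//.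
  apply: le_boxint; [exact: (csl _ _ It0 cuw)|exact: (csl _ _ It0 cuG)|].
  by move=> y _; rewrite ler_wpM2l ?u0s//; exact: w_le (y, t0).
have chGb := boxint_time_continuous (ctr x) r (ccl _ chG).
have cub := boxint_time_continuous (ctr x) r (ccl _ cu).
rewrite -segintZ// -segintD//; last by apply: continuousMR => //; exact: cont_cst.
apply: le_segint.
- exact: (boxint_time_continuous (ctr x) r (ccl _ cgi)).
- apply: continuousDR => //; apply: continuousMR => //; exact: cont_cst.
move=> s Is; rewrite clampr_id//.
rewrite -boxintZ; last exact: (csl _ _ Is cu).
have cu' : continuous (fun y : 'rV[R]_n => duh_const n / r ^+ n.+2 * u (y, s)).
  by apply: continuousMR; [exact: cont_cst|exact: (csl _ _ Is cu)].
rewrite -boxintD//; last exact: (csl _ _ Is chG).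
apply: le_boxint; [exact: (csl _ _ Is cgi)|by apply: continuousDR => //; exact: (csl _ _ Is chG)|].
move=> y yr; rewrite /green_integrand lerD//.
  by rewrite ler_wpM2l ?f0 ?It//; exact: w_le (y, s).
rewrite mulrC ler_wpM2r ?u0s//; apply: (err_bound (p := (y, s))) => //.
by have /andP[] := Is.
Qed.

End duhamel.

Section gaussian_integral.
Context {R : realType}.

(** From [exp (- v) <= 1 / (1 + v)], whose primitive is an arctangent. The constant [pi] instead of
    [sqrt pi] is harmless, since only upper bounds of Gaussian masses are used. *)
Lemma segint_gauss (a b x B : R) : 0 < B -> a <= b ->
  segint a b (fun z => expR (- ((z - x) ^+ 2 / B))) <= pi * Num.sqrt B.
Proof.
move=> B0 ab; set S := Num.sqrt B; have S0 : 0 < S by rewrite sqrtr_gt0.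
have SB : S ^+ 2 = B by rewrite sqr_sqrtr// ltW.
pose g (z : R) := (1 + ((z - x) / S) ^+ 2)^-1.
have g0 (z : R) : 1 + ((z - x) / S) ^+ 2 != 0.
  by rewrite gt_eqF// ltr_wpDr// sqr_ge0.
have caff : continuous (fun z : R => (z - x) / S).
  apply: continuousMR; last exact: cont_cst.
  by apply: continuousBR; [exact: cont_id|exact: cont_cst].
have cg : continuous g.
  move=> z; apply: (for_cont_comp (h := GRing.inv) (f := fun z : R => 1 + ((z - x) / S) ^+ 2)).
    by apply: continuousDR; [exact: cont_cst|exact: continuousXR].
  exact: inv_continuous.
apply: (@le_trans _ _ (segint a b g)).
  apply: le_segint => //.
    move=> z; apply: (for_cont_comp (h := expR) (f := fun z : R => - ((z - x) ^+ 2 / B))).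
      apply: for_contN; apply: for_contM; last exact: for_cont_cst.
      by apply: continuousXR; apply: continuousBR; [exact: cont_id|exact: cont_cst].
    exact: continuous_expR.
  move=> z _; rewrite /g expr_div_n SB expRN lef_pV2 ?posrE ?expR_gt0//.
    exact: expR_ge1Dx.
  by rewrite ltr_wpDr// divr_ge0 ?sqr_ge0// ltW.
have dF (z : R) : is_derive z 1 (fun z => S * atan ((z - x) / S)) (g z).
  apply: (is_der_eq (is_derM (is_der_cst S z) (is_der_comp (is_derive1_atan _)
    (is_derM (is_derB (is_der_id z) (is_der_cst x z)) (is_der_cst S^-1 z))))).
  by rewrite /g mul0r add0r mulr0 addr0 subr0 mul1r mulrCA divff ?mulr1 ?gt_eqF.
rewrite (_ : segint a b g = S * atan ((b - x) / S) - S * atan ((a - x) / S)); last first.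
  apply: (@segint_FTC _ a b g (fun z => S * atan ((z - x) / S))) => // z _.
  exact: is_der_continuous (dF z).
rewrite -mulrBr mulrC ler_pM2r//.
have := atan_ltpi2 ((b - x) / S); have := atan_gtNpi2 ((a - x) / S); lra.
Qed.

Lemma boxint_gauss n (x : 'rV[R]_n) (c : nat -> R) (L B : R) : 0 < B -> 0 <= L ->
  boxint c L (fun z => expR (- ((\sum_(i < n) (z 0 i - x 0 i) ^+ 2) / B))) <=
  (pi * Num.sqrt B) ^+ n.
Proof.
move=> B0 L0.
have -> : boxint c L (fun z => expR (- ((\sum_(i < n) (z 0 i - x 0 i) ^+ 2) / B))) =
  boxint c L (fun z => \prod_(i < n) expR (- ((z 0 i - ctr x i) ^+ 2 / B))).
  apply: eq_boxint => z _; rewrite -expR_sum; congr (expR _).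
  by rewrite mulr_suml -sumrN; apply: eq_bigr => i _; rewrite ctrE.
rewrite (@boxint_prod _ n c L (fun i z => expR (- ((z - ctr x i) ^+ 2 / B)))); last first.
  move=> i z; apply: (for_cont_comp (h := expR) (f := fun z : R => - ((z - ctr x i) ^+ 2 / B))).
    apply: for_contN; apply: for_contM; last exact: for_cont_cst.
    by apply: continuousXR; apply: continuousBR; [exact: cont_id|exact: cont_cst].
  exact: continuous_expR.
rewrite -[n in leRHS]card_ord -prodr_const; apply: ler_prod => i _.
rewrite segint_ge0/=; last by move=> z _; exact: expR_ge0.
by apply: segint_gauss => //; lra.
Qed.

Lemma GamE n (x z : 'rV[R]_n) (a : R) : 0 < a ->
  Gam x z a = (Num.sqrt a) ^- n * expR (- ((\sum_(i < n) (z 0 i - x 0 i) ^+ 2) / (4 * a))).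
Proof.
move=> a0; rewrite /Gam.
under eq_bigr do rewrite gamE//.
rewrite big_split/= prodr_const card_ord exprVn -expR_sum; congr (_ * expR _).
by rewrite mulr_suml -sumrN.
Qed.

Lemma boxint_Gam n (x : 'rV[R]_n) (c : nat -> R) (L a : R) : 0 < a -> 0 <= L ->
  boxint c L (fun z => Gam x z a) <= (2 * pi) ^+ n.
Proof.
move=> a0 L0; have S0 : 0 < Num.sqrt a by rewrite sqrtr_gt0.
have -> : boxint c L (fun z => Gam x z a) = boxint c L (fun z =>
   (Num.sqrt a) ^- n * expR (- ((\sum_(i < n) (z 0 i - x 0 i) ^+ 2) / (4 * a)))).
  by apply: eq_boxint => z _; exact: GamE.
rewrite boxintZ; last first.
  move=> z; apply: (for_cont_comp (h := expR)
    (f := fun z : 'rV[R]_n => - ((\sum_(i < n) (z 0 i - x 0 i) ^+ 2) / (4 * a)))).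
    apply: for_contN; apply: for_contM; last exact: for_cont_cst.
    apply: cont_bigsum => i; apply: continuousXR.
    by apply: continuousBR; [exact: coord_continuous|exact: cont_cst].
  exact: continuous_expR.
rewrite mulrC ler_pdivrMr ?exprn_gt0//.
apply: le_trans (boxint_gauss _ _ _ L0) _; first by rewrite mulr_gt0.
rewrite -exprMn le_eqVlt; apply/orP; left; apply/eqP; congr (_ ^+ n).
rewrite sqrtrM// -[4]/(2 * 2)%:R natrM -expr2 sqrtr_sqr ger0_norm//.
by rewrite mulrCA mulrA.
Qed.

End gaussian_integral.

Section norms.
Context {R : realType}.

Lemma inboxP n (c x : 'rV[R]_n) (L : R) : 0 <= L -> inbox (ctr c) L x <-> `|x - c| <= L.
Proof.
move=> L0; split.
  move=> h; rewrite [leLHS]/Num.norm /= mx_normrE; apply/bigmax_leP; split => // -[i j] _ /=.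
  by have := h j; rewrite ctrE (ord1 i) !mxE.
move=> h i; apply: le_trans h; rewrite ctrE [leRHS]/Num.norm /= mx_normrE.
by apply: (bigmax_sup (ord0, i)) => //=; rewrite !mxE.
Qed.

End norms.

(** * The critical estimate *)

Section clamped_integrals.
Context {R : realType} (n : nat) (T : R) (F : 'rV[R]_n * R -> R).
Hypothesis cF : forall p, 0 < p.2 < T -> {for p, continuous F}.
Variables (c : nat -> R) (L : R).

(** Space-time integral over a time interval away from 0. Clamping at its own endpoints makes the
    integrand continuous even if [F] is singular at the ends of []0, T[]. *)
Definition stint (a b : R) := segint a b (fun s => boxint c L (fun z => F (z, clampr a b s))).

Lemma stint_continuous a b : 0 < a -> a <= b -> b < T ->
  continuous (fun p : 'rV[R]_n * R => F (p.1, clampr a b p.2)).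
Proof.
move=> a0 ab bT; apply: (cont_clamp ab) => p /andP[h1 h2]; apply: cF.
by rewrite (lt_le_trans a0)// (le_lt_trans h2).
Qed.

Lemma stint_inner_continuous a b : 0 < a -> a <= b -> b < T ->
  continuous (fun s : R => boxint c L (fun z => F (z, clampr a b s))).
Proof. by move=> a0 ab bT; exact: (boxint_time_continuous c L (stint_continuous a0 ab bT)). Qed.

Lemma stint_clamp a b a' b' : a' <= a -> b <= b' ->
  stint a b = segint a b (fun s => boxint c L (fun z => F (z, clampr a' b' s))).
Proof.
move=> aa bb; apply: eq_segint => s /[!in_itv]/= /andP[h1 h2].
by rewrite !clampr_id ?h1// (le_trans aa h1) (le_trans h2 bb).
Qed.

Lemma stint_split a b d : 0 < a -> a <= b -> b <= d -> d < T ->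
  stint a d = stint a b + stint b d.
Proof.
move=> a0 ab bd dT.
rewrite (@stint_clamp a b a d)// (@stint_clamp b d a d)//.
rewrite -segint_split ?ab//.
by apply: stint_inner_continuous => //; exact: le_trans bd.
Qed.

Lemma stint_ge0 a b : 0 < a -> b < T ->
  (forall z s, inbox c L z -> 0 < s < T -> 0 <= F (z, s)) -> 0 <= stint a b.
Proof.
move=> a0 bT F0; apply: segint_ge0 => s Is; apply: boxint_ge0 => z zL.
rewrite clampr_id//; apply: F0 => //; move: Is => /andP[h1 h2].
by rewrite (lt_le_trans a0)// (le_lt_trans h2).
Qed.

(** The masses over [[t0, t1]] have a finite supremum over [t0], which is nearly reached at some
    [d]; by additivity the mass located before [d] is at most [e]. *)
Lemma small_mass t1 m e : 0 < t1 -> t1 < T -> 0 < e ->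
  (forall z s, inbox c L z -> 0 < s < T -> 0 <= F (z, s)) ->
  (forall t0, 0 < t0 -> t0 <= t1 -> stint t0 t1 <= m) ->
  exists2 d, 0 < d <= t1 & forall t0, 0 < t0 -> t0 <= d -> stint t0 d <= e.
Proof.
move=> t10 t1T e0 F0 Fm.
pose E := [set stint t0 t1 | t0 in [set t0 | 0 < t0 <= t1]].
have supE : has_sup E.
  split; first by exists (stint t1 t1), t1 => //=; rewrite t10 lexx.
  by exists m => _ [t0 /andP[h1 h2] <-]; exact: Fm.
have [_ [d /= /andP[d0 dt1] <-] dsup] := sup_adherent e0 supE.
exists d; first by rewrite d0.
move=> t0 t00 t0d.
have : stint t0 t1 <= sup E.
  by apply: sup_upper_bound => //; exists t0 => //=; rewrite t00 (le_trans t0d).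
by rewrite (@stint_split t0 d t1)//; lra.
Qed.

End clamped_integrals.

Section critical.
Context {R : realType}.
Variables (n : nat) (T : R) (u : 'rV[R]_n * R -> R).
Hypothesis n0 : (0 < n)%N.
Hypothesis uC : C21 [set p | 0 < p.2 < T] u.
Hypothesis u0 : forall x t, 0 < t < T -> 0 <= u (x, t).
Variables (c : 'rV[R]_n) (r t1 m N : R).
Hypotheses (r0 : 0 < r) (t10 : 0 < t1) (t1T : t1 < T) (m0 : 0 <= m) (N0 : 0 <= N).
Hypothesis f0 : forall z t, inbox (ctr c) r z -> 0 < t < T -> 0 <= heat_source u (z, t).
Hypothesis um : forall t0, 0 < t0 -> t0 <= t1 -> boxint (ctr c) r (fun y => u (y, t0)) <= m.
Hypothesis fm : forall t0, 0 < t0 -> t0 <= t1 -> stint (heat_source u) (ctr c) r t0 t1 <= m.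
Hypothesis fN : forall z t, inbox (ctr c) r z -> 0 < t <= t1 ->
  heat_source u (z, t) <= N * powR (u (z, t)) ((n%:R + 2) / n%:R).

Let kap : R := (2 * expR (- 4^-1)) ^+ n.
Let kap0 : 0 < kap. Proof. by rewrite exprn_gt0// mulr_gt0// expR_gt0. Qed.

Let cu p : 0 < p.2 < T -> {for p, continuous u}. Proof. by move=> /uC[]. Qed.
Let chs p : 0 < p.2 < T -> {for p, continuous (heat_source u)}.
Proof. exact: (heat_source_continuous uC). Qed.

(* [q] is the length scale with [q ^+ n * u (x, t) = 1]. Duhamel's formula on the
   cylinder of size [k * q] is split at the lag [(mu * q) ^+ 2]: older sources are
   controlled by their mass [e], recent ones by the critical power of [u]. *)
Lemma core_estimate (x : 'rV[R]_n) (t q k mu e : R) :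
  0 < q -> 0 < mu -> mu <= k -> 0 <= e ->
  0 < t - (k * q) ^+ 2 -> t <= t1 ->
  `|x - c| + k * q <= r ->
  u (x, t) = q ^- n ->
  (forall z s, inbox (ctr x) (k * q) z -> t - (k * q) ^+ 2 <= s <= t ->
     u (z, s) <= 2 ^+ n * q ^- n) ->
  stint (heat_source u) (ctr c) r (t - (k * q) ^+ 2) t <= e ->
  kap / 2 <= (1 + duh_const n) * m * k ^- n + e * mu ^- n +
    N * 2 ^+ n.+2 * (2 * pi) ^+ n * mu ^+ 2.
Proof.
move=> q0 mu0 muk e0 t00 tt1 xcr uq uM fe.
have k0 : 0 < k by exact: lt_le_trans muk.
set rho := k * q in t00 xcr uM fe; set t0 := t - rho ^+ 2 in t00 uM fe.
have rho0 : 0 < rho by rewrite mulr_gt0.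
pose l := mu * q; have l0 : 0 < l by rewrite mulr_gt0.
have lrho : l <= rho by rewrite ler_pM2r.
pose t2 := t - l ^+ 2.
have t0t2 : t0 <= t2.
  by rewrite lerD2l lerN2; apply: lerXn2r; rewrite ?nnegrE ?(ltW l0) ?(ltW rho0).
have t2t : t2 <= t by rewrite gerBl sqr_ge0.
have t0t := le_trans t0t2 t2t.
have tT : t < T by exact: le_lt_trans t1T.
have It s : t0 <= s <= t -> 0 < s < T.
  by move=> /andP[h1 h2]; rewrite (lt_le_trans t00)// (le_lt_trans h2).
have sub i : (i < n)%N -> ctr c i - r <= ctr x i - rho /\ ctr x i + rho <= ctr c i + r.
  move=> ni; have /inboxP/(_ (Ordinal ni)) := lexx `|x - c|.
  rewrite normr_ge0 => /(_ isT) /=; rewrite -(ctrE x (Ordinal ni)) /= => h.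
  by move: h; rewrite ler_distl; lra.
have subb (z : 'rV[R]_n) : inbox (ctr x) rho z -> inbox (ctr c) r z.
  move=> h i; have := h i; have [] := sub i (ltn_ord i).
  by rewrite !ler_distl; lra.
have f0x z s : inbox (ctr x) rho z -> 0 < s < T -> 0 <= heat_source u (z, s).
  by move=> /subb; exact: f0.
have Itt : 0 < t < T by apply: It; rewrite t0t lexx.
have eta0 : 0 < u (x, t) / 2 by rewrite uq divr_gt0// invr_gt0 exprn_gt0.
have [d d0 [dr ud]] : exists2 d, 0 < d & Num.sqrt d <= rho / 2 /\
    forall z, inbox (ctr x) (Num.sqrt d) z -> u (x, t) - u (x, t) / 2 <= u (z, t).
  have /cvgrPdist_lt/(_ _ eta0)/nbhs_ballP[e1 /= e10 He1] := cu (Itt : 0 < (x, t).2 < T).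
  pose d := Num.min (rho / 2) (e1 / 2).
  have dd : 0 < d by rewrite lt_min !divr_gt0.
  exists (d ^+ 2); first by rewrite exprn_gt0.
  rewrite sqrtr_sqr gtr0_norm//; split; first by rewrite ge_min lexx.
  move=> z /(inboxP _ _ (ltW dd)) zd.
  have : `|u (x, t) - u (z, t)| < u (x, t) / 2.
    apply: He1; split => /=; last exact: ballxx.
    rewrite -ball_normE /= distrC (le_lt_trans zd)//.
    have e12 : e1 / 2 < e1 by rewrite ltr_pdivrMr// ltr_pMr// ltr1n.
    by rewrite gt_min e12 orbT.
  by rewrite ltr_distl => /andP[_]; lra.
have D := @duhamel_ineq R n T u uC u0 x rho t0 t d rho0 t00 t0t tT d0 f0x (u (x, t) / 2) dr ud.
rewrite -/kap in D.
have Im s : t0 <= s <= t -> boxint (ctr x) rho (fun y => u (y, s)) <= m.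
  move=> Is; have /andP[h1 h2] := Is.
  apply: le_trans (um (lt_le_trans t00 h1) (le_trans h2 tt1)).
  apply: boxint_sub => //; first by apply: cont_slice => y; apply: cu; exact: It.
    exact: ltW.
  by move=> y _; apply: u0; exact: It.
have GamA a z L : 0 < L -> L ^+ 2 <= a -> Gam x z a <= L ^- n.
  move=> L0 La; have a0 : 0 < a by apply: lt_le_trans La; rewrite exprn_gt0.
  apply: le_trans (Gam_le _ _ a0) _; rewrite lef_pV2 ?posrE ?exprn_gt0 ?sqrtr_gt0//.
  apply: lerXn2r; rewrite ?nnegrE ?sqrtr_ge0 ?(ltW L0)//.
  by have := ler_wsqrtr La; rewrite sqrtr_sqr gtr0_norm.
pose A := t + d.
have cGm p : p.2 <= t -> {for p, continuous (fun p : 'rV[R]_n * R => Gam x p.1 (A - p.2))}.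
  by move=> h; apply: for_cont_Gam; rewrite /A (le_lt_trans h)// ltrDl.
have I1 : boxint (ctr x) rho (fun z => u (z, t0) * Gam x z (A - t0)) <= rho ^- n * m.
  have It0 : t0 <= t0 <= t by rewrite lexx.
  apply: le_trans (ler_wpM2l _ (Im _ It0)); last by rewrite invr_ge0 exprn_ge0// ltW.
  have cut0 : continuous (fun y => u (y, t0)).
    by apply: cont_slice => y; apply: cu; exact: It.
  rewrite -boxintZ//; apply: le_boxint.
  - apply: (@cont_slice _ _ _ (fun p => u p * Gam x p.1 (A - p.2))) => y.
    by apply: for_contM; [apply: cu; exact: It|exact: cGm].
  - by apply: continuousMR => //; exact: cont_cst.
  - move=> z _; rewrite mulrC ler_wpM2r ?u0 ?It//; apply: GamA => //.
    by rewrite /A addrAC ler_wpDr ?(ltW d0)// lerBrDr addrC /t0 subrK.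
have I3 : segint t0 t (fun s => boxint (ctr x) rho (fun z => u (z, clampr t0 t s))) <= rho ^+ 2 * m.
  have -> : rho ^+ 2 * m = segint t0 t (fun=> m).
    by rewrite segint_cst// /t0; congr (_ * _); lra.
  apply: le_segint; [exact: (stint_inner_continuous cu)|exact: cont_cst|].
  by move=> s Is; rewrite clampr_id//; exact: Im.
have chG p : t0 <= p.2 <= t -> {for p, continuous (fun p : 'rV[R]_n * R =>
    heat_source u p * Gam x p.1 (A - p.2))}.
  move=> h; apply: for_contM; first by apply: chs; exact: It.
  by apply: cGm; case/andP: h.
have chGc := boxint_time_continuous (ctr x) rho (cont_clamp t0t chG).
have I2a : segint t0 t2 (fun s => boxint (ctr x) rho (fun z =>
    heat_source u (z, clampr t0 t s) * Gam x z (A - clampr t0 t s))) <= l ^- n * e.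
  have e1 : stint (heat_source u) (ctr c) r t0 t2 <= e.
    apply: le_trans fe; rewrite (@stint_split R n T _ chs _ _ t0 t2 t)// lerDl.
    by apply: (@stint_ge0 R n T) => //; exact: lt_le_trans t0t2.
  have ln : 0 <= l ^- n by rewrite invr_ge0 exprn_ge0// ltW.
  apply: le_trans (ler_wpM2l ln e1).
  rewrite (@stint_clamp R n _ _ _ t0 t2 t0 t)//.
  have chr := @stint_inner_continuous R n T (heat_source u) chs (ctr c) r t0 t t00 t0t tT.
  rewrite -segintZ//; apply: le_segint => //.
    by apply: continuousMR => //; exact: cont_cst.
  move=> s /andP[h1 h2]; have Is : t0 <= s <= t by rewrite h1 (le_trans h2).
  rewrite clampr_id//.
  have chss : continuous (fun y => heat_source u (y, s)).
    by apply: cont_slice => y; apply: chs; exact: It.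
  apply: (@le_trans _ _ (boxint (ctr x) rho (fun z => l ^- n * heat_source u (z, s)))).
    apply: le_boxint.
    - by apply: (@cont_slice _ _ _ (fun p => heat_source u p * Gam x p.1 (A - p.2))) => y; exact: chG.
    - by apply: continuousMR => //; exact: cont_cst.
    - move=> z zx; rewrite mulrC ler_wpM2r ?f0x ?It//; apply: GamA => //.
      by rewrite /A addrAC ler_wpDr ?(ltW d0)// lerBrDr addrC -lerBrDr.
  rewrite boxintZ// ler_wpM2l//; apply: boxint_sub => //; first exact: ltW.
  by move=> z zc; apply: f0 => //; exact: It.
(* From [u <= (2 / q)^n] the power [1 + 2/n] yields [(2 / q)^(n+2)]. Multiplied by the duration
   [(mu q)^2] this scales like [q^(-n)], as all other terms do, so [q] disappears from the final
   estimate: this is where the exponent is critical. *)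
have fb z s : inbox (ctr x) rho z -> t0 <= s <= t ->
    heat_source u (z, s) <= N * (2 / q) ^+ n.+2.
  move=> zx Is; apply: le_trans (fN (subb _ zx) _) _.
    by have /andP[h _] := It _ Is; rewrite h; case/andP: Is => _ /le_trans; exact.
  rewrite ler_wpM2l//.
  have -> : (2 / q) ^+ n.+2 = powR (2 ^+ n * q ^- n) ((n%:R + 2) / n%:R).
    rewrite -exprVn -exprMn -powR_mulrn; last by rewrite divr_ge0// ltW.
    rewrite -powR_mulrn; last by rewrite divr_ge0// ltW.
    rewrite -powRrM; congr (powR _ _).
    rewrite mulrCA divff ?mulr1; last by rewrite pnatr_eq0 -lt0n.
    by rewrite -natrD addn2.
  apply: ge0_ler_powR; rewrite ?nnegrE.
  - by rewrite divr_ge0// addr_ge0.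
  - by apply: u0; exact: It.
  - by rewrite mulr_ge0 ?exprn_ge0// invr_ge0 exprn_ge0// ltW.
  - exact: uM.
have I2b : segint t2 t (fun s => boxint (ctr x) rho (fun z =>
    heat_source u (z, clampr t0 t s) * Gam x z (A - clampr t0 t s))) <=
    l ^+ 2 * (N * (2 / q) ^+ n.+2 * (2 * pi) ^+ n).
  have -> : l ^+ 2 * (N * (2 / q) ^+ n.+2 * (2 * pi) ^+ n) =
      segint t2 t (fun=> N * (2 / q) ^+ n.+2 * (2 * pi) ^+ n).
    by rewrite segint_cst//; congr (_ * _); rewrite /t2; lra.
  apply: le_segint => //; first exact: cont_cst.
  move=> s /andP[h1 h2]; have Is : t0 <= s <= t by rewrite (le_trans t0t2 h1).
  rewrite clampr_id//.
  have NN : 0 <= N * (2 / q) ^+ n.+2.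
    by rewrite mulr_ge0// exprn_ge0// divr_ge0// ltW.
  have As : 0 < A - s by rewrite subr_gt0 /A (le_lt_trans h2)// ltrDl.
  apply: (@le_trans _ _ (N * (2 / q) ^+ n.+2 * boxint (ctr x) rho (fun z => Gam x z (A - s)))).
    have cGs : continuous (fun z => Gam x z (A - s)).
      by apply: (@cont_slice _ _ _ (fun p => Gam x p.1 (A - p.2))) => y; exact: cGm.
    rewrite -boxintZ//; apply: le_boxint.
    - by apply: (@cont_slice _ _ _ (fun p => heat_source u p * Gam x p.1 (A - p.2))) => y; exact: chG.
    - by apply: continuousMR => //; exact: cont_cst.
    - by move=> z zx; rewrite ler_wpM2r ?Gam_ge0//; exact: fb.
  by rewrite ler_wpM2l//; apply: boxint_Gam => //; exact: ltW.
have dc : 0 <= duh_const n :> R.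
  rewrite mulr_ge0// mulr_ge0 ?(ltW (gauss_bound_gt0 _))//.
  by apply: le_trans (chi1_bounds 0).1; exact: normr_ge0.
have {}D : kap * (q ^- n / 2) <= rho ^- n * m + (l ^- n * e +
    l ^+ 2 * (N * (2 / q) ^+ n.+2 * (2 * pi) ^+ n)) + duh_const n / rho ^+ n.+2 * (rho ^+ 2 * m).
  have -> : q ^- n / 2 = u (x, t) - u (x, t) / 2 by rewrite uq; field; rewrite expf_neq0// gt_eqF.
  apply: le_trans D _; rewrite lerD//; last first.
    by rewrite ler_wpM2l// divr_ge0// exprn_ge0// ltW.
  rewrite lerD//; rewrite (@segint_split _ t0 t2 t) ?t0t2//; exact: lerD.
have qn : 0 < q ^+ n by rewrite exprn_gt0.
rewrite -(@ler_pM2l _ (q ^- n)) ?invr_gt0//.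
apply: le_trans (le_trans D _); first by rewrite le_eqVlt; apply/orP; left; apply/eqP; ring.
rewrite le_eqVlt; apply/orP; left; apply/eqP.
have eS (y : R) : y ^+ n.+2 = y ^+ n * y ^+ 2 by rewrite -exprD addn2.
rewrite expr_div_n (eS q) (eS rho) /rho /l !exprMn.
have kn : k ^+ n != 0 by rewrite expf_neq0// gt_eqF.
have mn : mu ^+ n != 0 by rewrite expf_neq0// gt_eqF.
have qn0 : q ^+ n != 0 by rewrite gt_eqF.
have q00 : q != 0 by rewrite gt_eqF.
have k00 : k != 0 by rewrite gt_eqF.
move: (2 ^+ n.+2) (2 ^+ n * pi ^+ n) (duh_const n) (k ^+ n) kn (mu ^+ n) mn (q ^+ n) qn0 =>
  a1 a2 a3 X X0 Y Y0 Z Z0.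
by field; rewrite X0 Y0 Z0 q00 k00.
Qed.

End critical.

Section critical_bound.
Context {R : realType}.
Variables (n : nat) (T : R) (u : 'rV[R]_n * R -> R).
Hypothesis n0 : (0 < n)%N.
Hypothesis uC : C21 [set p | 0 < p.2 < T] u.
Hypothesis u0 : forall x t, 0 < t < T -> 0 <= u (x, t).
Variables (c : 'rV[R]_n) (r t1 m N : R).
Hypotheses (r0 : 0 < r) (t10 : 0 < t1) (t1T : t1 < T) (m0 : 0 <= m) (N0 : 0 <= N).
Hypothesis f0 : forall z t, inbox (ctr c) r z -> 0 < t < T -> 0 <= heat_source u (z, t).
Hypothesis um : forall t0, 0 < t0 -> t0 <= t1 -> boxint (ctr c) r (fun y => u (y, t0)) <= m.
Hypothesis fm : forall t0, 0 < t0 -> t0 <= t1 -> stint (heat_source u) (ctr c) r t0 t1 <= m.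
Hypothesis fN : forall z t, inbox (ctr c) r z -> 0 < t <= t1 ->
  heat_source u (z, t) <= N * powR (u (z, t)) ((n%:R + 2) / n%:R).

Let kap : R := (2 * expR (- 4^-1)) ^+ n.
Let kap0 : 0 < kap. Proof. by rewrite exprn_gt0// mulr_gt0// expR_gt0. Qed.

Let cu p : 0 < p.2 < T -> {for p, continuous u}. Proof. by move=> /uC[]. Qed.
Let chs p : 0 < p.2 < T -> {for p, continuous (heat_source u)}.
Proof. exact: (heat_source_continuous uC). Qed.

(** The order of choice matters: [k] is large against the mass [m], [mu] small against [N], and [e]
    comes last because it is divided by [mu^n]. Each of the three terms is then at most
    [kap / 8]. *)
Lemma constants_exist : exists k mu e : R, [/\ 0 < mu, mu <= k, 0 < e &
  (1 + duh_const n) * m * k ^- n + e * mu ^- n +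
    N * 2 ^+ n.+2 * (2 * pi) ^+ n * mu ^+ 2 < kap / 2].
Proof.
have dc : 0 <= duh_const n :> R.
  rewrite mulr_ge0// mulr_ge0 ?(ltW (gauss_bound_gt0 _))//.
  by apply: le_trans (chi1_bounds 0).1; exact: normr_ge0.
pose Q := (1 + duh_const n) * m.
have Q0 : 0 <= Q by rewrite mulr_ge0// addr_ge0.
pose B : R := N * 2 ^+ n.+2 * (2 * pi) ^+ n.
have B0 : 0 <= B.
  apply: mulr_ge0; first by apply: mulr_ge0 => //; exact: exprn_ge0.
  by apply: exprn_ge0; apply: mulr_ge0 => //; exact: pi_ge0.
pose k := Num.max 1 (8 * Q / kap); pose mu := Num.min 1 (kap / (8 * (B + 1))).
have k1 : 1 <= k by rewrite le_max lexx.
have k0 : 0 < k by exact: lt_le_trans k1.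
have mu1 : mu <= 1 by rewrite ge_min lexx.
have B1 : 0 < 8 * (B + 1) by rewrite mulr_gt0// ltr_wpDl.
have mu0 : 0 < mu by rewrite lt_min ltr01 divr_gt0.
have mn : 0 < mu ^+ n by rewrite exprn_gt0.
exists k, mu, (kap / 8 * mu ^+ n); split => //.
- exact: le_trans k1.
- by rewrite mulr_gt0// divr_gt0.
have e1 : Q * k ^- n <= kap / 8.
  rewrite ler_pdivrMr ?exprn_gt0//.
  have kn : k <= k ^+ n by rewrite -[leLHS]expr1; apply: ler_weXn2l.
  apply: (@le_trans _ _ (kap / 8 * k)); last by rewrite ler_pM2l// divr_gt0.
  have : 8 * Q / kap <= k by rewrite le_max lexx orbT.
  by rewrite ler_pdivrMr// => h; rewrite mulrAC ler_pdivlMr// mulrC (mulrC kap).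
have e2 : kap / 8 * mu ^+ n * mu ^- n = kap / 8 by rewrite mulfK// gt_eqF.
have e3 : B * mu ^+ 2 <= kap / 8.
  have mu2 : mu ^+ 2 <= mu by rewrite expr2 ler_piMl// ltW.
  apply: le_trans (ler_wpM2l B0 mu2) _.
  apply: (@le_trans _ _ ((B + 1) * mu)); first by rewrite ler_pM2r// lerDl.
  have : mu <= kap / (8 * (B + 1)) by rewrite ge_min lexx orbT.
  rewrite ler_pdivlMr// => h; rewrite ler_pdivlMr//.
  by have -> : (B + 1) * mu * 8 = mu * (8 * (B + 1)) by ring.
rewrite e2 -/Q -/B; have := kap0; lra.
Qed.

(** The distance is measured to a time [tau > 0], so that the maximum is taken over a compact set on
    which [u] is continuous. The resulting bound [(2 k)^n] does not depend on [tau], and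
    [tau = t / 2] gives the rate in [t]. *)
Lemma critical_bound : exists C d, 0 < d /\ forall t x, 0 < t < d -> `|x - c| <= r / 2 ->
  u (x, t) <= C * powR t (- (n%:R / 2)).
Proof.
have [k [mu [e [mu0 muk e0 small]]]] := constants_exist.
have k0 : 0 < k by exact: lt_le_trans muk.
have [d1 /andP[d10 d1t1] d1e] := small_mass chs t10 t1T e0 f0 fm.
pose d := Num.min d1 ((r / 2) ^+ 2).
have r20 : 0 < r / 2 by rewrite divr_gt0.
have d0 : 0 < d by rewrite lt_min d10 exprn_gt0.
have dd1 : d <= d1 by rewrite ge_min lexx.
have dr : Num.sqrt d <= r / 2.
  have : d <= (r / 2) ^+ 2 by rewrite ge_min lexx orbT.
  by move=> /ler_wsqrtr; rewrite sqrtr_sqr gtr0_norm.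
have dt1 : d <= t1 := le_trans dd1 d1t1.
have key tau x t : 0 < tau -> tau <= t -> t <= d -> `|x - c| <= r ->
    Num.min (Num.sqrt (t - tau)) (r - `|x - c|) ^+ n * u (x, t) <= (2 * k) ^+ n.
  move=> tau0 taut td xr.
  pose D (p : 'rV[R]_n * R) := Num.min (Num.sqrt (p.2 - tau)) (r - `|p.1 - c|).
  pose Psi p := D p ^+ n * u p.
  pose K1 := [set v : 'rV[R]_n | forall i, `[c 0 i - r, c 0 i + r]%classic (v ord0 i)].
  pose K := K1 `*` `[tau, d].
  have K1P y : K1 y <-> `|y - c| <= r.
    rewrite -(inboxP _ _ (ltW r0)); split => h i; have := h i.
      by rewrite ctrE /= in_itv/= -ler_distl.
    by rewrite ctrE /= in_itv/= -ler_distl.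
  have IK p : K p -> 0 < p.2 < T.
    move=> [_ /=]; rewrite in_itv/= => /andP[h1 h2].
    by rewrite (lt_le_trans tau0 h1)//= (le_lt_trans h2)// (le_lt_trans dt1).
  have cK : compact K.
    apply: compact_setX; last exact: segment_compact.
    by apply: (@rV_compact R n (fun i => `[c 0 i - r, c 0 i + r]%classic)) => i; exact: segment_compact.
  have cD : continuous D.
    move=> p; apply: (@continuous_min _ _ (fun p : 'rV[R]_n * R => Num.sqrt (p.2 - tau))
       (fun p : 'rV[R]_n * R => r - `|p.1 - c|)).
      apply: (for_cont_comp (h := Num.sqrt) (f := fun p : 'rV[R]_n * R => p.2 - tau));
        last exact: sqrt_continuous.
      by apply: continuousBR; [apply: cont_snd; exact: cont_id|exact: cont_cst].
    apply: for_contB; first exact: for_cont_cst.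
    apply: (@continuous_comp _ _ _ (fun p : 'rV[R]_n * R => p.1 - c) (fun y => `|y|));
      last exact: norm_continuous.
    apply: continuousB; last exact: cvg_cst.
    by apply: cont_fst; exact: cont_id.
  have cPsi : {within K, continuous Psi}.
    apply: continuous_in_subspaceT => p /[!inE] Kp.
    apply: (@for_contM _ _ (fun p => D p ^+ n) u).
      by apply: continuousXR.
    by apply: cu; exact: IK.
  have Kxt : K (x, t) by split; [apply/K1P|rewrite /= in_itv/= taut].
  have [[x1 s1] /[!inE] KP Pmax] := compact_EVT_max (ex_intro _ _ Kxt) cK cPsi.
  apply: (@le_trans _ _ (Psi (x1, s1))); first by apply: (Pmax (x, t)); rewrite inE.
  rewrite leNgt; apply/negP => big.
  have [/= /K1P x1r] := KP; rewrite /= in_itv/= => /andP[taus1 s1d].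
  have Is1 := IK _ KP; rewrite /= in Is1.
  set dd := D (x1, s1) in big.
  have dd0 : 0 <= dd by rewrite /dd /D le_min sqrtr_ge0 subr_ge0.
  have M0 : 0 <= u (x1, s1) by exact: u0.
  have big0 : 0 < dd ^+ n * u (x1, s1).
    by apply: lt_trans big; rewrite exprn_gt0// mulr_gt0.
  have ddp : 0 < dd.
    rewrite lt_neqAle dd0 andbT; apply/eqP => e0'.
    by move: big0; rewrite -e0' expr0n eqn0Ngt n0 mul0r ltxx.
  have Mp : 0 < u (x1, s1).
    rewrite lt_neqAle M0 andbT; apply/eqP => e0'.
    by move: big0; rewrite -e0' mulr0 ltxx.
  pose q := powR (u (x1, s1)) (- n%:R^-1).
  have q0 : 0 < q by rewrite powR_gt0.
  have nn0 : n%:R != 0 :> R by rewrite pnatr_eq0 -lt0n.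
  have qn : q ^+ n = (u (x1, s1))^-1.
    rewrite -powR_mulrn ?(ltW q0)// /q -powRrM mulNr mulVf//.
    by rewrite powR_inv1.
  have uq : u (x1, s1) = q ^- n by rewrite qn invrK.
  (* A maximum above [(2 k)^n] means precisely this. The cylinder of size [k q] below [(x1, s1)]
     then stays where the distance is at least [dd / 2], and maximality of [D^n u] bounds [u] there
     by [2^n] times its value at [(x1, s1)]. *)
  have kq : k * q < dd / 2.
    have : (2 * k) ^+ n < (dd / q) ^+ n by rewrite expr_div_n -uq.
    rewrite ltr_pXn2r ?nnegrE ?mulr_ge0 ?invr_ge0 ?(ltW k0) ?(ltW q0)//.
    by rewrite ltr_pdivlMr// => h; rewrite ltr_pdivlMr// mulrC mulrA.
  have kq0 : 0 < k * q by rewrite mulr_gt0.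
  have kq2 : (k * q) ^+ 2 <= dd ^+ 2 / 4.
    have -> : dd ^+ 2 / 4 = (dd / 2) ^+ 2 by field.
    by apply: lerXn2r; rewrite ?nnegrE ?(ltW kq0) ?(ltW kq)// divr_ge0.
  have dds : dd ^+ 2 <= s1 - tau.
    rewrite -[leRHS]sqr_sqrtr ?subr_ge0//; apply: lerXn2r; rewrite ?nnegrE ?sqrtr_ge0//.
    by rewrite /dd /D ge_min lexx.
  have ddr : dd <= r - `|x1 - c| by rewrite /dd /D ge_min lexx orbT.
  have d2p : 0 < dd ^+ 2 by rewrite exprn_gt0.
  have s1q : tau <= s1 - (k * q) ^+ 2 by move: (k * q) (dd ^+ 2) kq2 dds d2p => a1 a2; lra.
  have q2 : s1 - (k * q) ^+ 2 <= s1 by rewrite gerBl sqr_ge0.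
  have p0 := lt_le_trans tau0 s1q.
  have subK z s : inbox (ctr x1) (k * q) z -> s1 - (k * q) ^+ 2 <= s <= s1 ->
      K (z, s) /\ dd / 2 <= D (z, s).
    move=> /(inboxP _ _ (ltW kq0)) zx /andP[h1 h2].
    have zc : `|z - c| <= k * q + `|x1 - c|.
      have -> : z - c = (z - x1) + (x1 - c) by rewrite addrA subrK.
      by apply: le_trans (ler_normD _ _) _; rewrite lerD2r.
    split.
      split; [apply/K1P|rewrite /= in_itv/= (le_trans s1q h1) (le_trans h2)//].
      by move: (`|z - c|) (`|x1 - c|) (k * q) zc ddr kq ddp => a1 a2 a3; lra.
    rewrite /D /= le_min; apply/andP; split; last first.
      by move: (`|z - c|) (`|x1 - c|) (k * q) zc ddr kq ddp => a1 a2 a3; lra.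
    have : (dd / 2) ^+ 2 <= s - tau.
      have -> : (dd / 2) ^+ 2 = dd ^+ 2 / 4 by field.
      by move: (k * q) (dd ^+ 2) kq2 dds d2p h1 => a1 a2; lra.
    by move=> /ler_wsqrtr; rewrite sqrtr_sqr ger0_norm// divr_ge0.
  suff : kap / 2 <= (1 + duh_const n) * m * k ^- n + e * mu ^- n +
      N * 2 ^+ n.+2 * (2 * pi) ^+ n * mu ^+ 2 by rewrite leNgt small.
  apply: (@core_estimate R n T u n0 uC u0 c r t1 m N t1T N0 f0 um fN x1 s1 q k mu e
    q0 mu0 muk (ltW e0) p0 (le_trans s1d dt1)) => //.
  - by move: (`|x1 - c|) (k * q) ddr kq ddp => a2 a3; lra.
  - move=> z s zx Is; have [Kzs Dzs] := subK _ _ zx Is.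
    have uzs : 0 <= u (z, s) by apply: u0; exact: (IK _ Kzs).
    have : Psi (z, s) <= Psi (x1, s1) by apply: Pmax; rewrite inE.
    rewrite /Psi -/dd uq.
    have h : (dd / 2) ^+ n * u (z, s) <= D (z, s) ^+ n * u (z, s).
      by rewrite ler_wpM2r//; apply: lerXn2r; rewrite ?nnegrE ?(le_trans _ Dzs) ?divr_ge0.
    move=> /(le_trans h); rewrite expr_div_n mulrAC ler_pdivrMr ?exprn_gt0// -mulrA.
    by rewrite ler_pM2l ?exprn_gt0// mulrC.
  - have s1d1 := le_trans s1d dd1.
    have d1T := le_lt_trans d1t1 t1T.
    apply: le_trans (d1e _ p0 (le_trans q2 s1d1)).
    rewrite (@stint_split R n T _ chs _ _ _ s1 d1)// lerDl.
    by apply: (@stint_ge0 R n T) => //; case/andP: Is1.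
(* For [tau = t / 2], [t < d] and [x] in the half ball the minimum defining the distance is
   [sqrt (t / 2)], by the choice of [d]; hence the factor [sqrt 2 ^+ n]. *)
exists ((2 * k) ^+ n * Num.sqrt 2 ^+ n), d; split => // t x /andP[t0 td] xc.
have xr : `|x - c| <= r by apply: le_trans xc _; rewrite ler_pdivrMr// ler_pMr// ler1n.
have t20 : 0 < t / 2 by rewrite divr_gt0.
have t2t : t / 2 <= t by rewrite ler_pdivrMr// ler_pMr// ler1n.
have := key (t / 2) x t t20 t2t (ltW td) xr.
have -> : t - t / 2 = t / 2 by field.
have st : Num.sqrt (t / 2) <= r - `|x - c|.
  apply: le_trans (_ : _ <= r / 2) _; last by move: (`|x - c|) xc => a; lra.
  by apply: le_trans dr; rewrite ler_wsqrtr// (le_trans t2t)// ltW.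
rewrite (min_idPl st) => h.
have -> : powR t (- (n%:R / 2)) = Num.sqrt t ^- n.
  rewrite powRN -powR12_sqrt ?(ltW t0)// -powR_mulrn ?powR_ge0// -powRrM.
  by rewrite mulrC.
have s20 : 0 < Num.sqrt (2 : R) ^+ n by rewrite exprn_gt0// sqrtr_gt0.
have st0 : 0 < Num.sqrt t ^+ n by rewrite exprn_gt0// sqrtr_gt0.
rewrite ler_pdivlMr//.
have e2 : Num.sqrt t = Num.sqrt (t / 2) * Num.sqrt 2.
  by rewrite -sqrtrM ?(ltW t20)// divfK.
by rewrite e2 exprMn mulrC mulrAC ler_pM2r.
Qed.

End critical_bound.

(** * The nonlocal term *)

Section power_functions.
Context {R : realType}.

Lemma for_cont_powR_pos (V : topologicalType) (f : V -> R) a p : {for p, continuous f} ->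
  0 < f p -> {for p, continuous (fun x => powR (f x) a)}.
Proof.
move=> cf fp.
have H : {for f p, continuous (fun x : R => powR x a)}.
  by apply: differentiable_continuous; apply/derivable1_diffP; apply: derivable_powR; rewrite in_itv/= fp.
exact: (@for_cont_comp R V (fun x : R => powR x a) f p cf H).
Qed.

Lemma for_cont_powR (V : topologicalType) (f : V -> R) a p : {for p, continuous f} ->
  0 < a -> (\forall x \near p, 0 <= f x) -> {for p, continuous (fun x => powR (f x) a)}.
Proof.
move=> cf a0 f0; have fp : 0 <= f p by exact: (nbhs_singleton f0).
move: fp; rewrite le_eqVlt => /predU1P[fp|]; last exact: for_cont_powR_pos.
apply/cvgrPdist_lt => e e0; rewrite -fp powR0 ?gt_eqF//.
have d0 : 0 < powR e a^-1 by exact: powR_gt0.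
have /cvgrPdist_lt/(_ _ d0) := cf; rewrite -fp => h.
near=> x; rewrite sub0r normrN ger0_norm ?powR_ge0//.
have x0 : 0 <= f x by near: x.
have : `|0 - f x| < powR e a^-1 by near: x.
rewrite sub0r normrN ger0_norm// => fx.
have -> : e = powR (powR e a^-1) a by rewrite -powRrM mulVf ?gt_eqF// powRr1// ltW.
by apply: gt0_ltr_powR => //; rewrite nnegrE ltW.
Unshelve. all: by end_near. Qed.

Lemma is_der_powR (f : R -> R) x a d : 0 < f x -> is_derive x 1 f d ->
  is_derive x 1 (fun x => powR (f x) a) (a * powR (f x) (a - 1) * d).
Proof. by move=> f0 df; exact: (is_der_comp (is_derive1_powR a f0) df). Qed.

Lemma powR_expR (x a : R) : powR (expR x) a = expR (a * x).
Proof. by rewrite /powR gt_eqF ?expR_gt0// expRK. Qed.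

(** In logarithms this is [ln z < z] at [z = b / (s a)]. It bounds the kernel, uniformly in time,
    away from its pole in space. *)
Lemma powR_exp_bound (a b : R) : 0 < a -> 0 < b ->
  exists C, forall s, 0 < s -> powR s (- a) * expR (- (b / s)) <= C.
Proof.
move=> a0 b0; exists (expR (a * ln (a / b))) => s s0.
rewrite /powR gt_eqF// -expRD ler_expR.
have h : 0 < b / (s * a) by rewrite divr_gt0// mulr_gt0.
have := ltW (ln_sublinear h).
have -> : ln (b / (s * a)) = - ln s - ln (a / b).
  have -> : b / (s * a) = (s * (a / b))^-1 by field; rewrite !gt_eqF.
  have ab : 0 < a / b by rewrite divr_gt0.
  rewrite -opprD -(lnM s0 ab) /=; apply: lnV; exact: mulr_gt0.
rewrite -(ler_pM2l a0).
have -> : a * (b / (s * a)) = b / s by field; rewrite !gt_eqF.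
by move: (b / s) (ln s) (ln (a / b)) => x y z; lra.
Qed.

Lemma segint_powR_lag (e t s0 s1 : R) : -1 < e -> 0 < s0 -> s0 <= s1 -> s1 < t ->
  segint s0 s1 (fun s => powR (t - clampr s0 s1 s) e) <= powR t (e + 1) / (e + 1).
Proof.
move=> e1 s00 s01 s1t.
have e10 : 0 < e + 1 by rewrite -ltrBlDr sub0r.
have lag s : s <= s1 -> 0 < t - s by move=> h; rewrite subr_gt0 (le_lt_trans h).
pose F s := - (powR (t - s) (e + 1) / (e + 1)).
have dF s : s <= s1 -> is_derive s 1 F (powR (t - s) e).
  move=> /lag ts.
  apply: (is_der_eq (is_derN (is_derM (@is_der_powR (fun s => t - s) s (e + 1) _ ts
    (is_derB (is_der_cst t s) (is_der_id s))) (is_der_cst (e + 1)^-1 s)))).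
  rewrite addrK; field; exact: lt0r_neq0.
apply: (@le_trans _ _ (F s1 - F s0)); last first.
  rewrite /F opprK addrC; apply: (@le_trans _ _ (powR (t - s0) (e + 1) / (e + 1))).
    by rewrite gerBl divr_ge0 ?powR_ge0// ltW.
  rewrite ler_pM2r ?invr_gt0//; apply: ge0_ler_powR; rewrite ?nnegrE ?(ltW e10)//.
  - by rewrite ltW// lag.
  - by rewrite ltW// (lt_le_trans s00)// ltW// (le_lt_trans s01).
  - by rewrite gerBl ltW.
rewrite le_eqVlt; apply/orP; left; apply/eqP; apply: segint_FTC => //.
- by move=> s /andP[_ h]; apply: is_der_continuous; exact: dF.
- move=> s /andP[h1 h2]; rewrite clampr_id ?(ltW h1) ?(ltW h2)//.
  by apply: dF; exact: ltW.
- move=> s; apply: (@for_cont_powR_pos _ (fun s : R => t - clampr s0 s1 s)).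
    apply: for_contB; [exact: for_cont_cst|exact: continuous_clampr].
  by apply: lag; case/andP: (clampr_in s s01).
Qed.

Lemma continuous_abs_lag (d s' : R) : continuous (fun s : R => `|s - s'| + d).
Proof.
apply: continuousDR; last exact: cont_cst.
apply: (@cont_comp _ _ _ (fun s : R => s - s') (fun x : R => `|x|)); last exact: norm_continuous.
by apply: continuousBR; [exact: cont_id|exact: cont_cst].
Qed.

(** The interval is split at [s'], and each side has an explicit primitive; hence the factor 2. The
    shift [d] keeps the integrand continuous and does not enter the bound except through [B]. *)
Lemma segint_powR_abs (e d s' s0 s1 B : R) : -1 < e -> 0 < d -> s0 <= s1 ->
  (forall s, s0 <= s <= s1 -> `|s - s'| + d <= B) ->
  segint s0 s1 (fun s => powR (`|s - s'| + d) e) <= 2 * (powR B (e + 1) / (e + 1)).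
Proof.
move=> e1 d0 s01 sB.
have e10 : 0 < e + 1 by rewrite -ltrBlDr sub0r.
pose g (s : R) := powR (`|s - s'| + d) e.
have lag s : 0 < `|s - s'| + d by rewrite ltr_wpDl.
have cg : continuous g.
  by move=> s; apply: (@for_cont_powR_pos _ (fun s : R => `|s - s'| + d)); [exact: continuous_abs_lag|exact: lag].
have PB s : s0 <= s <= s1 -> powR (`|s - s'| + d) (e + 1) / (e + 1) <= powR B (e + 1) / (e + 1).
  move=> Is; rewrite ler_pM2r ?invr_gt0//; apply: ge0_ler_powR; rewrite ?nnegrE ?(ltW e10) ?(ltW (lag _))//.
    by apply: le_trans (sB _ Is); rewrite ltW.
  exact: sB.
have P0 x : 0 <= powR x (e + 1) / (e + 1) by rewrite divr_ge0 ?powR_ge0// ltW.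
have up a b : s0 <= a -> a <= b -> b <= s1 -> s' <= a ->
    segint a b g <= powR B (e + 1) / (e + 1).
  move=> s0a ab bs1 sa.
  pose F s := powR (s - s' + d) (e + 1) / (e + 1).
  have dF s : a <= s -> is_derive s 1 F (g s).
    move=> as_; have ss : s' <= s by exact: le_trans as_.
    have ss0 : 0 < s - s' + d by rewrite ltr_wpDl// subr_ge0.
    apply: (is_der_eq (is_derM (@is_der_powR (fun s => s - s' + d) s (e + 1) _ ss0
      (is_derD (is_derB (is_der_id s) (is_der_cst s' s)) (is_der_cst d s))) (is_der_cst (e + 1)^-1 s))).
    rewrite addrK /g ger0_norm ?subr_ge0//; field; exact: lt0r_neq0.
  have -> : segint a b g = F b - F a.
    apply: segint_FTC => //.
    - by move=> s /andP[h _]; apply: is_der_continuous; exact: dF.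
    - by move=> s /andP[h _]; apply: dF; exact: ltW.
  apply: (@le_trans _ _ (F b)); first by rewrite gerBl P0.
  have := PB b; rewrite ger0_norm ?subr_ge0 ?(le_trans sa)//; apply.
  by rewrite (le_trans s0a).
have down a b : s0 <= a -> a <= b -> b <= s1 -> b <= s' ->
    segint a b g <= powR B (e + 1) / (e + 1).
  move=> s0a ab bs1 sb.
  pose F s := - (powR (s' - s + d) (e + 1) / (e + 1)).
  have dF s : s <= b -> is_derive s 1 F (g s).
    move=> sb_; have ss : s <= s' by exact: le_trans sb.
    have ss0 : 0 < s' - s + d by rewrite ltr_wpDl// subr_ge0.
    apply: (is_der_eq (is_derN (is_derM (@is_der_powR (fun s => s' - s + d) s (e + 1) _ ss0
      (is_derD (is_derB (is_der_cst s' s) (is_der_id s)) (is_der_cst d s))) (is_der_cst (e + 1)^-1 s)))).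
    rewrite addrK /g distrC ger0_norm ?subr_ge0//; field; exact: lt0r_neq0.
  have -> : segint a b g = F b - F a.
    apply: segint_FTC => //.
    - by move=> s /andP[_ h]; apply: is_der_continuous; exact: dF.
    - by move=> s /andP[_ h]; apply: dF; exact: ltW.
  apply: (@le_trans _ _ (- F a)); first by rewrite gerDr oppr_le0 P0.
  have := PB a; rewrite /F opprK distrC ger0_norm ?subr_ge0 ?(le_trans ab)//; apply.
  by rewrite s0a.
have [h|h] := leP s' s0.
  apply: le_trans (up s0 s1 (lexx _) s01 (lexx _) h) _.
  by rewrite ler_peMl// ler1n.
have [h'|h'] := leP s1 s'.
  apply: le_trans (down s0 s1 (lexx _) s01 (lexx _) h') _.
  by rewrite ler_peMl// ler1n.
rewrite (@segint_split _ s0 s' s1) ?(ltW h) ?(ltW h')// mulrDl mul1r.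
by apply: lerD; [apply: down|apply: up]; rewrite // ltW.
Qed.

Lemma powR_conj_le (l a b : R) : 0 <= l <= 1 -> 0 <= a -> 0 <= b ->
  powR a (1 - l) * powR b l <= a + b.
Proof.
move=> /andP[l0 l1] a0 b0.
pose M := Num.max a b; have aM : a <= M by rewrite le_max lexx.
have bM : b <= M by rewrite le_max lexx orbT.
have M0 : 0 <= M := le_trans a0 aM.
apply: (@le_trans _ _ (powR M (1 - l) * powR M l)).
  apply: ler_pM; rewrite ?powR_ge0//; apply: ge0_ler_powR; rewrite ?nnegrE ?subr_ge0//.
rewrite -powRD; last by rewrite subrK oner_eq0.
rewrite subrK powRr1// ge_max; apply/andP; split; first by rewrite lerDl.
by rewrite lerDr.
Qed.

Lemma powR_sum_le (l a b : R) : 0 <= l -> 0 <= a -> 0 <= b ->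
  powR (a + b) l <= powR 2 l * (powR a l + powR b l).
Proof.
move=> l0 a0 b0.
wlog ab : a b a0 b0 / a <= b.
  move=> H; have [/H->//|/ltW/H] := leP a b.
  by rewrite addrC [X in _ * X]addrC; apply.
apply: (@le_trans _ _ (powR (2 * b) l)).
  apply: ge0_ler_powR; rewrite ?nnegrE ?addr_ge0 ?mulr_ge0//.
  by rewrite mulrDl mul1r lerD2r.
by rewrite powRM// ler_pM2l ?powR_gt0// lerDr powR_ge0.
Qed.

(** The smaller of the two bases alone accounts for the product. This separates two singularities in
    time located at different instants. *)
Lemma powR_mul_le (x y a b : R) : 0 < x -> 0 < y -> 0 <= a -> 0 <= b ->
  powR x (- a) * powR y (- b) <= powR x (- (a + b)) + powR y (- (a + b)).
Proof.
move=> x0 y0 a0 b0; have mono z w c : 0 < z -> z <= w -> 0 <= c -> powR w (- c) <= powR z (- c).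
  move=> z0 zw c0; rewrite !powRN lef_pV2 ?posrE ?powR_gt0//; last exact: lt_le_trans zw.
  by apply: ge0_ler_powR; rewrite ?nnegrE ?(ltW z0)// (le_trans (ltW z0)).
have pD z : 0 < z -> powR z (- (a + b)) = powR z (- a) * powR z (- b).
  by move=> z0; rewrite opprD powRD// (gt_eqF z0) implybT.
have [xy|/ltW yx] := leP x y.
  apply: ler_wpDr; first exact: powR_ge0.
  by rewrite pD// ler_pM2l ?powR_gt0//; exact: mono.
apply: ler_wpDl; first exact: powR_ge0.
by rewrite pD// ler_pM2r ?powR_gt0//; exact: mono.
Qed.

(** The convex function [g^l] lies above its tangent at [b]. Being affine in [g], the left side can
    be integrated against any positive functional, which is how Jensen's inequality is obtained. *)
Lemma powR_tangent (l b g : R) : 1 <= l -> 0 <= b -> 0 <= g ->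
  l * powR b (l - 1) * g - (l - 1) * powR b l <= powR g l.
Proof.
move=> l1 b0 g0.
have l0 : 0 < l by exact: lt_le_trans l1.
move: l1; rewrite le_eqVlt => /predU1P[<-|l1].
  by rewrite subrr powRr0 !powRr1// !mul1r mul0r subr0.
have l10 : 0 < l - 1 by rewrite subr_gt0.
(* Young's inequality for the conjugate exponents [l] and [l / (l - 1)] *)
have c1 : 0 < l / (l - 1) by rewrite divr_gt0.
have pq : l^-1 + (l / (l - 1))^-1 = 1 by field; rewrite !gt_eqF.
have := @conjugate_powR R g (powR b (l - 1)) l (l / (l - 1)) g0 (powR_ge0 _ _) l0 c1 pq.
rewrite -powRrM.
have -> : (l - 1) * (l / (l - 1)) = l by field; rewrite !gt_eqF.
rewrite -(ler_pM2l l0).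
have -> : l * (powR g l / l + powR b l / (l / (l - 1))) = powR g l + (l - 1) * powR b l.
  by field; rewrite !gt_eqF.
by rewrite lerBlDr => h; apply: le_trans h; rewrite -mulrA (mulrC (powR b _)).
Qed.

End power_functions.

(** * Powers of the heat kernel *)

Section kernel_power.
Context {R : realType}.
Variables (n : nat) (alpha : R).
Hypotheses (n0 : (0 < n)%N) (a0 : 0 < alpha).

(** The Gaussian factor of the kernel to the power [alpha / n] is
    [exp (- |z|^2 / (gauss_rate * s))]. *)
Definition gauss_rate : R := 4 * n%:R / alpha.

Lemma gauss_rate_gt0 : 0 < gauss_rate.
Proof. by rewrite divr_gt0// mulr_gt0// ltr0n. Qed.

Lemma heat_kernel_powR (z : 'rV[R]_n) (s : R) : 0 < s ->
  powR (heat_kernel z s) (alpha / n%:R) =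
  powR (4 * pi) (- (alpha / 2)) * powR s (- (alpha / 2)) * expR (- (sqnorm z / (gauss_rate * s))).
Proof.
move=> s0; have nn : n%:R != 0 :> R by rewrite pnatr_eq0 -lt0n.
have p0 : 0 <= 4 * pi :> R by rewrite mulr_ge0// pi_ge0.
rewrite /heat_kernel s0 powRM ?powR_ge0 ?expR_ge0// -powRrM powR_expR.
have -> : - (n%:R / 2) * (alpha / n%:R) = - (alpha / 2) by field.
rewrite powRM// ?(ltW s0)//; congr (_ * expR _).
rewrite /gauss_rate; field; rewrite nn !gt_eqF//.
Qed.

Lemma heat_kernel_powR0 (z : 'rV[R]_n) (s : R) : s <= 0 ->
  powR (heat_kernel z s) (alpha / n%:R) = 0.
Proof.
by move=> s0; rewrite /heat_kernel ltNge s0/= powR0// gt_eqF// divr_gt0// ltr0n.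
Qed.

Lemma continuous_sqnorm_sub (x : 'rV[R]_n) :
  continuous (fun p : 'rV[R]_n * R => sqnorm (x - p.1)).
Proof.
apply: cont_bigsum => i; apply: continuousXR.
have -> : (fun p : 'rV[R]_n * R => (x - p.1) 0 i) = (fun p => x 0 i - p.1 0 i).
  by apply/funext => p; rewrite !mxE.
apply: continuousBR; first exact: cont_cst.
apply: (@cont_comp _ _ _ (fun p : 'rV[R]_n * R => p.1) (fun y : 'rV[R]_n => y 0 i)).
  by apply: cont_fst; exact: cont_id.
exact: continuous_coord.
Qed.

Lemma for_cont_lagp (t : R) (p : 'rV[R]_n * R) :
  {for p, continuous (fun p : 'rV[R]_n * R => t - p.2)}.
Proof.
suff h : continuous (fun p : 'rV[R]_n * R => t - p.2) by exact: h.
by apply: continuousBR; [exact: cont_cst|apply: cont_snd; exact: cont_id].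
Qed.

Lemma for_cont_gauss (x : 'rV[R]_n) (t b : R) (p : 'rV[R]_n * R) : 0 < b -> p.2 < t ->
  {for p, continuous (fun p : 'rV[R]_n * R => expR (- (sqnorm (x - p.1) / (b * (t - p.2)))))}.
Proof.
move=> b0 pt; apply: (@for_cont_comp _ _ expR); last exact: continuous_expR.
apply: for_contN; apply: for_contM; first exact: continuous_sqnorm_sub.
apply: (@for_cont_comp _ _ (fun x : R => x^-1) (fun p : 'rV[R]_n * R => b * (t - p.2))).
  by apply: for_contM; [exact: for_cont_cst|exact: for_cont_lagp].
by apply: inv_continuous; rewrite mulf_neq0 ?gt_eqF// subr_gt0.
Qed.

Lemma for_cont_kernel (x : 'rV[R]_n) (t : R) (p : 'rV[R]_n * R) : p.2 < t ->
  {for p, continuous (fun p : 'rV[R]_n * R =>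
    powR (4 * pi) (- (alpha / 2)) * powR (t - p.2) (- (alpha / 2)) *
    expR (- (sqnorm (x - p.1) / (gauss_rate * (t - p.2)))))}.
Proof.
move=> pt; apply: for_contM; last by apply: for_cont_gauss => //; exact: gauss_rate_gt0.
apply: for_contM; first exact: for_cont_cst.
apply: (@for_cont_powR_pos _ _ (fun p : 'rV[R]_n * R => t - p.2)); first exact: for_cont_lagp.
by rewrite subr_gt0.
Qed.

Lemma for_cont_heat_kernel_powR (x : 'rV[R]_n) (t : R) (p : 'rV[R]_n * R) : p.2 < t ->
  {for p, continuous (fun p : 'rV[R]_n * R =>
    powR (heat_kernel (x - p.1) (t - p.2)) (alpha / n%:R))}.
Proof.
move=> pt; have := @for_cont_kernel x t p pt; rewrite /prop_for /=.
rewrite /continuous_at heat_kernel_powR ?subr_gt0//; apply: cvg_trans.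
apply: near_eq_cvg.
have /cvgrPdist_lt/(_ (t - p.2)) := @for_cont_lagp t p; rewrite subr_gt0 => /(_ pt) h.
near=> q; rewrite heat_kernel_powR//.
have : `|t - p.2 - (t - q.2)| < t - p.2 by near: q.
by rewrite ltr_distl; move: (t - p.2) (t - q.2) => a b; lra.
Unshelve. all: by end_near. Qed.

Lemma sqnorm_subE (x y : 'rV[R]_n) : sqnorm (x - y) = \sum_(i < n) (y 0 i - x 0 i) ^+ 2.
Proof. by apply: eq_bigr => i _; rewrite !mxE -sqrrN opprB. Qed.

End kernel_power.

(** * The nonlocal term near the observation point, for [lambda < 1] *)

Section near_subcritical.
Context {R : realType}.
Variables (n : nat) (alpha lambda T : R) (u : 'rV[R]_n * R -> R).
Hypotheses (n0 : (0 < n)%N) (a0 : 0 < alpha) (l0 : 0 < lambda).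
Hypothesis cu : forall p, 0 < p.2 < T -> {for p, continuous u}.
Hypothesis u0 : forall x t, 0 < t < T -> 0 <= u (x, t).

Lemma for_cont_upow p : 0 < p.2 < T -> {for p, continuous (fun p => powR (u p) lambda)}.
Proof.
move=> Ip; apply: for_cont_powR => //; first exact: cu.
have c2 : {for p, continuous (fun p : 'rV[R]_n * R => p.2)}.
  by apply: cont_snd; exact: cont_id.
have /andP[p0 pT] := Ip.
near=> q.
have h1 : 0 < q.2 by near: q; exact: (cvgr_gt _ c2).
have h2 : q.2 < T by near: q; exact: (cvgr_lt _ c2).
by have := u0 q.1 (introT andP (conj h1 h2)); rewrite -surjective_pairing.
Unshelve. all: by end_near. Qed.

Variables (c : nat -> R) (r t1 m : R).
Hypotheses (r0 : 0 <= r) (t1T : t1 < T) (m0 : 0 <= m).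
Hypothesis um : forall t0, 0 < t0 -> t0 <= t1 -> boxint c r (fun y => u (y, t0)) <= m.
Hypothesis l1 : lambda < 1.
Let e : R := (n%:R - alpha - n%:R * lambda) / 2.
Hypothesis e1 : -1 < e.

Let ka : R := powR (4 * pi) (- (alpha / 2)).
Let b : R := gauss_rate n alpha * (1 - lambda).
Let Kc : R := ka * ((pi * Num.sqrt b) ^+ n + m).

(** The kernel is [ka tau^e (be E)^(1 - lambda)] with [be E] a Gaussian of bounded mass, so its
    product with [u^lambda] is at most [ka tau^e (be E + u)] by [powR_conj_le]; the mass of [u] is
    bounded as well. *)
Lemma near_slice_lt1 (x : 'rV[R]_n) (s t : R) : 0 < s -> s < t -> t <= t1 ->
  boxint c r (fun y => powR (heat_kernel (x - y) (t - s)) (alpha / n%:R) * powR (u (y, s)) lambda)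
    <= Kc * powR (t - s) e.
Proof.
move=> s0 st tt1; set tau := t - s.
have tau0 : 0 < tau by rewrite subr_gt0.
have IsT : 0 < s < T by rewrite s0 (lt_trans st)// (le_lt_trans tt1).
have l10 : 0 < 1 - lambda by rewrite subr_gt0.
have b0 : 0 < b by rewrite mulr_gt0// gauss_rate_gt0.
pose be := powR tau (- (n%:R / 2)).
have be0 : 0 <= be by exact: powR_ge0.
pose E (y : 'rV[R]_n) := expR (- (sqnorm (x - y) / (b * tau))).
have cE : continuous E.
  by apply: (@cont_slice _ _ _ (fun p : 'rV[R]_n * R => expR (- (sqnorm (x - p.1) / (b * (t - p.2)))))) => y;
    exact: for_cont_gauss.
have cus : continuous (fun y => u (y, s)) by apply: cont_slice => y; exact: cu.
have pt y : powR (heat_kernel (x - y) tau) (alpha / n%:R) * powR (u (y, s)) lambda <=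
    ka * powR tau e * (be * E y + u (y, s)).
  rewrite heat_kernel_powR// -/ka.
  have -> : expR (- (sqnorm (x - y) / (gauss_rate n alpha * tau))) = powR (E y) (1 - lambda).
    rewrite powR_expR; congr expR; rewrite /b; field.
    by rewrite !gt_eqF// gauss_rate_gt0.
  have -> : powR tau (- (alpha / 2)) = powR tau e * powR be (1 - lambda).
    rewrite /be -powRrM -powRD; last by rewrite (gt_eqF tau0) implybT.
    by congr powR; rewrite /e; field.
  rewrite -!mulrA ler_wpM2l ?powR_ge0// ler_wpM2l ?powR_ge0// mulrA -powRM ?expR_ge0//.
  by apply: powR_conj_le; rewrite ?(ltW l0) ?(ltW l1) ?mulr_ge0 ?expR_ge0// u0.
apply: (@le_trans _ _ (boxint c r (fun y => ka * powR tau e * (be * E y + u (y, s))))).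
  apply: le_boxint.
  - apply: (@cont_slice _ _ _ (fun p : 'rV[R]_n * R =>
      powR (heat_kernel (x - p.1) (t - p.2)) (alpha / n%:R) * powR (u p) lambda)) => y.
    by apply: for_contM; [exact: for_cont_heat_kernel_powR|exact: for_cont_upow].
  - apply: continuousMR; first exact: cont_cst.
    by apply: continuousDR => //; apply: continuousMR => //; exact: cont_cst.
  - by move=> y _; exact: pt.
have cbE : continuous (fun y => be * E y) by apply: continuousMR => //; exact: cont_cst.
rewrite boxintZ; last exact: continuousDR.
rewrite boxintD// boxintZ// /Kc mulrAC ler_wpM2r ?powR_ge0// ler_wpM2l ?powR_ge0//.
apply: lerD; last by apply: um => //; rewrite (le_trans (ltW st)).
have -> : be = Num.sqrt tau ^- n.
  rewrite /be powRN -powR12_sqrt ?(ltW tau0)// -powR_mulrn ?powR_ge0// -powRrM.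
  by rewrite (mulrC n%:R).
have h := @boxint_gauss R n x c r (b * tau) (mulr_gt0 b0 tau0) r0.
have -> : boxint c r E = boxint c r (fun z => expR (- ((\sum_(i < n) (z 0 i - x 0 i) ^+ 2) / (b * tau)))).
  by apply: eq_boxint => y _; rewrite /E sqnorm_subE.
have st0 : 0 < Num.sqrt tau ^+ n by rewrite exprn_gt0// sqrtr_gt0.
rewrite mulrC ler_pdivrMr//; apply: le_trans h _.
by rewrite sqrtrM ?(ltW b0)// mulrA exprMn.
Qed.

Lemma near_bound_lt1 : exists N, forall (x : 'rV[R]_n) s0 s1 t, 0 < s0 -> s0 <= s1 -> s1 < t -> t <= t1 ->
  segint s0 s1 (fun s => boxint c r (fun y =>
    powR (heat_kernel (x - y) (t - clampr s0 s1 s)) (alpha / n%:R) *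
    powR (u (y, clampr s0 s1 s)) lambda)) <= N.
Proof.
exists (Kc * (powR t1 (e + 1) / (e + 1))) => x s0 s1 t s00 s01 s1t tt1.
have e10 : 0 < e + 1 by rewrite -ltrBlDr sub0r.
have Kc0 : 0 <= Kc.
  by rewrite mulr_ge0 ?powR_ge0// addr_ge0// exprn_ge0// mulr_ge0 ?sqrtr_ge0 ?pi_ge0.
have t0 : 0 < t by rewrite (lt_trans _ s1t)// (lt_le_trans s00).
have clp s : 0 < clampr s0 s1 s /\ clampr s0 s1 s < t.
  by have /andP[h1 h2] := clampr_in s s01; split; [exact: lt_le_trans h1|exact: le_lt_trans s1t].
apply: (@le_trans _ _ (Kc * (powR t (e + 1) / (e + 1)))); last first.
  rewrite ler_wpM2l// ler_pM2r ?invr_gt0//.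
  by apply: ge0_ler_powR; rewrite ?nnegrE ?(ltW e10) ?(ltW t0) ?(le_trans (ltW t0) tt1).
have clg : continuous (fun s => powR (t - clampr s0 s1 s) e).
  move=> s; apply: (@for_cont_powR_pos _ _ (fun s : R => t - clampr s0 s1 s)).
    by apply: continuousBR; [exact: cont_cst|exact: continuous_clampr].
  by rewrite subr_gt0; case: (clp s).
apply: (le_trans _ (ler_wpM2l Kc0 (segint_powR_lag e1 s00 s01 s1t))).
rewrite -segintZ//; apply: le_segint.
- pose F (p : 'rV[R]_n * R) := powR (heat_kernel (x - p.1) (t - p.2)) (alpha / n%:R) * powR (u p) lambda.
  apply: (boxint_time_continuous c r (@cont_clamp _ _ s0 s1 F s01 _)) => p /andP[h1 h2].
  apply: for_contM; first by apply: for_cont_heat_kernel_powR => //; exact: le_lt_trans s1t.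
  apply: for_cont_upow; rewrite (lt_le_trans s00 h1)/= (le_lt_trans h2)// (lt_trans s1t)//.
  exact: le_lt_trans t1T.
- by apply: continuousMR => //; exact: cont_cst.
- move=> s _; have [h1 h2] := clp s; exact: near_slice_lt1.
Qed.

End near_subcritical.

(** * The positive functional behind Duhamel's formula, and Jensen's inequality for it *)

Section positive_functional.
Context {R : realType}.
Variables (n : nat) (c : nat -> R) (r s0 s1 m : R) (U : 'rV[R]_n -> R) (H : 'rV[R]_n * R -> R).
Hypotheses (r0 : 0 <= r) (s01 : s0 <= s1) (cU : continuous U) (cH : continuous H).
Hypotheses (U0 : forall z, inbox c r z -> 0 <= U z)
  (H0 : forall z s, inbox c r z -> s0 <= s <= s1 -> 0 <= H (z, s)).
Hypotheses (Um : boxint c r U <= m)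
  (Hm : segint s0 s1 (fun s => boxint c r (fun z => H (z, s))) <= m).

(** Integration against the measure formed by the initial slice [U] at time [s0] and the source [H]
    on [[s0, s1]]. Evaluated on a Gaussian it is the right side of Duhamel's formula; its total mass
    is at most [2 m]. *)
Definition srcint (phi : 'rV[R]_n * R -> R) := boxint c r (fun z => U z * phi (z, s0)) +
  segint s0 s1 (fun s => boxint c r (fun z => H (z, s) * phi (z, s))).

Let ct (phi : 'rV[R]_n * R -> R) : continuous phi -> continuous (fun z => U z * phi (z, s0)).
Proof.
by move=> cp; apply: continuousMR => //; apply: (cont_comp _ cp); cont_proj.
Qed.

Let cs (phi : 'rV[R]_n * R -> R) : continuous phi ->
  continuous (fun s => boxint c r (fun z => H (z, s) * phi (z, s))).
Proof.
move=> cp; apply: (@boxint_time_continuous _ _ c r (fun q => H q * phi q)).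
exact: continuousMR.
Qed.

Let ci (phi : 'rV[R]_n * R -> R) s : continuous phi -> continuous (fun z => H (z, s) * phi (z, s)).
Proof.
move=> cp; apply: (@continuousMR _ _ (fun z => H (z, s)) (fun z => phi (z, s))).
  by apply: (cont_comp _ cH); cont_proj.
by apply: (cont_comp _ cp); cont_proj.
Qed.

Lemma le_srcint (f g : 'rV[R]_n * R -> R) : continuous f -> continuous g ->
  (forall z s, inbox c r z -> s0 <= s <= s1 -> f (z, s) <= g (z, s)) -> srcint f <= srcint g.
Proof.
move=> cf cg fg; apply: lerD.
  apply: le_boxint; [exact: ct|exact: ct|move=> z zr; apply: ler_wpM2l; first exact: U0].
  by apply: fg => //; rewrite lexx.
apply: le_segint; [exact: cs|exact: cs|move=> s Is].
apply: le_boxint; [exact: ci|exact: ci|move=> z zr; apply: ler_wpM2l; first exact: H0].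
exact: fg.
Qed.

Lemma srcint_lin (A B : R) (f g : 'rV[R]_n * R -> R) : continuous f -> continuous g ->
  srcint (fun q => A * f q + B * g q) = A * srcint f + B * srcint g.
Proof.
move=> cf cg; rewrite /srcint.
have -> : boxint c r (fun z => U z * (A * f (z, s0) + B * g (z, s0))) =
    A * boxint c r (fun z => U z * f (z, s0)) + B * boxint c r (fun z => U z * g (z, s0)).
  rewrite -!boxintZ; [|exact: ct|exact: ct].
  rewrite -boxintD; first by apply: eq_boxint => z _; ring.
    by apply: continuousMR; [exact: cont_cst|exact: ct].
  by apply: continuousMR; [exact: cont_cst|exact: ct].
have -> : segint s0 s1 (fun s => boxint c r (fun z => H (z, s) * (A * f (z, s) + B * g (z, s)))) =
    A * segint s0 s1 (fun s => boxint c r (fun z => H (z, s) * f (z, s))) +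
    B * segint s0 s1 (fun s => boxint c r (fun z => H (z, s) * g (z, s))).
  rewrite -!segintZ; [|exact: cs|exact: cs].
  rewrite -segintD.
    apply: eq_segint => s _; rewrite -!boxintZ; [|exact: ci|exact: ci].
    rewrite -boxintD; first by apply: eq_boxint => z _; ring.
      by apply: continuousMR; [exact: cont_cst|exact: ci].
    by apply: continuousMR; [exact: cont_cst|exact: ci].
  by apply: continuousMR; [exact: cont_cst|exact: cs].
  by apply: continuousMR; [exact: cont_cst|exact: cs].
ring.
Qed.

Lemma srcintZ (A : R) (f : 'rV[R]_n * R -> R) : continuous f ->
  srcint (fun q => A * f q) = A * srcint f.
Proof.
move=> cf; apply: (@etrans _ _ (srcint (fun q => A * f q + 0 * f q))).
  by congr srcint; apply/funext => q; rewrite mul0r addr0.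
by apply: etrans (srcint_lin A 0 cf cf) _; rewrite mul0r addr0.
Qed.

Lemma srcint_cst k : 0 <= k -> srcint (fun=> k) <= k * (2 * m).
Proof.
move=> k0; have c1 : continuous (fun _ : 'rV[R]_n * R => 1 : R) by exact: cont_cst.
have -> : srcint (fun=> k) = k * srcint (fun=> 1).
  by rewrite -(srcintZ k c1); congr srcint; apply/funext => q; rewrite mulr1.
rewrite ler_wpM2l// mulrDl mul1r; apply: lerD.
  by apply: le_trans Um; under eq_boxint do rewrite mulr1.
apply: le_trans Hm; rewrite le_eqVlt; apply/orP; left; apply/eqP.
by apply: eq_segint => s _; apply: eq_boxint => z _; rewrite mulr1.
Qed.

Lemma srcint_continuous (P : topologicalType) (Phi : P * ('rV[R]_n * R) -> R) :
  continuous Phi -> continuous (fun p => srcint (fun q => Phi (p, q))).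
Proof.
move=> cP; apply: continuousDR.
  apply: (@boxint_continuous _ _ _ c r (fun w : P * 'rV[R]_n => U w.2 * Phi (w.1, (w.2, s0)))).
  apply: continuousMR; first by apply: (cont_comp _ cU); cont_proj.
  by apply: (cont_comp _ cP); cont_proj.
apply: (@segint_continuous _ _ (fun w : P * R => boxint c r (fun z => H (z, w.2) * Phi (w.1, (z, w.2))))).
apply: (@boxint_continuous _ _ _ c r (fun w : (P * R) * 'rV[R]_n =>
  H (w.2, w.1.2) * Phi (w.1.1, (w.2, w.1.2)))).
apply: continuousMR; first by apply: (cont_comp _ cH); cont_proj.
by apply: (cont_comp _ cP); cont_proj.
Qed.

Lemma boxint_srcint (c' : nat -> R) (L : R) (Phi : 'rV[R]_n * ('rV[R]_n * R) -> R) : 0 <= L ->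
  continuous Phi ->
  boxint c' L (fun y => srcint (fun q => Phi (y, q))) = srcint (fun q => boxint c' L (fun y => Phi (y, q))).
Proof.
move=> L0 cP.
have c1 : continuous (fun w : 'rV[R]_n * 'rV[R]_n => U w.2 * Phi (w.1, (w.2, s0))).
  apply: continuousMR; first by apply: (cont_comp _ cU); cont_proj.
  by apply: (cont_comp _ cP); cont_proj.
have c2 : continuous (fun w : (R * 'rV[R]_n) * 'rV[R]_n =>
  H (w.2, w.1.1) * Phi (w.1.2, (w.2, w.1.1))).
  apply: continuousMR; first by apply: (cont_comp _ cH); cont_proj.
  by apply: (cont_comp _ cP); cont_proj.
have c3 := @boxint_continuous R _ _ c r _ c2.
have cy q : continuous (fun y => Phi (y, q)) by apply: (cont_comp _ cP); cont_proj.
rewrite /srcint boxintD; first congr (_ + _).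
- rewrite (boxint_Fubini c' c c1 L0 r0); apply: eq_boxint => z _ /=.
  by rewrite -boxintZ.
- rewrite (boxint_segint_Fubini c' c3 L0 s01); apply: eq_segint => s _ /=.
  rewrite (@boxint_Fubini _ _ _ c' L c r (fun w => H (w.2, s) * Phi (w.1, (w.2, s))))//.
    by apply: eq_boxint => z _ /=; rewrite -boxintZ.
  apply: continuousMR; first by apply: (cont_comp _ cH); cont_proj.
  by apply: (cont_comp _ cP); cont_proj.
- exact: (@boxint_continuous R _ _ c r _ c1).
- apply: (@segint_continuous _ _ (fun w : 'rV[R]_n * R => boxint c r (fun z => H (z, w.2) * Phi (w.1, (z, w.2))))).
  refine (@cont_comp _ _ _ (fun w : 'rV[R]_n * R => (w.2, w.1)) _ _ c3); cont_proj.
Qed.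

Lemma segint_srcint (Phi : R * ('rV[R]_n * R) -> R) : continuous Phi ->
  segint s0 s1 (fun s => srcint (fun q => Phi (s, q))) = srcint (fun q => segint s0 s1 (fun s => Phi (s, q))).
Proof.
move=> cP.
have c1 : continuous (fun w : R * 'rV[R]_n => U w.2 * Phi (w.1, (w.2, s0))).
  apply: continuousMR; first by apply: (cont_comp _ cU); cont_proj.
  by apply: (cont_comp _ cP); cont_proj.
have c2 : continuous (fun w : (R * R) * 'rV[R]_n =>
  H (w.2, w.1.2) * Phi (w.1.1, (w.2, w.1.2))).
  apply: continuousMR; first by apply: (cont_comp _ cH); cont_proj.
  by apply: (cont_comp _ cP); cont_proj.
have c3 := @boxint_continuous R _ _ c r _ c2.
have cy q : continuous (fun y => Phi (y, q)) by apply: (cont_comp _ cP); cont_proj.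
rewrite /srcint segintD; first congr (_ + _).
- rewrite -(boxint_segint_Fubini c c1 r0 s01); apply: eq_boxint => z _ /=.
  by rewrite -segintZ.
- rewrite (segint_Fubini c3 s01 s01); apply: eq_segint => s _ /=.
  rewrite -(@boxint_segint_Fubini _ _ c r s0 s1 (fun w => H (w.2, s) * Phi (w.1, (w.2, s))))//.
    by apply: eq_boxint => z _ /=; rewrite -segintZ.
  apply: continuousMR; first by apply: (cont_comp _ cH); cont_proj.
  by apply: (cont_comp _ cP); cont_proj.
- exact: (@boxint_continuous R _ _ c r _ c1).
- exact: (@segint_continuous R _ _ s0 s1 c3).
Qed.

Lemma srcint_ge0 (f : 'rV[R]_n * R -> R) : continuous f ->
  (forall z s, inbox c r z -> s0 <= s <= s1 -> 0 <= f (z, s)) -> 0 <= srcint f.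
Proof.
move=> cf f0; apply: addr_ge0.
  by apply: boxint_ge0 => z zr; rewrite mulr_ge0 ?U0// f0// lexx.
by apply: segint_ge0 => s Is; apply: boxint_ge0 => z zr; rewrite mulr_ge0 ?H0 ?f0.
Qed.

(** Integrates the tangent inequality at the mean [b = srcint f / M]. Since the coefficient of
    [srcint 1] is nonpositive, an upper bound [M] of the total mass can stand for the mass
    itself. *)
Lemma srcint_jensen (l M : R) (f : 'rV[R]_n * R -> R) : continuous f ->
  (forall q, 0 < f q) -> 1 <= l -> 0 < M -> 2 * m <= M ->
  powR (srcint f) l <= powR M (l - 1) * srcint (fun q => powR (f q) l).
Proof.
move=> cf f0 l1 M0 mM.
have l0 : 0 < l by exact: lt_le_trans l1.
have c1 : continuous (fun _ : 'rV[R]_n * R => 1 : R) by exact: cont_cst.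
have cp : continuous (fun q => powR (f q) l).
  by move=> q; apply: (@for_cont_powR_pos _ _ f); [exact: cf|exact: f0].
have I0 : 0 <= srcint f by apply: srcint_ge0 => // z s _ _; exact: ltW.
pose b := srcint f / M.
have b0 : 0 <= b by rewrite divr_ge0// ltW.
have bM : srcint f = M * b by rewrite /b mulrCA divff ?mulr1// gt_eqF.
have h : l * powR b (l - 1) * srcint f + - ((l - 1) * powR b l) * srcint (fun=> 1)
    <= srcint (fun q => powR (f q) l).
  rewrite -srcint_lin//; apply: le_srcint => //.
    by apply: continuousDR; (apply: continuousMR; first exact: cont_cst).
  by move=> z s _ _; rewrite mulr1; apply: powR_tangent => //; exact: ltW.
have L1 : srcint (fun=> 1) <= M by apply: le_trans (srcint_cst ler01) _; rewrite mul1r.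
have e1 : powR b (l - 1) * srcint f = M * powR b l.
  by rewrite bM mulrCA -(mulr_powRB1 b0 l0) (mulrC b).
have pb : 0 <= (l - 1) * powR b l by rewrite mulr_ge0 ?subr_ge0// powR_ge0.
have h2 : M * powR b l <= srcint (fun q => powR (f q) l).
  apply: le_trans h; rewrite -mulrA e1 mulNr lerBrDr.
  apply: le_trans (lerD (lexx _) (ler_wpM2l pb L1)) _.
  by move: (powR b l) => X; rewrite le_eqVlt; apply/orP; left; apply/eqP; ring.
apply: le_trans (ler_wpM2l (powR_ge0 _ _) h2).
by rewrite bM powRM ?(ltW M0)// mulrA -(mulr_powRB1 (ltW M0) l0) (mulrC M).
Qed.

End positive_functional.

Section potential.
Context {R : realType}.

Lemma cont_Gam (P : topologicalType) n (y z : P -> 'rV[R]_n) (a : P -> R) :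
  continuous y -> continuous z -> continuous a -> (forall p, 0 < a p) ->
  continuous (fun p => Gam (y p) (z p) (a p)).
Proof.
move=> cy cz ca a0; apply: cont_bigprod => i p.
have h := @for_cont_gam R 0 (z p 0 i - y p 0 i) (- a p).
have e : (fun p => gam (z p 0 i - y p 0 i) (a p)) =
    (fun p => gam (z p 0 i - y p 0 i, - a p).1 (0 - (z p 0 i - y p 0 i, - a p).2)).
  by apply/funext => q /=; rewrite sub0r opprK.
rewrite e; apply: (@continuous_comp _ _ _ (fun p => (z p 0 i - y p 0 i, - a p))
  (fun q : R * R => gam q.1 (0 - q.2))); last by apply: h; rewrite oppr_lt0.
apply: (@cont_pair _ _ _ (fun p => z p 0 i - y p 0 i) (fun p => - a p)).
  apply: continuousBR; first exact: (cont_comp cz (@continuous_coord R n i)).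
  exact: (cont_comp cy (@continuous_coord R n i)).
have -> : (fun p => - a p) = (fun p => 0 - a p) by apply/funext => q; rewrite sub0r.
by apply: continuousBR => //; exact: cont_cst.
Qed.

Lemma Gam_gt0 n (x z : 'rV[R]_n) a : 0 < Gam x z a.
Proof. by apply: prodr_gt0 => i _; exact: gam_gt0. Qed.

Lemma cont_powR_pos (P : topologicalType) (f : P -> R) l : continuous f ->
  (forall p, 0 < f p) -> continuous (fun p => powR (f p) l).
Proof. by move=> cf f0 p; apply: (@for_cont_powR_pos _ _ f); [exact: cf|exact: f0]. Qed.

Lemma cont_powR_ge0 (P : topologicalType) (f : P -> R) l : continuous f -> 0 < l ->
  (forall p, 0 <= f p) -> continuous (fun p => powR (f p) l).
Proof.
move=> cf l0 f0 p; apply: (@for_cont_powR _ _ f) => //; first exact: cf.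
by apply: nearW => q; exact: f0.
Qed.

(** The power [l] of the Gaussian is [a^(- n l / 2)] times a Gaussian of variance proportional to
    [a / l], whose mass is of order [a^(n / 2)] because [l >= 1]. *)
Lemma boxint_Gam_powR n (z : 'rV[R]_n) (c : nat -> R) (L a l : R) : 0 < a -> 0 <= L -> 1 <= l ->
  boxint c L (fun y => powR (Gam y z a) l) <= (2 * pi) ^+ n * powR a (- (n%:R * (l - 1) / 2)).
Proof.
move=> a0 L0 l1; have l0 : 0 < l by exact: lt_le_trans l1.
have sa : 0 < Num.sqrt a ^+ n by rewrite exprn_gt0// sqrtr_gt0.
have sE : Num.sqrt a ^+ n = powR a (n%:R / 2).
  by rewrite -powR12_sqrt ?(ltW a0)// -powR_mulrn ?powR_ge0// -powRrM mulrC.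
have h := @boxint_gauss R n z c L (4 * a / l) (divr_gt0 (mulr_gt0 (ltr0n _ 4) a0) l0) L0.
pose E (y : 'rV[R]_n) := expR (- ((\sum_(i < n) (y 0 i - z 0 i) ^+ 2) / (4 * a / l))).
have e y : powR (Gam y z a) l = powR a (- (n%:R * l / 2)) * E y.
  rewrite GamE// powRM ?expR_ge0// ?invr_ge0 ?(ltW sa)// powR_expR sE -powRN -powRrM.
  congr (powR _ _ * expR _); first by field.
  have -> : \sum_(i < n) (z 0 i - y 0 i) ^+ 2 = \sum_(i < n) (y 0 i - z 0 i) ^+ 2.
    by apply: eq_bigr => i _; rewrite -sqrrN opprB.
  by field; rewrite !gt_eqF.
have cE : continuous E.
  have := @cont_powR_pos _ (fun y => Gam y z a) l
    (cont_Gam (@cont_id _) (@cont_cst _ _ z) (@cont_cst _ _ a) (fun=> a0)) (fun y => Gam_gt0 y z a).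
  have pa : powR a (- (n%:R * l / 2)) != 0 by rewrite gt_eqF// powR_gt0.
  move=> k; have -> : E = (fun y => (powR a (- (n%:R * l / 2)))^-1 * powR (Gam y z a) l).
    by apply/funext => y; rewrite e mulKf.
  by apply: continuousMR => //; exact: cont_cst.
under eq_boxint do rewrite e.
rewrite boxintZ//; apply: le_trans (ler_wpM2l (powR_ge0 _ _) h) _.
have -> : powR a (- (n%:R * (l - 1) / 2)) = powR a (- (n%:R * l / 2)) * Num.sqrt a ^+ n.
  rewrite sE -powRD; last by rewrite (gt_eqF a0) implybT.
  by congr powR; field.
rewrite mulrCA ler_wpM2l ?powR_ge0// -exprMn; apply: lerXn2r; rewrite ?nnegrE ?mulr_ge0 ?sqrtr_ge0 ?pi_ge0//.
rewrite (_ : 2 * pi * _ = pi * (2 * Num.sqrt a)); last by ring.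
rewrite ler_wpM2l ?pi_ge0//.
have -> : 2 * Num.sqrt a = Num.sqrt (4 * a).
  have -> : (4 : R) = 2 ^+ 2 by rewrite -natrX.
  by rewrite sqrtrM ?sqr_ge0// sqrtr_sqr ger0_norm.
by rewrite ler_wsqrtr// ler_pdivrMr// ler_peMr// mulr_ge0// ltW.
Qed.

Variables (n : nat) (c : nat -> R) (r s0 s1 m : R) (U : 'rV[R]_n -> R) (H : 'rV[R]_n * R -> R).
Hypotheses (r0 : 0 <= r) (s00 : 0 < s0) (s01 : s0 <= s1) (cU : continuous U) (cH : continuous H).
Hypotheses (U0 : forall z, inbox c r z -> 0 <= U z)
  (H0 : forall z s, inbox c r z -> s0 <= s <= s1 -> 0 <= H (z, s)).
Hypotheses (Um : boxint c r U <= m)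
  (Hm : segint s0 s1 (fun s => boxint c r (fun z => H (z, s))) <= m).
Variables (rho t t1 a l d C0 k1 : R).
Hypotheses (rho0 : 0 <= rho) (s1t : s1 < t) (tt1 : t <= t1) (a0 : 0 < a) (l1 : 1 <= l)
  (d0 : 0 < d) (d1 : d <= 1) (C00 : 0 <= C0) (k10 : 0 <= k1) (m0 : 0 <= m).
(** [be] is the exponent lost by integrating the power [l] of a Gaussian, and [ga] the total
    singularity in time. For [a = alpha / 2] and [l = lambda], the condition [ga < 1] is the range
    of [lambda] in (i). *)
Let be := n%:R * (l - 1) / 2.
Let ga := a + be.
Hypothesis ga1 : ga < 1.
Variable v : 'rV[R]_n * R -> R.
Hypotheses (cv : continuous v) (v0 : forall p, 0 <= v p).
Hypothesis hv : forall y s, inbox c rho y -> s0 <= s <= s1 ->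
  v (y, s) <= C0 + k1 * srcint c r s0 s1 U H (fun q => Gam y q.1 (`|s - q.2| + d)).

Let w s := powR (t - clampr s0 s1 s) (- a).
Let lag s : 0 < t - clampr s0 s1 s.
Proof. by rewrite subr_gt0 (le_lt_trans _ s1t)//; case/andP: (clampr_in s s01). Qed.
Let cw : continuous w.
Proof.
apply: cont_powR_pos lag.
by apply: continuousBR; [exact: cont_cst|exact: continuous_clampr].
Qed.
Let w0 s : 0 <= w s. Proof. exact: powR_ge0. Qed.
Let be0 : 0 <= be. Proof. by rewrite divr_ge0// mulr_ge0// subr_ge0. Qed.

Definition pot_time : R := powR t1 (- ga + 1) / (- ga + 1) + 2 * (powR (t1 + 1) (- ga + 1) / (- ga + 1)).
Definition pot_const : R := powR 2 l * (powR C0 l * ((2 * rho) ^+ n * (powR t1 (- a + 1) / (- a + 1))) +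
  powR k1 l * powR (2 * m + 1) (l - 1) * ((2 * pi) ^+ n * pot_time * (2 * m))).

Let t10 : 0 < t1.
Proof. by rewrite (lt_le_trans _ tt1)// (lt_trans _ s1t)// (lt_le_trans s00). Qed.

Let time_bound s' : s0 <= s' <= s1 ->
  segint s0 s1 (fun s => w s * powR (`|s - s'| + d) (- be)) <= pot_time.
Proof.
move=> /andP[h1 h2].
have ga1' : - 1 < - ga by rewrite ltrN2.
have g10 : 0 < - ga + 1 by rewrite addrC subr_gt0.
have t0 : 0 < t by rewrite (lt_trans _ s1t)// (lt_le_trans s00).
have ad s : 0 < `|s - s'| + d by rewrite ltr_wpDl.
have cA e : continuous (fun s => powR (`|s - s'| + d) e).
  by apply: cont_powR_pos ad; exact: continuous_abs_lag.
have cL : continuous (fun s => powR (t - clampr s0 s1 s) (- ga)).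
  apply: cont_powR_pos lag.
  by apply: continuousBR; [exact: cont_cst|exact: continuous_clampr].
apply: (@le_trans _ _ (segint s0 s1 (fun s => powR (t - clampr s0 s1 s) (- ga) +
    powR (`|s - s'| + d) (- ga)))).
  apply: le_segint.
  - exact: continuousMR.
  - exact: continuousDR.
  - by move=> s _; apply: powR_mul_le => //; exact: ltW.
rewrite segintD//; apply: lerD.
  apply: le_trans (segint_powR_lag ga1' s00 s01 s1t) _.
  rewrite ler_pM2r ?invr_gt0//.
  by apply: ge0_ler_powR; rewrite ?nnegrE ?(ltW g10) ?(ltW t0) ?(ltW t10).
apply: segint_powR_abs => // s /andP[h3 h4]; apply: lerD => //.
have s1t1 : s1 <= t1 by rewrite (le_trans (ltW s1t)).
have p0 : 0 <= s by rewrite (le_trans _ h3)// ltW.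
have p1 : 0 <= s' by rewrite (le_trans _ h1)// ltW.
rewrite ler_distl lerBlDl; apply/andP; split; [apply: ler_wpDr|apply: ler_wpDl] => //; first exact: le_trans h2 _.
exact: le_trans h4 _.
Qed.

(** Jensen's inequality replaces [v^l] by [srcint] of Gaussians to the power [l]. Exchanging the
    integrals and integrating in space leaves [w s * (|s - s'| + d)^(- be)], whose two singularities
    are separated and integrable in [s] because [ga < 1]. The bound is independent of [d], [s0] and
    [s1]. *)
Lemma potential_bound :
  segint s0 s1 (fun s => w s * boxint c rho (fun y => powR (v (y, s)) l)) <= pot_const.
Proof.
have l0 : 0 < l by exact: lt_le_trans l1.
have M0 : 0 < 2 * m + 1 by rewrite ltr_wpDl// mulr_ge0.
pose G (p : ('rV[R]_n * R) * ('rV[R]_n * R)) := Gam p.1.1 p.2.1 (`|p.1.2 - p.2.2| + d).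
have adp (p : ('rV[R]_n * R) * ('rV[R]_n * R)) : 0 < `|p.1.2 - p.2.2| + d by rewrite ltr_wpDl.
have cabs : continuous (fun p : ('rV[R]_n * R) * ('rV[R]_n * R) => `|p.1.2 - p.2.2| + d).
  apply: continuousDR; last exact: cont_cst.
  refine (@cont_comp _ _ _ (fun p : ('rV[R]_n * R) * ('rV[R]_n * R) => p.1.2 - p.2.2)
    (fun x : R => `|x|) _ _); last exact: norm_continuous.
  by apply: continuousBR; cont_proj.
have cG : continuous G by apply: cont_Gam => //; cont_proj.
have G0 p : 0 < G p by exact: Gam_gt0.
have cK : continuous (fun p => powR (G p) l) by exact: cont_powR_pos.
pose A1 := powR 2 l * powR C0 l; pose A2 := powR 2 l * (powR k1 l * powR (2 * m + 1) (l - 1)).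
pose I := srcint c r s0 s1 U H.
pose S p := I (fun q => powR (G (p, q)) l).
have cS : continuous S by exact: (@srcint_continuous _ _ _ _ _ _ _ _ cU cH _ _ cK).
have A10 : 0 <= A1 by rewrite mulr_ge0 ?powR_ge0.
have A20 : 0 <= A2 by rewrite mulr_ge0 ?mulr_ge0 ?powR_ge0.
have cGp p : continuous (fun q => G (p, q)).
  by refine (@cont_comp _ _ _ (fun q => (p, q)) G _ cG); cont_proj.
have cKp p : continuous (fun q => powR (G (p, q)) l) by exact: cont_powR_pos.
have pt y s : inbox c rho y -> s0 <= s <= s1 -> powR (v (y, s)) l <= A1 + A2 * S (y, s).
  move=> yr Is.
  have I0 : 0 <= I (fun q => G ((y, s), q)).
    by apply: srcint_ge0 => // z s' _ _; exact: ltW.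
  apply: (@le_trans _ _ (powR (C0 + k1 * I (fun q => G ((y, s), q))) l)).
    apply: ge0_ler_powR; rewrite ?nnegrE ?(ltW l0) ?addr_ge0 ?mulr_ge0//.
    exact: hv.
  apply: le_trans (powR_sum_le (ltW l0) C00 (mulr_ge0 k10 I0)) _.
  rewrite /A1 /A2 mulrDr lerD2l -mulrA ler_wpM2l ?powR_ge0// powRM// -mulrA ler_wpM2l ?powR_ge0//.
  apply: (srcint_jensen s01 cU cH U0 H0 Um Hm) => //.
  by rewrite lerDl.
have cvp s : continuous (fun y => powR (v (y, s)) l).
  apply: cont_powR_ge0 => //.
  by refine (@cont_comp _ _ _ (fun y => (y, s)) v _ cv); cont_proj.
have cSs s : continuous (fun y => S (y, s)).
  by refine (@cont_comp _ _ _ (fun y => (y, s)) S _ cS); cont_proj.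
have cSb : continuous (fun s => boxint c rho (fun y => S (y, s))) by exact: boxint_time_continuous.
apply: (@le_trans _ _ (segint s0 s1 (fun s => A1 * (2 * rho) ^+ n * w s +
    A2 * (w s * boxint c rho (fun y => S (y, s)))))).
  apply: le_segint.
  - apply: continuousMR => //; apply: (@boxint_time_continuous _ _ c rho (fun p => powR (v p) l)).
    exact: cont_powR_ge0.
  - apply: continuousDR; (apply: continuousMR; first exact: cont_cst) => //.
    exact: continuousMR.
  - move=> s Is.
    have -> : A1 * (2 * rho) ^+ n * w s + A2 * (w s * boxint c rho (fun y => S (y, s))) =
        w s * ((2 * rho) ^+ n * A1 + A2 * boxint c rho (fun y => S (y, s))) by ring.
    apply: ler_wpM2l => //; rewrite -(boxint_cst n c A1 rho0) -boxintZ//.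
    rewrite -boxintD; [|exact: cont_cst|by apply: continuousMR => //; exact: cont_cst].
    apply: le_boxint => //; last by move=> y yr; exact: pt.
    by apply: continuousDR; [exact: cont_cst|apply: continuousMR => //; exact: cont_cst].
rewrite segintD; first last.
- by apply: continuousMR; [exact: cont_cst|exact: continuousMR].
- by apply: continuousMR => //; exact: cont_cst.
rewrite segintZ// segintZ; last exact: continuousMR.
rewrite /pot_const mulrDr; apply: lerD.
  rewrite /A1 -!mulrA ler_wpM2l ?powR_ge0// ler_wpM2l ?powR_ge0// ler_wpM2l ?exprn_ge0 ?mulr_ge0//.
  have a1 : - 1 < - a by rewrite ltrN2 (le_lt_trans _ ga1)// lerDl.
  have g10 : 0 < - a + 1 by rewrite -ltrBlDr sub0r.
  have t0 : 0 < t by rewrite (lt_trans _ s1t)// (lt_le_trans s00).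
  apply: le_trans (segint_powR_lag a1 s00 s01 s1t) _.
  rewrite ler_pM2r ?invr_gt0//.
  by apply: ge0_ler_powR; rewrite ?nnegrE ?(ltW g10) ?(ltW t0) ?(ltW t10).
rewrite /A2 -mulrA ler_wpM2l ?powR_ge0// ler_wpM2l ?mulr_ge0 ?powR_ge0//.
pose Ph (p : R * ('rV[R]_n * R)) := w p.1 * ((2 * pi) ^+ n * powR (`|p.1 - p.2.2| + d) (- be)).
have cP1 : continuous (fun p : R * ('rV[R]_n * R) => (2 * pi) ^+ n * powR (`|p.1 - p.2.2| + d) (- be)).
  apply: continuousMR; first exact: cont_cst.
  apply: (@cont_powR_pos _ (fun p : R * ('rV[R]_n * R) => `|p.1 - p.2.2| + d)); last by move=> p; rewrite ltr_wpDl.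
  refine (@cont_comp _ _ _ (fun p : R * ('rV[R]_n * R) => ((0, p.1), (0, p.2.2)) : ('rV[R]_n * R) * ('rV[R]_n * R)) _ _ cabs).
  by cont_proj.
have cPh : continuous Ph.
  apply: continuousMR => //.
  by refine (@cont_comp _ _ _ (fun p : R * ('rV[R]_n * R) => p.1) w _ cw); cont_proj.
have cPs s : continuous (fun q : 'rV[R]_n * R => (2 * pi) ^+ n * powR (`|s - q.2| + d) (- be)).
  by refine (@cont_comp _ _ _ (fun q : 'rV[R]_n * R => (s, q)) _ _ cP1); cont_proj.
apply: (@le_trans _ _ (segint s0 s1 (fun s => I (fun q => Ph (s, q))))).
  apply: le_segint; first exact: continuousMR.
    exact: (@srcint_continuous _ _ _ _ _ _ _ _ cU cH _ _ cPh).
  move=> s _; rewrite /I /Ph /= (srcintZ c r s0 s1 cU cH _ (cPs s)); apply: ler_wpM2l => //.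
  have cKs : continuous (fun w : 'rV[R]_n * ('rV[R]_n * R) => powR (G ((w.1, s), w.2)) l).
    by refine (@cont_comp _ _ _ (fun w : 'rV[R]_n * ('rV[R]_n * R) => ((w.1, s), w.2)) _ _ cK); cont_proj.
  rewrite (boxint_srcint c r0 s01 cU cH c rho0 cKs).
  apply: le_srcint => //.
    apply: (@boxint_continuous _ _ _ c rho (fun w : ('rV[R]_n * R) * 'rV[R]_n => powR (G ((w.2, s), w.1)) l)).
    by refine (@cont_comp _ _ _ (fun w : ('rV[R]_n * R) * 'rV[R]_n => (w.2, w.1)) _ _ cKs); cont_proj.
  move=> z s' _ _; have sd : 0 < `|s - s'| + d by rewrite ltr_wpDl.
  exact: (@boxint_Gam_powR n z c rho (`|s - s'| + d) l sd rho0 l1).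
rewrite (segint_srcint c r0 s01 cU cH cPh).
have pt0 : 0 <= pot_time.
  have g10 : 0 <= - ga + 1 by rewrite addrC subr_ge0 ltW.
  have h x : 0 <= powR x (- ga + 1) / (- ga + 1) by rewrite divr_ge0 ?powR_ge0.
  by apply: addr_ge0 => //; apply: mulr_ge0.
apply: le_trans (srcint_cst cU cH Um Hm _); last first.
  by rewrite mulr_ge0// exprn_ge0// mulr_ge0 ?pi_ge0.
apply: le_srcint => //.
- apply: (@segint_continuous _ _ (fun p : ('rV[R]_n * R) * R => Ph (p.2, p.1))).
  by refine (@cont_comp _ _ _ (fun p : ('rV[R]_n * R) * R => (p.2, p.1)) _ _ cPh); cont_proj.
- exact: cont_cst.
move=> z s' _ Is'; rewrite /Ph /=.
have cws : continuous (fun s => w s * powR (`|s - s'| + d) (- be)).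
  apply: continuousMR => //; apply: cont_powR_pos; first exact: continuous_abs_lag.
  by move=> s; rewrite ltr_wpDl.
have -> : segint s0 s1 (fun s => w s * ((2 * pi) ^+ n * powR (`|s - s'| + d) (- be))) =
   (2 * pi) ^+ n * segint s0 s1 (fun s => w s * powR (`|s - s'| + d) (- be)).
  by rewrite -segintZ//; apply: eq_segint => s _; rewrite mulrCA.
by apply: ler_wpM2l; [rewrite exprn_ge0// mulr_ge0 ?pi_ge0|exact: time_bound].
Qed.

End potential.

(** * The nonlocal term near the observation point, for [lambda >= 1] *)

Section near_supercritical.
Context {R : realType}.
Variables (n : nat) (T : R) (u : 'rV[R]_n * R -> R).
Hypothesis uC : C21 [set p | 0 < p.2 < T] u.
Hypothesis u0 : forall x t, 0 < t < T -> 0 <= u (x, t).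
Variables (c : 'rV[R]_n) (r t1 m : R).
Hypotheses (r0 : 0 < r) (t10 : 0 < t1) (t1T : t1 < T) (m0 : 0 <= m).
Hypothesis f0 : forall z t, inbox (ctr c) r z -> 0 < t < T -> 0 <= heat_source u (z, t).
Hypothesis um : forall t0, 0 < t0 -> t0 <= t1 -> boxint (ctr c) r (fun y => u (y, t0)) <= m.
Hypothesis fm : forall t0, 0 < t0 -> t0 <= t1 -> stint (heat_source u) (ctr c) r t0 t1 <= m.

Let kap : R := (2 * expR (- 4^-1)) ^+ n.
Let kap0 : 0 < kap. Proof. by rewrite exprn_gt0// mulr_gt0// expR_gt0. Qed.
Let cu p : 0 < p.2 < T -> {for p, continuous u}. Proof. by move=> /uC[]. Qed.
Let chs p : 0 < p.2 < T -> {for p, continuous (heat_source u)}.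
Proof. exact: (heat_source_continuous uC). Qed.

(** By compactness one [d] works for all points of the half cube and all times of [[s0, s1]], as the
    functional in Duhamel's formula must be given the same [d] everywhere. This [d] may degenerate
    as [s0] tends to 0, which is harmless since later bounds do not involve it. *)
Lemma uniform_oscillation s0 s1 : 0 < s0 -> s1 < T -> exists2 d, 0 < d & forall y s z,
  inbox (ctr c) (r / 2) y -> s0 <= s <= s1 -> inbox (ctr y) d z -> u (y, s) - 1 <= u (z, s).
Proof.
move=> s00 s1T.
have r20 : 0 <= r / 2 by rewrite divr_ge0// ltW.
pose K1 := [set v : 'rV[R]_n | forall i, `[c 0 i - r / 2, c 0 i + r / 2]%classic (v ord0 i)].
have cK : compact (K1 `*` `[s0, s1]).
  apply: compact_setX; last exact: segment_compact.
  by apply: (@rV_compact R n (fun i => `[c 0 i - r / 2, c 0 i + r / 2]%classic)) => i; exact: segment_compact.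
pose P (d : R) (p : 'rV[R]_n * R) := forall z, `|z - p.1| <= d -> u p - 1 <= u (z, p.2).
have /compact_near_coveringP/(_ _ _ P) := cK.
move=> /(_ (0^'+) _)[].
  move=> [y s] [_ /= Is].
  have Isp : 0 < (y, s).2 < T.
    by move: Is; rewrite in_itv/= => /andP[h1 h2]; rewrite (lt_le_trans s00)// (le_lt_trans h2).
  have /cvgrPdist_lt/(_ 2^-1) := cu Isp; rewrite invr_gt0 => /(_ (ltr0n _ 2)).
  move=> /nbhs_ballP[e /= e0 He].
  have e20 : 0 < e / 2 by rewrite divr_gt0.
  exists (ball (y, s) (e / 2), [set d : R | d < e / 2]).
    split; first exact: nbhsx_ballx.
    by near=> d; near: d; exact: nbhs_right_lt.
  move=> [[y' s'] d] [/= [yy ss]] dd z /= zd.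
  have h1 : `|u (y, s) - u (y', s')| < 2^-1.
    by apply: He; apply: (@le_ball _ _ (y, s) (e / 2)) => //; rewrite ler_pdivrMr// ler_peMr ?ler1n// ltW.
  have h2 : `|u (y, s) - u (z, s')| < 2^-1.
    apply: He; split => /=; last first.
      by apply: (@le_ball _ _ s (e / 2)) => //; rewrite ler_pdivrMr// ler_peMr ?ler1n// ltW.
    move: yy; rewrite -!ball_normE /= => yy.
    rewrite (_ : y - z = (y - y') + (y' - z)); last by rewrite addrA subrK.
    apply: le_lt_trans (ler_normD _ _) _; rewrite [e]splitr ltrD// distrC.
    exact: le_lt_trans dd.
  by move: h1 h2; rewrite !ltr_distl; move: (u (y, s)) (u (y', s')) (u (z, s')) => a1 a2 a3; lra.
move=> d /= d0 Hd; exists (d / 2); first by rewrite divr_gt0.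
move=> y s z yr Is zy.
have d20 : 0 < d / 2 by rewrite divr_gt0.
apply: (Hd (d / 2) _ d20 (y, s)) => //.
- by rewrite /= sub0r normrN gtr0_norm// ltr_pdivrMr// ltr_pMr// ltr1n.
- split => //= i; have := yr i; rewrite ctrE /= in_itv/= -ler_distl; exact.
- by apply/inboxP => //; exact: ltW.
Unshelve. all: by end_near. Qed.

(** [D0] bounds the cutoff error of Duhamel's formula on the half cube; in [C0] the summand 1 is the
    oscillation allowed by [uniform_oscillation]. *)
Let D0 : R := duh_const n / (r / 2) ^+ n.+2 * (t1 * m).
Let C0 : R := 1 + kap^-1 * D0.

Let dc : 0 <= duh_const n :> R.
Proof.
rewrite mulr_ge0// mulr_ge0 ?(ltW (gauss_bound_gt0 _))//.
by apply: le_trans (chi1_bounds 0).1; exact: normr_ge0.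
Qed.

Let C00 : 0 <= C0.
Proof.
apply: addr_ge0 => //; apply: mulr_ge0; first by rewrite invr_ge0 ltW.
apply: mulr_ge0; last by rewrite mulr_ge0// ltW.
by rewrite divr_ge0// exprn_ge0// divr_ge0// ltW.
Qed.

(** In Duhamel's formula the sources lie before [s]. Extending the integral to all of [[s0, s1]]
    with lag [|s - s'| + d], and to the large cube, only increases it, and gives a functional that
    depends on neither [y] nor [s]. *)
Lemma duhamel_upper s0 s1 d y s : 0 < s0 -> s0 <= s1 -> s1 <= t1 -> 0 < d ->
  Num.sqrt d <= r / 4 ->
  inbox (ctr c) (r / 2) y -> s0 <= s <= s1 ->
  (forall z, inbox (ctr y) (Num.sqrt d) z -> u (y, s) - 1 <= u (z, s)) ->
  u (y, s) <= C0 + kap^-1 * srcint (ctr c) r s0 s1 (fun z => u (z, s0))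
    (fun q => heat_source u (q.1, clampr s0 s1 q.2)) (fun q => Gam y q.1 (`|s - q.2| + d)).
Proof.
move=> s00 s01 s1t1 d0 dr yr /andP[s0s ss1] uosc.
have r20 : 0 < r / 2 by rewrite divr_gt0.
have s1T := le_lt_trans s1t1 t1T.
have sT := le_lt_trans ss1 s1T.
have It s' : s0 <= s' <= s1 -> 0 < s' < T.
  by move=> /andP[h1 h2]; rewrite (lt_le_trans s00)// (le_lt_trans h2).
have It' s' : s0 <= s' <= s -> s0 <= s' <= s1.
  by move=> /andP[-> h2]/=; rewrite (le_trans h2).
have sub i : (i < n)%N -> ctr c i - r <= ctr y i - r / 2 /\ ctr y i + r / 2 <= ctr c i + r.
  move=> ni; have := yr (Ordinal ni); rewrite -(ctrE y (Ordinal ni)) /=.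
  by rewrite ler_distl; move: (ctr c i) (ctr y i) => a1 a2; lra.
have subb (z : 'rV[R]_n) : inbox (ctr y) (r / 2) z -> inbox (ctr c) r z.
  move=> h i; have := h i; have [] := sub i (ltn_ord i).
  by rewrite !ler_distl; move: (ctr c i) (ctr y i) (z 0 i) => a1 a2 a3; lra.
have f0y z s' : inbox (ctr y) (r / 2) z -> 0 < s' < T -> 0 <= heat_source u (z, s').
  by move=> /subb; exact: f0.
have dr' : Num.sqrt d <= r / 2 / 2 by apply: le_trans dr _; rewrite -mulrA -invfM -natrM.
have D := @duhamel_ineq R n T u uC u0 y (r / 2) s0 s d r20 s00 s0s sT d0 f0y 1 dr' uosc.
rewrite -/kap in D.
have ad s' : 0 < `|s - s'| + d by rewrite ltr_wpDl.
have cGs s' : continuous (fun z : 'rV[R]_n => Gam y z (`|s - s'| + d)).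
  by apply: cont_Gam => //; cont_proj.
have cus s' : s0 <= s' <= s1 -> continuous (fun z => u (z, s')).
  by move=> Is'; apply: cont_slice => z; apply: cu; exact: It.
have chss s' : s0 <= s' <= s1 -> continuous (fun z => heat_source u (z, s')).
  by move=> Is'; apply: cont_slice => z; apply: chs; exact: It.
have ss0 : s0 <= s0 <= s1 by rewrite lexx.
have T1 : boxint (ctr y) (r / 2) (fun z => u (z, s0) * Gam y z (s + d - s0)) <=
    boxint (ctr c) r (fun z => u (z, s0) * Gam y z (`|s - s0| + d)).
  rewrite ger0_norm ?subr_ge0// (addrAC s d).
  have := cGs s0; rewrite ger0_norm ?subr_ge0// => cG.
  apply: boxint_sub => //; [|exact: ltW|].
    by apply: continuousMR => //; exact: cus.
  by move=> z zr; rewrite mulr_ge0 ?Gam_ge0// u0// It.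
have cH : continuous (fun q : 'rV[R]_n * R => heat_source u (q.1, clampr s0 s1 q.2)).
  exact: (stint_continuous chs s00 s01 s1T).
have cHG : continuous (fun q : 'rV[R]_n * R => heat_source u (q.1, clampr s0 s1 q.2) *
    Gam y q.1 (`|s - q.2| + d)).
  apply: continuousMR => //; apply: cont_Gam => //; try cont_proj.
  apply: continuousDR; last exact: cont_cst.
  refine (@cont_comp _ _ _ (fun q : 'rV[R]_n * R => s - q.2) (fun x : R => `|x|) _ _);
    last exact: norm_continuous.
  by apply: continuousBR; cont_proj.
have T2 : segint s0 s (fun s' => boxint (ctr y) (r / 2) (fun z =>
      heat_source u (z, clampr s0 s s') * Gam y z (s + d - clampr s0 s s'))) <=
    segint s0 s1 (fun s' => boxint (ctr c) r (fun z =>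
      heat_source u (z, clampr s0 s1 s') * Gam y z (`|s - s'| + d))).
  have -> : segint s0 s (fun s' => boxint (ctr y) (r / 2) (fun z =>
      heat_source u (z, clampr s0 s s') * Gam y z (s + d - clampr s0 s s'))) =
    segint s0 s (fun s' => boxint (ctr y) (r / 2) (fun z =>
      heat_source u (z, clampr s0 s1 s') * Gam y z (`|s - s'| + d))).
    apply: eq_segint => s' /[!in_itv]/= Is'; rewrite !clampr_id ?It'//.
    have ss' : 0 <= s - s' by rewrite subr_ge0; case/andP: Is'.
    by rewrite (ger0_norm ss') (addrAC s d).
  have cB := boxint_time_continuous (ctr c) r cHG.
  apply: (@le_trans _ _ (segint s0 s (fun s' => boxint (ctr c) r (fun z =>
      heat_source u (z, clampr s0 s1 s') * Gam y z (`|s - s'| + d))))); last first.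
    apply: segint_sub => // s' Is'; apply: boxint_ge0 => z zr.
    by rewrite mulr_ge0 ?Gam_ge0// f0// It// clampr_in.
  apply: le_segint => //; first exact: (boxint_time_continuous (ctr y) (r / 2) cHG).
  move=> s' Is'; apply: boxint_sub => //; [|exact: ltW|].
    apply: (@cont_slice _ _ _ (fun q : 'rV[R]_n * R => heat_source u (q.1, clampr s0 s1 q.2) *
      Gam y q.1 (`|s - q.2| + d))) => z; exact: cHG.
  by move=> z zr; rewrite mulr_ge0 ?Gam_ge0// f0// It// clampr_in.
have T3 : segint s0 s (fun s' => boxint (ctr y) (r / 2) (fun z => u (z, clampr s0 s s'))) <= t1 * m.
  apply: (@le_trans _ _ (segint s0 s (fun=> m))).
    apply: le_segint; [exact: (stint_inner_continuous cu)|exact: cont_cst|].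
    move=> s' Is'; rewrite clampr_id//.
    have Is1 := It' _ Is'; have /andP[h1 h2] := Is1.
    apply: le_trans (um (lt_le_trans s00 h1) (le_trans h2 s1t1)).
    apply: boxint_sub => //; [exact: cus|exact: ltW|].
    by move=> z _; apply: u0; exact: It.
  rewrite segint_cst// ler_wpM2r// lerBlDr (le_trans ss1)// (le_trans s1t1)// lerDl ltW//.
rewrite -lerBlDl -(ler_pM2l kap0).
have -> : kap * (kap^-1 * srcint (ctr c) r s0 s1 (fun z => u (z, s0))
    (fun q => heat_source u (q.1, clampr s0 s1 q.2)) (fun q => Gam y q.1 (`|s - q.2| + d))) =
    srcint (ctr c) r s0 s1 (fun z => u (z, s0))
    (fun q => heat_source u (q.1, clampr s0 s1 q.2)) (fun q => Gam y q.1 (`|s - q.2| + d)).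
  by rewrite mulVKf// gt_eqF.
have -> : kap * (u (y, s) - C0) = kap * (u (y, s) - 1) - D0.
  by rewrite /C0; field; rewrite gt_eqF.
rewrite lerBlDr; apply: le_trans D _; rewrite lerD//; first exact: lerD.
by rewrite ler_wpM2l// divr_ge0// exprn_ge0// ltW.
Qed.

Variables (alpha lambda : R).
Hypotheses (n0 : (0 < n)%N) (a0 : 0 < alpha) (l1 : 1 <= lambda).
Hypothesis ga1 : alpha / 2 + n%:R * (lambda - 1) / 2 < 1.

Lemma near_bound_ge1 : exists N, forall (x : 'rV[R]_n) s0 s1 t, 0 < s0 -> s0 <= s1 -> s1 < t -> t <= t1 ->
  segint s0 s1 (fun s => boxint (ctr c) (r / 2) (fun y =>
    powR (heat_kernel (x - y) (t - clampr s0 s1 s)) (alpha / n%:R) *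
    powR (u (y, clampr s0 s1 s)) lambda)) <= N.
Proof.
pose ka : R := powR (4 * pi) (- (alpha / 2)).
exists (ka * pot_const n m (r / 2) t1 (alpha / 2) lambda C0 kap^-1) => x s0 s1 t s00 s01 s1t tt1.
have l0 : 0 < lambda by exact: lt_le_trans l1.
have s1t1 : s1 <= t1 by rewrite (le_trans (ltW s1t)).
have s1T := le_lt_trans s1t1 t1T.
have It s' : s0 <= s' <= s1 -> 0 < s' < T.
  by move=> /andP[h1 h2]; rewrite (lt_le_trans s00)// (le_lt_trans h2).
have r20 : 0 < r / 2 by rewrite divr_gt0.
have r40 : 0 < r / 4 by rewrite divr_gt0.
have [e e0 He] := uniform_oscillation s00 s1T.
(* The three bounds serve [d <= 1] in [potential_bound], the oscillation of [u], and the size of the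
   cube in [duhamel_upper]. *)
pose e' := Num.min 1 (Num.min e (r / 4)).
have e'0 : 0 < e' by rewrite !lt_min ltr01 e0.
have e'1 : e' <= 1 by rewrite ge_min lexx.
have e'e : e' <= e by rewrite !ge_min lexx orbT.
have e'r : e' <= r / 4 by rewrite !ge_min lexx !orbT.
pose d := e' ^+ 2.
have d0 : 0 < d by rewrite exprn_gt0.
have d1 : d <= 1 by rewrite /d expr_le1// ltW.
have dE : Num.sqrt d = e' by rewrite sqrtr_sqr gtr0_norm.
have cv : continuous (fun p : 'rV[R]_n * R => u (p.1, clampr s0 s1 p.2)).
  exact: (stint_continuous cu s00 s01 s1T).
have cH : continuous (fun q : 'rV[R]_n * R => heat_source u (q.1, clampr s0 s1 q.2)).
  exact: (stint_continuous chs s00 s01 s1T).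
have ss0 : s0 <= s0 <= s1 by rewrite lexx.
have cU : continuous (fun z => u (z, s0)).
  by apply: cont_slice => z; apply: cu; exact: It.
have v0 (p : 'rV[R]_n * R) : 0 <= u (p.1, clampr s0 s1 p.2) by apply: u0; apply: It; exact: clampr_in.
have U0 (z : 'rV[R]_n) : inbox (ctr c) r z -> 0 <= u (z, s0) by move=> _; apply: u0; exact: It.
have H0 z s : inbox (ctr c) r z -> s0 <= s <= s1 -> 0 <= heat_source u (z, clampr s0 s1 s).
  by move=> zr _; apply: f0 => //; apply: It; exact: clampr_in.
have Um := um s00 (le_trans s01 s1t1).
have Hm : segint s0 s1 (fun s => boxint (ctr c) r (fun z => heat_source u (z, clampr s0 s1 s))) <= m.
  apply: le_trans (fm s00 (le_trans s01 s1t1)).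
  rewrite (@stint_split R n T _ chs _ _ _ s1 t1)// lerDl.
  by apply: (@stint_ge0 R n T) => //; exact: lt_le_trans s01.
have hv (y : 'rV[R]_n) s : inbox (ctr c) (r / 2) y -> s0 <= s <= s1 ->
    u (y, clampr s0 s1 s) <= C0 + kap^-1 * srcint (ctr c) r s0 s1 (fun z => u (z, s0))
    (fun q => heat_source u (q.1, clampr s0 s1 q.2)) (fun q => Gam y q.1 (`|s - q.2| + d)).
  move=> yr Is; rewrite clampr_id//; apply: duhamel_upper => //; rewrite dE//.
  move=> z zy; apply: He => // i; apply: le_trans (zy i) _; exact: e'e.
have kv0 : 0 <= kap^-1 by rewrite invr_ge0 ltW.
have a20 : 0 < alpha / 2 by rewrite divr_gt0.
have := @potential_bound R n (ctr c) r s0 s1 m (fun z => u (z, s0))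
  (fun q => heat_source u (q.1, clampr s0 s1 q.2)) (ltW r0) s00 s01 cU cH U0 H0 Um Hm
  (r / 2) t t1 (alpha / 2) lambda d C0 kap^-1 (ltW r20) s1t tt1 a20 l1 d0 d1 C00 kv0 m0 ga1
  (fun p => u (p.1, clampr s0 s1 p.2)) cv v0 hv.
have ka0 : 0 <= ka by exact: powR_ge0.
move=> /(ler_wpM2l ka0); apply: le_trans.
have lag s : 0 < t - clampr s0 s1 s.
  by rewrite subr_gt0 (le_lt_trans _ s1t)//; case/andP: (clampr_in s s01).
have cw : continuous (fun s : R => powR (t - clampr s0 s1 s) (- (alpha / 2))).
  apply: cont_powR_pos lag.
  by apply: continuousBR; [exact: cont_cst|exact: continuous_clampr].
have cvp : continuous (fun p : 'rV[R]_n * R => powR (u (p.1, clampr s0 s1 p.2)) lambda).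
  exact: cont_powR_ge0.
have cvs := boxint_time_continuous (ctr c) (r / 2) cvp.
rewrite -segintZ; last exact: continuousMR.
pose F (p : 'rV[R]_n * R) := powR (heat_kernel (x - p.1) (t - p.2)) (alpha / n%:R) * powR (u p) lambda.
have cF p : s0 <= p.2 <= s1 -> {for p, continuous F}.
  move=> Ip; apply: for_contM.
    by apply: for_cont_heat_kernel_powR => //; case/andP: Ip => _ /le_lt_trans; apply.
  by apply: (@for_cont_upow R n lambda T u l0 cu u0); exact: It.
have cFc := cont_clamp s01 cF.
apply: le_segint.
- exact: (boxint_time_continuous (ctr c) (r / 2) cFc).
- by apply: continuousMR; [exact: cont_cst|exact: continuousMR].
move=> s Is; rewrite mulrA -boxintZ; last first.
  by apply: (@cont_slice _ _ _ (fun p : 'rV[R]_n * R => powR (u (p.1, clampr s0 s1 p.2)) lambda)) => y; exact: cvp.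
apply: le_boxint.
- by apply: (@cont_slice _ _ _ (fun p : 'rV[R]_n * R => F (p.1, clampr s0 s1 p.2))) => y; exact: cFc.
- apply: continuousMR; first exact: cont_cst.
  by apply: (@cont_slice _ _ _ (fun p : 'rV[R]_n * R => powR (u (p.1, clampr s0 s1 p.2)) lambda)) => y; exact: cvp.
(* The Gaussian factor of the kernel is bounded by 1, so the estimate is uniform in [x]; the space
   integrability comes from [u] alone. *)
- move=> y _; rewrite ler_wpM2r ?powR_ge0// heat_kernel_powR//.
  rewrite ler_piMr ?mulr_ge0 ?powR_ge0// expR_le1 oppr_le0 divr_ge0//.
    by apply: sumr_ge0 => i _; exact: sqr_ge0.
  by rewrite mulr_ge0// ltW// gauss_rate_gt0.
Qed.

End near_supercritical.

(** * The whole nonlocal term near a point of [Omega] *)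

Section local_bound.
Context {R : realType}.
Variables (n : nat) (alpha lambda T : R) (u : 'rV[R]_n * R -> R).
Hypotheses (n0 : (0 < n)%N) (a0 : 0 < alpha) (l0 : 0 < lambda)
  (lc : lambda < (n%:R + 2 - alpha) / n%:R).
Hypothesis uC : C21 [set p | 0 < p.2 < T] u.
Hypothesis u0 : forall x t, 0 < t < T -> 0 <= u (x, t).
Hypothesis uL : (int_spacetime T (fun y s => (powR (u (y, s)) lambda)%:E) < +oo)%E.

Let cu p : 0 < p.2 < T -> {for p, continuous u}. Proof. by move=> /uC[]. Qed.
Let cup := @for_cont_upow R n lambda T u l0 cu u0.

Lemma stint_upow_le c L s0 s1 : 0 <= L -> 0 < s0 -> s0 <= s1 -> s1 < T ->
  stint (fun p => powR (u p) lambda) c L s0 s1 <=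
  fine (int_spacetime T (fun y s => (powR (u (y, s)) lambda)%:E)).
Proof.
move=> L0 s00 s01 s1T.
have T0 : 0 < T by rewrite (lt_trans _ s1T)// (lt_le_trans s00).
have p0 (p : 'rV[R]_n * R) : 0 < p.2 < T -> 0 <= powR (u p) lambda by move=> _; exact: powR_ge0.
have pT (p : 'rV[R]_n * R) : T <= p.2 < T -> powR (u p) lambda = 0.
  by move=> /andP[h1 h2]; have := lt_le_trans h2 h1; rewrite ltxx.
have h := @int_spacetime_ge R n T T (fun p => powR (u p) lambda) T0 (lexx _) p0 cup pT c L s0 s1 L0 s00 s01 s1T.
have fin : int_spacetime T (fun y s => (powR (u (y, s)) lambda)%:E) \is a fin_num.
  by rewrite fin_numE; apply/andP; split; [rewrite gt_eqF// (lt_le_trans (ltNyr _) h)|rewrite lt_eqF].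
by move: h; rewrite -(fineK fin) lee_fin.
Qed.

Variables (c : 'rV[R]_n) (r t1 m : R).
Hypotheses (r0 : 0 < r) (t10 : 0 < t1) (t1T : t1 < T) (m0 : 0 <= m).
Hypothesis f0 : forall z t, inbox (ctr c) r z -> 0 < t < T -> 0 <= heat_source u (z, t).
Hypothesis um : forall t0, 0 < t0 -> t0 <= t1 -> boxint (ctr c) r (fun y => u (y, t0)) <= m.
Hypothesis fm : forall t0, 0 < t0 -> t0 <= t1 -> stint (heat_source u) (ctr c) r t0 t1 <= m.

Let nn0 : 0 < n%:R :> R. Proof. by rewrite ltr0n. Qed.

Lemma near_bound : exists N, forall (x : 'rV[R]_n) s0 s1 t, 0 < s0 -> s0 <= s1 -> s1 < t -> t <= t1 ->
  segint s0 s1 (fun s => boxint (ctr c) (r / 2) (fun y =>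
    powR (heat_kernel (x - y) (t - clampr s0 s1 s)) (alpha / n%:R) *
    powR (u (y, clampr s0 s1 s)) lambda)) <= N.
Proof.
have lcn : lambda * n%:R < n%:R + 2 - alpha by rewrite -ltr_pdivlMr.
have r20 : 0 <= r / 2 by rewrite divr_ge0// ltW.
have [l1|l1] := ltP lambda 1.
  have e1 : -1 < (n%:R - alpha - n%:R * lambda) / 2.
    by rewrite ltr_pdivlMr// (mulrC n%:R); move: (lambda * n%:R) lcn => X; lra.
  have um2 s : 0 < s -> s <= t1 -> boxint (ctr c) (r / 2) (fun y => u (y, s)) <= m.
    move=> s0 st; apply: le_trans (um s0 st); apply: boxint_sub => //.
    - by apply: cont_slice => y; apply: cu; rewrite /= s0 (le_lt_trans st).
    - have r2r : r / 2 <= r by rewrite ler_pdivrMr// ler_peMr ?ler1n// ltW.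
      by move=> i _; rewrite lerD2l lerN2 lerD2l.
    - by move=> y _; apply: u0; rewrite s0 (le_lt_trans st).
  exact: (near_bound_lt1 n0 a0 l0 cu u0 r20 t1T m0 um2 l1 e1).
apply: (near_bound_ge1 uC u0 r0 t10 t1T m0 f0 um fm n0 a0 l1).
have -> : alpha / 2 + n%:R * (lambda - 1) / 2 = (alpha + lambda * n%:R - n%:R) / 2 by field.
by rewrite ltr_pdivrMr//; move: (lambda * n%:R) lcn => X; lra.
Qed.

(** A continuous substitute for the indicator of the near region, since the box integrals take
    continuous functions: 1 on the cube of half-side [r / 4], 0 outside that of half-side
    [r / 2]. *)
Let cut (y : 'rV[R]_n) := \prod_(i < n) chi1 ((y 0 i - c 0 i) / (r / 2)).

Let cut01 y : 0 <= cut y <= 1.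
Proof.
apply/andP; split; first by apply: prodr_ge0 => i _; exact: chi1_ge0.
have -> : 1 = \prod_(i < n) (1 : R) by rewrite big1.
by apply: ler_prod => i _; rewrite chi1_ge0 chi1_le1.
Qed.

Let continuous_cut : continuous cut.
Proof.
apply: cont_bigprod => i.
refine (@cont_comp _ _ _ (fun y : 'rV[R]_n => (y 0 i - c 0 i) / (r / 2)) chi1 _ continuous_chi1).
apply: continuousMR; last exact: cont_cst.
by apply: continuousBR; [exact: continuous_coord|exact: cont_cst].
Qed.

Let cut_supp y : ~ inbox (ctr c) (r / 2) y -> cut y = 0.
Proof.
move=> h; have /existsNP[i /negP] : ~ forall i, `|y 0 i - c 0 i| <= r / 2.
  by move=> h'; apply: h => i; rewrite ctrE.
rewrite -ltNge => hi; have r20 : 0 < r / 2 by rewrite divr_gt0.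
have [e _ _] : [/\ chi1 ((y 0 i - c 0 i) / (r / 2)) = 0, chi1' ((y 0 i - c 0 i) / (r / 2)) = 0 &
    chi1'' ((y 0 i - c 0 i) / (r / 2)) = 0]; last by rewrite /cut (bigD1 i)//= e mul0r.
apply: chi1_out; by rewrite normrM normfV (gtr0_norm r20) ler_pdivlMr// mul1r ltW.
Qed.

Let cut_core (y : 'rV[R]_n) : (forall i, `|y 0 i - c 0 i| <= r / 4) -> cut y = 1.
Proof.
move=> h; rewrite /cut big1// => i _.
suff h2 : ((y 0 i - c 0 i) / (r / 2)) ^+ 2 <= 2^-1 by have [] := chi1_core h2.
have r20 : 0 < r / 2 by rewrite divr_gt0.
have : `|(y 0 i - c 0 i) / (r / 2)| <= 2^-1.
  rewrite normrM normfV (gtr0_norm r20) ler_pdivrMr//.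
  by have -> : 2^-1 * (r / 2) = r / 4 by field.
move=> hi; rewrite -[_ ^+ 2]ger0_norm ?sqr_ge0// normrX.
have : `|(y 0 i - c 0 i) / (r / 2)| ^+ 2 <= 2^-1 ^+ 2.
  by apply: lerXn2r; rewrite ?nnegrE ?invr_ge0.
by move: (`|_|) => X; lra.
Qed.

(** Where [cut y] is not 1, some coordinate of [y] is farther than [r / 4] from [c], whereas [x] is
    within [r / 8]. Hence [|x - y| >= r / 8], and the exponential beats the singularity in time. *)
Lemma far_kernel_bound : exists2 C, 0 <= C & forall x y s, inbox (ctr c) (r / 8) x -> 0 < s ->
  (1 - cut y) * powR (heat_kernel (x - y) s) (alpha / n%:R) <= C.
Proof.
pose b := (r / 8) ^+ 2 / gauss_rate n alpha.
have r80 : 0 < r / 8 by rewrite divr_gt0.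
have g0 := gauss_rate_gt0 n0 a0.
have b0 : 0 < b by rewrite divr_gt0// exprn_gt0.
have a20 : 0 < alpha / 2 by rewrite divr_gt0.
have [C HC] := powR_exp_bound a20 b0.
have C0 : 0 <= C.
  by apply: le_trans (HC 1 ltr01); rewrite mulr_ge0 ?powR_ge0 ?expR_ge0.
pose ka : R := powR (4 * pi) (- (alpha / 2)).
have ka0 : 0 <= ka by exact: powR_ge0.
exists (ka * C); first by rewrite mulr_ge0.
move=> x y s xr s0; have /andP[c0 c1] := cut01 y.
have [h|/existsNP[i /negP]] := pselect (forall i, `|y 0 i - c 0 i| <= r / 4).
  by rewrite cut_core// subrr mul0r mulr_ge0.
rewrite -ltNge => hi.
apply: (@le_trans _ _ (powR (heat_kernel (x - y) s) (alpha / n%:R))).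
  by rewrite ler_piMl ?powR_ge0// gerBl.
rewrite heat_kernel_powR// -/ka -mulrA ler_wpM2l//; apply: le_trans (HC _ s0).
rewrite ler_wpM2l ?powR_ge0// ler_expR lerN2 /b.
have -> : (r / 8) ^+ 2 / gauss_rate n alpha / s = (r / 8) ^+ 2 / (gauss_rate n alpha * s).
  move: ((r / 8) ^+ 2) (gauss_rate n alpha) (lt0r_neq0 g0) (lt0r_neq0 s0) => X Y Y0 S0.
  by field; rewrite Y0 S0.
have gs : 0 < (gauss_rate n alpha * s)^-1 by rewrite invr_gt0; exact: mulr_gt0.
rewrite (ler_pM2r gs).
have xi := xr i; rewrite ctrE in xi.
have yx : r / 8 <= `|(x - y) 0 i|.
  rewrite !mxE distrC.
  have : `|y 0 i - c 0 i| <= `|y 0 i - x 0 i| + `|x 0 i - c 0 i|.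
    by rewrite (_ : y 0 i - c 0 i = (y 0 i - x 0 i) + (x 0 i - c 0 i)) ?ler_normD// addrA subrK.
  move: (`|y 0 i - c 0 i|) (`|y 0 i - x 0 i|) (`|x 0 i - c 0 i|) hi xi => X Y Z; lra.
rewrite /sqnorm (bigD1 i)//=; apply: ler_wpDr.
  by apply: sumr_ge0 => j _; exact: sqr_ge0.
rewrite -[leRHS]ger0_norm ?sqr_ge0// normrX.
by apply: lerXn2r; rewrite ?nnegrE ?(ltW r80).
Qed.

(** The near part is bounded by [near_bound], and the far part by the bounded kernel times the
    finite integral of [u^lambda] over the whole strip; this is where global integrability of
    [u^lambda] enters. *)
Lemma nonlocal_bound : exists2 N, 0 <= N & forall x t, inbox (ctr c) (r / 8) x -> 0 < t <= t1 ->
  (int_spacetime T (fun y s => (powR (heat_kernel (x - y) (t - s)) (alpha / n%:R) *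
     powR (u (y, s)) lambda)%:E) <= N%:E)%E.
Proof.
have [N1 HN1] := near_bound.
have [C C0 HC] := far_kernel_bound.
pose A := fine (int_spacetime T (fun y s => (powR (u (y, s)) lambda)%:E)).
exists (Num.max 0 (N1 + C * A)); first by rewrite le_max lexx.
move=> x t xr /andP[t0 tt1].
pose F (p : 'rV[R]_n * R) := powR (heat_kernel (x - p.1) (t - p.2)) (alpha / n%:R) * powR (u p) lambda.
have tT := le_lt_trans tt1 t1T.
have F0 (p : 'rV[R]_n * R) : 0 <= F p by rewrite mulr_ge0 ?powR_ge0.
have cF (p : 'rV[R]_n * R) : 0 < p.2 < t -> {for p, continuous F}.
  move=> /andP[h1 h2]; apply: for_contM; first exact: for_cont_heat_kernel_powR.
  by apply: cup; rewrite h1 (lt_trans h2).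
have Ft (p : 'rV[R]_n * R) : t <= p.2 < T -> F p = 0.
  by move=> /andP[h1 h2]; rewrite /F heat_kernel_powR0 ?mul0r// subr_le0.
apply: (@int_spacetime_le R n T t F t0 (ltW tT) (fun p _ => F0 p) cF Ft (ctr c)) => k s0 s1 s00 s01 s1t.
rewrite le_max; apply/orP; right.
have s1T := lt_trans s1t tT.
have It s : s0 <= s <= s1 -> 0 < s < t.
  by move=> /andP[h1 h2]; rewrite (lt_le_trans s00)// (le_lt_trans h2).
have cFc := cont_clamp s01 (fun p Ip => cF p (It _ Ip)).
have cuc : continuous (fun p : 'rV[R]_n * R => powR (u (p.1, clampr s0 s1 p.2)) lambda).
  exact: (stint_continuous cup s00 s01 s1T).
have ccut : continuous (fun p : 'rV[R]_n * R => cut p.1).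
  by refine (@cont_comp _ _ _ (fun p : 'rV[R]_n * R => p.1) cut _ continuous_cut); cont_proj.
have cin : continuous (fun p : 'rV[R]_n * R => cut p.1 * F (p.1, clampr s0 s1 p.2)) by exact: continuousMR.
have sl (G : 'rV[R]_n * R -> R) s : continuous G -> continuous (fun y => G (y, s)).
  by move=> cG; refine (@cont_comp _ _ _ (fun y => (y, s)) G _ cG); cont_proj.
have cout : continuous (fun p : 'rV[R]_n * R => C * powR (u (p.1, clampr s0 s1 p.2)) lambda).
  by apply: continuousMR => //; exact: cont_cst.
have r20 : 0 < r / 2 by rewrite divr_gt0.
apply: (@le_trans _ _ (segint s0 s1 (fun s =>
    boxint (ctr c) (r / 2) (fun y => F (y, clampr s0 s1 s)) +
    C * boxint (ctr c) k%:R (fun y => powR (u (y, clampr s0 s1 s)) lambda)))).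
  apply: le_segint.
  - exact: (boxint_time_continuous _ _ cFc).
  - apply: continuousDR; first exact: (boxint_time_continuous _ _ cFc).
    apply: continuousMR; [exact: cont_cst|exact: (boxint_time_continuous _ _ cuc)].
  move=> s Is; rewrite -boxintZ; last exact: (sl _ s cuc).
  apply: (@le_trans _ _ (boxint (ctr c) k%:R (fun y => cut y * F (y, clampr s0 s1 s)) +
      boxint (ctr c) k%:R (fun y => C * powR (u (y, clampr s0 s1 s)) lambda))).
    rewrite -boxintD; [|exact: (sl _ s cin)|exact: (sl _ s cout)].
    apply: le_boxint; [exact: (sl _ s cFc)| |].
      by apply: continuousDR; [exact: (sl _ s cin)|exact: (sl _ s cout)].
    move=> y _; rewrite -lerBlDl -[X in X - _]mul1r -mulrBl /F mulrA ler_wpM2r ?powR_ge0//.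
    apply: HC => //; rewrite subr_gt0; case/andP: (It _ (clampr_in s s01)) => //.
  rewrite lerD2r.
  (* The box is enlarged so that it contains the support of [cut] for every [k]. *)
  apply: (@le_trans _ _ (boxint (ctr c) (k%:R + r / 2) (fun y => cut y * F (y, clampr s0 s1 s)))).
    apply: boxint_sub => //; first exact: (sl _ s cin).
      by move=> i _; rewrite lerD2l lerN2 lerD2l lerDl ltW.
    by move=> y _; rewrite mulr_ge0//; case/andP: (cut01 y).
  rewrite (@boxint_supp _ _ (ctr c) (r / 2) (k%:R + r / 2)) ?lerDr ?(ltW r20)//; last 2 first.
  - exact: (sl _ s cin).
  - by move=> y yr; rewrite cut_supp// mul0r.
  apply: le_boxint; [exact: (sl _ s cin)|exact: (sl _ s cFc)|].
  by move=> y _; rewrite ler_piMl//; case/andP: (cut01 y).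
have cb1 := boxint_time_continuous (ctr c) (r / 2) cFc.
have cb2 := boxint_time_continuous (ctr c) k%:R cuc.
rewrite segintD//; last by apply: continuousMR => //; exact: cont_cst.
rewrite segintZ//; apply: lerD; first exact: HN1.
by rewrite ler_wpM2l//; apply: stint_upow_le.
Qed.

End local_bound.

Section initial_blow_up_rate.
Context {R : realType}.
Variables (n : nat) (alpha lambda T : R) (Omega : set 'rV[R]_n) (u : 'rV[R]_n * R -> R).
Hypotheses (n0 : (0 < n)%N) (a0 : 0 < alpha) (T0 : 0 < T) (oO : open Omega) (l0 : 0 < lambda)
  (lc : lambda < (n%:R + 2 - alpha) / n%:R).
Hypothesis adm : admissible alpha lambda (g_alpha n alpha lambda) T Omega u.

(** The estimates are applied on shrinking cubes: the mass is bounded on the half of [r1], the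
    nonlocal factor is then bounded on the cube of half-side [r / 8], and the mass estimate is run
    again from [r / 4] so that it lives on that same cube, where the critical estimate takes
    over. *)
Lemma local_rate c : Omega c -> exists r C d, [/\ 0 < r, 0 < d & forall x t, `|x - c| <= r ->
  0 < t < d -> u (x, t) <= C * powR t (- (n%:R / 2))].
Proof.
move=> Oc; have [u0 uC uL hsrc] := adm.
have /nbhs_ballP[e /= e0 He] : nbhs c Omega by exact: open_nbhs_nbhs.
pose r1 := e / 2; have r10 : 0 < r1 by rewrite divr_gt0.
have boxO (z : 'rV[R]_n) L : 0 <= L -> L <= r1 -> inbox (ctr c) L z -> Omega z.
  move=> L0 Lr /(inboxP _ _ L0) h; apply: He; rewrite -ball_normE /= distrC (le_lt_trans h)//.
  by rewrite (le_lt_trans Lr)// ltr_pdivrMr// ltr_pMr// ltr1n.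
have f0 L z t : 0 <= L -> L <= r1 -> inbox (ctr c) L z -> 0 < t < T -> 0 <= heat_source u (z, t).
  by move=> L0 Lr zL It; have [] := hsrc z t (boxO _ _ L0 Lr zL) It.
pose t1 := T / 2; have t10 : 0 < t1 by rewrite divr_gt0.
have t1T : t1 < T by rewrite ltr_pdivrMr// ltr_pMr// ltr1n.
have It1 : 0 < t1 < T by rewrite t10.
pose r := r1 / 2; have r0 : 0 < r by rewrite divr_gt0.
have rr1 : r <= r1 by rewrite ler_pdivrMr// ler_peMr ?ler1n// ltW.
have [m [m0 Hm]] := supertemp_mass uC u0 r10 (fun z t => @f0 r1 z t (ltW r10) (lexx _)) It1.
have [N N0 HN] := nonlocal_bound n0 a0 l0 lc uC u0 uL r0 t10 t1T m0
  (fun z t => @f0 r z t (ltW r0) rr1)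
  (fun t h1 h2 => (Hm t h1 h2).1) (fun t h1 h2 => (Hm t h1 h2).2).
have r40 : 0 < r / 4 by rewrite divr_gt0.
have r80 : 0 < r / 4 / 2 by rewrite divr_gt0.
have r8E : r / 4 / 2 = r / 8 by field.
have r4r1 : r / 4 <= r1.
  by apply: le_trans rr1; rewrite ler_pdivrMr// ler_peMr ?ler1n// ltW.
have r8r1 : r / 4 / 2 <= r1.
  by apply: le_trans r4r1; rewrite ler_pdivrMr// ler_peMr ?ler1n// ltW.
have [m' [m'0 Hm']] := supertemp_mass uC u0 r40 (fun z t => @f0 (r / 4) z t (ltW r40) r4r1) It1.
have fN z t : inbox (ctr c) (r / 4 / 2) z -> 0 < t <= t1 ->
    heat_source u (z, t) <= N * powR (u (z, t)) ((n%:R + 2) / n%:R).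
  move=> zr It; have It' : 0 < t < T by case/andP: It => -> /= /le_lt_trans; exact.
  have [_] := hsrc z t (boxO _ _ (ltW r80) r8r1 zr) It'.
  rewrite /g_alpha lc => h; rewrite -lee_fin EFinM; apply: le_trans h _.
  apply: lee_wpmul2r; first by rewrite lee_fin powR_ge0.
  by apply: HN => //; rewrite -r8E.
have [C [d [d0 Hd]]] := critical_bound n0 uC u0 r80 t10 t1T m'0 N0
  (fun z t => @f0 _ z t (ltW r80) r8r1)
  (fun t h1 h2 => (Hm' t h1 h2).1) (fun t h1 h2 => (Hm' t h1 h2).2) fN.
exists (r / 4 / 2 / 2), C, d; split => //; first by rewrite divr_gt0.
by move=> x t xr It; apply: Hd.
Qed.

(** A single parameter [d] is used both as the time horizon and as the inverse of the constant: the
    local statement then holds for all small [d], which is the form in which compactness of [K]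
    makes it uniform. *)
Lemma compact_rate (K : set 'rV[R]_n) : compact K -> K `<=` Omega ->
  exists C delta : R, 0 < delta /\ forall t, 0 < t < delta -> forall x, K x ->
    u (x, t) <= C * powR t (- (n%:R / 2)).
Proof.
move=> cK KO.
pose P (d : R) (x : 'rV[R]_n) := forall t, 0 < t < d -> u (x, t) <= d^-1 * powR t (- (n%:R / 2)).
have /compact_near_coveringP/(_ _ _ P) := cK.
move=> /(_ (0^'+) _)[].
  move=> c /KO Oc; have [r [C [d [r0 d0 H]]]] := local_rate Oc.
  pose C' := Num.max 1 C.
  have C'0 : 0 < C' by rewrite lt_max ltr01.
  exists (ball c r, [set e : R | 0 < e /\ e < Num.min d C'^-1]).
    split; first exact: nbhsx_ballx.
    near=> e; split; first by near: e; exact: nbhs_right_gt.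
    by near: e; apply: nbhs_right_lt; rewrite lt_min d0 invr_gt0.
  move=> [x e] /= [xr [e0]]; rewrite lt_min => /andP[ed eC] t /andP[t0 te].
  apply: (@le_trans _ _ (C * powR t (- (n%:R / 2)))).
    apply: H; last by rewrite t0 (lt_trans te).
    by move: xr; rewrite -ball_normE /= distrC => /ltW.
  rewrite ler_wpM2r ?powR_ge0//; apply: (@le_trans _ _ C'); first by rewrite le_max lexx orbT.
  by rewrite -[C']invrK lef_pV2 ?posrE ?invr_gt0// ltW.
move=> d /= d0 Hd.
have d20 : 0 < d / 2 by rewrite divr_gt0.
exists (d / 2)^-1, (d / 2); split => // t It x Kx.
apply: (Hd (d / 2)) => //.
by rewrite /= sub0r normrN gtr0_norm// ltr_pdivrMr// ltr_pMr// ltr1n.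
Unshelve. all: by end_near. Qed.

End initial_blow_up_rate.

(** * Cascades of bumps *)

Section bump.
Context {R : realType}.

(** A smooth switch from 0 for [z <= 0] to 1 for [z >= 1], made of two nested copies of [p3]. *)
Definition ramp (z : R) := 1 - p3 (1 - p3 z).
Definition ramp' (z : R) := 9 * posp (1 - p3 z) ^+ 2 * posp z ^+ 2.

Lemma is_der_ramp (x : R) : is_derive x 1 ramp (ramp' x).
Proof.
apply: (is_der_eq (is_derB (is_der_cst 1 x) (is_der_comp (is_der_p3 _)
  (is_derB (is_der_cst 1 x) (is_der_p3 x))))).
by rewrite /ramp'; ring.
Qed.

Lemma continuous_p3 : continuous (@p3 R).
Proof. by apply: continuousXR; exact: continuous_posp. Qed.

Lemma continuous_ramp : continuous ramp.
Proof. by move=> x; exact: is_der_continuous (is_der_ramp x). Qed.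

Lemma continuous_ramp' : continuous ramp'.
Proof.
apply: continuousMR; last by apply: continuousXR; exact: continuous_posp.
apply: continuousMR; first exact: cont_cst.
apply: continuousXR.
refine (@cont_comp _ _ _ (fun z => 1 - p3 z) (@posp R) _ continuous_posp).
by apply: continuousBR; [exact: cont_cst|exact: continuous_p3].
Qed.

Lemma p3_ge0 (z : R) : 0 <= p3 z. Proof. by rewrite exprn_ge0// posp_ge0. Qed.
Lemma p3_le1 (z : R) : z <= 1 -> p3 z <= 1.
Proof. by move=> z1; rewrite exprn_ile1 ?posp_ge0// posp_le1. Qed.

Lemma ramp01 z : 0 <= ramp z <= 1.
Proof.
by rewrite /ramp subr_ge0 gerBl p3_ge0 andbT p3_le1// gerBl p3_ge0.
Qed.

Lemma ramp_neg z : z <= 0 -> ramp z = 0 /\ ramp' z = 0.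
Proof.
move=> z0; rewrite /ramp /ramp' (posp_neg z0) expr0n /= mulr0; split => //.
by rewrite /p3 (posp_neg z0) expr0n /= subr0 posp_pos// expr1n subrr.
Qed.

Lemma ramp_ge1 z : 1 <= z -> ramp z = 1 /\ ramp' z = 0.
Proof.
move=> z1; have z0 : 0 <= z by exact: le_trans z1.
have h : 1 - p3 z <= 0 by rewrite subr_le0 /p3 posp_pos// exprn_ege1.
by rewrite /ramp /ramp' (posp_neg h) {1}/p3 (posp_neg h) !expr0n /= subr0 mulr0 mul0r.
Qed.

Lemma ramp'_ge0 z : 0 <= ramp' z.
Proof. by rewrite mulr_ge0 ?sqr_ge0// mulr_ge0 ?sqr_ge0. Qed.

Lemma ramp'_le z : ramp' z <= 9.
Proof.
have [z1|/ltW z1] := leP z 1; last by rewrite (ramp_ge1 z1).2.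
have h1 : posp (1 - p3 z) ^+ 2 <= 1.
  by rewrite exprn_ile1 ?posp_ge0// posp_le1// gerBl p3_ge0.
have h2 : posp z ^+ 2 <= 1 by rewrite exprn_ile1 ?posp_ge0// posp_le1.
rewrite /ramp' -mulrA ler_piMr// -[leRHS]mulr1.
by apply: ler_pM; rewrite ?sqr_ge0.
Qed.

(* A positive $C^1$ extension of [1 + z] to negative [z]: the Gaussian factor of
   a bump stays smooth before the bump is switched on. *)
Definition poslag (z : R) := 1 + z + posp (- z) ^+ 2.

Lemma poslagE z : 0 <= z -> poslag z = 1 + z.
Proof. by move=> z0; rewrite /poslag posp_neg ?oppr_le0// expr0n /= addr0. Qed.

Lemma poslag_gt0 z : 0 < poslag z.
Proof.
have [z0|/ltW z0] := leP 0 z; first by rewrite poslagE// ltr_pwDl.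
rewrite /poslag posp_pos ?oppr_ge0// sqrrN.
have -> : 1 + z + z ^+ 2 = (z + 2^-1) ^+ 2 + 3 / 4 by field.
by rewrite ltr_wpDl ?sqr_ge0// divr_gt0.
Qed.

Lemma is_der_poslag (z : R) : is_derive z 1 poslag (1 - 2 * posp (- z)).
Proof.
apply: (is_der_eq (is_derD (is_derD (is_der_cst 1 z) (is_der_id z))
  (is_der_comp (is_der_posp2 _) (is_derN (is_der_id z))))).
by rewrite add0r mulrN1.
Qed.

(** Space derivatives of [gam] by order. Every order above 2 gets the placeholder [gamzz]; the
    derivation rule is stated for orders at most 1. *)
Definition gder (k : nat) : R -> R -> R :=
  match k with 0 => gam | 1 => gamz | _ => gamzz end.

Arguments gder : simpl never.

Lemma is_der_gder k (z a : R) : (k <= 1)%N -> 0 < a ->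
  is_derive z 1 (fun z => gder k z a) (gder k.+1 z a).
Proof.
case: k => [|[|//]] _ a0; [exact: is_der_gam_z|exact: is_der_gamz_z].
Qed.

Lemma cont_gder (P : topologicalType) k (z a : P -> R) : continuous z -> continuous a ->
  (forall p, 0 < a p) -> continuous (fun p => gder k (z p) (a p)).
Proof.
move=> cz ca a0 p.
have e : (fun p => gder k (z p) (a p)) =
    (fun p => gder k (z p, - a p).1 (0 - (z p, - a p).2)).
  by apply/funext => q /=; rewrite sub0r opprK.
have h : {for (z p, - a p), continuous (fun q : R * R => gder k q.1 (0 - q.2))}.
  have ap : - a p < 0 by rewrite oppr_lt0.
  by case: k {e} => [|[|k]]; [exact: for_cont_gam|exact: for_cont_gamz|exact: for_cont_gamzz].
rewrite e; apply: (@continuous_comp _ _ _ (fun p => (z p, - a p))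
  (fun q : R * R => gder k q.1 (0 - q.2)) p _ h).
apply: (@cont_pair _ _ _ z (fun p => - a p)) => //.
have -> : (fun p => - a p) = (fun p => 0 - a p) by apply/funext => q; rewrite sub0r.
by apply: continuousBR => //; exact: cont_cst.
Qed.

Variables (n : nat) (x0 : 'rV[R]_n).

(** A mixed partial derivative of the Gaussian, [d i] being the order in coordinate [i]. With this
    indexing the space derivatives of a bump are again of the form [bumpD]. *)
Definition gprod (d : 'I_n -> nat) (x : 'rV[R]_n) (a : R) :=
  \prod_(i < n) gder (d i) (x 0 i - x0 0 i) a.

Lemma cont_gprod (P : topologicalType) d (x : P -> 'rV[R]_n) (a : P -> R) :
  continuous x -> continuous a -> (forall p, 0 < a p) -> continuous (fun p => gprod d (x p) (a p)).
Proof.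
move=> cx ca a0; apply: cont_bigprod => i; apply: cont_gder => //.
apply: continuousBR; last exact: cont_cst.
exact: (cont_comp cx (@continuous_coord R n i)).
Qed.

Lemma gprod0 x a : gprod (fun=> 0%N) x a = Gam x0 x a. Proof. by []. Qed.

Variables (A s th : R).
Hypothesis th0 : 0 < th.

Let zt (t : R) := (t - s) / th.
(** The age of the Gaussian. It equals [th] at the switching time [s], so the bump never gets
    narrower than [sqrt th]. *)
Definition bump_lag (t : R) := th * poslag (zt t).

Lemma bump_lag_gt0 t : 0 < bump_lag t. Proof. by rewrite mulr_gt0// poslag_gt0. Qed.

Lemma bump_lagE t : s <= t -> bump_lag t = t - s + th.
Proof.
move=> st; rewrite /bump_lag poslagE; last by rewrite divr_ge0 ?subr_ge0// ltW.
by rewrite /zt; field; rewrite gt_eqF.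
Qed.

Let is_der_zt (t : R) : is_derive t 1 zt th^-1.
Proof.
apply: (is_der_eq (is_derM (is_derB (is_der_id t) (is_der_cst s t)) (is_der_cst th^-1 t))).
by rewrite subr0 mul1r mulr0 addr0.
Qed.

Let is_der_lag (t : R) : is_derive t 1 bump_lag (1 - 2 * posp (- zt t)).
Proof.
apply: (is_der_eq (is_derM (is_der_cst th t) (is_der_comp (is_der_poslag _) (is_der_zt t)))).
by rewrite mul0r add0r mulrCA divff ?mulr1// gt_eqF.
Qed.

Let continuous_zt : continuous (fun p : 'rV[R]_n * R => zt p.2).
Proof.
apply: continuousMR; last exact: cont_cst.
by apply: continuousBR; cont_proj.
Qed.

Let continuous_lag : continuous (fun p : 'rV[R]_n * R => bump_lag p.2).
Proof.
have cl : continuous bump_lag by move=> t; exact: is_der_continuous (is_der_lag t).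
by refine (@cont_comp _ _ _ (fun p : 'rV[R]_n * R => p.2) bump_lag _ cl); cont_proj.
Qed.

Definition bumpD (d : 'I_n -> nat) (p : 'rV[R]_n * R) :=
  A * (ramp (zt p.2) * gprod d p.1 (bump_lag p.2)).

(** The time derivative of a bump, in which the time derivative of the Gaussian is written as its
    Laplacian. Before [s], where the age is not affine in [t], this is still correct because [ramp]
    vanishes there. *)
Definition bumpT (p : 'rV[R]_n * R) := A * (ramp' (zt p.2) / th * gprod (fun=> 0%N) p.1 (bump_lag p.2) +
  ramp (zt p.2) * \sum_(i < n) gprod (fun k => (k == i) + (k == i))%N p.1 (bump_lag p.2)).

Lemma bumpD_continuous d : continuous (bumpD d).
Proof.
apply: continuousMR; first exact: cont_cst.
apply: continuousMR.
  by refine (@cont_comp _ _ _ (fun p : 'rV[R]_n * R => zt p.2) ramp _ continuous_ramp).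
apply: cont_gprod => //; first by cont_proj.
by move=> p; exact: bump_lag_gt0.
Qed.

Lemma bumpT_continuous : continuous bumpT.
Proof.
have cg d : continuous (fun p : 'rV[R]_n * R => gprod d p.1 (bump_lag p.2)).
  by apply: cont_gprod => //; [cont_proj|move=> p; exact: bump_lag_gt0].
apply: continuousMR; first exact: cont_cst.
apply: continuousDR.
  apply: continuousMR => //; apply: continuousMR; last exact: cont_cst.
  by refine (@cont_comp _ _ _ (fun p : 'rV[R]_n * R => zt p.2) ramp' _ continuous_ramp').
apply: continuousMR; last exact: cont_bigsum.
by refine (@cont_comp _ _ _ (fun p : 'rV[R]_n * R => zt p.2) ramp _ continuous_ramp).
Qed.

Lemma is_derive_bumpD d j p : (d j <= 1)%N ->
  is_derive p (ex R j) (bumpD d) (bumpD (fun k => d k + (k == j))%N p).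
Proof.
move=> dj; have lp := bump_lag_gt0 p.2.
set a := bump_lag p.2 in lp.
pose Q := \prod_(k < n | k != j) gder (d k) (p.1 0 k - x0 0 k) a.
have -> : bumpD (fun k => d k + (k == j))%N p = A * (ramp (zt p.2) * Q) * gder (d j).+1 (p.1 0 j - x0 0 j) a.
  rewrite /bumpD /gprod -/a (bigD1 j)//= eqxx addn1.
  have -> : \prod_(k < n | k != j) gder (d k + (k == j)) (p.1 0 k - x0 0 k) a = Q.
    by apply: eq_bigr => k /negbTE ->; rewrite addn0.
  by ring.
apply: (@is_derive_growth _ _ _ _ (fun z : R => A * (ramp (zt p.2) * Q) * gder (d j) z a) p _
  (p.1 0 j - x0 0 j) 1) => [h|].
  rewrite /bumpD /gprod /= scaler0 add0r -/a (bigD1 j)//= !mxE eqxx.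
  have -> : \prod_(k < n | k != j) gder (d k) ((h *: delta_mx 0 j + p.1) 0 k - x0 0 k) a = Q.
    by apply: eq_bigr => k /negbTE kj; rewrite !mxE eqxx kj /= mulr0 add0r.
  have -> : h *: (1 : R) + (p.1 0 j - x0 0 j) = h * 1 + p.1 0 j - x0 0 j by rewrite addrA.
  by rewrite eqxx /=; ring.
apply: (is_der_eq (is_derM (is_der_cst _ _) (is_der_gder _ dj lp))).
by rewrite mul0r add0r.
Qed.

Lemma is_derive_bumpT p : is_derive p (@et R n) (bumpD (fun=> 0%N)) (bumpT p).
Proof.
have lp := bump_lag_gt0 p.2.
apply: (@is_derive_growth _ _ _ _ (fun t : R => A * (ramp (zt t) *
  \prod_(i < n) gam (p.1 0 i - x0 0 i) (bump_lag t))) p _ p.2 1) => [h|].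
  by rewrite /bumpD /gprod /= scaler0 add0r.
have dg (i : 'I_n) : is_derive p.2 1 (fun t => gam (p.1 0 i - x0 0 i) (bump_lag t))
    (gamzz (p.1 0 i - x0 0 i) (bump_lag p.2) * (1 - 2 * posp (- zt p.2))).
  by apply: is_der_comp; [exact: is_der_gam_a|exact: is_der_lag].
apply: (is_der_eq (is_derM (is_der_cst A _) (is_derM (is_der_comp (is_der_ramp _) (is_der_zt p.2))
  (@is_derive_bigprod R n (fun i t => gam (p.1 0 i - x0 0 i) (bump_lag t))
    (fun i t => gamzz (p.1 0 i - x0 0 i) (bump_lag t) * (1 - 2 * posp (- zt t))) p.2 dg)))).
rewrite mul0r add0r /bumpT; congr (_ * (_ + _)).
have [z0|/ltW z0] := leP (zt p.2) 0; first by rewrite (ramp_neg z0).1 !mul0r.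
congr (_ * _); apply: eq_bigr => i _.
rewrite (@posp_neg _ (- zt p.2)) ?oppr_le0// mulr0 subr0 mulr1 /gprod [RHS](bigD1 i)//= eqxx.
by congr (_ * _); apply: eq_bigr => k /negbTE ->.
Qed.

(** Since the Gaussian solves the heat equation, only the derivative of [ramp] produces a source,
    hence only for [t] between [s] and [s + th]. *)
Lemma bump_source p : bumpT p - \sum_(i < n) bumpD (fun k => (k == i) + (k == i))%N p =
  A * (ramp' (zt p.2) / th * Gam x0 p.1 (bump_lag p.2)).
Proof.
rewrite /bumpT /bumpD -mulr_sumr -mulr_sumr mulrDr addrK.
by rewrite gprod0.
Qed.

End bump.

(** * Series of functions with geometric tails, and their derivatives *)

Section geometric_series.
Context {R : realType} (r : R).
Hypotheses (r0 : 0 < r) (r1 : r < 1).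

Let r10 : 0 < 1 - r. Proof. by rewrite subr_gt0. Qed.

Lemma geo_sum_le J N : \sum_(J <= m < N) r ^+ m <= r ^+ J / (1 - r).
Proof.
have [JN|NJ] := leqP J N; last first.
  by rewrite big_geq ?divr_ge0 ?exprn_ge0 ?(ltW r0) ?(ltW r10)// ltnW.
apply: (@le_trans _ _ ((r ^+ J - r ^+ N) / (1 - r))).
  rewrite -(subnKC JN); elim: (N - J)%N => [|k IH].
    by rewrite addn0 big_geq// subrr mul0r.
  rewrite addnS big_nat_recr ?leq_addr//= exprS.
  apply: le_trans (lerD IH (lexx _)) _; rewrite le_eqVlt; apply/orP; left; apply/eqP.
  by field; rewrite gt_eqF.
by rewrite ler_pM2r ?invr_gt0// gerBl exprn_ge0// ltW.
Qed.

Lemma geo_partial_le (a : nat -> R) C m0 J N : (m0 <= J)%N -> (J <= N)%N ->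
  (forall m, (m0 <= m)%N -> `|a m| <= C * r ^+ m) ->
  `|series a N - series a J| <= C * r ^+ J / (1 - r).
Proof.
move=> mJ JN aC; have -> : series a N - series a J = \sum_(J <= m < N) a m.
  by rewrite sub_series_geq.
apply: le_trans (ler_norm_sum _ _ _) _.
apply: (@le_trans _ _ (\sum_(J <= m < N) C * r ^+ m)).
  rewrite big_nat_cond [leRHS]big_nat_cond; apply: ler_sum => m /andP[/andP[Jm _] _].
  by apply: aC; exact: leq_trans Jm.
have C0 : 0 <= C.
  by rewrite -(@pmulr_lge0 _ (r ^+ m0)) ?exprn_gt0// (le_trans _ (aC m0 (leqnn _))).
by rewrite -mulr_sumr -mulrA ler_wpM2l//; exact: geo_sum_le.
Qed.

Lemma geo_cvg (a : nat -> R) C m0 : (forall m, (m0 <= m)%N -> `|a m| <= C * r ^+ m) ->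
  cvg (series a @ \oo).
Proof.
move=> aC; apply: normed_cvg.
pose C' := `|C| + \sum_(0 <= m < m0) `|a m| / r ^+ m.
have s0 m : 0 <= `|a m| / r ^+ m by rewrite divr_ge0// exprn_ge0// ltW.
have C'0 : 0 <= C' by rewrite addr_ge0// sumr_ge0.
apply: (@series_le_cvg _ _ (geometric C' r)) => [m|m|m|] //=.
- by rewrite mulr_ge0// exprn_ge0// ltW.
- have rm : 0 < r ^+ m by rewrite exprn_gt0.
  have [mm|mm] := leqP m0 m.
    apply: le_trans (aC m mm) _; rewrite ler_pM2r//.
    apply: le_trans (ler_norm _) _; by rewrite lerDl sumr_ge0.
  rewrite -ler_pdivrMr// /C' (bigD1_seq m) /= ?iota_uniq ?mem_index_iota//.
  by rewrite addrCA lerDl addr_ge0// sumr_ge0.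
- by apply: is_cvg_geometric_series; rewrite gtr0_norm.
Qed.

Lemma geo_tail (a : nat -> R) C m0 J : (m0 <= J)%N ->
  (forall m, (m0 <= m)%N -> `|a m| <= C * r ^+ m) ->
  `|limn (series a) - series a J| <= C * r ^+ J / (1 - r).
Proof.
move=> mJ aC; have ca := geo_cvg aC.
have h : `|series a N - series a J| @[N --> \oo] --> `|limn (series a) - series a J|.
  by apply: cvg_norm; apply: cvgB => //; exact: cvg_cst.
apply: (cvgr_to_le h); exists J => //= N JN.
exact: geo_partial_le aC.
Qed.

Lemma series_ge_partial (a : nat -> R) J : cvg (series a @ \oo) -> (forall m, 0 <= a m) ->
  series a J <= limn (series a).
Proof.
move=> ca a0; apply: nondecreasing_cvgn_le => //.
by apply/nondecreasing_seqP => m; rewrite /series /= big_nat_recr//= lerDl.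
Qed.

Lemma series_ge_term (a : nat -> R) m : cvg (series a @ \oo) -> (forall m, 0 <= a m) ->
  a m <= limn (series a).
Proof.
move=> ca a0; apply: le_trans (series_ge_partial m.+1 ca a0).
by rewrite /series /= big_nat_recr//= lerDr sumr_ge0.
Qed.

Lemma series_le_bound (a : nat -> R) B : cvg (series a @ \oo) ->
  (forall J, series a J <= B) -> limn (series a) <= B.
Proof. by move=> ca aB; apply: limr_le => //; apply: nearW. Qed.

Lemma geo_small (C e : R) m0 : 0 < e -> exists2 J, (m0 <= J)%N & C * r ^+ J / (1 - r) < e.
Proof.
move=> e0.
have r1' : `|r| < 1 by rewrite gtr0_norm.
have h : (C / (1 - r) * r ^+ J) @[J --> \oo] --> (C / (1 - r) * 0 : R).
  by apply: cvgM; [exact: cvg_cst|exact: cvg_expr].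
rewrite mulr0 in h; have /(cvgr_lt 0)/(_ _ e0)[J0 _ HJ] := h.
exists (maxn m0 J0); first exact: leq_maxl.
by have := HJ (maxn m0 J0) (leq_maxr _ _); rewrite /= mulrAC.
Qed.

Section functions.
Variable V : normedModType R.
Implicit Type F : nat -> V -> R.

Definition fsum F (q : V) := limn (series (fun m => F m q)).

(** The constant and the starting index may depend on the point: for the cascade they degenerate as
    the time tends to 0. *)
Definition geo_bounded F (p : V) := exists C m0, \forall q \near p,
  forall m, (m0 <= m)%N -> `|F m q| <= C * r ^+ m.

Lemma geo_bounded_cvg F p : geo_bounded F p -> cvg (series (fun m => F m p) @ \oo).
Proof. by move=> [C [m0 /nbhs_singleton h]]; exact: (geo_cvg h). Qed.

Lemma for_cont_partial F p J : (forall m, {for p, continuous (F m)}) ->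
  {for p, continuous (fun q => series (fun m => F m q) J)}.
Proof.
move=> cF; rewrite (_ : (fun q => _) = (fun q => \sum_(m <- index_iota 0 J) F m q)) //.
exact: for_contS.
Qed.

Lemma fsum_continuous F p : geo_bounded F p -> (forall m, {for p, continuous (F m)}) ->
  {for p, continuous (fsum F)}.
Proof.
move=> [C [m0 Hb]] cF; apply/cvgrPdist_lt => e e0.
have e3 : 0 < e / 3 by rewrite divr_gt0.
have [J mJ HJ] := geo_small C m0 e3.
have /cvgrPdist_lt/(_ _ e3) hJ := @for_cont_partial F p J cF.
near=> q.
have hq : forall m, (m0 <= m)%N -> `|F m q| <= C * r ^+ m by near: q.
have hp : forall m, (m0 <= m)%N -> `|F m p| <= C * r ^+ m := nbhs_singleton Hb.
have h1 := le_lt_trans (geo_tail mJ hq) HJ.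
have h2 := le_lt_trans (geo_tail mJ hp) HJ.
have h3 : `|series (fun m => F m p) J - series (fun m => F m q) J| < e / 3 by near: q.
move: h1 h2 h3; rewrite -/(fsum F q) -/(fsum F p) !ltr_distl.
by move: (fsum F q) (fsum F p) (series _ J) (series _ J) => a1 a2 a3 a4; lra.
Unshelve. all: by end_near. Qed.

Lemma segment_mvt (F F' : V -> R) (p v : V) (e M h : R) : 0 < e ->
  (forall q, ball p e q -> is_derive q v F (F' q) /\ `|F' q| <= M) ->
  `|h| * `|v| < e -> `|F (h *: v + p) - F p| <= `|h| * M.
Proof.
move=> e0 HF hv.
have inb (t : R) : `|t| <= `|h| -> ball p e (t *: v + p).
  move=> th; rewrite -ball_normE /= distrC addrK normrZ (le_lt_trans _ hv)//.
  by rewrite ler_wpM2r.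
pose phi (t : R) := F (t *: v + p).
have dphi (t : R) : `|t| <= `|h| -> is_derive t 1 phi (F' (t *: v + p)).
  move=> /inb/HF[dF _].
  by apply: (is_derive_path _ dF) => k; rewrite scalerDl addrA.
have M0 : 0 <= M by have [_] := HF _ (ballxx p e0); exact: le_trans.
have key (a b : R) : a <= b -> (forall t, a <= t <= b -> `|t| <= `|h|) -> b - a <= `|h| ->
    `|phi b - phi a| <= `|h| * M.
  move=> ab abh bah.
  have [||t] := @MVT_segment R phi (fun t => F' (t *: v + p)) a b ab.
  - by move=> t; rewrite in_itv/= => /andP[/ltW h1 /ltW h2]; apply: dphi; apply: abh; rewrite h1.
  - apply: continuous_in_subspaceT => t /[!inE]/=; rewrite in_itv/= => Iab.
    by apply: is_der_continuous; apply: dphi; exact: abh.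
  rewrite in_itv/= => Iab ->; rewrite normrM mulrC; apply: ler_pM => //.
    by rewrite ger0_norm// subr_ge0.
  by have [] := HF _ (inb _ (abh _ Iab)).
have p0 : F p = phi 0 by rewrite /phi scale0r add0r.
rewrite p0 -/(phi h); have [h0|/ltW h0] := leP 0 h.
  apply: key => //; last by rewrite subr0 ger0_norm.
  by move=> t /andP[t0 th]; rewrite !ger0_norm.
rewrite distrC; apply: key => //; last by rewrite sub0r ler0_norm.
by move=> t /andP[t0 th]; rewrite !ler0_norm// lerN2.
Qed.

Lemma is_derive_partial F F' p v J : (forall m, is_derive p v (F m) (F' m p)) ->
  is_derive p v (fun q => series (fun m => F m q) J) (series (fun m => F' m p) J).
Proof.
move=> dF; elim: J => [|J IH].
  rewrite /series /= (_ : (fun q => _) = cst 0); last by apply/funext => q; rewrite big_geq.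
  by rewrite big_geq//; exact: is_derive_cst.
rewrite /series /= (_ : (fun q => _) = (fun q => \sum_(0 <= m < J) F m q) + F J); last first.
  by apply/funext => q; rewrite big_nat_recr.
by rewrite big_nat_recr//=; exact: is_deriveD.
Qed.

(** By the mean value inequality along the segment, the difference quotients of the tail are bounded
    by the geometric tail of [F'], uniformly in [h]; finitely many terms remain, which are
    differentiated one by one. *)
Lemma fsum_is_derive F F' p v : geo_bounded F p -> geo_bounded F' p ->
  (forall q m, is_derive q v (F m) (F' m q)) ->
  is_derive p v (fsum F) (fsum F' p).
Proof.
move=> [C0 [m1 Hb0]] [C [m2 Hb]] dF.
suff H : h^-1 *: (fsum F (h *: v + p) - fsum F p) @[h --> 0^'] --> fsum F' p.
  by apply: DeriveDef; [apply/cvg_ex; exists (fsum F' p)|exact/cvg_lim].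
apply/cvgrPdist_lt => e e0.
have e3 : 0 < e / 3 by rewrite divr_gt0.
have [J mJ HJ] := geo_small C m2 e3.
have near3 : \forall q \near p, [/\ forall m, (m1 <= m)%N -> `|F m q| <= C0 * r ^+ m,
    forall m, (m2 <= m)%N -> `|F' m q| <= C * r ^+ m & forall m, is_derive q v (F m) (F' m q)].
  by near=> q; split; [near: q|near: q|move=> m; exact: dF].
have /nbhs_ballP[d /= d0 Hd] := near3.
have [dJ DJ] := @is_derive_partial F F' p v J (fun m => let: And3 _ _ c := nbhs_singleton near3 in c m).
have limJ : h^-1 *: (series (fun m => F m (h *: v + p)) J - series (fun m => F m p) J)
    @[h --> 0^'] --> series (fun m => F' m p) J.
  by rewrite -DJ; exact: dJ.
have /cvgrPdist_lt/(_ _ e3) hJ := limJ.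
have v1 : 0 < `|v| + 1 by rewrite ltr_wpDl.
have dv : 0 < d / (`|v| + 1) by rewrite divr_gt0.
near=> h.
have h0 : h != 0 by near: h; exact: nbhs_dnbhs_neq.
have hd : `|h| < d / (`|v| + 1) by near: h; exact: dnbhs0_lt.
have hv : `|h| * `|v| < d.
  move: hd; rewrite ltr_pdivlMr// mulrDr mulr1 => hd; apply: le_lt_trans hd.
  by rewrite lerDl.
have h3 : `|series (fun m => F' m p) J - h^-1 *: (series (fun m => F m (h *: v + p)) J -
    series (fun m => F m p) J)| < e / 3 by near: h.
have bh : ball p d (h *: v + p).
  by rewrite -ball_normE /= distrC addrK normrZ.
have [q1 _ _] := Hd _ bh; have [p1 p2 _] := Hd _ (ballxx p d0).
pose a m := F m (h *: v + p) - F m p.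
have ha m : (m2 <= m)%N -> `|a m| <= `|h| * C * r ^+ m.
  move=> mm; rewrite -mulrA; apply: (@segment_mvt (F m) (F' m) p v d (C * r ^+ m) h d0) => //.
  by move=> q /Hd[_ q2 q3]; split; [exact: q3|exact: q2].
have La : limn (series a) = fsum F (h *: v + p) - fsum F p.
  by rewrite /fsum -lim_seriesB//; [exact: geo_cvg q1|exact: geo_cvg p1].
have Sa : series a J = series (fun m => F m (h *: v + p)) J - series (fun m => F m p) J.
  by rewrite /series /= sumrB.
have t1 := geo_tail mJ ha; rewrite La Sa in t1.
have t2 := le_lt_trans (geo_tail mJ p2) HJ; rewrite -/(fsum F' p) in t2.
have t1' : `|h^-1 *: (fsum F (h *: v + p) - fsum F p) -
    h^-1 *: (series (fun m => F m (h *: v + p)) J - series (fun m => F m p) J)| < e / 3.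
  rewrite -scalerBr normrZ normfV ltr_pdivrMl ?normr_gt0//.
  apply: le_lt_trans t1 _; rewrite -!mulrA ltr_pM2l ?normr_gt0//.
  by rewrite mulrA.
move: t1' t2 h3; rewrite !ltr_distl.
set a1 := h^-1 *: (fsum F _ - _); set a2 := h^-1 *: (series _ J - _); set a3 := fsum F' p.
by move: a1 a2 a3 (series (fun m => F' m p) J) => b1 b2 b3 b4; lra.
Unshelve. all: by end_near. Qed.

End functions.

End geometric_series.

(** * The sum of all bumps and its regularity at positive times *)

Section cascade.
Context {R : realType}.
Variables (n : nat) (x0 : 'rV[R]_n) (kp th0 : R) (st : nat -> nat).
Hypotheses (th00 : 0 < th0) (kpn : kp < n%:R).
Hypotheses (stm : forall m, (st m <= m)%N)
  (stoo : forall k, exists m0, forall m, (m0 <= m)%N -> (k <= st m)%N).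

(** With ratio 16, bump [m.+1], whose age while it is switched on is at most [2 * cth m.+1], decays
    in space at least as fast as the lower bound for the nonlocal term created by bump [m]. Given
    the ratio, two demands determine [cs]: consecutive bumps start [3 * cth m] apart, so bump [m]
    starts [16 / 5 * cth m] before the focusing time, and a seed starts at [- cth m], which puts the
    focusing time at [16 / 5 - 1 = 11 / 5] times the seed scale. *)
Definition cth (m : nat) : R := th0 * 16^-1 ^+ m.
Definition cA (m : nat) : R := powR (cth m) ((n%:R - kp) / 2).
(* The cascade of index [st m] focuses at the time [11 / 5 * cth (st m)]. *)
Definition cs (m : nat) : R := 11 / 5 * cth (st m) - 16 / 5 * cth m.
(** The amplitude [cA m] is a constant times [cr ^+ m]: at positive times the series of bumps is
    geometric with this ratio. *)
Definition cr : R := powR 16^-1 ((n%:R - kp) / 2).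

Lemma cth_gt0 m : 0 < cth m. Proof. by rewrite mulr_gt0// exprn_gt0// invr_gt0. Qed.

Lemma cthS m : cth m = 16 * cth m.+1.
Proof. by rewrite /cth exprS; field. Qed.

Lemma cth_le m k : (m <= k)%N -> cth k <= cth m.
Proof.
by move=> mk; rewrite ler_pM2l//; apply: ler_wiXn2l => //; rewrite ?invr_ge0// invf_le1// ler1n.
Qed.

Lemma cth_le0 m : cth m <= th0.
Proof. by apply: le_trans (cth_le (leq0n m)) _; rewrite /cth expr0 mulr1. Qed.

Lemma cth_small e : 0 < e -> exists k, forall m, (k <= m)%N -> cth m < e.
Proof.
move=> e0; have b1 : `|16^-1 : R| < 1 by rewrite gtr0_norm ?invr_gt0// invf_lt1// ltr1n.
have h : cth m @[m --> \oo] --> (th0 * 0 : R).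
  by apply: cvgM; [exact: cvg_cst|exact: cvg_expr].
rewrite mulr0 in h; have /(cvgr_lt 0)/(_ _ e0)[k _ Hk] := h.
by exists k => m km; exact: Hk.
Qed.

Let e0 : 0 < (n%:R - kp) / 2. Proof. by rewrite divr_gt0// subr_gt0. Qed.

Lemma cr_gt0 : 0 < cr. Proof. by rewrite powR_gt0// invr_gt0. Qed.

Lemma powR16_lt1 (e : R) : 0 < e -> powR 16^-1 e < 1.
Proof.
move=> he; rewrite -[ltRHS](_ : powR (1 : R) e = 1); last by rewrite powR1.
by apply: gt0_ltr_powR => //; rewrite ?nnegrE ?invr_ge0// invf_lt1// ltr1n.
Qed.

Lemma cr_lt1 : cr < 1. Proof. exact: powR16_lt1. Qed.

Lemma cth_powR (e : R) m : powR (cth m) e = powR th0 e * powR 16^-1 e ^+ m.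
Proof.
rewrite /cth powRM ?(ltW th00) ?exprn_ge0 ?invr_ge0//; congr (_ * _).
by rewrite -powR_mulrn ?invr_ge0// powRAC powR_mulrn// powR_ge0.
Qed.

Lemma cA_ge0 m : 0 <= cA m. Proof. exact: powR_ge0. Qed.

Lemma cs_ge m : - cth m <= cs m.
Proof. by rewrite /cs; have := cth_le (stm m); move: (cth (st m)) (cth m) => a b; lra. Qed.

(** As [st m] tends to infinity, so do the scales and the focusing times tend to 0: at a given
    positive time all bumps but finitely many are completely switched on. *)
Lemma cs_late e : 0 < e -> exists m0, forall m, (m0 <= m)%N -> cs m + cth m <= e /\ cth m <= e.
Proof.
move=> he; have e3 : 0 < e / 3 by rewrite divr_gt0.
have [k Hk] := cth_small e3; have [m0 Hm0] := stoo k.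
exists m0 => m /Hm0 km; have h1 := Hk _ km; have h2 := Hk _ (leq_trans km (stm m)).
have h3 := cth_gt0 m; have h4 := cth_gt0 (st m).
by rewrite /cs; move: (cth (st m)) (cth m) h1 h2 h3 h4 => a b; lra.
Qed.

(** Once switched on, all bumps and their derivatives are values of one continuous function [Psi] of
    the position and the age, times the amplitude. Near [p] the ages of late bumps stay in a compact
    part of the positive axis, so [Psi] is bounded there. *)
Lemma late_bump_geo (F : nat -> 'rV[R]_n * R -> R) (Psi : 'rV[R]_n * R -> R) p : 0 < p.2 ->
  (forall m q, cs m + cth m <= q.2 -> F m q = cA m * Psi (q.1, q.2 - cs m + cth m)) ->
  (forall q, 0 < q.2 -> {for q, continuous Psi}) -> geo_bounded cr F p.
Proof.
move=> p0 FP cP; pose tau := p.2 / 2; have tau0 : 0 < tau by rewrite divr_gt0.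
have t20 : 0 < tau / 2 by rewrite divr_gt0.
have [m0 Hm0] := cs_late t20.
pose K1 := [set v : 'rV[R]_n | forall i, `[p.1 0 i - 1, p.1 0 i + 1]%classic (v ord0 i)].
(* The age is [q.2 - cs m + cth m], with [- cs m <= cth m <= th0]; hence the summand [2 * th0]. *)
pose K := K1 `*` `[tau / 2, p.2 + 1 + 2 * th0].
have cK : compact K.
  apply: compact_setX; last exact: segment_compact.
  by apply: (@rV_compact R n (fun i => `[p.1 0 i - 1, p.1 0 i + 1]%classic)) => i; exact: segment_compact.
have cPK : {within K, continuous (fun q => `|Psi q|)}.
  apply: continuous_in_subspaceT => q /[!inE] -[_ /=]; rewrite in_itv/= => /andP[h _].
  apply: (@continuous_comp _ _ _ Psi (fun x : R => `|x|)); last exact: norm_continuous.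
  by apply: cP; exact: lt_le_trans h.
have KP : K (p.1, tau / 2).
  split => [i|] /=; rewrite in_itv/=.
    by rewrite gerBl lerDl ler01.
  rewrite lexx/=; apply: (@le_trans _ _ p.2); first by rewrite /tau; lra.
  by rewrite -addrA lerDl addr_ge0// mulr_ge0// ltW.
have [qm _ Hmax] := compact_EVT_max (ex_intro _ _ KP) cK cPK.
exists (powR th0 ((n%:R - kp) / 2) * `|Psi qm|), m0.
near=> q => m mm; have [h1 h2] := Hm0 m mm.
have qp : ball p (Num.min tau 1) q by near: q; apply: nbhsx_ballx; rewrite lt_min tau0 ltr01.
move: qp => [/= q1 q2]; rewrite -ball_normE /= in q1; rewrite -ball_normE /= in q2.
have q2a : tau < q.2.
  move: q2; rewrite lt_min => /andP[+ _]; rewrite ltr_distl => /andP[_].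
  by rewrite /tau; move: (p.2) (q.2) => a b; lra.
have q2b : q.2 < p.2 + 1.
  by move: q2; rewrite lt_min distrC => /andP[_]; rewrite ltr_distl => /andP[].
have late : cs m + cth m <= q.2.
  by apply: le_trans h1 _; apply: ltW; apply: le_lt_trans q2a; lra.
rewrite FP// normrM (ger0_norm (cA_ge0 m)) /cA cth_powR -/cr -!mulrA ler_wpM2l ?powR_ge0//.
rewrite mulrC ler_wpM2r ?exprn_ge0 ?(ltW cr_gt0)//.
apply: Hmax; rewrite inE; split => /=.
  move=> i; rewrite /= in_itv/= -ler_distl.
  have : `|q.1 - p.1| <= 1.
    by move: q1; rewrite lt_min distrC => /andP[_ /ltW].
  by move=> /(inboxP _ _ ler01)/(_ i); rewrite ctrE.
have h3 := cth_gt0 m; have h4 := cs_ge m; have h5 := cth_le0 m.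
rewrite in_itv/=; apply/andP; split.
  by move: (q.2) (cs m) (cth m) (tau) q2a h1 h3 => a1 a2 a3 a4; lra.
by move: (q.2) (p.2) (cs m) (cth m) q2b h4 h5 => a1 a2 a3 a4; lra.
Unshelve. all: by end_near. Qed.

Definition cbD d m := bumpD x0 (cA m) (cs m) (cth m) d.
Definition cbT m := bumpT x0 (cA m) (cs m) (cth m).

Let late_ramp m (q : 'rV[R]_n * R) : cs m + cth m <= q.2 ->
  [/\ ramp ((q.2 - cs m) / cth m) = 1, ramp' ((q.2 - cs m) / cth m) = 0 &
      bump_lag (cs m) (cth m) q.2 = q.2 - cs m + cth m].
Proof.
move=> h; have c0 := cth_gt0 m.
have z1 : 1 <= (q.2 - cs m) / cth m by rewrite ler_pdivlMr// mul1r lerBrDl.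
have [-> ->] := ramp_ge1 z1; split => //; apply: bump_lagE => //.
by apply: le_trans h; rewrite lerDl ltW.
Qed.

Lemma for_cont_gprod d (q : 'rV[R]_n * R) : 0 < q.2 ->
  {for q, continuous (fun p : 'rV[R]_n * R => gprod x0 d p.1 p.2)}.
Proof.
(* The age is replaced by one that is bounded below by [q.2 / 2] everywhere and agrees with it near
   [q]. *)
move=> q0; have : {for q, continuous (fun p : 'rV[R]_n * R => gprod x0 d p.1 (Num.max p.2 (q.2 / 2)))}.
  apply: cont_gprod; first by cont_proj.
    move=> p; apply: (@continuous_max _ _ (fun p : 'rV[R]_n * R => p.2) (fun=> q.2 / 2)); last exact: cvg_cst.
    exact: (@cont_snd _ _ _ (fun x => x) (@cont_id _)).
  by move=> p; rewrite lt_max divr_gt0// orbT.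
have q2 : q.2 / 2 < q.2 by rewrite ltr_pdivrMr// ltr_pMr// ltr1n.
rewrite /prop_for /continuous_at max_l ?(ltW q2)//; apply: cvg_trans; apply: near_eq_cvg.
have c2 : {for q, continuous (fun p : 'rV[R]_n * R => p.2)}.
  by apply: cont_snd; exact: cont_id.
near=> p; rewrite max_l// ltW//; near: p; exact: (cvgr_gt _ c2).
Unshelve. all: by end_near. Qed.

Lemma cbD_geo d p : 0 < p.2 -> geo_bounded cr (cbD d) p.
Proof.
move=> p0; apply: (@late_bump_geo _ (fun q => gprod x0 d q.1 q.2)) => //.
  by move=> m q /late_ramp[h1 _ h2]; rewrite /cbD /bumpD h1 h2 mul1r.
by move=> q q0; exact: for_cont_gprod.
Qed.

Lemma cbT_geo p : 0 < p.2 -> geo_bounded cr cbT p.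
Proof.
move=> p0; apply: (@late_bump_geo _ (fun q => \sum_(i < n) gprod x0 (fun k => (k == i) + (k == i))%N q.1 q.2)) => //.
  by move=> m q /late_ramp[h1 h2 h3]; rewrite /cbT /bumpT h1 h2 h3 !mul0r add0r mul1r.
by move=> q q0; apply: for_contS => i; exact: for_cont_gprod.
Qed.

Definition cu : 'rV[R]_n * R -> R := fsum (cbD (fun=> 0%N)).

Let cont_near (f g : 'rV[R]_n * R -> R) p : (\forall q \near p, f q = g q) ->
  {for p, continuous g} -> {for p, continuous f}.
Proof.
move=> fg; rewrite /prop_for /continuous_at (nbhs_singleton fg); apply: cvg_trans.
by apply: near_eq_cvg; near=> q; apply/esym; near: q.
Unshelve. all: by end_near. Qed.

Let near_pos (p : 'rV[R]_n * R) : 0 < p.2 -> \forall q \near p, 0 < q.2.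
Proof.
move=> p0; have c2 : {for p, continuous (fun p : 'rV[R]_n * R => p.2)}.
  by apply: cont_snd; exact: cont_id.
exact: (cvgr_gt _ c2).
Qed.

Let dD d (p : 'rV[R]_n * R) j : (d j <= 1)%N -> 0 < p.2 ->
  is_derive p (ex R j) (fsum (cbD d)) (fsum (cbD (fun k => d k + (k == j))%N) p).
Proof.
move=> dj p0; apply: (@fsum_is_derive R cr cr_gt0 cr_lt1 _ (cbD d) (cbD (fun k => d k + (k == j))%N)).
- exact: cbD_geo.
- exact: cbD_geo.
- by move=> q m; apply: is_derive_bumpD => //; exact: cth_gt0.
Qed.

Let dT (p : 'rV[R]_n * R) : 0 < p.2 -> is_derive p (@et R n) cu (fsum cbT p).
Proof.
move=> p0; apply: (@fsum_is_derive R cr cr_gt0 cr_lt1 _ (cbD (fun=> 0%N)) cbT).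
- exact: cbD_geo.
- exact: cbT_geo.
- by move=> q m; apply: is_derive_bumpT => //; exact: cth_gt0.
Qed.

Let cD d (p : 'rV[R]_n * R) : 0 < p.2 -> {for p, continuous (fsum (cbD d))}.
Proof.
move=> p0; apply: (@fsum_continuous R cr cr_gt0 cr_lt1); first exact: cbD_geo.
by move=> m; apply: bumpD_continuous; exact: cth_gt0.
Qed.

Let dxE i (p : 'rV[R]_n * R) : 0 < p.2 -> dx i cu p = fsum (cbD (fun k => (k == i))%N) p.
Proof. by move=> p0; have [_] := @dD (fun=> 0%N) p i isT p0. Qed.

Let d2 i j (p : 'rV[R]_n * R) : 0 < p.2 ->
  is_derive p (ex R j) (dx i cu) (fsum (cbD (fun k => (k == i) + (k == j))%N) p).
Proof.
move=> p0; apply: near_eq_is_derive (@dD (fun k => (k == i))%N p j _ p0); last first.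
  by case: (j == i).
by near=> q; apply/esym; apply: dxE; near: q; exact: near_pos.
Unshelve. all: by end_near. Qed.

Lemma cascade_dt p : 0 < p.2 -> dt cu p = fsum cbT p.
Proof. by move=> p0; have [_] := dT p0. Qed.

Lemma cascade_dxx i p : 0 < p.2 -> dx i (dx i cu) p = fsum (cbD (fun k => (k == i) + (k == i))%N) p.
Proof. by move=> p0; have [_] := d2 i i p0. Qed.

Lemma cascade_C21 T : C21 [set p | 0 < p.2 < T] cu.
Proof.
move=> p /= /andP[p0 _]; split.
- exact: cD.
- by have [] := dT p0.
- apply: (@cont_near _ (fsum cbT)).
    by near=> q; apply: cascade_dt; near: q; exact: near_pos.
  apply: (@fsum_continuous R cr cr_gt0 cr_lt1); first exact: cbT_geo.
  by move=> m; apply: bumpT_continuous; exact: cth_gt0.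
move=> i; split.
- by have [] := @dD (fun=> 0%N) p i isT p0.
- apply: (@cont_near _ (fsum (cbD (fun k => (k == i))%N))); last exact: cD.
  by near=> q; apply: dxE; near: q; exact: near_pos.
move=> j; split; first by have [] := d2 i j p0.
apply: (@cont_near _ (fsum (cbD (fun k => (k == i) + (k == j))%N))); last exact: cD.
near=> q; have q0 : 0 < q.2 by near: q; exact: near_pos.
by have [_] := d2 i j q0.
Unshelve. all: by end_near. Qed.

Definition cH m (p : 'rV[R]_n * R) : R :=
  cA m * (ramp' ((p.2 - cs m) / cth m) / cth m * Gam x0 p.1 (bump_lag (cs m) (cth m) p.2)).

(** Convergence is recorded together with the value because [fsum] is a limit that carries no
    information for a divergent series. *)
Lemma cascade_source p : 0 < p.2 ->
  dt cu p - lap cu p = fsum cH p /\ cvg (series (fun m => cH m p) @ \oo).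
Proof.
move=> p0; rewrite cascade_dt// /lap.
under eq_bigr do rewrite cascade_dxx//.
have cT := geo_bounded_cvg cr_gt0 cr_lt1 (cbT_geo p0).
have cD2 i := geo_bounded_cvg cr_gt0 cr_lt1 (cbD_geo (fun k => (k == i) + (k == i))%N p0).
have sE m : cH m p = cbT m p - \sum_(i < n) cbD (fun k => (k == i) + (k == i))%N m p.
  by rewrite /cbT /cbD bump_source.
have h : series (fun m => cH m p) @ \oo --> fsum cbT p - \sum_(i < n) fsum (cbD (fun k => (k == i) + (k == i))%N) p.
  have -> : series (fun m => cH m p) = (fun J => series (fun m => cbT m p) J -
      \sum_(i < n) series (fun m => cbD (fun k => (k == i) + (k == i))%N m p) J).
    apply/funext => J; rewrite /series /= exchange_big /= -sumrB.
    by apply: eq_bigr => m _; rewrite sE.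
  apply: cvgB; first exact: cT.
  elim: (index_enum _) => [|i l IH].
    rewrite big_nil (_ : (fun x : nat => _) = (fun=> 0)); first exact: cvg_cst.
    by apply/funext => J; rewrite big_nil.
  rewrite big_cons (_ : (fun x : nat => _) = (fun J : nat =>
      series (fun m => cbD (fun k => (k == i) + (k == i))%N m p) J +
      \sum_(j <- l) series (fun m => cbD (fun k => (k == j) + (k == j))%N m p) J)).
    by apply: cvgD => //; exact: cD2.
  by apply/funext => J; rewrite big_cons.
by split; [apply/esym; exact: (cvg_lim _ h)|apply/cvg_ex; exists (fsum cbT p - \sum_(i < n) fsum (cbD (fun k => (k == i) + (k == i))%N) p)].
Qed.

End cascade.

Section nonnegative_integrals.
Context {R : realType}.

Lemma intRn_ge0 n (f : 'rV[R]_n -> \bar R) : (forall y, 0 <= f y)%E -> (0 <= intRn f)%E.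
Proof.
elim: n f => [|n IH] f f0 /=; first exact: f0.
by apply: integral_ge0 => a _; apply: IH => y; exact: f0.
Qed.

Lemma int_spacetime_ge0 n T (F : 'rV[R]_n -> R -> \bar R) : (forall y s, 0 <= F y s)%E ->
  (0 <= int_spacetime T F)%E.
Proof. by move=> F0; apply: integral_ge0 => s _; exact: intRn_ge0. Qed.

End nonnegative_integrals.

(** * The source of each bump is paid for by the preceding bump through the nonlocal term *)

Section cascade_source_bound.
Context {R : realType}.
Variables (n : nat) (x0 : 'rV[R]_n) (kp th0 : R) (st : nat -> nat).
Hypotheses (n0 : (0 < n)%N) (th00 : 0 < th0) (kpn : kp < n%:R).
Hypotheses (stm : forall m, (st m <= m)%N)
  (stoo : forall k, exists m0, forall m, (m0 <= m)%N -> (k <= st m)%N).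
Variables (alpha lambda T : R).
Hypotheses (a0 : 0 < alpha) (an : alpha <= 4 * n%:R) (l0 : 0 < lambda).

Local Notation th := (cth th0).
Local Notation s_ := (cs th0 st).
Local Notation u := (cu x0 kp th0 st).
Local Notation bmp := (cbD x0 kp th0 st (fun=> 0%N)).
Let q (x : 'rV[R]_n) := \sum_(i < n) (x 0 i - x0 0 i) ^+ 2.

Lemma bmp_ge0 m p : 0 <= bmp m p.
Proof.
rewrite mulr_ge0 ?cA_ge0// mulr_ge0//; first by case/andP: (ramp01 ((p.2 - s_ m) / th m)).
by rewrite gprod0 Gam_ge0.
Qed.

Let bcvg p : 0 < p.2 -> cvg (series (fun m => bmp m p) @ \oo).
Proof.
move=> p0; apply: (geo_bounded_cvg (cr_gt0 n kp) (cr_lt1 kpn)); exact: cbD_geo.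
Qed.

Lemma cascade_ge0 p : 0 < p.2 -> 0 <= u p.
Proof.
move=> p0; have := series_ge_partial 0 (bcvg p0) (bmp_ge0^~ p).
by rewrite {1}/series /= big_geq.
Qed.

Lemma cascade_ge_bmp m p : 0 < p.2 -> bmp m p <= u p.
Proof. by move=> p0; exact: (series_ge_term m (bcvg p0) (bmp_ge0^~ p)). Qed.

Let c1 : R := Num.sqrt 3 ^- n * expR (- n%:R).
Let ka : R := powR (4 * pi) (- (alpha / 2)).
Let c2 : R := ka * powR 3 (- (alpha / 2)) * expR (- (2 * n%:R)) * powR c1 lambda * (2 ^+ n * 2^-1).
Let c10 : 0 < c1. Proof. by rewrite mulr_gt0 ?expR_gt0// invr_gt0 exprn_gt0// sqrtr_gt0. Qed.
Let c20 : 0 < c2.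
Proof.
have pi4 : 0 < 4 * pi :> R by rewrite mulr_gt0// pi_gt0.
apply: mulr_gt0; last by rewrite mulr_gt0 ?invr_gt0// exprn_gt0.
by rewrite !mulr_gt0 ?powR_gt0 ?expR_gt0.
Qed.

Let sqrtn (a : R) : 0 <= a -> Num.sqrt a ^+ n = powR a (n%:R / 2).
Proof. by move=> ha; rewrite -powR12_sqrt// -powR_mulrn ?powR_ge0// -powRrM mulrC. Qed.

(** In this window the bump is fully switched on and its age lies between [2 * th m] and [3 * th m],
    so it has the size of amplitude times [(th m)^(-n/2)], which is [(th m)^(- kp / 2)]. *)
Lemma bmp_lower m y s : inbox (ctr x0) (Num.sqrt (th m)) y ->
  s_ m + 3 / 2 * th m <= s <= s_ m + 2 * th m -> c1 * powR (th m) (- (kp / 2)) <= bmp m (y, s).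
Proof.
move=> yr /andP[h1 h2]; have t0 := cth_gt0 th00 m.
have ss : s_ m <= s by move: (s_ m) (th m) h1 t0 => a b; lra.
have z1 : 1 <= (s - s_ m) / th m by rewrite ler_pdivlMr// mul1r; move: (s_ m) (th m) h1 t0 => a b; lra.
rewrite /cbD /bumpD /= (ramp_ge1 z1).1 mul1r gprod0 bump_lagE//.
set a := s - s_ m + th m.
have a1 : 2 * th m <= a by rewrite /a; move: (s_ m) (th m) h1 t0 => x y'; lra.
have a2 : a <= 3 * th m by rewrite /a; move: (s_ m) (th m) h2 t0 => x y'; lra.
have ap : 0 < a by apply: lt_le_trans a1; rewrite mulr_gt0.
rewrite GamE//.
have e1 : expR (- n%:R) <= expR (- ((\sum_(i < n) (y 0 i - x0 0 i) ^+ 2) / (4 * a))).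
  rewrite ler_expR lerN2 ler_pdivrMr ?mulr_gt0//.
  have -> : n%:R * (4 * a) = \sum_(i < n) (4 * a) by rewrite sumr_const card_ord [LHS]mulr_natl.
  apply: ler_sum => i _; apply: (@le_trans _ _ (th m)); last by move: (th m) t0 a1 => b; lra.
  rewrite -[leRHS](sqr_sqrtr (ltW t0)) -[leLHS]ger0_norm ?sqr_ge0// normrX.
  by apply: lerXn2r; rewrite ?nnegrE ?sqrtr_ge0//; have := yr i; rewrite ctrE.
have e2 : Num.sqrt 3 ^- n * powR (th m) (- (n%:R / 2)) <= Num.sqrt a ^- n.
  rewrite powRN -sqrtn ?(ltW t0)// -invfM -exprMn -sqrtrM// lef_pV2 ?posrE ?exprn_gt0 ?sqrtr_gt0 ?mulr_gt0//.
  by apply: lerXn2r; rewrite ?nnegrE ?sqrtr_ge0// ler_wsqrtr.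
have -> : c1 * powR (th m) (- (kp / 2)) =
    cA n kp th0 m * (Num.sqrt 3 ^- n * powR (th m) (- (n%:R / 2)) * expR (- n%:R)).
  have -> : powR (th m) (- (kp / 2)) = cA n kp th0 m * powR (th m) (- (n%:R / 2)).
    rewrite /cA -powRD; last by rewrite (gt_eqF t0) implybT.
    by congr powR; field.
  by rewrite /c1; ring.
rewrite ler_wpM2l ?cA_ge0//; apply: ler_pM => //.
by rewrite mulr_ge0 ?powR_ge0// invr_ge0 exprn_ge0// sqrtr_ge0.
Qed.

(** Only the window of [bmp_lower] is integrated: its volume is of order [(th m)^(1 + n/2)], the lag
    lies between [th m] and [3 * th m] so the kernel gives [(th m)^(- alpha / 2)], and [u^lambda]
    gives [(th m)^(- kp * lambda / 2)]. The exponential comes from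
    [|x - y|^2 <= 2 |x - x0|^2 + 2 |y - x0|^2]. *)
Lemma nonlocal_lower m (x : 'rV[R]_n) t : 0 < t < T ->
  s_ m + 3 * th m <= t <= s_ m + 4 * th m ->
  ((c2 * powR (th m) (1 + n%:R / 2 - alpha / 2 - kp * lambda / 2) * expR (- (2 * q x / th m)))%:E <=
   int_spacetime T (fun y s => (powR (heat_kernel (x - y) (t - s)) (alpha / n%:R) *
     powR (u (y, s)) lambda)%:E))%E.
Proof.
move=> /andP[t0 tT] /andP[h1 h2]; have th1 := cth_gt0 th00 m.
have sge := cs_ge th00 stm m.
pose F (p : 'rV[R]_n * R) := powR (heat_kernel (x - p.1) (t - p.2)) (alpha / n%:R) * powR (u p) lambda.
have F0 (p : 'rV[R]_n * R) : 0 <= F p by rewrite mulr_ge0 ?powR_ge0.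
have cuu (p : 'rV[R]_n * R) : 0 < p.2 < T -> {for p, continuous u}.
  by move=> Ip; have [] := @cascade_C21 R n x0 kp th0 st th00 kpn stm stoo T p Ip.
have uu0 y s : 0 < s < T -> 0 <= u (y, s) by move=> /andP[s0 _]; exact: cascade_ge0.
have cF (p : 'rV[R]_n * R) : 0 < p.2 < t -> {for p, continuous F}.
  move=> /andP[k1 k2]; apply: for_contM; first exact: for_cont_heat_kernel_powR.
  by apply: (@for_cont_upow R n lambda T u l0 cuu uu0); rewrite k1 (lt_trans k2).
have Ft (p : 'rV[R]_n * R) : t <= p.2 < T -> F p = 0.
  by move=> /andP[k1 k2]; rewrite /F heat_kernel_powR0 ?mul0r// subr_le0.
pose s0 := s_ m + 3 / 2 * th m; pose s1 := s_ m + 2 * th m.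
have s00 : 0 < s0 by rewrite /s0; move: (s_ m) (th m) sge th1 => a b; lra.
have s01 : s0 <= s1 by rewrite /s0 /s1; move: (s_ m) (th m) th1 => a b; lra.
have s1t : s1 < t by rewrite /s1; move: (s_ m) (th m) th1 h1 => a b; lra.
have h := @int_spacetime_ge R n T t F t0 (ltW tT) (fun p _ => F0 p) cF Ft (ctr x0)
  (Num.sqrt (th m)) s0 s1 (sqrtr_ge0 _) s00 s01 s1t.
apply: le_trans h; rewrite lee_fin.
pose w := ka * powR (3 * th m) (- (alpha / 2)) * (expR (- (2 * q x / th m)) * expR (- (2 * n%:R))) *
  powR (c1 * powR (th m) (- (kp / 2))) lambda.
have -> : c2 * powR (th m) (1 + n%:R / 2 - alpha / 2 - kp * lambda / 2) * expR (- (2 * q x / th m)) =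
    (s1 - s0) * ((2 * Num.sqrt (th m)) ^+ n * w).
  have -> : s1 - s0 = th m / 2 by rewrite /s1 /s0; field.
  have -> : powR (th m) (1 + n%:R / 2 - alpha / 2 - kp * lambda / 2) =
     th m * powR (th m) (n%:R / 2) * powR (th m) (- (alpha / 2)) * powR (th m) (- (kp / 2) * lambda).
    rewrite -[X in X * powR _ (n%:R / 2)]powRr1 ?(ltW th1)//.
    rewrite -!powRD ?(gt_eqF th1) ?implybT//.
    by congr powR; field.
  rewrite /w exprMn sqrtn ?(ltW th1)// powRM ?(ltW th1)// powRM ?powR_ge0 ?(ltW c10)// -powRrM.
  rewrite /c2; move: (powR (th m) (n%:R / 2)) (powR (th m) (- (alpha / 2))) (powR (th m) (- (kp / 2) * lambda))
    (powR c1 lambda) (powR 3 (- (alpha / 2))) (expR (- (2 * q x / th m))) (expR (- (2 * n%:R))) (2 ^+ n) (th m).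
  by move=> x1 x2 x3 x4 x5 x6 x7 x8 x9; field.
have Ic s : s0 <= s <= s1 -> 0 < s < t.
  by move=> /andP[k1 k2]; rewrite (lt_le_trans s00)// (le_lt_trans k2).
have cFc := cont_clamp s01 (fun p Ip => cF p (Ic _ Ip)).
rewrite -segint_cst//; apply: le_segint; [exact: cont_cst|exact: (boxint_time_continuous _ _ cFc)|].
move=> s Is; rewrite clampr_id// -(boxint_cst n (ctr x0) w (sqrtr_ge0 _)).
apply: le_boxint; first exact: cont_cst.
  by apply: (@cont_slice _ _ _ F) => y; apply: cF; exact: Ic.
have /andP[k1 k2] := Is.
have tau1 : th m <= t - s by move: k2; rewrite /s1; move: (s_ m) (th m) h1 => a b; lra.
have tau2 : t - s <= 3 * th m by move: k1; rewrite /s0; move: (s_ m) (th m) h2 th1 => a b; lra.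
have tau0 : 0 < t - s by exact: lt_le_trans tau1.
move=> y yr; rewrite /F /=; apply: ler_pM.
- by rewrite !mulr_ge0 ?powR_ge0 ?expR_ge0.
- exact: powR_ge0.
- rewrite heat_kernel_powR// -/ka -[leLHS]mulrA -[leRHS]mulrA ler_wpM2l ?powR_ge0//; apply: ler_pM.
  + exact: powR_ge0.
  + by rewrite mulr_ge0 ?expR_ge0.
  + rewrite !powRN lef_pV2 ?posrE ?powR_gt0 ?mulr_gt0//.
    apply: ge0_ler_powR => //; rewrite ?nnegrE; first by rewrite divr_ge0// ltW.
      exact: ltW.
    by rewrite mulr_ge0// ltW.
  rewrite -expRD ler_expR -opprD lerN2.
  have g0 := gauss_rate_gt0 n0 a0.
  have nn : 0 < n%:R :> R by rewrite ltr0n.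
  (* Equivalent to [alpha <= 4 n], which gives the explicit decay rate 2 in the exponential. *)
  have gr1 : (gauss_rate n alpha)^-1 <= 1.
    rewrite invf_le1// /gauss_rate ler_pdivlMr// mul1r//.
  have sq : sqnorm (x - y) <= 2 * q x + 2 * (n%:R * th m).
    have -> : n%:R * th m = \sum_(i < n) th m by rewrite sumr_const card_ord [LHS]mulr_natl.
    rewrite /sqnorm /q !mulr_sumr -big_split /=; apply: ler_sum => i _; rewrite !mxE.
    have yi : (y 0 i - x0 0 i) ^+ 2 <= th m.
      rewrite -[leRHS](sqr_sqrtr (ltW th1)) -[leLHS]ger0_norm ?sqr_ge0// normrX.
      by apply: lerXn2r; rewrite ?nnegrE ?sqrtr_ge0//; have := yr i; rewrite ctrE.
    have := sqr_ge0 (x 0 i - x0 0 i + (y 0 i - x0 0 i)).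
    move: yi; move: (x 0 i) (y 0 i) (x0 0 i) (th m) => b1 b2 b3 b4 yi.
    have -> : (b1 - b2) ^+ 2 = 2 * (b1 - b3) ^+ 2 + 2 * (b2 - b3) ^+ 2 - (b1 - b3 + (b2 - b3)) ^+ 2 by ring.
    by move: ((b1 - b3 + (b2 - b3)) ^+ 2) ((b2 - b3) ^+ 2) ((b1 - b3) ^+ 2) yi => d1 d2 d3; lra.
  have q0 : 0 <= sqnorm (x - y) by apply: sumr_ge0 => i _; exact: sqr_ge0.
  apply: (@le_trans _ _ (sqnorm (x - y) / th m)).
    rewrite ler_wpM2l// invfM; apply: (@le_trans _ _ (1 * (t - s)^-1)).
      by rewrite ler_wpM2r// invr_ge0 ltW.
    by rewrite mul1r lef_pV2 ?posrE.
  rewrite ler_pdivrMr// mulrDl divfK ?(gt_eqF th1)//.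
  by rewrite -mulrA.
apply: ge0_ler_powR; rewrite ?nnegrE ?(ltW l0)//.
- by rewrite mulr_ge0 ?powR_ge0 ?(ltW c10).
- by apply: cascade_ge0; exact: lt_le_trans k1.
- by apply: le_trans (bmp_lower yr Is) _; apply: cascade_ge_bmp; exact: lt_le_trans k1.
Qed.

Definition casc_const : R := 9 * powR 16 (kp / 2 + 1) / c2.
(** The source of bump [m.+1] is of order [(th m)^(- kp / 2 - 1)]; [casc_gap] is what this exponent
    exceeds that of [nonlocal_lower] by. Being positive, it leaves a factor that is summable over
    [m]. *)
Definition casc_gap : R := (kp * (lambda - 1) - (n%:R + 4 - alpha)) / 2.

Lemma casc_const_ge0 : 0 <= casc_const.
Proof. by rewrite divr_ge0 ?mulr_ge0 ?powR_ge0// ltW. Qed.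

Lemma cH_ge0 m p : 0 <= cH x0 kp th0 st m p.
Proof.
rewrite mulr_ge0 ?cA_ge0// mulr_ge0 ?Gam_ge0// divr_ge0 ?ramp'_ge0// ltW//.
exact: cth_gt0.
Qed.

Hypothesis stS : forall m, st m.+1 = m.+1 \/ st m.+1 = st m.

(** The source of bump [m.+1] is active only while the bump is being switched on. Within a cascade
    this is a part of the time window of [nonlocal_lower] for bump [m], and there both the power and
    the spatial decay compare. *)
Lemma cH_le m x t (N : R) : 0 < t < T ->
  (int_spacetime T (fun y s => (powR (heat_kernel (x - y) (t - s)) (alpha / n%:R) *
     powR (u (y, s)) lambda)%:E) = N%:E)%E ->
  cH x0 kp th0 st m.+1 (x, t) <= casc_const * powR (th m) casc_gap * N.
Proof.
move=> It NE; have /andP[t0 tT] := It.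
have N0 : 0 <= N.
  by rewrite -lee_fin -NE; apply: int_spacetime_ge0 => y s; rewrite lee_fin mulr_ge0 ?powR_ge0.
have cg0 : 0 <= casc_const * powR (th m) casc_gap.
  by apply: mulr_ge0; [exact: casc_const_ge0|exact: powR_ge0].
have rhs0 : 0 <= casc_const * powR (th m) casc_gap * N by exact: mulr_ge0.
have th1 := cth_gt0 th00 m.+1; have thS := cthS th0 m.
have th2 := cth_gt0 th00 m.
have [z0|z0] := leP ((t - s_ m.+1) / th m.+1) 0.
  by rewrite /cH /= (ramp_neg z0).2 !mul0r mulr0.
have [z1|z1] := leP 1 ((t - s_ m.+1) / th m.+1).
  by rewrite /cH /= (ramp_ge1 z1).2 !mul0r mulr0.
have ts : s_ m.+1 <= t.
  by move: z0; rewrite pmulr_lgt0 ?invr_gt0// subr_gt0 => /ltW.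
have ts' : t <= s_ m.+1 + th m.+1.
  by move: z1; rewrite ltr_pdivrMr// mul1r ltrBlDl => /ltW.
case: (stS m) => [seed|same].
  (* a seed is already fully switched on at time 0 *)
  move: ts'; rewrite /cs seed; move: (th m.+1) th1 t0 => a b c.
  by lra.
have sE : s_ m.+1 = s_ m + 3 * th m.
  by rewrite /cs same thS; field.
have hw : s_ m + 3 * th m <= t <= s_ m + 4 * th m.
  rewrite -sE ts /=; apply: le_trans ts' _; rewrite sE thS.
  by move: (s_ m) (th m.+1) th1 => a b; lra.
have := nonlocal_lower x It hw; rewrite NE lee_fin => lowN.
have up : cH x0 kp th0 st m.+1 (x, t) <= 9 * powR (th m.+1) (- (kp / 2) - 1) * expR (- (2 * q x / th m)).
  rewrite /cH /= bump_lagE//; set a := t - s_ m.+1 + th m.+1.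
  have a1 : th m.+1 <= a by rewrite /a lerDr subr_ge0.
  have a2 : a <= 2 * th m.+1.
    by rewrite /a; move: (s_ m.+1) (th m.+1) ts' => b d; lra.
  have ap : 0 < a by exact: lt_le_trans a1.
  have -> : 9 * powR (th m.+1) (- (kp / 2) - 1) * expR (- (2 * q x / th m)) =
      cA n kp th0 m.+1 * (9 / th m.+1 * (powR (th m.+1) (- (n%:R / 2)) * expR (- (2 * q x / th m)))).
    have -> : powR (th m.+1) (- (kp / 2) - 1) =
        cA n kp th0 m.+1 * powR (th m.+1) (- (n%:R / 2)) / th m.+1.
      rewrite -(powR_inv1 (ltW th1)) /cA -!powRD ?(gt_eqF th1) ?implybT//.
      by congr powR; field.
    by field; rewrite gt_eqF.
  rewrite ler_wpM2l ?cA_ge0//; apply: ler_pM; rewrite ?Gam_ge0 ?divr_ge0 ?ramp'_ge0 ?(ltW th1)//.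
    by rewrite ler_pM2r ?invr_gt0// ramp'_le.
  rewrite GamE//; apply: ler_pM; rewrite ?expR_ge0 ?invr_ge0 ?exprn_ge0 ?sqrtr_ge0//.
    rewrite powRN -sqrtn ?(ltW th1)// lef_pV2 ?posrE ?exprn_gt0 ?sqrtr_gt0//.
    by apply: lerXn2r; rewrite ?nnegrE ?sqrtr_ge0// ler_wsqrtr.
  rewrite ler_expR lerN2 -/(q x) thS.
  have q0 : 0 <= q x by apply: sumr_ge0 => i _; exact: sqr_ge0.
  (* The ratio 16 is what turns the decay of a Gaussian of age [2 * th m.+1] into the rate of the
     lower bound at scale [th m]. *)
  have -> : 2 * q x / (16 * th m.+1) = q x / (8 * th m.+1) by field; rewrite gt_eqF.
  rewrite ler_wpM2l// lef_pV2 ?posrE ?mulr_gt0//.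
  by move: (th m.+1) a2 => b; lra.
apply: le_trans up _.
have -> : 9 * powR (th m.+1) (- (kp / 2) - 1) * expR (- (2 * q x / th m)) =
    casc_const * powR (th m) casc_gap *
    (c2 * powR (th m) (1 + n%:R / 2 - alpha / 2 - kp * lambda / 2) * expR (- (2 * q x / th m))).
  have -> : powR (th m.+1) (- (kp / 2) - 1) = powR 16 (kp / 2 + 1) * powR (th m) (- (kp / 2) - 1).
    rewrite thS powRM ?(ltW th1)// mulrA -powRD ?pnatr_eq0 ?implybT//.
    by rewrite (_ : kp / 2 + 1 + (- (kp / 2) - 1) = 0) ?powRr0 ?mul1r//; ring.
  have -> : powR (th m) (- (kp / 2) - 1) = powR (th m) casc_gap *
      powR (th m) (1 + n%:R / 2 - alpha / 2 - kp * lambda / 2).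
    by rewrite -powRD ?(gt_eqF th2) ?implybT//; congr powR; rewrite /casc_gap; field.
  rewrite /casc_const; move: (lt0r_neq0 c20) (powR (th m) casc_gap) (powR (th m) _) => c2n y1 y2.
  move: (powR 16 (kp / 2 + 1)) (expR (- (2 * q x / th m))) => y3 y4.
  by field.
exact: ler_wpM2l.
Qed.

End cascade_source_bound.

(** * The sum of the bumps satisfies the differential inequality and lies in [L^lambda] *)

Section cascade_admissible.
Context {R : realType}.
Variables (n : nat) (x0 : 'rV[R]_n) (kp th0 : R) (st : nat -> nat).
Hypotheses (n0 : (0 < n)%N) (th00 : 0 < th0) (kpn : kp < n%:R).
Hypotheses (stm : forall m, (st m <= m)%N)
  (stoo : forall k, exists m0, forall m, (m0 <= m)%N -> (k <= st m)%N)
  (stS : forall m, st m.+1 = m.+1 \/ st m.+1 = st m).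
Variables (alpha lambda T : R).
Hypotheses (a0 : 0 < alpha) (an : alpha <= 4 * n%:R) (l1 : 1 <= lambda).

Local Notation th := (cth th0).
Local Notation s_ := (cs th0 st).
Local Notation u := (cu x0 kp th0 st).
Local Notation bmp := (cbD x0 kp th0 st (fun=> 0%N)).
Let gap := casc_gap n kp alpha lambda.
Hypotheses (gap0 : 0 < gap)
  (th0s : casc_const n kp alpha lambda * powR th0 gap / (1 - powR 16^-1 gap) <= 1).
Let l0 : 0 < lambda. Proof. exact: lt_le_trans l1. Qed.

(** The sources of all bumps add up to at most a geometric series times the nonlocal term, and
    [th0s] makes the total factor at most 1. An infinite nonlocal term leaves nothing to prove. *)
Lemma cascade_supersol (x : 'rV[R]_n) t : 0 < t < T ->
  0 <= dt u (x, t) - lap u (x, t) /\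
  ((dt u (x, t) - lap u (x, t))%:E <=
     int_spacetime T (fun y s => (powR (heat_kernel (x - y) (t - s)) (alpha / n%:R) *
       powR (u (y, s)) lambda)%:E))%E.
Proof.
move=> It; have /andP[t0 tT] := It.
have [-> cvH] := @cascade_source R n x0 kp th0 st th00 kpn stm stoo (x, t) t0.
have H0 m : 0 <= cH x0 kp th0 st m (x, t) by exact: cH_ge0.
split; first by have := series_ge_partial 0 cvH H0; rewrite {1}/series /= big_geq.
have N0 : (0 <= int_spacetime T (fun y s => (powR (heat_kernel (x - y) (t - s)) (alpha / n%:R) *
       powR (u (y, s)) lambda)%:E))%E.
  by apply: int_spacetime_ge0 => y s; rewrite lee_fin mulr_ge0 ?powR_ge0.
case E : (int_spacetime _ _) N0 => [N| |] //; last by move=> _; rewrite leey.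
rewrite !lee_fin => N0; apply: series_le_bound => // J.
have seed : cH x0 kp th0 st 0 (x, t) = 0.
  have st0 : st 0 = 0%N by apply/eqP; rewrite -leqn0 stm.
  have h0 := cth_gt0 th00 0.
  have z1 : 1 <= (t - s_ 0) / th 0.
    by rewrite ler_pdivlMr// mul1r /cs st0; move: (th 0) => a; lra.
  by rewrite /cH /= (ramp_ge1 z1).2 !mul0r mulr0.
case: J => [|J]; first by rewrite /series /= big_geq.
rewrite /series /= big_nat_recl//= seed add0r.
have cc := casc_const_ge0 n kp alpha lambda.
apply: (@le_trans _ _ (\sum_(0 <= m < J) casc_const n kp alpha lambda * powR th0 gap * N *
    powR 16^-1 gap ^+ m)).
  apply: ler_sum => m _; apply: le_trans (cH_le n0 th00 kpn stm stoo a0 an l0 stS m It E) _.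
  rewrite -/gap cth_powR// le_eqVlt; apply/orP; left; apply/eqP.
  by move: (casc_const _ _ _ _) (powR th0 _) (_ ^+ m) => y1 y2 y3; ring.
rewrite -mulr_sumr.
have g0 : 0 < powR (16^-1 : R) gap by rewrite powR_gt0// invr_gt0.
have g1 := powR16_lt1 gap0.
have cN : 0 <= casc_const n kp alpha lambda * powR th0 gap * N.
  by apply: mulr_ge0 => //; apply: mulr_ge0 => //; exact: powR_ge0.
apply: le_trans (ler_wpM2l cN (geo_sum_le g0 g1 0 J)) _.
rewrite expr0 mul1r mulrAC -[leRHS]mul1r; exact: ler_wpM2r.
Qed.

Let be := n%:R * (lambda - 1) / 2.
Let qq := (n%:R + 2 - kp * lambda) / 2.
Hypotheses (qq0 : 0 < qq) (be1 : 1 <= be) (T0 : 0 < T).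
(** Scaling suggests [(th m)^qq] for the integral of a bump to the power [lambda]. The exponent [ze]
    is given up so that the remaining time singularity [1 - ze] is integrable on the whole of []0,
    T[]; what is left, [q'], is still positive. *)
Let ze := Num.min (qq / 2) 2^-1.
Let q' := qq - ze.
Let ze0 : 0 < ze. Proof. by rewrite lt_min divr_gt0//= invr_gt0. Qed.
Let ze1 : ze < 1. Proof. by rewrite gt_min invf_lt1// ltr1n orbT. Qed.
Let q'0 : 0 < q'.
Proof.
have : ze <= qq / 2 by rewrite ge_min lexx.
by rewrite /q'; move: ze qq qq0 => a b; lra.
Qed.

Lemma Gam_sym (x z : 'rV[R]_n) a : Gam x z a = Gam z x a.
Proof. by apply: eq_bigr => i _; rewrite /gam -sqrrN opprB. Qed.

Let bmp_continuous m : continuous (bmp m).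
Proof. by apply: bumpD_continuous; exact: cth_gt0. Qed.

Let bmpp_continuous m : continuous (fun p => powR (bmp m p) lambda).
Proof. by apply: cont_powR_ge0 => // p; exact: bmp_ge0. Qed.

Let W : R := 2 * (powR (T + 4 * th0) ze / ze).

(** Each time slice is a Gaussian to the power [lambda] with integral of order
    [(|s - s_ m| + th m)^(- be)]. All of this exponent but [1 - ze] is traded for powers of [th m],
    which is possible because [be >= 1]. *)
Lemma bmp_Lp m c L s0 s1 : 0 <= L -> 0 < s0 -> s0 <= s1 -> s1 < T ->
  segint s0 s1 (fun s => boxint c L (fun y => powR (bmp m (y, s)) lambda)) <=
  (2 * pi) ^+ n * W * powR (th m) q'.
Proof.
move=> L0 s00 s01 s1T; have tm := cth_gt0 th00 m.
have ad (s : R) : 0 < `|s - s_ m| + th m by rewrite ltr_wpDl.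
have pt y s : bmp m (y, s) <= cA n kp th0 m * Gam y x0 (`|s - s_ m| + th m).
  rewrite /cbD /bumpD /= ler_wpM2l ?cA_ge0//.
  have [z0|z0] := leP ((s - s_ m) / th m) 0.
    by rewrite (ramp_neg z0).1 mul0r Gam_ge0.
  have ss : 0 < s - s_ m by move: z0; rewrite pmulr_lgt0 ?invr_gt0.
  rewrite gprod0 bump_lagE//; last by rewrite -subr_ge0 ltW.
  rewrite (gtr0_norm ss) Gam_sym ler_piMl ?Gam_ge0//.
  by case/andP: (ramp01 ((s - s_ m) / th m)).
pose K := powR (cA n kp th0 m) lambda * ((2 * pi) ^+ n * powR (th m) (- (be - (1 - ze)))).
have K0 : 0 <= K by rewrite !mulr_ge0 ?powR_ge0// exprn_ge0// mulr_ge0 ?pi_ge0.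
have sl s : continuous (fun y => powR (bmp m (y, s)) lambda).
  by refine (@cont_comp _ _ _ (fun y => (y, s)) _ _ (@bmpp_continuous m)); cont_proj.
have slice s : boxint c L (fun y => powR (bmp m (y, s)) lambda) <=
    K * powR (`|s - s_ m| + th m) (- (1 - ze)).
  have cG : continuous (fun y => powR (Gam y x0 (`|s - s_ m| + th m)) lambda).
    apply: cont_powR_pos; last by move=> y; exact: Gam_gt0.
    by apply: cont_Gam => //; cont_proj.
  apply: (@le_trans _ _ (boxint c L (fun y => powR (cA n kp th0 m) lambda *
      powR (Gam y x0 (`|s - s_ m| + th m)) lambda))).
    apply: le_boxint => //; first by apply: continuousMR => //; exact: cont_cst.
    move=> y _; rewrite -powRM ?cA_ge0 ?Gam_ge0//.
    by apply: ge0_ler_powR; rewrite ?nnegrE ?(ltW l0) ?bmp_ge0 ?mulr_ge0 ?cA_ge0 ?Gam_ge0.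
  rewrite boxintZ// /K -!mulrA ler_wpM2l ?powR_ge0//.
  apply: le_trans (boxint_Gam_powR x0 c (ad s) L0 l1) _.
  rewrite -/be ler_wpM2l//.
    by rewrite exprn_ge0// mulr_ge0 ?pi_ge0.
  have e : - be = - (be - (1 - ze)) - (1 - ze) by ring.
  rewrite {1}e powRD ?(gt_eqF (ad s)) ?implybT// ler_wpM2r ?powR_ge0//.
  have bz : 0 <= be - (1 - ze).
    by rewrite subr_ge0 (le_trans _ be1)// gerBl ltW.
  rewrite !powRN lef_pV2 ?posrE ?powR_gt0//.
  by apply: ge0_ler_powR; rewrite ?nnegrE ?(ltW tm) ?(ltW (ad s))// lerDr.
have cabs : continuous (fun s => powR (`|s - s_ m| + th m) (- (1 - ze))).
  by apply: cont_powR_pos ad; exact: continuous_abs_lag.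
apply: (@le_trans _ _ (K * W)).
  apply: (@le_trans _ _ (segint s0 s1 (fun s => K * powR (`|s - s_ m| + th m) (- (1 - ze))))).
    apply: le_segint => //; first exact: (boxint_time_continuous _ _ (@bmpp_continuous m)).
    by apply: continuousMR => //; exact: cont_cst.
  rewrite segintZ// ler_wpM2l//.
  have e1 : -1 < - (1 - ze) by rewrite ltrN2 gtrBl.
  have sB s : s0 <= s <= s1 -> `|s - s_ m| + th m <= T + 4 * th0.
    move=> /andP[h1 h2]; have g1 := cs_ge th00 stm m.
    have g2 := cth_le0 th00 m; have g3 := cth_le0 th00 (st m).
    have g4 : s_ m <= 11 / 5 * th (st m) by rewrite /cs gerBl mulr_ge0// ltW.
    have a1 : `|s - s_ m| <= T + 3 * th0.
      rewrite ler_distl; apply/andP; split.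
        by move: (s_ m) (th m) (th (st m)) g1 g2 g3 g4 h1 s00 s01 s1T th00 T0 => b1 b2 b3; lra.
      by move: (s_ m) (th m) (th (st m)) g1 g2 g3 g4 h2 s1T th00 => b1 b2 b3; lra.
    by apply: le_trans (lerD a1 g2) _; move: th0 => b; lra.
  have := segint_powR_abs e1 tm s01 sB.
  by have -> : - (1 - ze) + 1 = ze by ring.
rewrite /K le_eqVlt; apply/orP; left; apply/eqP.
have -> : powR (th m) q' = powR (cA n kp th0 m) lambda * powR (th m) (- (be - (1 - ze))).
  rewrite /cA -powRrM -powRD ?(gt_eqF tm) ?implybT//; congr powR.
  by rewrite /q' /qq /be; field.
by move: (powR (cA _ _ _ _) _) (powR (th m) _) ((2 * pi) ^+ n) W => y1 y2 y3 y4; ring.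
Qed.

(** As the weights sum to at most 1, some [a m] is at least [S * w m], and that term alone bounds
    [S^lambda]. This stands in for the triangle inequality in [L^lambda] and is additive over the
    terms, so it can be integrated. *)
Lemma powR_weighted_sum (a w : nat -> R) J : (forall m, 0 <= a m) -> (forall m, 0 < w m) ->
  \sum_(0 <= m < J) w m <= 1 ->
  powR (\sum_(0 <= m < J) a m) lambda <= \sum_(0 <= m < J) powR (w m) (- lambda) * powR (a m) lambda.
Proof.
move=> am wm w1; set S := \sum_(0 <= m < J) a m.
have t0 m : 0 <= powR (w m) (- lambda) * powR (a m) lambda by rewrite mulr_ge0 ?powR_ge0.
have S0 : 0 <= S by exact: sumr_ge0.
move: S0; rewrite le_eqVlt => /predU1P[<-|S0].
  by rewrite powR0 ?sumr_ge0// gt_eqF.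
have J0 : (0 < J)%N by rewrite lt0n; apply/eqP => J0; move: S0; rewrite /S J0 big_geq// ltxx.
have [[m [mJ hm]]|no] := pselect (exists m, (m < J)%N /\ S * w m <= a m).
  rewrite (bigD1_seq m) /= ?iota_uniq ?mem_index_iota//; apply: ler_wpDr; first exact: sumr_ge0.
  have wl : 0 < powR (w m) lambda by rewrite powR_gt0.
  rewrite powRN mulrC ler_pdivlMr// -powRM ?(ltW S0) ?(ltW (wm m))//.
  by apply: ge0_ler_powR; rewrite ?nnegrE ?(ltW l0)// mulr_ge0 ?(ltW S0) ?(ltW (wm m)).
have : S < \sum_(0 <= m < J) S * w m.
  apply: ltr_sum_nat => // m /andP[_ mJ]; rewrite ltNge; apply/negP => h.
  by apply: no; exists m.
rewrite -mulr_sumr => h; have := lt_le_trans h (ler_wpM2l (ltW S0) w1).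
by rewrite mulr1 ltxx.
Qed.

Lemma stint_series (G : nat -> 'rV[R]_n * R -> R) c L s0 s1 J : (forall m, continuous (G m)) ->
  segint s0 s1 (fun s => boxint c L (fun y => \sum_(0 <= m < J) G m (y, s))) =
  \sum_(0 <= m < J) segint s0 s1 (fun s => boxint c L (fun y => G m (y, s))).
Proof.
move=> cG.
have sl m s : continuous (fun y => G m (y, s)).
  by refine (@cont_comp _ _ _ (fun y => (y, s)) _ _ (@cG m)); cont_proj.
have cS K : continuous (fun p => \sum_(0 <= m < K) G m p) by apply: cont_bigsum.
have sS K s : continuous (fun y => \sum_(0 <= m < K) G m (y, s)).
  by refine (@cont_comp _ _ _ (fun y => (y, s)) _ _ (cS K)); cont_proj.
elim: J => [|J IH].
  rewrite big_geq//; have [s01|s10] := leP s0 s1.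
    have -> : segint s0 s1 (fun s => boxint c L (fun y => \sum_(0 <= m < 0) G m (y, s))) =
        segint s0 s1 (fun=> 0).
      apply: eq_segint => s _; apply: (etrans _ (@boxint0 R n c L)); apply: eq_boxint => y _.
      by rewrite big_geq.
    by rewrite segint_cst// mulr0.
  by rewrite /segint set_itv_ge ?Rintegral_set0// bnd_simp -ltNge.
rewrite big_nat_recr//= -IH -segintD;
  [|exact: (boxint_time_continuous c L (cS J))|exact: (boxint_time_continuous c L (@cG J))].
apply: eq_segint => s _; rewrite -boxintD//; apply: eq_boxint => y _.
by rewrite big_nat_recr.
Qed.

(** The weights decay so slowly that their power [- lambda] costs only half of the decay [(th m)^q']
    of the bumps; the other half is the ratio [rho'] of a convergent series. *)
Let rho := powR (16^-1 : R) (q' / (2 * lambda)).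
Let rho' := powR (16^-1 : R) (q' / 2).
Let rho0 : 0 < rho. Proof. by rewrite powR_gt0// invr_gt0. Qed.
Let rho1 : rho < 1. Proof. by apply: powR16_lt1; rewrite divr_gt0// mulr_gt0. Qed.
Let rho'0 : 0 < rho'. Proof. by rewrite powR_gt0// invr_gt0. Qed.
Let rho'1 : rho' < 1. Proof. by apply: powR16_lt1; rewrite divr_gt0. Qed.
Let wt (m : nat) := (1 - rho) * rho ^+ m.
Let C1 : R := powR (1 - rho) (- lambda) * ((2 * pi) ^+ n * W * powR th0 q').

Let W0 : 0 <= W.
Proof. by apply: mulr_ge0 => //; apply: divr_ge0; [exact: powR_ge0|exact: ltW]. Qed.

Let C10 : 0 <= C1.
Proof.
apply: mulr_ge0; first exact: powR_ge0.
apply: mulr_ge0; last exact: powR_ge0.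
by apply: mulr_ge0 => //; apply: exprn_ge0; rewrite mulr_ge0 ?pi_ge0.
Qed.

Let wt0 m : 0 < wt m. Proof. by rewrite mulr_gt0 ?subr_gt0// exprn_gt0. Qed.

Let wt_powR m : powR (wt m) (- lambda) * ((2 * pi) ^+ n * W * powR (th m) q') = C1 * rho' ^+ m.
Proof.
have r10 : 0 <= 1 - rho by rewrite subr_ge0 ltW.
rewrite /wt powRM ?exprn_ge0 ?(ltW rho0)// cth_powR//.
have -> : powR (rho ^+ m) (- lambda) = powR 16^-1 (- (q' / 2)) ^+ m.
  rewrite -powR_mulrn ?(ltW rho0)// powRAC powR_mulrn ?powR_ge0// /rho -powRrM.
  by congr (powR _ _ ^+ _); field; rewrite gt_eqF.
have -> : rho' ^+ m = powR 16^-1 (- (q' / 2)) ^+ m * powR 16^-1 q' ^+ m.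
  rewrite -exprMn /rho' -powRD ?invr_eq0 ?pnatr_eq0 ?implybT//.
  by congr (powR _ _ ^+ _); field.
rewrite /C1; move: (powR (1 - rho) _) ((2 * pi) ^+ n) (powR th0 q') (powR 16^-1 (- (q' / 2)) ^+ m).
by move=> y1 y2 y3 y4; move: (powR 16^-1 q' ^+ m) => y5; ring.
Qed.

Lemma partial_Lp J c L s0 s1 : 0 <= L -> 0 < s0 -> s0 <= s1 -> s1 < T ->
  segint s0 s1 (fun s => boxint c L (fun y => powR (\sum_(0 <= m < J) bmp m (y, s)) lambda)) <=
  C1 / (1 - rho').
Proof.
move=> L0 s00 s01 s1T.
have cS : continuous (fun p => \sum_(0 <= m < J) bmp m p) by apply: cont_bigsum.
have S0 p : 0 <= \sum_(0 <= m < J) bmp m p by apply: sumr_ge0 => m _; exact: bmp_ge0.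
have cSp := cont_powR_ge0 cS l0 S0.
pose G m p := powR (wt m) (- lambda) * powR (bmp m p) lambda.
have cG m : continuous (G m) by apply: continuousMR; [exact: cont_cst|exact: bmpp_continuous].
have cGs : continuous (fun p => \sum_(0 <= m < J) G m p) by apply: cont_bigsum.
have slc (F : 'rV[R]_n * R -> R) s : continuous F -> continuous (fun y => F (y, s)).
  by move=> cF; refine (@cont_comp _ _ _ (fun y => (y, s)) _ _ cF); cont_proj.
apply: (@le_trans _ _ (segint s0 s1 (fun s => boxint c L (fun y => \sum_(0 <= m < J) G m (y, s))))).
  apply: le_segint; [exact: (boxint_time_continuous c L cSp)|exact: (boxint_time_continuous c L cGs)|].
  move=> s _; apply: le_boxint; [exact: (slc _ s cSp)|exact: (slc _ s cGs)|].
  move=> y _; apply: powR_weighted_sum => [m|m|]; [exact: bmp_ge0|exact: wt0|].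
  rewrite /wt -mulr_sumr mulrC -ler_pdivlMr ?subr_gt0//.
  by have := geo_sum_le rho0 rho1 0 J; rewrite expr0.
rewrite stint_series//; apply: (@le_trans _ _ (\sum_(0 <= m < J) C1 * rho' ^+ m)); last first.
  rewrite -mulr_sumr ler_wpM2l//.
  by have := geo_sum_le rho'0 rho'1 0 J; rewrite expr0 mul1r.
apply: ler_sum => m _; rewrite -wt_powR.
have bc := boxint_time_continuous c L (@bmpp_continuous m).
have -> : segint s0 s1 (fun s => boxint c L (fun y => G m (y, s))) =
    powR (wt m) (- lambda) * segint s0 s1 (fun s => boxint c L (fun y => powR (bmp m (y, s)) lambda)).
  rewrite -segintZ//; apply: eq_segint => s _; rewrite -boxintZ//.
  exact: (slc _ s (@bmpp_continuous m)).
by rewrite ler_wpM2l ?powR_ge0//; exact: bmp_Lp.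
Qed.

(** After time [s0] late bumps have age at least [s0 / 2], hence are bounded by their amplitude
    times a constant, uniformly in space. *)
Lemma cascade_tail s0 e : 0 < s0 -> 0 < e -> exists J, forall p : 'rV[R]_n * R, s0 <= p.2 ->
  u p <= \sum_(0 <= m < J) bmp m p + e.
Proof.
move=> s00 e0; have s20 : 0 < s0 / 2 by rewrite divr_gt0.
have [m0 Hm0] := cs_late th00 stm stoo s20.
pose C := powR th0 ((n%:R - kp) / 2) * Num.sqrt (s0 / 2) ^- n.
have c0 := cr_gt0 n kp; have c1 := cr_lt1 kpn.
have [J mJ HJ] := geo_small c0 c1 C m0 e0.
exists J => p sp.
have hb m : (m0 <= m)%N -> `|bmp m p| <= C * cr n kp ^+ m.
  move=> mm; have [h1 h2] := Hm0 m mm; have tm := cth_gt0 th00 m.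
  have h3 : s0 / 2 <= p.2 - s_ m by move: (s_ m) (th m) (p.2) h1 sp tm => a b d; lra.
  rewrite ger0_norm ?bmp_ge0// /cbD /bumpD gprod0 bump_lagE//; last by rewrite -subr_ge0 (le_trans _ h3)// ltW.
  rewrite /C mulrAC -cth_powR// ler_wpM2l ?powR_ge0//.
  set a := p.2 - s_ m + th m.
  have a1 : s0 / 2 <= a by rewrite /a (le_trans h3)// lerDl ltW.
  have ap : 0 < a by exact: lt_le_trans a1.
  apply: (@le_trans _ _ (Gam x0 p.1 a)).
    by rewrite ler_piMl ?Gam_ge0//; case/andP: (ramp01 ((p.2 - s_ m) / th m)).
  apply: le_trans (Gam_le _ _ ap) _; rewrite lef_pV2 ?posrE ?exprn_gt0 ?sqrtr_gt0//.
  by apply: lerXn2r; rewrite ?nnegrE ?sqrtr_ge0// ler_wsqrtr.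
have := le_lt_trans (geo_tail c0 c1 mJ hb) HJ.
by rewrite -/(fsum _ p) -/(u p) /series /= ltr_distl => /andP[_ /ltW].
Qed.

Lemma cascade_Lp : (int_spacetime T (fun y s => (powR (u (y, s)) lambda)%:E) < +oo)%E.
Proof.
have cuu (p : 'rV[R]_n * R) : 0 < p.2 < T -> {for p, continuous u}.
  by move=> Ip; have [] := @cascade_C21 R n x0 kp th0 st th00 kpn stm stoo T p Ip.
have uu0 y s : 0 < s < T -> 0 <= u (y, s) by move=> /andP[s0 _]; exact: cascade_ge0.
have cup := @for_cont_upow R n lambda T u l0 cuu uu0.
have p0 (p : 'rV[R]_n * R) : 0 < p.2 < T -> 0 <= powR (u p) lambda by move=> _; exact: powR_ge0.
have pT (p : 'rV[R]_n * R) : T <= p.2 < T -> powR (u p) lambda = 0.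
  by move=> /andP[h1 h2]; have := lt_le_trans h2 h1; rewrite ltxx.
pose B := powR 2 lambda * (C1 / (1 - rho') + 1).
apply: (@le_lt_trans _ _ B%:E); last by rewrite ltry.
apply: (@int_spacetime_le R n T T (fun p => powR (u p) lambda) T0 (lexx _) p0 cup pT (fun=> 0)).
move=> k s0 s1 s00 s01 s1T.
(* The partial sums are bounded independently of the region. The uniform error [e] of the tail is
   adapted to the volume [V] of the region, so that its contribution [V * e^lambda] is at most 1. *)
pose V : R := (s1 - s0) * (2 * k%:R) ^+ n.
have V0 : 0 <= V by rewrite mulr_ge0 ?subr_ge0// exprn_ge0// mulr_ge0.
pose e := powR (V + 1)^-1 lambda^-1.
have V1 : 0 < V + 1 by rewrite ltr_wpDl.
have e0 : 0 < e by rewrite powR_gt0// invr_gt0.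
have eE : powR e lambda = (V + 1)^-1.
  by rewrite /e -powRrM mulVf ?gt_eqF// powRr1// invr_ge0 ltW.
have [J HJ] := cascade_tail s00 e0.
pose U p := \sum_(0 <= m < J) bmp m p.
have U0 p : 0 <= U p by apply: sumr_ge0 => m _; exact: bmp_ge0.
have cU : continuous U by apply: cont_bigsum.
have cUp := cont_powR_ge0 cU l0 U0.
have cuc : continuous (fun p : 'rV[R]_n * R => powR (u (p.1, clampr s0 s1 p.2)) lambda).
  exact: (stint_continuous cup s00 s01 s1T).
have slc (F : 'rV[R]_n * R -> R) s : continuous F -> continuous (fun y => F (y, s)).
  by move=> cF; refine (@cont_comp _ _ _ (fun y => (y, s)) _ _ cF); cont_proj.
have k0 : 0 <= k%:R :> R by [].
have bUc := boxint_time_continuous (fun=> 0) k%:R cUp.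
apply: (@le_trans _ _ (segint s0 s1 (fun s => powR 2 lambda *
    (boxint (fun=> 0) k%:R (fun y => powR (U (y, s)) lambda) + (2 * k%:R) ^+ n * powR e lambda)))).
  apply: le_segint; first exact: (boxint_time_continuous _ _ cuc).
    apply: continuousMR; first exact: cont_cst.
    by apply: continuousDR => //; exact: cont_cst.
  move=> s Is; rewrite clampr_id//.
  have cUs := slc _ s cUp.
  rewrite -(boxint_cst n (fun=> 0) (powR e lambda) k0).
  rewrite -boxintD//; last exact: cont_cst.
  have cUe : continuous (fun y => powR (U (y, s)) lambda + powR e lambda).
    by apply: continuousDR => //; exact: cont_cst.
  rewrite -boxintZ//; apply: le_boxint.
  - apply: (@cont_slice _ _ _ (fun p => powR (u p) lambda)) => y; apply: cup.
    by case/andP: Is => h1 h2; rewrite /= (lt_le_trans s00)// (le_lt_trans h2).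
  - by apply: continuousMR => //; exact: cont_cst.
  move=> y _; case/andP: Is => h1 h2.
  apply: le_trans (powR_sum_le (ltW l0) (U0 (y, s)) (ltW e0)).
  apply: ge0_ler_powR; rewrite ?nnegrE ?(ltW l0)//.
  - by apply: cascade_ge0 => //=; exact: lt_le_trans h1.
  - by rewrite addr_ge0// ltW.
  - exact: HJ.
rewrite segintZ; last by apply: continuousDR => //; exact: cont_cst.
rewrite ler_wpM2l ?powR_ge0// segintD//; last exact: cont_cst.
apply: lerD; first by apply: partial_Lp.
by rewrite segint_cst// mulrA -/V eE ler_pdivrMr// mul1r lerDl.
Qed.

End cascade_admissible.

(** * Restarted cascades beat any prescribed rate *)

Section no_universal_rate.
Context {R : realType}.

(** The square of Bernoulli's inequality: [(y^2)^m >= m^2 (y - 1)^2], which beats any linear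
    function of [m]. *)
Lemma linear_le_exp (a b y : R) : 0 < b -> 1 < y ->
  exists M, forall m, (M <= m)%N -> m%:R * a <= b * (y ^+ 2) ^+ m.
Proof.
move=> b0 y1; have d0 : 0 < b * (y - 1) ^+ 2 by rewrite mulr_gt0// exprn_gt0// subr_gt0.
have [M HM] : exists M : nat, `|a| / (b * (y - 1) ^+ 2) < M%:R.
  by exists (Num.truncn (`|a| / (b * (y - 1) ^+ 2))).+1; exact: truncnS_gt.
exists M => m Mm.
have bern : m%:R * (y - 1) <= y ^+ m.
  elim: m {Mm} => [|m IH]; first by rewrite mul0r expr0.
  have ym : 1 <= y ^+ m by rewrite exprn_ege1// ltW.
  rewrite exprS -natr1 mulrDl mul1r.
  have : (y - 1) * 1 <= (y - 1) * y ^+ m by rewrite ler_wpM2l// subr_ge0 ltW.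
  by move: (m%:R * (y - 1)) (y ^+ m) IH => z w IH; rewrite mulr1 mulrBl mul1r; lra.
have bern2 : (m%:R * (y - 1)) ^+ 2 <= (y ^+ 2) ^+ m.
  rewrite -exprM mulnC exprM; apply: lerXn2r; rewrite ?nnegrE//.
    by rewrite mulr_ge0// subr_ge0 ltW.
  by rewrite exprn_ge0// (le_trans _ (ltW y1)).
apply: (@le_trans _ _ (b * (m%:R * (y - 1)) ^+ 2)); last by rewrite ler_pM2l.
have -> : b * (m%:R * (y - 1)) ^+ 2 = m%:R * (m%:R * (b * (y - 1) ^+ 2)) by ring.
rewrite ler_wpM2l//; apply: le_trans (ler_norm a) _.
rewrite -ler_pdivrMr//; apply: (le_trans (ltW HM)); by rewrite ler_nat.
Qed.

(** [restarts P m] is the index of the seed of the cascade to which bump [m] belongs. As soon as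
    bump [m] of a cascade with seed [a] reaches the goal [P m a], the next bump is a new seed. The
    seeds are thus chosen by recursion, each once its predecessor's cascade has succeeded. *)
Fixpoint restarts (P : nat -> nat -> bool) (m : nat) : nat :=
  if m is k.+1 then if P k (restarts P k) then k.+1 else restarts P k else 0%N.

Lemma restarts_le P m : (restarts P m <= m)%N.
Proof. by elim: m => [//|m IH] /=; case: ifP => // _; exact: leq_trans (leqnSn _). Qed.

Lemma restartsS P m : restarts P m.+1 = m.+1 \/ restarts P m.+1 = restarts P m.
Proof. by rewrite /=; case: ifP; [left|right]. Qed.

Lemma restarts_mono P m k : (m <= k)%N -> (restarts P m <= restarts P k)%N.
Proof.
elim: k => [|k IH]; first by rewrite leqn0 => /eqP ->.
rewrite leq_eqVlt => /predU1P[-> //|]; rewrite ltnS => /IH h.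
apply: leq_trans h _ => /=; case: ifP => // _.
exact: leq_trans (restarts_le P k) (leqnSn _).
Qed.

(** If the goal were never reached after [M], the seed would stay the same from then on, and for a
    fixed seed the goal is eventually reached. *)
Lemma restarts_infinite (P : nat -> nat -> bool) : (forall a, exists M, forall m, (M <= m)%N -> P m a) ->
  forall M, exists2 m, (M <= m)%N & P m (restarts P m).
Proof.
move=> HP M; apply: contrapT => no.
have cst k : restarts P (M + k) = restarts P M.
  elim: k => [|k IH]; first by rewrite addn0.
  rewrite addnS /= IH; case: ifP => // h; exfalso; apply: no.
  by exists (M + k)%N; rewrite ?leq_addr// IH.
have [M' HM'] := HP (restarts P M).
apply: no; exists (M + M')%N; first exact: leq_addr.
by rewrite cst; apply: HM'; exact: leq_addl.
Qed.

Lemma restarts_unbounded (P : nat -> nat -> bool) : (forall a, exists M, forall m, (M <= m)%N -> P m a) ->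
  forall k, exists m0, forall m, (m0 <= m)%N -> (k <= restarts P m)%N.
Proof.
move=> HP k; have [m km Pm] := restarts_infinite HP k.
exists m.+1 => m' mm; apply: leq_trans (restarts_mono P mm).
by rewrite /= Pm; exact: leq_trans km (leqnSn _).
Qed.

Variables (n : nat) (alpha lambda T : R) (Omega : set 'rV[R]_n).
Hypotheses (n0 : (0 < n)%N) (a2 : 2 < alpha) (an2 : alpha < n%:R + 2) (T0 : 0 < T)
  (Onon : Omega !=set0) (lc : (n%:R + 2) / (alpha - 2) < lambda).

Let nn : 1 <= n%:R :> R. Proof. by rewrite ler1n. Qed.
Let lcm : n%:R + 2 < lambda * (alpha - 2). Proof. by rewrite -ltr_pdivrMr// subr_gt0. Qed.
Let l0 : 0 < lambda.
Proof.
have a20 : 0 <= alpha - 2 by rewrite subr_ge0 ltW.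
by apply: le_lt_trans lc; rewrite divr_ge0// addr_ge0.
Qed.
Let ln : n%:R + 2 < lambda * n%:R.
Proof.
apply: lt_trans lcm _; rewrite ltr_pM2l//.
by move: an2; rewrite -ltrBlDr.
Qed.
Let l1 : 1 < lambda.
Proof.
have h : 1 * n%:R < lambda * n%:R by rewrite mul1r (lt_trans _ ln)// ltrDl.
by move: h; rewrite ltr_pM2r// (lt_le_trans _ nn).
Qed.

Lemma g_alpha_eq0 : g_alpha n alpha lambda = 0.
Proof.
have n00 : 0 < n%:R :> R by exact: lt_le_trans nn.
rewrite /g_alpha !ltNge !ler_pdivrMr//.
rewrite (_ : n%:R + 2 - alpha <= lambda * n%:R)/=; last first.
  by rewrite (le_trans _ (ltW ln))// gerBl (le_trans _ (ltW a2)).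
rewrite (ltW ln)/=; apply/max_idPl; rewrite subr_le0 mulrAC ler_pdivlMr ?addr_gt0// mul1r.
by rewrite mulrC ltW.
Qed.

(** [kp] is the midpoint of [lo] and [hi]; [lo < hi] is the hypothesis [n + 2 < lambda (alpha - 2)]
    rearranged, and [hi < n] follows from it because [alpha - 2 < n]. *)
Lemma exists_kappa : exists kp : R, [/\ 0 < kp, kp < n%:R,
  0 < casc_gap n kp alpha lambda & 0 < (n%:R + 2 - kp * lambda) / 2].
Proof.
pose lo := (n%:R + 4 - alpha) / (lambda - 1); pose hi := (n%:R + 2) / lambda.
have l10 : 0 < lambda - 1 by rewrite subr_gt0.
have n4 : 0 < n%:R + 4 - alpha by rewrite subr_gt0 (lt_trans an2)// ltrD2l ltr_nat.
have lo0 : 0 < lo by rewrite divr_gt0.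
have lohi : lo < hi.
  rewrite ltr_pdivrMr// mulrAC ltr_pdivlMr//.
  rewrite -subr_gt0 (_ : _ - _ = lambda * (alpha - 2) - (n%:R + 2)); first by rewrite subr_gt0.
  by ring.
pose kp := (lo + hi) / 2.
have [lk kh] : lo < kp /\ kp < hi by rewrite (midf_lt lohi).1 (midf_lt lohi).2.
exists kp; split.
- exact: lt_trans lk.
- by apply: lt_trans kh _; rewrite ltr_pdivrMr// mulrC.
- by rewrite divr_gt0// subr_gt0 -ltr_pdivrMr.
- by rewrite divr_gt0// subr_gt0 -ltr_pdivlMr.
Qed.

Lemma cascade_blow_up (phi : R -> R) : (forall t, 0 < t < 1 -> 0 < phi t) ->
  exists (x0 : 'rV[R]_n) (u : 'rV[R]_n * R -> R), [/\ Omega x0,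
    admissible alpha lambda (g_alpha n alpha lambda) T Omega u &
    forall C d, 0 < d -> exists t, [/\ 0 < t < d, t < 1 & C * phi t < u (x0, t)]].
Proof.
move=> phi0; have [x0 Ox0] := Onon.
have [kp [kp0 kpn gap0 qq0]] := exists_kappa.
set gap := casc_gap n kp alpha lambda in gap0.
have g1 : 0 < 1 - powR (16^-1 : R) gap by rewrite subr_gt0; exact: powR16_lt1.
pose C := casc_const n kp alpha lambda.
have C0 : 0 <= C by exact: casc_const_ge0.
have C1 : 0 < C + 1 by rewrite ltr_wpDl.
(* Solves [(C + 1) th0^gap = 1 - 16^(- gap)], so that the geometric series of the factors
   [C (cth th0 m)^gap] sums to at most 1. *)
pose th0 := powR ((1 - powR (16^-1 : R) gap) / (C + 1)) gap^-1.
have th00 : 0 < th0 by rewrite powR_gt0// divr_gt0.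
have th0s : C * powR th0 gap / (1 - powR 16^-1 gap) <= 1.
  have -> : powR th0 gap = (1 - powR 16^-1 gap) / (C + 1).
    by rewrite -powRrM mulVf ?gt_eqF// powRr1// divr_ge0// ltW.
  move: (1 - powR 16^-1 gap) (lt0r_neq0 g1) => X X0.
  have -> : C * (X / (C + 1)) / X = C / (C + 1) by field; rewrite X0 gt_eqF.
  by rewrite ler_pdivrMr// mul1r lerDl.
(* The height of bump [m] at [x0] at its focusing time, when its age is [16 / 5 + 1 = 21 / 5] times
   [cth th0 m]. It grows geometrically in [m]. *)
pose h m := cA n kp th0 m * Gam x0 x0 (21 / 5 * cth th0 m).
have [b [y [b0 y1 hE]]] : exists b y : R, [/\ 0 < b, 1 < y & forall m, h m = b * (y ^+ 2) ^+ m].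
  exists (Num.sqrt (21 / 5) ^- n * powR th0 (- (kp / 2))), (powR 16^-1 (- (kp / 4))).
  have p16 : 0 < powR (16^-1 : R) (kp / 4) by rewrite powR_gt0// invr_gt0.
  split.
  - apply: mulr_gt0; last exact: powR_gt0.
    by rewrite invr_gt0; apply: exprn_gt0; rewrite sqrtr_gt0 divr_gt0.
  - by rewrite powRN invf_gt1//; apply: powR16_lt1; rewrite divr_gt0.
  move=> m; have tm := cth_gt0 th00 m.
  have -> : powR (16^-1 : R) (- (kp / 4)) ^+ 2 = powR 16^-1 (- (kp / 2)).
    rewrite -powR_mulrn ?powR_ge0// -powRrM; congr powR; by field.
  rewrite -mulrA -cth_powR// /h GamE ?mulr_gt0 ?divr_gt0//.
  have -> : \sum_(i < n) (x0 0 i - x0 0 i) ^+ 2 = 0.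
    by apply: big1 => i _; rewrite subrr expr0n.
  rewrite mul0r oppr0 expR0 mulr1 sqrtrM ?divr_ge0// exprMn invfM.
  have -> : powR (cth th0 m) (- (kp / 2)) = cA n kp th0 m * Num.sqrt (cth th0 m) ^- n.
    have -> : Num.sqrt (cth th0 m) ^+ n = powR (cth th0 m) (n%:R / 2).
      by rewrite -powR12_sqrt ?(ltW tm)// -powR_mulrn ?powR_ge0// -powRrM mulrC.
    rewrite -powRN /cA -powRD ?(gt_eqF tm) ?implybT//; congr powR; by field.
  by rewrite mulrCA.
(* The goal carries the factor [m] so that infinitely many successes beat every constant times
   [phi]. For fixed [a] the time, hence the value of [phi], is fixed. *)
pose P (m a : nat) : bool := m%:R * phi (11 / 5 * cth th0 a) <= h m.
have HP a : exists M, forall m, (M <= m)%N -> P m a.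
  have [M HM] := linear_le_exp (phi (11 / 5 * cth th0 a)) b0 y1.
  by exists M => m /HM; rewrite /P hE.
pose st := restarts P.
have stm := restarts_le P : forall m, (st m <= m)%N.
have stS := restartsS P : forall m, st m.+1 = m.+1 \/ st m.+1 = st m.
have stoo := restarts_unbounded HP : forall k, exists m0, forall m, (m0 <= m)%N -> (k <= st m)%N.
have a0 : 0 < alpha by exact: lt_trans a2.
have a4n : alpha <= 4 * n%:R.
  by apply: le_trans (ltW an2) _; move: (n%:R) nn => z; lra.
have be1 : 1 <= n%:R * (lambda - 1) / 2.
  by rewrite ler_pdivlMr// mul1r mulrBr mulr1 (mulrC n%:R) lerBrDl ltW.
exists x0, (cu x0 kp th0 st); split => //.
  split.
  - by move=> x t /andP[t0 _]; exact: cascade_ge0.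
  - exact: cascade_C21.
  - exact: (@cascade_Lp R n x0 kp th0 st th00 kpn stm stoo lambda T (ltW l1) qq0 be1 T0).
  (* [powR] with exponent 0 is 1 even at 0, so the right side is the nonlocal term alone. *)
  move=> x t _ It; rewrite g_alpha_eq0 powRr0 mule1.
  exact: (@cascade_supersol R n x0 kp th0 st n0 th00 kpn stm stoo stS alpha lambda T a0 a4n (ltW l1) gap0 th0s).
move=> K d d0.
have e0 : 0 < Num.min d 1 / 3 by rewrite divr_gt0// lt_min d0 ltr01.
have [k Hk] := cth_small th0 e0.
have [m0 Hm0] := stoo k.
(* [m] is taken beyond [K], and late enough for the focusing time of its cascade to be below [d] and
   1. *)
have [m mM Pm] := restarts_infinite HP (maxn m0 (Num.truncn K).+1).
have Km : K < m%:R.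
  apply: (lt_le_trans (truncnS_gt K)); rewrite ler_nat; exact: leq_trans (leq_maxr _ _) mM.
have ths : cth th0 (st m) < Num.min d 1 / 3.
  by apply: Hk; apply: Hm0; exact: leq_trans (leq_maxl _ _) mM.
have t0 := cth_gt0 th00 (st m); have tm := cth_gt0 th00 m.
set t := 11 / 5 * cth th0 (st m).
have tp : 0 < t by rewrite mulr_gt0// divr_gt0.
have tmin : t < Num.min d 1.
  by rewrite /t; move: (cth th0 (st m)) (Num.min d 1) t0 ths => z1 z2; lra.
move: tmin; rewrite lt_min => /andP[td t1].
exists t; split => //; first by rewrite tp.
apply: (@lt_le_trans _ _ (m%:R * phi t)).
  by rewrite ltr_pM2r// phi0// tp.
apply: le_trans (Pm : _ <= h m) _.
have := @cascade_ge_bmp R n x0 kp th0 st th00 kpn stm stoo m (x0, t) tp.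
apply: le_trans; rewrite /cbD /bumpD /=.
have ts : t - cs th0 st m = 16 / 5 * cth th0 m by rewrite /t /cs; ring.
have z1 : 1 <= (t - cs th0 st m) / cth th0 m.
  by rewrite ts ler_pdivlMr// mul1r; move: (cth th0 m) tm => z; lra.
rewrite (ramp_ge1 z1).1 mul1r gprod0 bump_lagE//; last first.
  by rewrite -subr_ge0 ts mulr_ge0// ltW.
by rewrite ts /h (_ : 16 / 5 * cth th0 m + cth th0 m = 21 / 5 * cth th0 m)//; field.
Qed.

End no_universal_rate.

Theorem theorem1p4 (R : realType) (n : nat) (alpha T : R)
    (Omega : set 'rV[R]_n) :
  (0 < n)%N -> 0 < alpha < n%:R + 2 -> 0 < T ->
  open Omega -> Omega !=set0 ->
  (* (i) *)
  (forall lambda : R, 0 < lambda < (n%:R + 2 - alpha) / n%:R ->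
    forall K : set 'rV[R]_n, compact K -> K `<=` Omega ->
    forall u : 'rV[R]_n * R -> R,
      admissible alpha lambda (g_alpha n alpha lambda) T Omega u ->
      exists C delta : R, 0 < delta /\
        forall t, 0 < t < delta -> forall x, K x ->
          u (x, t) <= C * powR t (- (n%:R / 2)))
  /\
  (* (ii) *)
  (2 < alpha ->
   forall lambda : R, (n%:R + 2) / (alpha - 2) < lambda ->
   ~ exists phi : R -> R,
       {within `]0, 1[, continuous phi} /\
       (forall t, 0 < t < 1 -> 0 < phi t) /\
       forall K : set 'rV[R]_n, compact K -> K `<=` Omega ->
       forall u : 'rV[R]_n * R -> R,
         admissible alpha lambda (g_alpha n alpha lambda) T Omega u ->
         exists C delta : R, 0 < delta /\
           forall t, 0 < t < delta -> t < 1 -> forall x, K x ->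
             u (x, t) <= C * phi t).
Proof.
move=> n0 /andP[a0 an] T0 oO Onon; split.
  move=> lambda /andP[l0 lc] K cK KO u adm.
  exact: (compact_rate n0 a0 T0 oO l0 lc adm cK KO).
move=> a2 lambda lc [phi [_ [phi0 H]]].
have [x0 [u [Ox0 adm blow]]] := cascade_blow_up n0 a2 an T0 Onon lc phi0.
have [|C [d [d0 bnd]]] := H [set x0] (@compact_set1 _ x0) _ u adm.
  by move=> _ ->.
have [t [td t1]] := blow C d d0.
by rewrite ltNge bnd.
Qed.
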